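(* Let $\kappa\in\{-1,0,1\}$ and fix $A>0$ (with $A\le 2\pi$ if $\kappa=1$). There exists a unique (up to isometry of $M^2_\kappa$) perimeter minimizer among all piecewise smooth simple closed curves in $M^2_\kappa$ enclosing area $A$, and it is a circle in $M^2_\kappa$ of radius $AS_\kappa\!\left(\frac{\sqrt{A(4\pi-\kappa A)}}{2\pi}\right)$.
   Context: $M^2_\kappa$ denotes the complete simply connected surface of constant curvature $\kappa$: the Euclidean plane for $\kappa=0$, the unit sphere $S^2\subset\mathbb{R}^3$ for $\kappa=1$, the hyperbolic plane for $\kappa=-1$; $d_\kappa$ is its Riemannian distance. A circle in $M^2_\kappa$ of radius $r>0$ ($r<\pi$ if $\kappa=1$) is a set $\{x\in M^2_\kappa : d_\kappa(p,x)=r\}$ with $p\in M^2_\kappa$. The perimeter of a curve is its arc-length. For $\kappa\ne 1$ the area enclosed by a simple closed curve is the area of the unique relatively compact component of its complement; for $\kappa=1$, a simple closed curve encloses area $A$ if one of the two components of its complement has area $A$. The function $AS_\kappa$ is $AS_0(t)=t$, $AS_1(t)=\arcsin t$, $AS_{-1}(t)=\sinh^{-1}t$. *)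

(* Defs.v *)
From HB Require Import structures.
From mathcomp Require Import all_boot all_order all_algebra.
From mathcomp Require Import all_classical all_reals all_analysis.
From mathcomp Require Import ring.
Set Implicit Arguments.
Unset Strict Implicit.
Unset Printing Implicit Defensive.
Import Order.TTheory GRing.Theory Num.Theory.
Import numFieldNormedType.Exports.
Local Open Scope classical_set_scope.
Local Open Scope ring_scope.

(* Points of the ambient space R^3 are triples
   p = (x, y, z) : R * R * R, so that x = p.1.1, y = p.1.2 and z = p.2. *)

(* The three model surfaces, for k = -1, 0, 1, are the surfaces
     { z^2 + k (x^2 + y^2) = 1 }   (with z > 0 unless k = 1)
   with the Riemannian metric induced by dx^2 + dy^2 + k dz^2:
   - k =  1 is the unit sphere of Euclidean R^3;
   - k =  0 is the plane z = 1 with the metric dx^2 + dy^2;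
   - k = -1 is the hyperboloid model of the hyperbolic plane, the upper sheet of
     x^2 + y^2 - z^2 = -1 in Minkowski space. *)
Definition surface {R : realType} (k : R) : set (R * R * R) :=
  [set p | p.2 ^+ 2 + k * (p.1.1 ^+ 2 + p.1.2 ^+ 2) = 1
           /\ (k <> 1 -> 0 < p.2)].

Definition metric {R : realType} (k : R) (v w : R * R * R) : R :=
  v.1.1 * w.1.1 + v.1.2 * w.1.2 + k * (v.2 * w.2).

Definition smooth1 {R : realType} (f : R -> R) : Prop :=
  forall (n : nat) (t : R), derivable (derive1n n f) t 1.

Definition smooth {R : realType} (g : R -> R * R * R) : Prop :=
  [/\ smooth1 (fun t => (g t).1.1), smooth1 (fun t => (g t).1.2)
    & smooth1 (fun t => (g t).2)].

(* Smoothness of c on a closed piece, up to the end points, is expressed by the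
   existence of a smooth extension to the whole line.  No regularity
   (c' <> 0) is imposed. *)
Definition piecewise_smooth {R : realType} (c : R -> R * R * R) : Prop :=
  exists s : seq R, itv_partition 0 1 s /\
    forall i, (i < size s)%N -> exists g : R -> R * R * R, smooth g /\
      {in `[nth 0 (0 :: s) i, nth 0 (0 :: s) i.+1], c =1 g}.

(* Curves are parametrized by [0, 1]; values of c outside [0, 1] are
   irrelevant. *)
Definition curve_in {R : realType} (k : R) (c : R -> R * R * R) : Prop :=
  [/\ {within `[0, 1]%classic, continuous c}, piecewise_smooth c
    & forall t, t \in `[0, 1] -> surface k (c t)].

Definition simple_closed {R : realType} (c : R -> R * R * R) : Prop :=
  c 0 = c 1 /\ {in `[0, 1[ &, injective c}.

Definition curve_image {R : realType} (c : R -> R * R * R) : set (R * R * R) :=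
  c @` `[0, 1]%classic.

Definition velocity {R : realType} (c : R -> R * R * R) (t : R) : R * R * R :=
  ((derive1 (fun u => (c u).1.1) t, derive1 (fun u => (c u).1.2) t),
   derive1 (fun u => (c u).2) t).

(* The finitely many break points of c, where the velocity may be meaningless,
   do not contribute to the integral. *)
Definition arc_length {R : realType} (k : R) (c : R -> R * R * R) : R :=
  Rintegral (@lebesgue_measure R) `[0, 1]%classic
    (fun t => Num.sqrt (metric k (velocity c t) (velocity c t))).

Definition riem_dist {R : realType} (k : R) (p q : R * R * R) : R :=
  inf [set arc_length k c |
    c in [set c | [/\ curve_in k c, c 0 = p & c 1 = q]]].

Definition circle {R : realType} (k : R) (p : R * R * R) (r : R) :
    set (R * R * R) :=
  [set x | surface k x /\ riem_dist k p x = r].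

Definition is_circle {R : realType} (k r : R) (C : set (R * R * R)) : Prop :=
  [/\ 0 < r, (k = 1 -> r < pi) & exists2 p, surface k p & C = circle k p r].

Definition surface_isometry {R : realType} (k : R)
    (phi : R * R * R -> R * R * R) : Prop :=
  set_bij (surface k) (surface k) phi /\
  forall p q, surface k p -> surface k q ->
    riem_dist k (phi p) (phi q) = riem_dist k p q.

Definition height {R : realType} (k : R) (w : R * R) : R :=
  Num.sqrt (1 - k * (w.1 ^+ 2 + w.2 ^+ 2)).

(* Riemannian area of E, a subset of the surface.  Up to the equator when k = 1,
   which has area 0, the surface is the union of the graphs z = height k (x, y)
   and, when k = 1, z = - height k (x, y).  In the graph chart (x, y), the area
   element sqrt (det g) dx dy is dx dy / |z|, see [gram_chart] below.  When
   k <> 1, points with z < 0 are not on the surface and the second indicator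
   is 0. *)
Definition area {R : realType} (k : R) (E : set (R * R * R)) : \bar R :=
  (\int[(@lebesgue_measure R \x @lebesgue_measure R)%E]_(w in
      [set w : R * R | (k * (w.1 ^+ 2 + w.2 ^+ 2) < 1)%R])
    (((\1_E (w, height k w) + \1_E (w, - height k w)) / height k w)%R)%:E)%E.

(* By implicit differentiation of z^2 + k (x^2 + y^2) = 1, the coordinate vector
   fields of the graph chart are (1, 0, - k x / z) and (0, 1, - k y / z); the
   hypothesis k^3 = k holds for k = -1, 0, 1. *)
Lemma gram_chart {R : realType} (k x y z : R) :
  k ^+ 3 = k -> z ^+ 2 + k * (x ^+ 2 + y ^+ 2) = 1 -> z != 0 ->
  let e1 := ((1, 0), - k * x / z) in
  let e2 := ((0, 1), - k * y / z) in
  metric k e1 e1 * metric k e2 e2 - metric k e1 e2 ^+ 2 = (`|z|^-1) ^+ 2.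
Proof.
move=> k3 zE z0 /=; rewrite /metric /= exprVn -normrX ger0_norm ?sqr_ge0//.
transitivity ((z ^+ 2 + k ^+ 3 * (x ^+ 2 + y ^+ 2)) / z ^+ 2); first by field.
by rewrite k3 zE mul1r.
Qed.

(* The curve c encloses area A.  By the Jordan curve theorem the complement
   has two components, of which exactly one is relatively compact when k <> 1.
   The surface is closed in R^3, so the closure may be taken in R^3. *)
Definition encloses {R : realType} (k : R) (c : R -> R * R * R) (A : R) : Prop :=
  exists2 x, (surface k `\` curve_image c) x &
    let U := connected_component (surface k `\` curve_image c) x in
    (k <> 1 -> compact (closure U)) /\ area k U = A%:E.

Definition admissible {R : realType} (k A : R) (c : R -> R * R * R) : Prop :=
  [/\ curve_in k c, simple_closed c & encloses k c A].

Definition perimeter_minimizer {R : realType} (k A : R)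
    (c : R -> R * R * R) : Prop :=
  admissible k A c /\
  forall c', admissible k A c' -> arc_length k c <= arc_length k c'.

Definition sinh {R : realType} (x : R) : R := (expR x - expR (- x)) / 2.

Definition asinh {R : realType} (t : R) : R := get [set x | sinh x = t].

Definition AS {R : realType} (k t : R) : R :=
  if k == 1 then asin t else if k == -1 then asinh t else t.

(* Main.v *)
(* Let c be a simple closed curve on the model surface, z its image in the
   stereographic chart, in which the metric is lam^2 |dz|^2 with
   lam = 2 / (1 + k |z|^2), and let L be its length.  The double integral
     J = Re of the integral over c x c of
           conj(z - w) / (z - w) lam(z) lam(w) dz dw
   satisfies |J| <= L^2, since the integrand has modulus lam(z) |dz| lam(w) |dw|.
   With Psi(z) = conj z / (1 + k |z|^2), the kernel equals
     4 ((Psi z - Psi w) / (z - w) + k Psi z Psi w),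
   and lam^2 is the Laplacian of a potential whose gradient is Psi; Newton's
   formula and Fubini turn J into a^2 A (4 pi - k A), where A is the area
   enclosed by c and a its winding number.  That a is a nonzero integer,
   constant on the region, follows from Borsuk's argument on nonvanishing
   functions.  Equality forces the kernel to be aligned with the two velocities,
   which makes the image of c a circle in the chart, hence a plane section of
   the surface.  On the sphere a rotation first moves a point of the region to
   the pole of the chart. *)
Require Import Defs.
From HB Require Import structures.
From mathcomp Require Import all_boot all_order all_algebra.
From mathcomp Require Import all_classical all_reals all_analysis.
From mathcomp Require Import measurable_realfun.
From mathcomp Require Import ring lra complex.
Set Implicit Arguments.
Unset Strict Implicit.
Unset Printing Implicit Defensive.
Import Order.TTheory GRing.Theory Num.Theory.
Import numFieldNormedType.Exports.
Local Open Scope classical_set_scope.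
Local Open Scope ring_scope.

(** The double integral suits curves with corners and zero velocity: the region enters only through
    its winding number and its area. The term k Psi Psi factors into the square of the line integral
    of Psi, which is i a A / 2; this is the origin of the correction - k A^2. The difference
    quotient of Psi is bounded although z - w stands in its denominator, and this allows the second
    point to be moved onto the curve, where the winding computation behind the term pi a^2 A cannot
    be made directly. Since a^2 >= 1, the integer a only strengthens the inequality and orientation
    is irrelevant. In the case of equality a nonnegative defect has integral 0, so it vanishes where
    it is continuous. Inversion at one point with nonzero velocity then sends the curve into a line,
    and the intermediate value theorem shows that the whole line is covered. This does not give the
    radius, which comes from comparison with the round circle that encloses the same area; that
    circle also proves existence. On the sphere A (4 pi - A) is unchanged by A -> 4 pi - A, so the
    side that avoids the centre of projection can be used. *)

(** * Piecewise continuous and piecewise differentiable functions of one real variable *)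

Section pieces.
Context {R : realType}.
Implicit Types (a b : R) (s : seq R) (f g : R -> R).
Notation mu := (@lebesgue_measure R).

Fixpoint on_pieces (P : R -> R -> Prop) a s : Prop :=
 if s is b :: s' then P a b /\ on_pieces P b s' else True.

Lemma on_pieces_nth (P : R -> R -> Prop) a s :
 (forall i, (i < size s)%N -> P (nth 0 (a :: s) i) (nth 0 (a :: s) i.+1)) ->
 on_pieces P a s.
Proof.
elim: s a => //= b s IH a H; split; first exact: (H 0%N).
by apply: IH => i si; exact: (H i.+1).
Qed.

Lemma on_pieces_imp (P Q : R -> R -> Prop) a b s :
 (forall c d, a <= c -> c < d -> d <= b -> P c d -> Q c d) ->
 itv_partition a b s -> on_pieces P a s -> on_pieces Q a s.
Proof.
move=> PQ [ps /eqP lb] Ps; move: (lexx a) ps lb Ps.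
elim: s {2 3 4 5 6}a => //= c s IH a' aa' /andP[ac pc] lb [Pac Ps].
have cb : c <= b.
 rewrite -lb; have := mem_last c s; rewrite inE => /predU1P[->//|].
 by move: pc; rewrite lt_path_sortedE => /andP[/allP h _] /h /ltW.
split; first exact: PQ.
by apply: IH => //; exact: le_trans (ltW ac).
Qed.

Lemma on_pieces_glue (Q : R -> R -> Prop) a b s :
 (forall c d e, c < d -> d < e -> Q c d -> Q d e -> Q c e) ->
 a < b -> itv_partition a b s -> on_pieces Q a s -> Q a b.
Proof.
move=> Qtr + [+ /eqP].
elim: s a => [|c s IH] a /=; first by move=> ab _ e; rewrite e ltxx in ab.
move=> ab /andP[ac pc] lb [Qac Qs].
case: s IH pc lb Qs => [|d s] IH pc lb Qs; first by rewrite -lb.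
have cb : c < b.
 rewrite -lb /=; move: (pc); rewrite lt_path_sortedE => /andP[/allP h _].
 by apply: h; rewrite mem_last.
by apply: (Qtr _ c) => //; exact: IH.
Qed.

Lemma on_pieces_and (P Q : R -> R -> Prop) a s :
 on_pieces P a s -> on_pieces Q a s -> on_pieces (fun c d => P c d /\ Q c d) a s.
Proof. by elim: s a => //= b s IH a [? ?] [? ?]; split; [|exact: IH]. Qed.

(** Agreement is asked on the open interval only, because a velocity has no meaningful value at a
    break point; the extension to [[a, b]] still gives boundedness. *)
Definition pieceC f a b : Prop :=
 exists2 g, {within `[a, b], continuous g} & {in `]a, b[, f =1 g}.

(** The function is continuous up to the ends and differentiable inside, which is what the
    fundamental theorem of calculus uses. *)
Definition pieceD f f' a b : Prop :=
 [/\ {within `[a, b], continuous f}, pieceC f' a b &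
   forall t, t \in `]a, b[ -> is_derive t 1 f (f' t)].

Lemma within_pieceC f a b : {within `[a, b], continuous f} -> pieceC f a b.
Proof. by move=> cf; exists f. Qed.

Lemma pieceC_cst (k : R) a b : pieceC (cst k) a b.
Proof. by apply: within_pieceC => x; exact: cvg_cst. Qed.

Lemma pieceCD f g a b : pieceC f a b -> pieceC g a b ->
 pieceC (fun t => f t + g t) a b.
Proof.
move=> [f1 cf ff] [g1 cg gg]; exists (f1 \+ g1).
 by move=> x; apply: cvgD; [exact: cf|exact: cg].
by move=> t tab /=; rewrite ff// gg.
Qed.

Lemma pieceCM f g a b : pieceC f a b -> pieceC g a b ->
 pieceC (fun t => f t * g t) a b.
Proof.
move=> [f1 cf ff] [g1 cg gg]; exists (f1 \* g1).
 by move=> x; apply: cvgM; [exact: cf|exact: cg].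
by move=> t tab /=; rewrite ff// gg.
Qed.

Lemma pieceCN f a b : pieceC f a b -> pieceC (fun t => - f t) a b.
Proof.
move=> [f1 cf ff]; exists (fun t => - f1 t); first by move=> x; apply: cvgN; exact: cf.
by move=> t tab /=; rewrite ff.
Qed.

Lemma pieceC_comp (h : R -> R) f a b : continuous h -> pieceC f a b ->
 pieceC (h \o f) a b.
Proof.
move=> ch [f1 cf ff]; exists (h \o f1) => [|t tab /=]; last by rewrite ff.
by apply: (@within_continuous_comp _ _ _ _ f1 h) cf => t _; exact: ch.
Qed.

Lemma pieceC_eq f g a b : {in `]a, b[, f =1 g} -> pieceC f a b -> pieceC g a b.
Proof. by move=> fg [h ch fh]; exists h => // t tab; rewrite -fg// fh. Qed.

Lemma pieceD_eq f f' g' a b : {in `]a, b[, f' =1 g'} ->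
 pieceD f f' a b -> pieceD f g' a b.
Proof.
move=> fg [cf cf' df]; split => //; first exact: pieceC_eq fg cf'.
by move=> t tab; rewrite -fg//; exact: df.
Qed.

Lemma pieceC_sub f a b c d : a <= c -> d <= b -> pieceC f a b -> pieceC f c d.
Proof.
move=> ac db [g cg fg]; exists g.
 by apply: continuous_subspaceW cg; apply: subset_itvScc; rewrite bnd_simp.
by move=> t; rewrite in_itv/= => /andP[ct td]; apply: fg;
 rewrite in_itv/= (le_lt_trans ac)//= (lt_le_trans td).
Qed.

Lemma pieceD_sub f f' a b c d : a <= c -> d <= b ->
 pieceD f f' a b -> pieceD f f' c d.
Proof.
move=> ac db [cf cf' df]; split.
- by apply: continuous_subspaceW cf; apply: subset_itvScc; rewrite bnd_simp.
- exact: pieceC_sub cf'.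
- by move=> t; rewrite in_itv/= => /andP[ct td]; apply: df;
  rewrite in_itv/= (le_lt_trans ac)//= (lt_le_trans td).
Qed.

Lemma pieceD_cst (k : R) a b : pieceD (cst k) (cst 0) a b.
Proof.
split; [by move=> x; exact: cvg_cst|exact: pieceC_cst|].
by move=> t _; exact: is_derive_cst.
Qed.

Lemma pieceDD f f' g g' a b : pieceD f f' a b -> pieceD g g' a b ->
 pieceD (fun t => f t + g t) (fun t => f' t + g' t) a b.
Proof.
move=> [cf cf' df] [cg cg' dg]; split; last first.
- by move=> t tab; have := df t tab; have := dg t tab => ? ?; exact: is_deriveD.
- exact: pieceCD.
- by move=> x; apply: cvgD; [exact: cf|exact: cg].
Qed.

Lemma pieceDN f f' a b : pieceD f f' a b ->
 pieceD (fun t => - f t) (fun t => - f' t) a b.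
Proof.
move=> [cf cf' df]; split; last first.
- by move=> t tab; have := df t tab => ?; exact: is_deriveN.
- exact: pieceCN.
- by move=> x; apply: cvgN; exact: cf.
Qed.

Lemma pieceDM f f' g g' a b : pieceD f f' a b -> pieceD g g' a b ->
 pieceD (fun t => f t * g t) (fun t => f' t * g t + f t * g' t) a b.
Proof.
move=> [cf cf' df] [cg cg' dg]; split; last first.
- move=> t tab; have := df t tab; have := dg t tab => ? ?.
 by apply: is_derive_eq; rewrite /= addrC; congr (_ + _); rewrite mulrC.
- by apply: pieceCD; apply: pieceCM => //; exact: within_pieceC.
- by move=> x; apply: cvgM; [exact: cf|exact: cg].
Qed.

Lemma pieceD_comp (h h' : R -> R) f f' a b :
 (forall t, t \in `[a, b] -> is_derive (f t) 1 h (h' (f t))) ->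
 (forall t, t \in `[a, b] -> {for f t, continuous h'}) ->
 pieceD f f' a b -> pieceD (h \o f) (fun t => h' (f t) * f' t) a b.
Proof.
move=> dh ch' [cf cf' df].
have cmp (k : R -> R) : (forall t, t \in `[a, b] -> {for f t, continuous k}) ->
  {within `[a, b], continuous (k \o f)}.
 move=> ck; apply: (@within_continuous_comp _ _ _ _ f k) cf => _ /set_mem[t tab <-].
 exact: ck.
split.
- apply: cmp => t tab; apply: differentiable_continuous.
 by apply/derivable1_diffP; have := dh t tab => -[].
- by apply: pieceCM => //; apply: within_pieceC; exact: cmp.
- move=> t tab; have dft := df t tab.
 have /dh dht : t \in `[a, b] by exact: subset_itv_oo_cc.
 by apply: is_derive_eq; rewrite mulrC.
Qed.

Lemma itvcc_setU (c d e : R) : c < d -> d < e ->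
 `[c, e]%classic = `[c, d]%classic `|` `[d, e]%classic.
Proof.
move=> cd de; apply/seteqP; split => x /=; rewrite !in_itv/=.
 by move=> /andP[-> ->]; rewrite andbT; exact/orP/le_total.
by case=> /andP[xa xb]; lra.
Qed.

Lemma pieceC_prop f a b : a < b -> pieceC f a b ->
 measurable_fun `[a, b] f /\ exists M : R, forall t, t \in `[a, b] -> `|f t| <= M.
Proof.
move=> ab [g cg fg]; split.
 apply/measurable_fun_itv_bndo_bndcP.
 apply/measurable_fun_itv_obnd_cbndP.
 apply: (@eq_measurable_fun _ _ _ _ _ g).
  by move=> t; rewrite inE => tab; rewrite fg.
 apply: (@measurable_funS _ _ _ _ `[a, b]) => //; first exact: subset_itv_oo_cc.
 exact: subspace_continuous_measurable_fun.
have cng : {within `[a, b], continuous (fun t => `|g t|)}.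
 by move=> x; apply: cvg_norm; exact: cg.
have [c _ hc] := EVT_max (ltW ab) cng.
(* The values of [f] at the two ends are arbitrary, so they enter the bound separately. *)
exists (Num.max `|g c| (Num.max `|f a| `|f b|)) => t /[dup] tab.
rewrite !le_max in_itv/= => /andP[].
rewrite le_eqVlt => /predU1P[<-|at_]; first by rewrite lexx !orbT.
rewrite le_eqVlt => /predU1P[->|tb]; first by rewrite lexx !orbT.
by rewrite fg ?in_itv/= ?at_ ?tb// hc.
Qed.

Lemma pieceD_ftc f f' a b : a < b -> pieceD f f' a b ->
 (\int[mu]_(t in `[a, b]) (f' t)%:E = (f b - f a)%:E)%E.
Proof.
move=> ab [cf cf' df]; have [mf' _] := pieceC_prop ab cf'.
have [g cg fg] := cf'.
rewrite EFinB -(continuous_FTC2 ab cg); last 2 first.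
- have [_ cfa cfb] := (continuous_within_itvP f ab).1 cf.
 by split => // t tab; have := df t tab => -[].
- move=> t tab; rewrite -fg// derive1E; have := df t tab => ?.
 by rewrite derive_val.
rewrite [LHS](integral_itv_bndoo true false); last first.
 apply/measurable_EFinP; apply: measurable_funS mf' => //.
 exact: subset_itv_oo_cc.
rewrite [RHS](integral_itv_bndoo true false); last first.
 apply/measurable_EFinP; apply: (@measurable_funS _ _ _ _ `[a, b]) => //.
  exact: subset_itv_oo_cc.
 exact: subspace_continuous_measurable_fun.
by apply: eq_integral => t; rewrite inE => tab; rewrite fg.
Qed.

Lemma pieces_bounded f a b s : a < b -> itv_partition a b s ->
 on_pieces (pieceC f) a s ->
 measurable_fun `[a, b] f /\ exists M : R, forall t, t \in `[a, b] -> `|f t| <= M.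
Proof.
move=> ab pab Cf; pose Q (c d : R) := measurable_fun `[c, d] f /\
 exists M : R, forall t, t \in `[c, d] -> `|f t| <= M.
apply: (@on_pieces_glue Q a b s) => //; last first.
 apply: (on_pieces_imp _ pab Cf) => c d _ cd _; exact: pieceC_prop.
move=> c d e cd de [mcd [M Mcd]] [mde [N Nde]].
have cup : `[c, e]%classic = `[c, d]%classic `|` `[d, e]%classic.
 exact: itvcc_setU.
split; first by rewrite cup; apply/measurable_funU.
exists (Num.max M N) => t tce; rewrite le_max.
have : `[c, e]%classic t by [].
by rewrite cup => -[/Mcd ->|/Nde ->]; rewrite ?orbT.
Qed.

Lemma pieces_integrable f a b s : a < b -> itv_partition a b s ->
 on_pieces (pieceC f) a s -> mu.-integrable `[a, b] (EFin \o f).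
Proof.
move=> ab pab /(pieces_bounded ab pab)[mf [M fM]].
apply: measurable_bounded_integrable => //.
 by rewrite /= lebesgue_measure_itv/= lte_fin ab -EFinB ltry.
exists M; split; first exact: num_real.
by move=> x Mx t /= /fM /le_trans; apply; exact: ltW.
Qed.

Lemma pieces_ftc f f' a b s : a < b -> itv_partition a b s ->
 on_pieces (pieceD f f') a s ->
 \int[mu]_(t in `[a, b]) (f' t) = f b - f a.
Proof.
move=> ab pab Df; rewrite /Rintegral.
(* Measurability is carried along because additivity over adjacent pieces requires it. *)
pose Q (c d : R) := measurable_fun `[c, d] f' /\
 (\int[mu]_(t in `[c, d]) (f' t)%:E = (f d - f c)%:E)%E.
suff [_ ->] : Q a b by [].
apply: (@on_pieces_glue Q a b s) => //; last first.
 apply: (on_pieces_imp _ pab Df) => c d _ cd _ Dcd.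
 have [_ Cf' _] := Dcd; have [mf' _] := pieceC_prop cd Cf'.
 by split => //; exact: pieceD_ftc.
move=> c d e cd de [mcd Icd] [mde Ide].
have cup : `[c, e]%classic = `[c, d]%classic `|` `]d, e]%classic.
 by rewrite -itv_bndbnd_setU// bnd_simp ltW.
have cup' : `[c, e]%classic = `[c, d]%classic `|` `[d, e]%classic.
 exact: itvcc_setU.
have mce : measurable_fun `[c, e] f' by rewrite cup'; apply/measurable_funU.
have Ice : (\int[mu]_(t in `[c, e]) (f' t)%:E = (f e - f c)%:E)%E.
 rewrite cup integral_setU//; last 2 first.
 - by rewrite -cup; exact/measurable_EFinP.
 - apply/disj_setPRL => t; rewrite /= !in_itv/= => /andP[dt _].
  by move=> /andP[_ td]; have := lt_le_trans dt td; rewrite ltxx.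
 rewrite integral_itv_obnd_cbnd; last first.
  apply/measurable_EFinP; apply: measurable_funS mde => //.
  exact: subset_itv_oc_cc.
 by rewrite Icd Ide -EFinD; congr EFin; lra.
by [].
Qed.

Lemma on_pieces_restrict (P : R -> R -> Prop) a b s c d :
 (forall p q p' q', p <= p' -> p' < q' -> q' <= q -> P p q -> P p' q') ->
 itv_partition a b s -> on_pieces P a s -> a <= c -> c < d -> d <= b ->
 exists2 s', itv_partition c d s' & on_pieces P c s'.
Proof.
move=> hP pab Ps ac cd db.
(* Quantifying over all subintervals makes the property transitive: a subinterval that straddles a
   break point is cut there. *)
pose Q p q := forall p' q', p <= p' -> p' < q' -> q' <= q ->
 exists2 s', itv_partition p' q' s' & on_pieces P p' s'.
suff : Q a b by exact.
apply: (@on_pieces_glue Q a b s) => //.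
- move=> p r q pr rq Qpr Qrq p' q' pp' pq' qq'.
 have [rp|pr'] := leP r p'; first exact: Qrq.
 have [qr|rq'] := leP q' r; first exact: Qpr.
 have [s1 [p1 /eqP l1] P1] := Qpr p' r pp' pr' (lexx _).
 have [s2 [p2 /eqP l2] P2] := Qrq r q' (lexx _) rq' qq'.
 exists (s1 ++ s2).
  by split; rewrite ?cat_path ?last_cat l1 ?p1 ?p2// l2.
 elim: s1 p' P1 {p1 pp' pq' pr'} l1 => [|u s1 IH] p' /=; first by move=> _ ->.
 by move=> [? ?] l1; split => //; exact: IH.
- by apply: le_lt_trans ac _; exact: lt_le_trans db.
- apply: (on_pieces_imp _ pab Ps) => p q _ pq _ Ppq p' q' pp' pq' qq'.
 exists [:: q']; first by split; rewrite /= ?pq'.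
 by split => //; exact: hP Ppq.
Qed.
End pieces.

(** * Complex numbers: modulus, unit circle and angles *)

Notation cabs := Normc.normc.
Notation Re := (@complex.Re _).
Notation Im := (@complex.Im _).

Section complex_basics.
Context {R : realType}.
Implicit Types (z w : R[i]) (x y : R).
Local Open Scope complex_scope.

Lemma ReM z w : Re (z * w) = Re z * Re w - Im z * Im w.
Proof. by case: z w => [a b] [c d]. Qed.

Lemma ImM z w : Im (z * w) = Re z * Im w + Im z * Re w.
Proof. by case: z w => [a b] [c d]. Qed.

Lemma ReD z w : Re (z + w) = Re z + Re w. Proof. by case: z w => [a b] [c d]. Qed.
Lemma ImD z w : Im (z + w) = Im z + Im w. Proof. by case: z w => [a b] [c d]. Qed.
Lemma ReN z : Re (- z) = - Re z. Proof. by case: z. Qed.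
Lemma ImN z : Im (- z) = - Im z. Proof. by case: z. Qed.

Lemma complexP z w : Re z = Re w -> Im z = Im w -> z = w.
Proof. by case: z w => [a b] [c d] /= -> ->. Qed.

Lemma cabsE z : cabs z = Num.sqrt (Re z ^+ 2 + Im z ^+ 2).
Proof. by case: z. Qed.

Lemma cabs2 z : cabs z ^+ 2 = Re z ^+ 2 + Im z ^+ 2.
Proof. by rewrite cabsE sqr_sqrtr// addr_ge0// sqr_ge0. Qed.

Lemma cabs_ge0 z : 0 <= cabs z.
Proof. by rewrite cabsE sqrtr_ge0. Qed.

Lemma cabs0 : cabs (0 : R[i]) = 0.
Proof. by rewrite cabsE/= !expr0n/= addr0 sqrtr0. Qed.

Lemma cabs_eq0 z : (cabs z == 0) = (z == 0).
Proof.
by apply/eqP/eqP => [/Normc.eq0_normc//|->]; exact: cabs0.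
Qed.

Lemma cabs_gt0 z : (0 < cabs z) = (z != 0).
Proof. by rewrite lt_neqAle cabs_ge0 andbT eq_sym cabs_eq0. Qed.

Lemma cabsR x : cabs x%:C = `|x|.
Proof. by rewrite cabsE/= expr0n addr0 sqrtr_sqr. Qed.

Lemma Re_le_cabs z : `|Re z| <= cabs z.
Proof. by rewrite -sqrtr_sqr cabsE ler_wsqrtr// lerDl sqr_ge0. Qed.

Lemma Im_le_cabs z : `|Im z| <= cabs z.
Proof. by rewrite -sqrtr_sqr cabsE ler_wsqrtr// lerDr sqr_ge0. Qed.

Lemma cabs_le_ReIm z : cabs z <= `|Re z| + `|Im z|.
Proof.
rewrite -[leRHS]ger0_norm ?addr_ge0// -sqrtr_sqr cabsE ler_wsqrtr//.
rewrite -(real_normK (num_real (Re z))) -(real_normK (num_real (Im z))).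
have := normr_ge0 (Re z); have := normr_ge0 (Im z).
move: `|Re z| `|Im z| => a b; nra.
Qed.

Lemma cabsJ z : cabs (conjc z) = cabs z.
Proof. by rewrite !cabsE; case: z => a b /=; rewrite sqrrN. Qed.

Lemma cabsN z : cabs (- z) = cabs z.
Proof. by rewrite !cabsE; case: z => a b /=; rewrite !sqrrN. Qed.

Lemma cabs_triangle z w : cabs (z + w) <= cabs z + cabs w.
Proof. by have := ler_normD z w; rewrite !normc_def -!cabsE -rmorphD /= lecR. Qed.

Lemma mulJ z : z * (conjc z) = (cabs z ^+ 2)%:C.
Proof. by rewrite cabs2; case: z => a b; apply: complexP => /=; lra. Qed.

Lemma ReZ x z : Re (x%:C * z) = x * Re z.
Proof. by rewrite ReM/= mul0r subr0. Qed.

Lemma ImZ x z : Im (x%:C * z) = x * Im z.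
Proof. by rewrite ImM/= mul0r addr0. Qed.

Lemma ReJ z : Re (conjc z) = Re z. Proof. by case: z. Qed.
Lemma ImJ z : Im (conjc z) = - Im z. Proof. by case: z. Qed.

Lemma invCE z : z^-1 = ((cabs z ^+ 2)^-1)%:C * (conjc z).
Proof.
have [->|z0] := eqVneq z 0.
 by rewrite invr0 cabs0 expr0n/= invr0; apply: complexP; rewrite /= ?mul0r ?subr0 ?addr0 ?mulr0 ?subrr ?addr0.
apply: (mulfI z0); rewrite mulfV// mulrCA mulJ -rmorphM/= mulVf ?rmorph1//.
by rewrite sqrf_eq0 cabs_eq0.
Qed.

Lemma ReV z : Re z^-1 = Re z / cabs z ^+ 2.
Proof. by rewrite invCE ReZ ReJ mulrC. Qed.

Lemma ImV z : Im z^-1 = - Im z / cabs z ^+ 2.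
Proof. by rewrite invCE ImZ ImJ mulrC. Qed.

Definition expi x : R[i] := cos x +i* sin x.

Lemma expiD x y : expi (x + y) = expi x * expi y.
Proof. by apply: complexP; rewrite /= ?cosD// sinD addrC mulrC [X in _ + X]mulrC addrC. Qed.

Lemma expi0 : expi 0 = 1.
Proof. by rewrite /expi cos0 sin0. Qed.

Lemma cabs_expi x : cabs (expi x) = 1.
Proof. by rewrite cabsE/= cos2Dsin2 sqrtr1. Qed.

Lemma expi_neq0 x : expi x != 0.
Proof. by rewrite -cabs_eq0 cabs_expi oner_eq0. Qed.

Lemma expiN x : expi (- x) = (expi x)^-1.
Proof.
by apply: (mulfI (expi_neq0 x)); rewrite -expiD subrr expi0 mulfV// expi_neq0.
Qed.

Lemma expi_nat x n : expi (x *+ n) = expi x ^+ n.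
Proof. by elim: n => [|n IH]; rewrite ?mulr0n ?expi0// mulrS expiD IH exprS. Qed.

Lemma expi_int x (n : int) : expi (n%:~R * x) = expi x ^ n.
Proof.
case: n => n; first by rewrite -exprnP -expi_nat -mulr_natl.
by rewrite NegzE -exprz_inv -exprnP -expiN -expi_nat mulrNz mulNr -mulrN -[in RHS]mulr_natl.
Qed.

Lemma expi_2pi : expi (2 * pi) = 1.
Proof. by rewrite mulr_natl /expi cos2pi sin2pi. Qed.

Lemma expi_eq1 x : expi x = 1 -> exists n : int, x = 2 * pi * n%:~R.
Proof.
move=> x1; pose n := Num.floor (x / (2 * pi)); exists n.
have pi0 : 0 < 2 * pi :> R by rewrite mulr_gt0// pi_gt0.
pose y := x - 2 * pi * n%:~R.
have y1 : expi y = 1.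
 rewrite /y expiD x1 mul1r expiN mulrC expi_int expi_2pi.
 by rewrite exp1rz invr1.
(* [y] lies in [0, 2 pi) with sine 0 and cosine 1; the sign of the sine on the two open half turns,
   and the cosine at pi, leave only 0. *)
suff : y = 0 by move/eqP; rewrite subr_eq0 => /eqP.
have /andP[fl fu] := floor_itv (x / (2 * pi)).
have y0 : 0 <= y by rewrite /y subr_ge0 mulrC -ler_pdivlMr.
have y2 : y < 2 * pi.
 rewrite /y ltrBlDr -[X in X + _]mulr1 -mulrDr mulrC -ltr_pdivrMr//.
 by rewrite addrC -intrD1.
have [c1 s0] : cos y = 1 /\ sin y = 0.
 by split; [have := congr1 Re y1|have := congr1 Im y1].
have [ypi|] := ltP y pi.
 apply/eqP; rewrite eq_le y0 andbT leNgt; apply/negP => y_gt0.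
 by have := @sin_gt0_pi R y; rewrite s0 ltxx y_gt0 ypi => /(_ isT).
rewrite le_eqVlt => /predU1P[ypi|ypi].
 by move: c1; rewrite -ypi cospi; lra.
have := @sin_gt0_pi R (y - pi).
rewrite sinB cospi sinpi s0 !mulr0 !mul0r subr0 ltxx subr_gt0 ypi/=.
by rewrite ltrBlDr -mulr2n -mulr_natl y2 => /(_ isT).
Qed.

Lemma expi_eq x y : expi x = expi y -> exists n : int, x = y + 2 * pi * n%:~R.
Proof.
move=> xy; have [|n xyn] := @expi_eq1 (x - y).
 by rewrite expiD expiN xy mulfV// expi_neq0.
by exists n; rewrite -xyn addrC subrK.
Qed.

(** Radial projection to the unit circle, with value 0 at 0. *)
Definition uc z : R[i] := (cabs z)^-1%:C * z.

Lemma cabs_uc z : z != 0 -> cabs (uc z) = 1.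
Proof.
by move=> z0; rewrite Normc.normcM cabsR ger0_norm ?invr_ge0 ?cabs_ge0// mulVf// cabs_eq0.
Qed.

Lemma ucM z w : uc (z * w) = uc z * uc w.
Proof. by rewrite /uc Normc.normcM invfM rmorphM/=; ring. Qed.

Lemma uc_expi x : uc (expi x) = expi x.
Proof. by rewrite /uc cabs_expi invr1 mul1r. Qed.

Lemma uc_pos x : 0 < x -> uc x%:C = 1.
Proof.
move=> x0; rewrite /uc cabsR gtr0_norm// -rmorphM/= mulVf ?gt_eqF//.
Qed.

(** The principal argument, meaningful on the right half plane, where the sine determines the
    angle. *)
Definition ang z : R := asin (Im (uc z)).

Lemma expi_ang z : 0 < Re z -> expi (ang z) = uc z.
Proof.
move=> z0; have nz : z != 0 by apply/eqP => zE; rewrite zE ltxx in z0.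
have i1 : Im (uc z) ^+ 2 + Re (uc z) ^+ 2 = 1.
 by rewrite addrC -cabs2 cabs_uc// expr1n.
have iB : -1 <= Im (uc z) <= 1.
 by have := Im_le_cabs (uc z); rewrite cabs_uc// ler_norml.
have r0 : 0 <= Re (uc z) by rewrite ReZ mulr_ge0 ?invr_ge0 ?cabs_ge0 ?ltW.
apply: complexP => /=; last by rewrite asinK.
rewrite cos_asin// -i1 [_ + Re _ ^+ 2]addrC addrK sqrtr_sqr ger0_norm//.
Qed.
End complex_basics.

(** * Limits of complex functions, by real and imaginary parts *)

Section complex_limits.
Context {R : realType} {T : Type}.
Implicit Types (F : set_system T) (f g : T -> R[i]) (l m : R[i]).
Local Open Scope complex_scope.

Definition cvgC F f l : Prop :=
 Re (f x) @[x --> F] --> Re l /\ Im (f x) @[x --> F] --> Im l.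

Lemma cvgC_cst F l : Filter F -> cvgC F (fun=> l) l.
Proof. by move=> FF; split; exact: cvg_cst. Qed.

Lemma cvgCD F f g l m : Filter F -> cvgC F f l -> cvgC F g m ->
 cvgC F (fun x => f x + g x) (l + m).
Proof.
move=> FF [fr fi] [gr gi]; split.
 by under eq_fun do rewrite raddfD; rewrite raddfD; exact: cvgD.
by under eq_fun do rewrite raddfD; rewrite raddfD; exact: cvgD.
Qed.

Lemma cvgCN F f l : Filter F -> cvgC F f l -> cvgC F (fun x => - f x) (- l).
Proof.
move=> FF [fr fi]; split.
 by under eq_fun do rewrite raddfN; rewrite raddfN; exact: cvgN.
by under eq_fun do rewrite raddfN; rewrite raddfN; exact: cvgN.
Qed.

Lemma cvgCB F f g l m : Filter F -> cvgC F f l -> cvgC F g m ->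
 cvgC F (fun x => f x - g x) (l - m).
Proof. by move=> FF fl gm; apply: cvgCD => //; exact: cvgCN. Qed.

Lemma cvgCM F f g l m : Filter F -> cvgC F f l -> cvgC F g m ->
 cvgC F (fun x => f x * g x) (l * m).
Proof.
move=> FF [fr fi] [gr gi]; split.
 by under eq_fun do rewrite ReM; rewrite ReM; apply: cvgB; exact: cvgM.
by under eq_fun do rewrite ImM; rewrite ImM; apply: cvgD; exact: cvgM.
Qed.

Lemma cvgCJ F f l : Filter F -> cvgC F f l -> cvgC F (fun x => (conjc (f x))) (conjc l).
Proof.
move=> FF [fr fi]; split.
 by under eq_fun do rewrite ReJ; rewrite ReJ.
by under eq_fun do rewrite ImJ; rewrite ImJ; exact: cvgN.
Qed.

Lemma cvgCR F (f : T -> R) (l : R) : Filter F -> f x @[x --> F] --> l ->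
 cvgC F (fun x => (f x)%:C) l%:C.
Proof. by move=> FF fl; split => //=; exact: cvg_cst. Qed.

Lemma cvg_cabs F f l : Filter F -> cvgC F f l ->
 cabs (f x) @[x --> F] --> cabs l.
Proof.
move=> FF [fr fi]; under eq_fun do rewrite cabsE; rewrite cabsE.
apply: continuous_cvg; first exact: sqrt_continuous.
by rewrite !expr2; apply: cvgD; exact: cvgM.
Qed.

Lemma cvgCV F f l : Filter F -> l != 0 -> cvgC F f l ->
 cvgC F (fun x => (f x)^-1) l^-1.
Proof.
move=> FF l0 fl; under eq_fun do rewrite invCE; rewrite invCE.
apply: cvgCM; last exact: cvgCJ.
apply: cvgCR; apply: cvgV; first by rewrite sqrf_eq0 cabs_eq0.
by rewrite !expr2; apply: cvgM; exact: cvg_cabs.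
Qed.

Lemma cvgC_expr F f l n : Filter F -> cvgC F f l ->
 cvgC F (fun x => f x ^+ n) (l ^+ n).
Proof.
move=> FF fl; elim: n => [|n IH]; first exact: cvgC_cst.
by under eq_fun do rewrite exprS; rewrite exprS; exact: cvgCM.
Qed.

Lemma cvgC_exprz F f l (n : int) : Filter F -> l != 0 -> cvgC F f l ->
 cvgC F (fun x => f x ^ n) (l ^ n).
Proof.
move=> FF l0 fl; case: n => n; first exact: cvgC_expr.
change (cvgC F (fun x => (f x ^+ n.+1)^-1) (l ^+ n.+1)^-1).
by apply: cvgCV; [rewrite expf_neq0|exact: cvgC_expr].
Qed.

Lemma cvgC_uc F f l : Filter F -> l != 0 -> cvgC F f l ->
 cvgC F (fun x => uc (f x)) (uc l).
Proof.
move=> FF l0 fl; apply: cvgCM => //; apply: cvgCR; apply: cvgV.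
 by rewrite cabs_eq0.
exact: cvg_cabs.
Qed.

Lemma cvgC_expi F (f : T -> R) (l : R) : Filter F -> f x @[x --> F] --> l ->
 cvgC F (fun x => expi (f x)) (expi l).
Proof.
move=> FF fl; split => /=.
 by apply: (cvg_comp _ _ fl); exact: continuous_cos.
by apply: (cvg_comp _ _ fl); exact: continuous_sin.
Qed.

Lemma cvg_ang F f l : Filter F -> 0 < Re l -> cvgC F f l ->
 ang (f x) @[x --> F] --> ang l.
Proof.
move=> FF l_gt0 fl; have l0 : l != 0.
 by apply/eqP => lE; rewrite lE ltxx in l_gt0.
have [_ ucl] := cvgC_uc FF l0 fl; apply: (cvg_comp _ _ ucl).
apply: continuous_asin; rewrite -ltr_norml -(@ltr_pXn2r _ 2)//.
- rewrite real_normK ?num_real// expr1n.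
 have := cabs2 (uc l); rewrite cabs_uc// expr1n => ->.
 by rewrite ltrDr exprn_gt0// ReZ mulr_gt0// invr_gt0 cabs_gt0.
- by rewrite nnegrE.
Qed.
End complex_limits.

Lemma cvgC_comp {R : realType} {T U : Type} (F : set_system T) (G : set_system U) (g : T -> U)
  (f : U -> R[i]) (l : R[i]) : Filter F -> g x @[x --> F] --> G -> cvgC G f l ->
 cvgC F (fun x => f (g x)) l.
Proof.
move=> FF gG [fr fi]; split.
 exact: (@cvg_comp _ _ _ g (fun x => Re (f x)) F G).
exact: (@cvg_comp _ _ _ g (fun x => Im (f x)) F G).
Qed.

Lemma cvg_pair_pt {T : Type} {U V : topologicalType} (F : set_system T)
  (f : T -> U) (g : T -> V) (a : U) (b : V) : Filter F ->
 f x @[x --> F] --> a -> g x @[x --> F] --> b ->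
 (f x, g x) @[x --> F] --> (a, b).
Proof. by move=> FF fa gb; exact: cvg_pair. Qed.

Lemma cvg_sumr {R : realType} {T I : Type} (F : set_system T) (r : seq I)
  (f : I -> T -> R) (l : I -> R) : Filter F ->
 (forall i, f i x @[x --> F] --> l i) ->
 \sum_(i <- r) f i x @[x --> F] --> \sum_(i <- r) l i.
Proof.
move=> FF fl; elim: r => [|i r IH].
 by under eq_fun do rewrite big_nil; rewrite big_nil; exact: cvg_cst.
by under eq_fun do rewrite big_cons; rewrite big_cons; exact: cvgD.
Qed.

(** * Continuous angles of unit complex functions on a square *)

Section lifting.
Context {R : realType}.
Local Open Scope complex_scope.
Implicit Types (p q : R * R).

Lemma unit_expi (z : R[i]) : cabs z = 1 -> exists a, z = expi a.
Proof.
move=> z1; have e : Re z ^+ 2 + Im z ^+ 2 = 1 by rewrite -cabs2 z1 expr1n.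
have rB : -1 <= Re z <= 1 by have := Re_le_cabs z; rewrite z1 ler_norml.
have iE : Num.sqrt (1 - Re z ^+ 2) = `|Im z|.
 by rewrite -e addrAC subrr add0r sqrtr_sqr.
have [i0|i0] := leP 0 (Im z).
 exists (acos (Re z)); apply: complexP; rewrite /= ?acosK ?in_itv//.
 by rewrite sin_acos// iE ger0_norm.
exists (- acos (Re z)); apply: complexP; rewrite /= ?cosN ?acosK ?in_itv//.
by rewrite sinN sin_acos// iE ltr0_norm// opprK.
Qed.

(** Retraction of the line onto [0, 1]; it turns continuity within [0, 1] into continuity
    everywhere. *)
Definition clamp01 (t : R) : R := Num.max 0 (Num.min 1 t).

Lemma clamp01_itv t : clamp01 t \in `[0, 1].
Proof. by rewrite in_itv/= /clamp01 le_max lexx/= ge_max ler01 ge_min lexx. Qed.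

Lemma clamp01_id t : t \in `[0, 1] -> clamp01 t = t.
Proof.
by rewrite in_itv/= => /andP[t0 t1]; rewrite /clamp01 min_r// max_r.
Qed.

Lemma continuous_clamp01 : continuous clamp01.
Proof.
move=> t; apply: continuous_max; first exact: cvg_cst.
by apply: continuous_min; [exact: cvg_cst|exact: cvg_id].
Qed.

(** The value at p follows f along the segment from the origin to p, cut into n equal steps. When n
    is large every quotient of successive values lies in the right half plane, where [ang] is
    continuous; the lift is an initial angle plus the sum of the angles of these quotients. *)
Lemma lift_square (f : R * R -> R[i]) :
 (forall p, cvgC (nbhs p) f (f p)) -> (forall p, cabs (f p) = 1) ->
 exists2 h : R * R -> R, continuous h &
  forall p, p.1 \in `[0, 1] -> p.2 \in `[0, 1] -> f p = expi (h p).
Proof.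
move=> cf f1.
pose sc (s : R) p := (s * p.1, s * p.2).
pose step (s t : R) p := f (sc t p) * (conjc (f (sc s p))).
have csc (T : Type) (F : set_system T) (u : T -> R) (v : T -> R * R) u0 v0 :
  Filter F -> u x @[x --> F] --> u0 -> v x @[x --> F] --> v0 ->
  sc (u x) (v x) @[x --> F] --> sc u0 v0.
 move=> FF uu vv; apply: cvg_pair_pt; apply: cvgM => //.
  by apply: (cvg_comp _ _ vv); exact: cvg_fst.
 by apply: (cvg_comp _ _ vv); exact: cvg_snd.
have cfsc (T : Type) (F : set_system T) (u : T -> R) (v : T -> R * R) u0 v0 :
  Filter F -> u x @[x --> F] --> u0 -> v x @[x --> F] --> v0 ->
  cvgC F (fun x => f (sc (u x) (v x))) (f (sc u0 v0)).
 by move=> FF uu vv; apply: (cvgC_comp FF (csc _ _ _ _ _ _ FF uu vv)); exact: cf.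
have stepC (T : Type) (F : set_system T) (u u' : T -> R) (v : T -> R * R) u0 u0' v0 :
  Filter F -> u x @[x --> F] --> u0 -> u' x @[x --> F] --> u0' ->
  v x @[x --> F] --> v0 ->
  cvgC F (fun x => step (u x) (u' x) (v x)) (step u0 u0' v0).
 move=> FF uu uu' vv; apply: cvgCM; first exact: cfsc.
 by apply: cvgCJ; exact: cfsc.
have step1 s p : step s s p = 1 by rewrite /step mulJ f1 expr1n.
pose K := ((`[0, 1]%classic `*` `[0, 1]%classic) `*` `[0, 1]%classic) : set (R * R * R).
have cK : compact K.
 by apply: compact_setX; [apply: compact_setX|]; exact: segment_compact.
pose P (N : nat) (qs : R * R * R) := 0 < Re (step qs.2 (qs.2 + N.+1%:R^-1) qs.1).
(* The quotient over a step tends to 1 as the step shrinks; compactness gives one step size for all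
   points. *)
have [N0 _ HN] : \forall N \near \oo, K `<=` P N.
 move: cK => /compact_near_coveringP/(_ nat \oo P); apply.
 move=> [q s] _.
 have : cvgC (filter_prod (nbhs (q, s)) \oo)
   (fun x => step x.1.2 (x.1.2 + x.2.+1%:R^-1) x.1.1) (step s (s + 0) q).
  apply: stepC.
  - exact: (@cvg_comp _ _ _ fst snd _ (nbhs (q, s)) _ cvg_fst cvg_snd).
  - apply: cvgD.
    exact: (@cvg_comp _ _ _ fst snd _ (nbhs (q, s)) _ cvg_fst cvg_snd).
   exact: (@cvg_comp _ _ _ snd (@harmonic R) _ \oo _ cvg_snd (@cvg_harmonic R)).
  - exact: (@cvg_comp _ _ _ fst fst _ (nbhs (q, s)) _ cvg_fst cvg_fst).
 rewrite addr0 step1 => -[/= + _] => /cvgrPdist_lt/(_ 1 ltr01).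
 apply: filterS => -[[q' s'] n] /=; rewrite /P/= ltr_norml => /andP[_]; lra.
pose n := N0.+1; pose N := (n%:R : R).
have N_gt0 : 0 < N by rewrite ltr0n.
pose cl p := (clamp01 p.1, clamp01 p.2).
have ccl : continuous cl.
 move=> p; apply: cvg_pair_pt.
  by apply: continuous_comp; [exact: cvg_fst|exact: continuous_clamp01].
 by apply: continuous_comp; [exact: cvg_snd|exact: continuous_clamp01].
have [a0 fa0] := unit_expi (f1 (0, 0)).
have stepP (j : nat) p : (j < n)%N ->
  0 < Re (step (j%:R / N) (j.+1%:R / N) (cl p)).
 move=> jn; have := HN N0 (leqnn _) (cl p, j%:R / N).
 rewrite /P/= -[in j.+1%:R]addn1 natrD mulrDl mul1r; apply.
 split; first by split; exact: clamp01_itv.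
 rewrite /= in_itv/= divr_ge0//= ler_pdivrMr// mul1r ler_nat.
 exact: ltnW.
exists (fun p => a0 + \sum_(j < n) ang (step (j%:R / N) (j.+1%:R / N) (cl p))).
 move=> p; apply: (@cvgD _ _ _ (nbhs p) _ (cst a0)); first exact: cvg_cst.
 apply: (@cvg_sumr _ _ _ (nbhs p)) => j; apply: cvg_ang; first exact: stepP.
 by apply: stepC; [exact: cvg_cst|exact: cvg_cst|exact: ccl].
move=> p p1 p2; have clp : cl p = p.
 by case: p p1 p2 => a b /= ha hb; rewrite /cl !clamp01_id.
(* The quotients telescope, since every value of f has modulus 1. *)
have tele m : (m <= n)%N ->
  expi (\sum_(j < m) ang (step (j%:R / N) (j.+1%:R / N) (cl p))) =
  f (sc (m%:R / N) (cl p)) * (conjc (f (0, 0))).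
 elim: m => [_|m IH mn].
  by rewrite big_ord0 expi0 /sc !mul0r mulJ f1 expr1n.
 rewrite big_ord_recr/= expiD IH ?(ltnW mn)// expi_ang ?stepP//.
 rewrite /uc /step Normc.normcM cabsJ !f1 mulr1 invr1 mul1r.
 have e (a b c : R[i]) : a * b * (c * (conjc a)) = (a * (conjc a)) * (c * b) by ring.
 by rewrite e mulJ f1 expr1n mul1r.
rewrite expiD tele// /N divff ?gt_eqF// -fa0 mulrCA mulJ f1 expr1n mulr1 clp.
by rewrite /sc !mul1r; case: p {p1 p2 clp tele}.
Qed.

Lemma continuous_expi_cst (g : R -> R) (z : R[i]) (a b : R) : a <= b ->
 {within `[a, b], continuous g} -> {in `[a, b], forall t, expi (g t) = z} ->
 g a = g b.
Proof.
move=> ab cg gz.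
wlog gab : g z cg gz / g a <= g b.
 move=> H; have [gab|/ltW gba] := leP (g a) (g b); first exact: (H g z).
 apply: oppr_inj; apply: (H (fun t => - g t) z^-1).
 - by move=> x; apply: cvgN; exact: cg.
 - by move=> t tab; rewrite expiN gz.
 - by rewrite lerN2.
move: gab; rewrite le_eqVlt => /predU1P[//|gab].
(* An intermediate value less than pi above g a: the sine of the difference is positive, yet both
   angles give the same point. *)
pose v := Num.min (g b) (g a + 1).
have gav : g a < v by rewrite lt_min gab ltrDl ltr01.
have [t tab gt] : exists2 t, t \in `[a, b] & g t = v.
 apply: IVT => //.
 by rewrite (min_l (ltW gab)) (max_r (ltW gab)) ltW//= ge_min lexx.
have : expi (g t) = expi (g a) by rewrite !gz// in_itv/= lexx.
rewrite gt => e; have : expi (v - g a) = 1.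
 by rewrite expiD expiN e mulfV// expi_neq0.
move/(congr1 Im) => /=; have vpi : v - g a < pi.
 rewrite ltrBlDl; apply: (@le_lt_trans _ _ (g a + 1)); first by rewrite ge_min lexx orbT.
 by rewrite ltrD2l; have := @pi_ge2 R; lra.
by move=> s0; have := @sin_gt0_pi R (v - g a); rewrite subr_gt0 gav vpi s0 ltxx => /(_ isT).
Qed.
End lifting.

(** * Winding numbers and Borsuk's argument *)

Section winding.
Context {R : realType}.
Local Open Scope complex_scope.
Implicit Types (p q : R * R) (c : R -> R * R).

Definition toC p : R[i] := p.1 +i* p.2.

Lemma toCB p q : toC (p - q) = toC p - toC q.
Proof. by apply: complexP. Qed.

Lemma toC_eq0 p : (toC p == 0) = (p == 0).
Proof. by case: p => a b; rewrite /toC eq_complex xpair_eqE. Qed.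

Lemma cvgC_toC {T : Type} (F : set_system T) (f : T -> R * R) p : Filter F ->
 f x @[x --> F] --> p -> cvgC F (fun x => toC (f x)) (toC p).
Proof.
move=> FF fp; split => /=.
 exact: (@cvg_comp _ _ _ f fst F (nbhs p) _ fp cvg_fst).
exact: (@cvg_comp _ _ _ f snd F (nbhs p) _ fp cvg_snd).
Qed.

Lemma continuous_clamp01_comp {V : topologicalType} (f : R -> V) :
 {within `[0, 1], continuous f} -> continuous (f \o clamp01).
Proof.
move=> /subspace_continuousP cf t.
apply: (@cvg_comp _ _ _ clamp01 f _ (within `[0, 1]%classic (nbhs (clamp01 t)))).
 move=> P wP; have := @continuous_clamp01 R t _ wP.
 change (nbhs t [set s | `[0, 1]%classic (clamp01 s) -> P (clamp01 s)] ->
  nbhs t (clamp01 @^-1` P)).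
 by apply: filterS => s; apply; exact: clamp01_itv.
by apply: cf; exact: clamp01_itv.
Qed.

Definition curve01 c := c @` `[0, 1]%classic.

Definition lift_of c x (th : R -> R) : Prop :=
 continuous th /\ {in `[0, 1], forall t, uc (toC (c t - x)) = expi (th t)}.

Definition winding c x (n : int) : Prop :=
 exists2 th, lift_of c x th & th 1 - th 0 = 2 * pi * n%:~R.

Lemma exists_lift c x : {within `[0, 1], continuous c} -> ~ curve01 c x ->
 exists th, lift_of c x th.
Proof.
move=> cc nx; have ccl := continuous_clamp01_comp cc.
have ne t : toC (c (clamp01 t) - x) != 0.
 rewrite toC_eq0 subr_eq0; apply/eqP => cx; apply: nx; rewrite -cx.
 by exists (clamp01 t) => //; exact: clamp01_itv.
(* The lift on the square is applied to a function of the first coordinate alone. *)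
have [|p|h ch hf] := @lift_square R (fun p => uc (toC (c (clamp01 p.1) - x))).
- move=> p; apply: cvgC_uc => //; apply: cvgC_toC; apply: cvgB; last exact: cvg_cst.
 exact: (@cvg_comp _ _ _ fst (c \o clamp01) _ (nbhs p.1) _ cvg_fst (ccl _)).
- exact: cabs_uc.
exists (fun t => h (t, 0)); split.
 move=> t; apply: (@cvg_comp _ _ _ (fun t => (t, 0)) h _ (nbhs (t, 0))).
  by apply: cvg_pair_pt; [exact: cvg_id|exact: cvg_cst].
 exact: ch.
by move=> t t01; rewrite -hf/= ?clamp01_id// in_itv/= lexx ler01.
Qed.

Lemma exists_winding c x : {within `[0, 1], continuous c} -> c 0 = c 1 ->
 ~ curve01 c x -> exists n, winding c x n.
Proof.
move=> cc c01 nx; have [th thP] := exists_lift cc nx.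
have [|n thn] := @expi_eq R (th 1) (th 0).
 by have [_ h] := thP; rewrite -!h ?c01// in_itv/= ?lexx ?ler01.
by exists n, th => //; rewrite thn addrC addKr.
Qed.

(** Factoring out the dominant term w leaves 1 + q with |q| < 1, whose angle is single-valued, so
    there is no turning. *)
Lemma circle_lift_out (w : R[i]) (r : R) : 0 <= r -> r < cabs w ->
 exists2 k : R -> R, continuous k /\ k 1 = k 0 &
  forall s, uc (w + r%:C * expi (2 * pi * s)) = expi (k s).
Proof.
move=> r0 rw; have w0 : w != 0 by rewrite -cabs_gt0; exact: le_lt_trans rw.
have [a wa] := unit_expi (cabs_uc w0).
pose q s := 1 + r%:C * expi (2 * pi * s) / w.
have q_gt0 s : 0 < Re (q s).
 have : `|Re (r%:C * expi (2 * pi * s) / w)| < 1.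
  apply: le_lt_trans (Re_le_cabs _) _.
  rewrite !Normc.normcM Normc.normcV cabs_expi cabsR ger0_norm// mulr1.
  by rewrite ltr_pdivrMr ?mul1r//; exact: le_lt_trans rw.
 by rewrite ltr_norml /q raddfD/= => /andP[? _]; lra.
exists (fun s => a + ang (q s)); last first.
 move=> s; rewrite expiD expi_ang// -wa -ucM; congr uc.
 by rewrite /q; field.
split; last by rewrite /q mulr1 mulr0 expi_2pi expi0.
move=> s; apply: (@cvgD _ _ _ (nbhs s) _ (cst a)); first exact: cvg_cst.
apply: cvg_ang => //; apply: cvgCD; first exact: cvgC_cst.
apply: cvgCM; last exact: cvgC_cst.
apply: cvgCM; first exact: cvgC_cst.
by apply: cvgC_expi; apply: cvgM; [exact: cvg_cst|exact: cvg_id].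
Qed.

(** Here the rotating term dominates and is factored out; it contributes the full turn. *)
Lemma circle_lift_in (w : R[i]) (r : R) : cabs w < r ->
 exists2 k : R -> R, continuous k /\ k 1 = k 0 + 2 * pi &
  forall s, uc (w + r%:C * expi (2 * pi * s)) = expi (k s).
Proof.
move=> wr; have r_gt0 : 0 < r by exact: le_lt_trans (cabs_ge0 _) wr.
have rc0 : r%:C != 0 :> R[i] by rewrite -cabs_gt0 cabsR normr_gt0 gt_eqF.
pose q s := 1 + w / (r%:C * expi (2 * pi * s)).
have q_gt0 s : 0 < Re (q s).
 have : `|Re (w / (r%:C * expi (2 * pi * s)))| < 1.
  apply: le_lt_trans (Re_le_cabs _) _.
  rewrite !Normc.normcM Normc.normcV Normc.normcM cabs_expi cabsR gtr0_norm// mulr1.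
  by rewrite ltr_pdivrMr ?mul1r.
 by rewrite ltr_norml /q raddfD/= => /andP[? _]; lra.
have ne s : r%:C * expi (2 * pi * s) != 0 by rewrite mulf_neq0// expi_neq0.
exists (fun s => 2 * pi * s + ang (q s)); last first.
 move=> s; rewrite expiD expi_ang//.
 have -> : expi (2 * pi * s) * uc (q s) = uc (r%:C * expi (2 * pi * s) * q s).
  by rewrite !ucM uc_pos// mul1r uc_expi.
 congr uc.
 by rewrite /q; field; rewrite rc0 expi_neq0.
split; last by rewrite /q mulr1 mulr0 expi_2pi expi0 add0r addrC.
move=> s; apply: (@cvgD _ _ _ (nbhs s)).
 by apply: cvgM; [exact: cvg_cst|exact: cvg_id].
apply: cvg_ang => //; apply: cvgCD; first exact: cvgC_cst.
apply: cvgCM; first exact: cvgC_cst.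
apply: cvgCV => //; apply: cvgCM; first exact: cvgC_cst.
by apply: cvgC_expi; apply: cvgM; [exact: cvg_cst|exact: cvg_id].
Qed.

(** A continuous map from a compact interval is closed, so the image carries the quotient topology
    of the interval with its ends identified. In terms of sets, the preimage of a closed set is the
    image under c of a compact set. *)
Lemma descend_to_curve c (th : R -> R) : {within `[0, 1], continuous c} ->
 c 0 = c 1 -> {in `[0, 1[ &, injective c} -> continuous th -> th 0 = th 1 ->
 exists2 g : R * R -> R, {within curve01 c, continuous g} &
  {in `[0, 1], forall t, g (c t) = th t}.
Proof.
move=> cc c01 ci cth th01.
pose s p := xget 0 [set t | `[0, 1]%classic t /\ c t = p].
have sP t : t \in `[0, 1] -> th (s (c t)) = th t.
 move=> t01; have : [set t' | `[0, 1]%classic t' /\ c t' = c t] (s (c t)).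
  by apply: xgetPex; exists t.
 move: (s (c t)) => u [/= u01 cut].
 wlog ut : t u t01 u01 cut / u <= t.
  by move=> H; have [?|/ltW ?] := leP u t; [exact: H|apply/esym; exact: H].
 move: t01 u01; rewrite !in_itv/= => /andP[t0 t1] /andP[u0 u1].
 move: t1; rewrite le_eqVlt => /predU1P[t1|t1].
  move: u1; rewrite le_eqVlt => /predU1P[->|u1]; first by rewrite t1.
  rewrite t1 -th01; congr th; apply: ci; rewrite ?in_itv/= ?u0 ?lexx ?ltr01//.
  by rewrite cut t1 c01.
 by congr th; apply: ci; rewrite ?in_itv/= ?u0 ?t0//= (le_lt_trans ut).
exists (th \o s); last by move=> t t01; exact: sP.
apply/continuous_closedP => A cA; apply/closed_subspaceP.
exists (c @` (`[0, 1]%classic `&` th @^-1` A)).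
 apply: compact_closed; first exact: norm_hausdorff.
 apply: continuous_compact.
  by apply: continuous_subspaceW cc => ? [].
 apply: compact_closedI; first exact: segment_compact.
 by apply: closed_comp => // ? _; exact: cth.
apply/seteqP; split => p /= [].
 move=> [t [t01 At] <-] [u u01 cu]; split; last by exists u.
 by change (A (th (s (c t)))); rewrite sP.
move=> Ap [t t01 ctp]; split; exists t => //; split => //.
by change (A (th t)); rewrite -sP// ctp; exact: Ap.
Qed.

Lemma unit_exprz (u : R[i]) (n : int) : cabs u = 1 -> cabs (u ^ n) = 1.
Proof. by move=> /unit_expi[a ->]; rewrite -expi_int cabs_expi. Qed.

Definition punit x p := uc (toC (p - x)).

Lemma cvgC_punit x p : p != x -> cvgC (nbhs p) (punit x) (punit x p).
Proof.
move=> px; apply: cvgC_uc; first by rewrite toC_eq0 subr_eq0.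
by apply: cvgC_toC; apply: cvgB; [exact: cvg_id|exact: cvg_cst].
Qed.

Lemma cabs_punit x p : p != x -> cabs (punit x p) = 1.
Proof. by move=> px; rewrite cabs_uc// toC_eq0 subr_eq0. Qed.

(* A nonvanishing function with these three exponents would otherwise extend
  continuously over U, hence turn equally often around small and large circles
  centred at y. *)
Lemma winding_exponents c (U : set (R * R)) x1 x2 y (n1 n2 m a1 a2 b : int) :
 {within `[0, 1], continuous c} -> c 0 = c 1 -> {in `[0, 1[ &, injective c} ->
 open U -> bounded_set U -> U `&` curve01 c = set0 ->
 closure U `<=` U `|` curve01 c ->
 U x1 -> U x2 -> ~ U y -> ~ curve01 c y ->
 winding c x1 n1 -> winding c x2 n2 -> winding c y m ->
 a1 * n1 + a2 * n2 + b * m = 0 -> a1 + a2 = 0.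
Proof.
move=> cc c01 ci oU bU Uc clU Ux1 Ux2 nUy ncy.
move=> [th1 [cth1 th1P] w1] [th2 [cth2 th2P] w2] [th3 [cth3 th3P] w3] abE.
(* An angle of [h] along the curve. The relation between the exponents makes its total turning 0, so
   it descends to the image and extends to the plane by Tietze's theorem. *)
pose th t := a1%:~R * th1 t + a2%:~R * th2 t + b%:~R * th3 t.
have cth : continuous th.
 by move=> t; apply: cvgD; [apply: cvgD|]; apply: cvgM;
  [exact: cvg_cst|exact: cth1|exact: cvg_cst|exact: cth2|exact: cvg_cst|exact: cth3].
have th01 : th 0 = th 1.
 apply/esym/eqP; rewrite -subr_eq0; apply/eqP.
 transitivity (a1%:~R * (th1 1 - th1 0) + a2%:~R * (th2 1 - th2 0) +
  b%:~R * (th3 1 - th3 0)); first by rewrite /th; ring.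
 rewrite w1 w2 w3; transitivity (2 * pi * (a1 * n1 + a2 * n2 + b * m)%:~R : R).
  by rewrite !intrD !intrM; ring.
 by rewrite abE mulr0.
have [g0 cg0 g0P] := descend_to_curve cc c01 ci cth th01.
have cptc : compact (curve01 c).
 by apply: continuous_compact => //; exact: segment_compact.
have clc : closed (curve01 c) by apply: compact_closed => //; exact: norm_hausdorff.
have [M M_gt0 g0M] : exists2 M, 0 < M & forall p, curve01 c p -> `|g0 p| <= M.
 have /compact_bounded[N [_ HN]] : compact (g0 @` curve01 c).
  exact: continuous_compact.
 exists (Num.max 0 N + 1); first by rewrite ltr_wpDl// le_max lexx.
 move=> p cp; apply: (HN (Num.max 0 N + 1)); last by exists p.
 by rewrite ltr_pwDr// le_max lexx orbT.
have [g [g0g cg _]] :=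
 continuous_bounded_extension pseudometric_normal clc M_gt0 cg0 g0M.
pose h p := punit x1 p ^ a1 * punit x2 p ^ a2 * punit y p ^ b.
have hP p : p != x1 -> p != x2 -> p != y -> cvgC (nbhs p) h (h p) /\ cabs (h p) = 1.
 move=> p1 p2 p3; split; last first.
  by rewrite !Normc.normcM !unit_exprz ?mulr1// cabs_punit.
 by apply: cvgCM; [apply: cvgCM|]; apply: cvgC_exprz;
  try exact: cvgC_punit; rewrite -cabs_eq0 cabs_punit// oner_eq0.
have hg p : curve01 c p -> h p = expi (g p).
 move=> cp; rewrite -g0g ?inE//; move: cp => [t t01 <-].
 rewrite /h /punit th1P// th2P// th3P// -!expi_int -!expiD g0P//.
(* Inside U the function h, singular at x1 and x2, is replaced by exp(i g). Both agree on the curve,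
   which contains the boundary of U, so F is continuous away from y. *)
pose F p := if p \in U then expi (g p) else h p.
have nU p : ~ U p -> p != x1 /\ p != x2.
 by move=> nUp; split; apply/eqP => px; apply: nUp; rewrite px.
have FP p : p != y -> cvgC (nbhs p) F (F p) /\ cabs (F p) = 1.
 move=> py; rewrite {2 3}/F; case: ifPn => [|]; rewrite ?inE ?notin_setE => Up.
  split; last exact: cabs_expi.
  have [er ei] : cvgC (nbhs p) (fun p => expi (g p)) (expi (g p)).
   by apply: cvgC_expi; exact: cg.
  have nU' : \forall q \near p, F q = expi (g q).
   by apply: filterS (open_nbhs_nbhs (conj oU Up)) => q Uq; rewrite /F mem_set.
  by split; [apply: cvg_trans er|apply: cvg_trans ei]; apply: near_eq_cvg;
   apply: filterS nU' => q ->.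
 have [p1 p2] := nU _ Up; have [[hr hi] h1] := hP _ p1 p2 py.
 split => //; have [cp|ncp] := pselect (curve01 c p).
  have [er ei] : cvgC (nbhs p) (fun p => expi (g p)) (h p).
   by rewrite hg//; apply: cvgC_expi; exact: cg.
  split; apply/cvgrPdist_lt => e e0.
   move/cvgrPdist_lt : er => /(_ e e0) er; move/cvgrPdist_lt : hr => /(_ e e0) hr.
   by apply: filterS2 er hr => q; rewrite /F; case: ifP.
  move/cvgrPdist_lt : ei => /(_ e e0) ei; move/cvgrPdist_lt : hi => /(_ e e0) hi.
  by apply: filterS2 ei hi => q; rewrite /F; case: ifP.
 have nclU : (~` closure U) p by move=> /clU[].
 have nU' : \forall q \near p, F q = h q.
  have oc : open (~` closure U) by apply: closed_openC; exact: closed_closure.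
  apply: filterS (open_nbhs_nbhs (conj oc nclU)) => q nq.
  by rewrite /F memNset// => Uq; apply: nq; exact: subset_closure.
 by split; [apply: cvg_trans hr|apply: cvg_trans hi]; apply: near_eq_cvg;
  apply: filterS nU' => q ->.
have nclUy : (~` closure U) y by move=> /clU[].
have [e0 e0_gt0 e0U] : exists2 e, 0 < e & ball y e `<=` ~` U.
 have oc : open (~` closure U) by apply: closed_openC; exact: closed_closure.
 have /nbhs_ballP[e e0 eU] := open_nbhs_nbhs (conj oc nclUy).
 by exists e => // q /eU nq Uq; apply: nq; exact: subset_closure.
pose w1' := toC (y - x1); pose w2' := toC (y - x2).
have [ny1 ny2] := nU _ nUy.
have w1_gt0 : 0 < cabs w1' by rewrite cabs_gt0 toC_eq0 subr_eq0.
have w2_gt0 : 0 < cabs w2' by rewrite cabs_gt0 toC_eq0 subr_eq0.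
pose e := Num.min (e0 / 2) (Num.min (cabs w1' / 2) (cabs w2' / 2)).
have e_gt0 : 0 < e by rewrite !lt_min !divr_gt0.
have ee0 : e < e0.
 by apply: (@le_lt_trans _ _ (e0 / 2)); [rewrite ge_min lexx|rewrite ltr_pdivrMr; lra].
have ew1 : e < cabs w1'.
 apply: (@le_lt_trans _ _ (cabs w1' / 2)); first by rewrite !ge_min lexx orbT.
 by rewrite ltr_pdivrMr; lra.
have ew2 : e < cabs w2'.
 apply: (@le_lt_trans _ _ (cabs w2' / 2)); first by rewrite !ge_min lexx !orbT.
 by rewrite ltr_pdivrMr; lra.
have [B B0 BU] : exists2 B, 0 <= B & forall q, U q -> `|q| <= B.
 case: bU => N [_ HN]; exists (Num.max 0 N + 1) => [|q Uq].
  by rewrite addr_ge0// le_max lexx.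
 by apply: HN => //; rewrite ltr_pwDr// le_max lexx orbT.
(* 2 (B + |y|) bounds the distance from y to U, the factor 2 passing from the maximum norm to the
   modulus; the other summands put x1, x2 and the small circle inside. *)
pose rho := 2 * (B + `|y|) + 1 + e + cabs w1' + cabs w2'.
have By0 : 0 <= B + `|y| by rewrite addr_ge0.
have rw1 : cabs w1' < rho by rewrite /rho; lra.
have rw2 : cabs w2' < rho by rewrite /rho; lra.
have erho : e < rho by rewrite /rho; lra.
have rho_gt0 : 0 < rho by lra.
pose circ r s := (y.1 + r * cos (2 * pi * s), y.2 + r * sin (2 * pi * s)) : R * R.
have circC r s x : toC (circ r s - x) = toC (y - x) + r%:C * expi (2 * pi * s).
 by apply: complexP => /=; ring.
have circy r s : 0 < r -> circ r s != y.
 move=> r0; rewrite -subr_eq0 -toC_eq0 circC subrr.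
 have -> : toC 0 = 0 by apply/eqP; rewrite toC_eq0.
 by rewrite add0r mulf_neq0 ?expi_neq0// -cabs_gt0 cabsR normr_gt0 gt_eqF.
pose rr s := e + clamp01 s * (rho - e).
have rr_gt0 s : 0 < rr s.
 rewrite ltr_wpDr// mulr_ge0//; last by rewrite subr_ge0 ltW.
 by have := clamp01_itv s; rewrite in_itv/= => /andP[].
have crr : continuous rr.
 move=> s; apply: (@cvgD _ _ _ (nbhs s) _ (cst e)); first exact: cvg_cst.
 by apply: cvgM; [exact: continuous_clamp01|exact: cvg_cst].
have [|p|K cK KP] := @lift_square R (fun p => F (circ (rr p.1) p.2)).
- move=> p; have := (FP _ (circy _ p.2 (rr_gt0 p.1))).1; apply: cvgC_comp.
 have crr1 : rr x.1 @[x --> nbhs p] --> rr p.1.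
  exact: (@cvg_comp _ _ _ fst rr _ (nbhs p.1) _ cvg_fst (crr _)).
 have c2 : 2 * pi * x.2 @[x --> nbhs p] --> 2 * pi * p.2.
  by apply: cvgM; [exact: cvg_cst|exact: cvg_snd].
 apply: cvg_pair_pt; apply: cvgD; first exact: cvg_cst.
 - by apply: cvgM => //; apply: (cvg_comp _ _ c2); exact: continuous_cos.
 - exact: cvg_cst.
 - by apply: cvgM => //; apply: (cvg_comp _ _ c2); exact: continuous_sin.
- by have [] := FP _ (circy _ p.2 (rr_gt0 p.1)).
have cKl s : continuous (fun t => K (s, t)).
 move=> t; apply: (@cvg_comp _ _ _ (fun t => (s, t)) K _ (nbhs (s, t))).
  by apply: cvg_pair_pt; [exact: cvg_cst|exact: cvg_id].
 exact: cK.
have cKr t : continuous (fun s => K (s, t)).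
 move=> s; apply: (@cvg_comp _ _ _ (fun s => (s, t)) K _ (nbhs (s, t))).
  by apply: cvg_pair_pt; [exact: cvg_id|exact: cvg_cst].
 exact: cK.
have i0 : (0 : R) \in `[0, 1] by rewrite in_itv/= lexx ler01.
have i1 : (1 : R) \in `[0, 1] by rewrite in_itv/= lexx ler01.
(* Total turning of F along the circle of radius [rr s]: continuous in s with values in 2 pi Z,
   hence constant. *)
pose D s := K (s, 1) - K (s, 0).
have D01 : D 0 = D 1.
 apply: (@continuous_expi_cst R D 1) => //.
  apply: continuous_subspaceT => s.
  by apply: cvgB; [exact: (cKr 1)|exact: (cKr 0)].
 move=> s s01; rewrite /D expiD expiN -!KP//=.
 rewrite /circ mulr1 mulr0 cos0 sin0 mulr_natl cos2pi sin2pi mulfV//.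
 rewrite -cabs_eq0; have := (FP _ (circy _ 0 (rr_gt0 s))).2.
 by rewrite /circ mulr0 cos0 sin0 => ->; rewrite oner_eq0.
have DE (s1 r : R) (d1 d2 : int) (k1 k2 : R -> R) : s1 \in `[0, 1] -> rr s1 = r ->
  (forall s, ~ U (circ r s)) -> continuous k1 -> continuous k2 ->
  k1 1 = k1 0 + 2 * pi * d1%:~R -> k2 1 = k2 0 + 2 * pi * d2%:~R ->
  (forall s, uc (w1' + r%:C * expi (2 * pi * s)) = expi (k1 s)) ->
  (forall s, uc (w2' + r%:C * expi (2 * pi * s)) = expi (k2 s)) ->
  D s1 = 2 * pi * (a1 * d1 + a2 * d2 + b)%:~R.
 move=> s101 rE nUr ck1 ck2 k1E k2E k1P k2P.
 have r_gt0 : 0 < r by rewrite -rE.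
 pose k s := a1%:~R * k1 s + a2%:~R * k2 s + b%:~R * (2 * pi * s).
 have ck : continuous k.
  move=> s; apply: (@cvgD _ _ _ (nbhs s)).
   by apply: (@cvgD _ _ _ (nbhs s)); apply: cvgM;
    [exact: cvg_cst|exact: ck1|exact: cvg_cst|exact: ck2].
  apply: cvgM; first exact: cvg_cst.
  by apply: cvgM; [exact: cvg_cst|exact: cvg_id].
 have kK s : s \in `[0, 1] -> expi (K (s1, s)) = expi (k s).
  move=> s01; rewrite -KP//= rE /F memNset//.
  rewrite /h /punit !circC k1P k2P subrr.
  have -> : toC 0 = 0 by apply/eqP; rewrite toC_eq0.
  rewrite add0r ucM uc_pos// mul1r uc_expi.
  by rewrite -!expi_int -!expiD.
 have /eqP : K (s1, 0) - k 0 = K (s1, 1) - k 1.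
  apply: (@continuous_expi_cst R (fun s => K (s1, s) - k s) 1) => //.
   apply: continuous_subspaceT => s.
   by apply: (@cvgB _ _ _ (nbhs s)); [exact: (cKl s1)|exact: ck].
  by move=> s s01; rewrite expiD expiN kK// mulfV// expi_neq0.
 rewrite -subr_eq0 => /eqP KE; rewrite /D.
 have -> : K (s1, 1) - K (s1, 0) = k 1 - k 0 by lra.
 by rewrite /k k1E k2E !intrD !intrM; ring.
have nUe s : ~ U (circ e s).
 apply: e0U; split => /=; rewrite /ball/= opprD addNKr normrN normrM gtr0_norm//.
  by apply: le_lt_trans ee0; rewrite ler_piMr ?(ltW e_gt0)// ler_norml cos_geN1 cos_le1.
 by apply: le_lt_trans ee0; rewrite ler_piMr ?(ltW e_gt0)// ler_norml sin_geN1 sin_le1.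
have nUrho s : ~ U (circ rho s).
 move=> /BU Br.
 have : cabs (toC (circ rho s - y)) <= 2 * (B + `|y|).
  apply: le_trans (cabs_le_ReIm _) _.
  have nB : `|circ rho s - y| <= B + `|y|.
   by apply: le_trans (ler_normB _ _) _; rewrite lerD2r.
  have m1 : `|(circ rho s - y).1| <= B + `|y|.
   by apply: le_trans nB; rewrite prod_normE le_max lexx.
  have m2 : `|(circ rho s - y).2| <= B + `|y|.
   by apply: le_trans nB; rewrite prod_normE le_max lexx orbT.
  by have := lerD m1 m2; rewrite /toC /=; lra.
 rewrite circC subrr.
 have -> : toC 0 = 0 by apply/eqP; rewrite toC_eq0.
 rewrite add0r Normc.normcM cabs_expi cabsR gtr0_norm// mulr1 leNgt => /negP; apply.
 by rewrite /rho; lra.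
have [k1 [ck1 k1E] k1P] := circle_lift_out (ltW e_gt0) ew1.
have [k2 [ck2 k2E] k2P] := circle_lift_out (ltW e_gt0) ew2.
have [l1 [cl1 l1E] l1P] := circle_lift_in rw1.
have [l2 [cl2 l2E] l2P] := circle_lift_in rw2.
have D0 : D 0 = 2 * pi * (a1 * 0 + a2 * 0 + b)%:~R.
 apply: (DE _ e 0 0 k1 k2) => //.
 - by rewrite /rr clamp01_id// mul0r addr0.
 - by rewrite mulr0 addr0.
 - by rewrite mulr0 addr0.
have D1 : D 1 = 2 * pi * (a1 * 1 + a2 * 1 + b)%:~R.
 apply: (DE _ rho 1 1 l1 l2) => //.
 - by rewrite /rr clamp01_id// mul1r addrC subrK.
 - by rewrite mulr1.
 - by rewrite mulr1.
(* The small circle surrounds y only, the large one x1, x2 and y, so b = a1 + a2 + b. *)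
have : 2 * pi * (a1 + a2)%:~R = 0 :> R.
 move: D01; rewrite D0 D1 !mulr1 !mulr0 !add0r !intrD => /eqP.
 by rewrite -subr_eq0 => /eqP D01; lra.
move/eqP; rewrite !mulf_eq0 (gt_eqF (pi_gt0 R)) pnatr_eq0/= intr_eq0.
by move/eqP.
Qed.
End winding.

(** * Winding numbers of a Jordan curve, and the derivative of a lifted angle *)

Section winding_more.
Context {R : realType}.
Local Open Scope complex_scope.
Implicit Types (p q : R * R) (c : R -> R * R).

(** Three choices of exponents in [winding_exponents]: (1, 0, 0) shows that a is not 0, (n, -a, 0)
    that two points of U have the same winding number, and (n, 0, -a) that n = 0 off U. That the
    boundary of U lies on the curve is all that is known of its shape. *)
Lemma jordan_winding c (U : set (R * R)) :
 {within `[0, 1], continuous c} -> c 0 = c 1 -> {in `[0, 1[ &, injective c} ->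
 open U -> U !=set0 -> bounded_set U -> U `&` curve01 c = set0 ->
 closure U `<=` U `|` curve01 c ->
 exists2 a : int, a != 0 & forall x, ~ curve01 c x ->
  winding c x (if x \in U then a else 0).
Proof.
move=> cc c01 ci oU [x0 Ux0] bU Uc clU.
have ncU x : U x -> ~ curve01 c x.
 by move=> Ux cx; have : set0 x by rewrite -Uc.
have [y nUy ncy] : exists2 y, ~ U y & ~ curve01 c y.
 have /compact_bounded bc : compact (curve01 c).
  by apply: continuous_compact => //; exact: segment_compact.
 have [N HN] : exists N, forall q, (U `|` curve01 c) q -> `|q| <= Num.max 0 N + 1.
  case: bU => N1 [_ H1]; case: bc => N2 [_ H2]; exists (Num.max N1 N2).
  by move=> q [/H1|/H2]; apply; rewrite ltr_pwDr// !le_max lexx !orbT.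
 have K : ~ (U `|` curve01 c) (Num.max 0 N + 2, 0).
  move=> /HN; rewrite prod_normE/= normr0 max_l// ger0_norm; last first.
   by rewrite addr_ge0// le_max lexx.
  by rewrite lerD2l; lra.
 by exists (Num.max 0 N + 2, 0) => ?; apply: K; [left|right].
have [a xa] := exists_winding cc c01 (ncU _ Ux0).
have [b yb] := exists_winding cc c01 ncy.
have WE := winding_exponents cc c01 ci oU bU Uc clU.
exists a => [|x ncx].
 apply/eqP => a0; have := WE x0 x0 y a a b 1 0 0 Ux0 Ux0 nUy ncy xa xa yb.
 by rewrite a0 !mulr0 !mul0r !addr0 => /(_ erefl)/eqP; rewrite oner_eq0.
have [n xn] := exists_winding cc c01 ncx.
case: ifPn => [|/negP]; rewrite inE => Ux.
 have := WE x0 x y a n b n (- a) 0 Ux0 Ux nUy ncy xa xn yb.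
 rewrite mulNr mul0r addr0 mulrC subrr => /(_ erefl)/eqP.
 by rewrite subr_eq0 => /eqP <-.
have := WE x0 x0 x a a n n 0 (- a) Ux0 Ux0 Ux ncx xa xa xn.
rewrite mulNr mul0r addr0 mulrC subrr => /(_ erefl).
by rewrite addr0 => <-.
Qed.

(** Near t the lift is th t plus the arctangent of ii / rr, where rr + i ii is the product of conj
    (a t + i b t) with a s + i b s; continuity of th selects the branch. *)
Lemma lift_is_derive (a b th : R -> R) (a' b' t : R) :
 {for t, continuous th} -> a t +i* b t != 0 ->
 (\forall s \near t, uc (a s +i* b s) = expi (th s)) ->
 is_derive t 1 a a' -> is_derive t 1 b b' ->
 is_derive t 1 th ((a t * b' - b t * a') / (a t ^+ 2 + b t ^+ 2)).
Proof.
move=> cth dt0 thN da db.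
have th_t : uc (a t +i* b t) = expi (th t) by exact: nbhs_singleton thN.
pose rr s := a t * a s + b t * b s.
pose ii s := a t * b s - b t * a s.
have rr0 : 0 < rr t.
 rewrite /rr -!expr2; have -> : a t ^+ 2 + b t ^+ 2 = cabs (a t +i* b t) ^+ 2.
  by rewrite cabs2.
 by rewrite exprn_gt0// cabs_gt0.
have near_eq : \forall s \near t, th t + atan (ii s / rr s) = th s.
 move/cvgrPdist_lt : cth => /(_ _ (divr_gt0 (pi_gt0 R) (ltr0n R 2))).
 apply: filterS2 thN => s thsE.
 rewrite ltr_norml => /andP[u1 u2].
 have ds0 : a s +i* b s != 0.
  apply/eqP => ds; move: thsE; rewrite ds /uc mulr0 => /esym/eqP.
  by rewrite (negbTE (expi_neq0 _)).
 have u2' : th s - th t < pi / 2 by lra.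
 have u1' : - (pi / 2) < th s - th t by lra.
 rewrite -[th s in RHS](subrK (th t)) addrC; congr (_ + _).
 rewrite -[RHS]tanK ?in_itv/= ?u1' ?u2'//; congr atan.
 have : expi (th s - th t) = uc (a s +i* b s) * (conjc (uc (a t +i* b t))).
  rewrite expiD expiN -thsE -th_t; congr (_ * _).
  by rewrite invCE cabs_uc// expr1n invr1 mul1r.
 rewrite /uc; set ks := (cabs (a s +i* b s))^-1; set kt := (cabs (a t +i* b t))^-1.
 have ks0 : ks != 0 by rewrite invr_eq0 cabs_eq0.
 have kt0 : kt != 0 by rewrite invr_eq0 cabs_eq0.
 move=> e; rewrite /tan.
 have -> : cos (th s - th t) = ks * kt * rr s.
  by have := congr1 Re e; rewrite /= => ->; rewrite /rr; ring.
 have -> : sin (th s - th t) = ks * kt * ii s.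
  by have := congr1 Im e; rewrite /= => ->; rewrite /ii; ring.
 by rewrite -mulf_div divff ?mulf_neq0// mul1r.
apply: near_eq_is_derive near_eq _.
have drr : is_derive t 1 rr (a t * a' + b t * b').
 by apply: is_derive_eq; rewrite /GRing.scale/=; ring.
have dii : is_derive t 1 ii (a t * b' - b t * a').
 by apply: is_derive_eq; rewrite /GRing.scale/=; ring.
have dV := is_deriveV (lt0r_neq0 rr0) drr.
have dq : is_derive t 1 (fun s => ii s / rr s) ((a t * b' - b t * a') / rr t).
 have h := is_deriveM dii dV.
 apply: (is_derive_eq h); rewrite /GRing.scale/=.
 have -> : ii t = 0 by rewrite /ii; ring.
 by rewrite mul0r add0r mulrC.
pose q (s : R) := ii s / rr s.
have datan := @is_derive1_comp R atan q t _ _ (is_derive1_atan (q t)) dq.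
have h := is_deriveD (is_derive_cst (th t) t 1) datan.
apply: (is_derive_eq h).
rewrite add0r /q; have -> : ii t = 0 by rewrite /ii; ring.
by rewrite mul0r expr0n addr0 invr1 mul1r /rr -!expr2.
Qed.

End winding_more.

(** * Piecewise calculus for complex functions *)

Section complex_pieces.
Context {R : realType}.
Local Open Scope complex_scope.

Lemma rcD (x y : R) : (x + y)%:C = x%:C + y%:C. Proof. exact: rmorphD. Qed.
Lemma rcN (x : R) : (- x)%:C = - x%:C. Proof. exact: rmorphN. Qed.
Lemma rcM (x y : R) : (x * y)%:C = x%:C * y%:C. Proof. exact: rmorphM. Qed.
Lemma rcV (x : R) : (x^-1)%:C = x%:C^-1. Proof. exact: fmorphV. Qed.
Lemma rcX (x : R) n : (x ^+ n)%:C = x%:C ^+ n. Proof. exact: rmorphXn. Qed.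
Lemma conjcM (z w : R[i]) : (conjc (z * w)) = (conjc z) * (conjc w). Proof. exact: rmorphM. Qed.

Implicit Types (a b : R) (f g df dg : R -> R[i]).

Definition cpieceC f a b :=
 pieceC (fun t => Re (f t)) a b /\ pieceC (fun t => Im (f t)) a b.

Definition cpieceD f df a b :=
 pieceD (fun t => Re (f t)) (fun t => Re (df t)) a b /\
 pieceD (fun t => Im (f t)) (fun t => Im (df t)) a b.

Lemma cpieceD_C f df a b : cpieceD f df a b -> cpieceC df a b.
Proof. by move=> [[_ ? _] [_ ? _]]. Qed.

Lemma cpieceD_C0 f df a b : cpieceD f df a b -> cpieceC f a b.
Proof. by move=> [[? _ _] [? _ _]]; split; exact: within_pieceC. Qed.

Lemma pieceD_eq1 (f g df dg : R -> R) a b : f =1 g -> df =1 dg ->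
 pieceD f df a b -> pieceD g dg a b.
Proof. by move=> /funext -> /funext ->. Qed.

Lemma pieceC_eq1 (f g : R -> R) a b : f =1 g -> pieceC f a b -> pieceC g a b.
Proof. by move=> /funext ->. Qed.

Lemma cpieceCM f g a b : cpieceC f a b -> cpieceC g a b ->
 cpieceC (fun t => f t * g t) a b.
Proof.
move=> [fr fi] [gr gi]; split.
 apply: (pieceC_eq1 (fun t => esym (ReM (f t) (g t)))).
 by apply: pieceCD; [exact: pieceCM|apply: pieceCN; exact: pieceCM].
apply: (pieceC_eq1 (fun t => esym (ImM (f t) (g t)))).
by apply: pieceCD; exact: pieceCM.
Qed.

Lemma cpieceC_cst z a b : cpieceC (fun=> z) a b.
Proof. by split; exact: pieceC_cst. Qed.

Lemma cpieceDD f df g dg a b : cpieceD f df a b -> cpieceD g dg a b ->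
 cpieceD (fun t => f t + g t) (fun t => df t + dg t) a b.
Proof.
move=> [fr fi] [gr gi]; split.
 apply: pieceD_eq1 (pieceDD fr gr) => t; rewrite ?ReD ?ImD //.
apply: pieceD_eq1 (pieceDD fi gi) => t; rewrite ?ReD ?ImD //.
Qed.

Lemma cpieceD_cst z a b : cpieceD (fun=> z) (fun=> 0) a b.
Proof. by split; exact: pieceD_cst. Qed.

Lemma cpieceDM f df g dg a b : cpieceD f df a b -> cpieceD g dg a b ->
 cpieceD (fun t => f t * g t) (fun t => df t * g t + f t * dg t) a b.
Proof.
move=> [fr fi] [gr gi]; split.
 apply: pieceD_eq1 (pieceDD (pieceDM fr gr) (pieceDN (pieceDM fi gi))) => t.
  by rewrite ReM.
 by rewrite ReD !ReM; ring.
apply: pieceD_eq1 (pieceDD (pieceDM fr gi) (pieceDM fi gr)) => t.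
 by rewrite ImM.
by rewrite ImD !ImM; ring.
Qed.

Lemma pieceDV (f df : R -> R) a b : (forall t, t \in `[a, b] -> f t != 0) ->
 pieceD f df a b -> pieceD (fun t => (f t)^-1) (fun t => - (f t ^- 2) * df t) a b.
Proof.
move=> f0 Df; apply: (@pieceD_comp _ (fun x => x^-1) (fun x => - x ^- 2)) Df => t tab.
 have := @is_deriveV R id (f t) 1 1 (f0 t tab) (is_derive_id _ _).
 by move=> h; apply: (is_derive_eq h); rewrite /GRing.scale/= mulr1.
apply: cvgN; apply: cvgV; first by rewrite sqrf_eq0 f0.
by rewrite /continuous_at expr2; apply: cvgM; exact: cvg_id.
Qed.

Lemma cpieceDJ f df a b : cpieceD f df a b ->
 cpieceD (fun t => (conjc (f t))) (fun t => (conjc (df t))) a b.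
Proof.
move=> [fr fi]; split.
 by apply: pieceD_eq1 fr => t; rewrite ReJ.
by apply: pieceD_eq1 (pieceDN fi) => t; rewrite ImJ.
Qed.

Lemma cpieceDR (f df : R -> R) a b : pieceD f df a b ->
 cpieceD (fun t => (f t)%:C) (fun t => (df t)%:C) a b.
Proof. by move=> Df; split => //=; exact: pieceD_cst. Qed.

Lemma pieceD_cabs2 f df a b : cpieceD f df a b ->
 pieceD (fun t => cabs (f t) ^+ 2) (fun t => 2 * Re ((conjc (f t)) * df t)) a b.
Proof.
move=> [fr fi]; apply: pieceD_eq1 (pieceDD (pieceDM fr fr) (pieceDM fi fi)) => t.
 by rewrite cabs2.
by rewrite ReM ReJ ImJ; ring.
Qed.

Lemma cpieceDV f df a b : (forall t, t \in `[a, b] -> f t != 0) ->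
 cpieceD f df a b -> cpieceD (fun t => (f t)^-1) (fun t => - (f t ^- 2) * df t) a b.
Proof.
move=> f0 Df.
have n0 t : t \in `[a, b] -> cabs (f t) ^+ 2 != 0.
 by move=> tab; rewrite sqrf_eq0 cabs_eq0 f0.
have D1 := pieceDV n0 (pieceD_cabs2 Df).
have D2 := cpieceDM (cpieceDR D1) (cpieceDJ Df).
have fE t : ((cabs (f t) ^+ 2)^-1)%:C * (conjc (f t)) = (f t)^-1 by rewrite -invCE.
have Re2 (z : R[i]) : (2 * Re z)%:C = z + (conjc z).
 by case: z => x y; apply: complexP => /=; ring.
have Jne t : t \in `[a, b] -> (conjc (f t)) != 0.
 by move=> tab; rewrite -cabs_eq0 cabsJ cabs_eq0 f0.
have dE t : t \in `]a, b[ ->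
  (- (cabs (f t) ^+ 2) ^- 2 * (2 * Re ((conjc (f t)) * df t)))%:C * (conjc (f t)) +
  ((cabs (f t) ^+ 2)^-1)%:C * (conjc (df t)) = - f t ^- 2 * df t.
 move=> /subset_itv_oo_cc tab; have ft := f0 t tab; have jt := Jne t tab.
 rewrite rcM rcN !rcV rcX -mulJ Re2 conjcM conjcK.
 by field; rewrite ft jt.
case: D2 => Dr Di; split.
 apply: (@pieceD_eq _ _ _ (fun t => Re (- f t ^- 2 * df t))).
  by move=> t tab; rewrite -dE.
 by apply: pieceD_eq1 Dr => t //; rewrite fE.
apply: (@pieceD_eq _ _ _ (fun t => Im (- f t ^- 2 * df t))).
 by move=> t tab; rewrite -dE.
by apply: pieceD_eq1 Di => t //; rewrite fE.
Qed.
End complex_pieces.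

(** * Integrals of complex functions *)

Section complex_integral.
Context d (T : measurableType d) {R : realType} (mu : {measure set T -> \bar R}).
Local Open Scope complex_scope.
Implicit Types (D : set T) (f g : T -> R[i]) (z : R[i]).

Definition Cint D f : R[i] :=
 (\int[mu]_(x in D) Re (f x)) +i* (\int[mu]_(x in D) Im (f x)).

Definition Cintegrable D f : Prop :=
 mu.-integrable D (fun x => (Re (f x))%:E) /\
 mu.-integrable D (fun x => (Im (f x))%:E).

Lemma eq_Cint D f g : {in D, f =1 g} -> Cint D f = Cint D g.
Proof.
move=> fg; rewrite /Cint; congr Complex; apply: eq_Rintegral => x xD;
 by rewrite fg.
Qed.

Lemma Cintegrable_eq D f g : f =1 g -> Cintegrable D f -> Cintegrable D g.
Proof. by move=> /funext ->. Qed.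

Lemma integrable_ext D (f g : T -> \bar R) : f =1 g ->
 mu.-integrable D f -> mu.-integrable D g.
Proof. by move=> /funext ->. Qed.

Lemma CintegrableD D f g : measurable D -> Cintegrable D f -> Cintegrable D g ->
 Cintegrable D (fun x => f x + g x).
Proof.
move=> mD [fr fi] [gr gi]; split.
 by apply: integrable_ext (integrableD mD fr gr) => x; rewrite ReD EFinD.
by apply: integrable_ext (integrableD mD fi gi) => x; rewrite ImD EFinD.
Qed.

Lemma CintegrableZ D f z : measurable D -> Cintegrable D f ->
 Cintegrable D (fun x => z * f x).
Proof.
move=> mD [fr fi]; split.
 apply: integrable_ext (integrableB mD (integrableZl mD (Re z) fr)
  (integrableZl mD (Im z) fi)) => x.
 by rewrite ReM -!EFinM -EFinB.
apply: integrable_ext (integrableD mD (integrableZl mD (Re z) fi)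
  (integrableZl mD (Im z) fr)) => x.
by rewrite ImM -!EFinM -EFinD.
Qed.

Lemma CintD D f g : measurable D -> Cintegrable D f -> Cintegrable D g ->
 Cint D (fun x => f x + g x) = Cint D f + Cint D g.
Proof.
move=> mD [fr fi] [gr gi]; apply: complexP; rewrite ?ReD ?ImD /=.
 by rewrite -RintegralD//; apply: eq_Rintegral => x _; rewrite ReD.
by rewrite -RintegralD//; apply: eq_Rintegral => x _; rewrite ImD.
Qed.

Lemma CintZ D f z : measurable D -> Cintegrable D f ->
 Cint D (fun x => z * f x) = z * Cint D f.
Proof.
move=> mD [fr fi]; apply: complexP; rewrite ?ReM ?ImM /=.
 rewrite -!RintegralZl// -RintegralB//.
 - by apply: eq_Rintegral => x _; rewrite ReM.
 - exact: integrableZl fr.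
 - exact: integrableZl fi.
rewrite -!RintegralZl// -RintegralD//.
- by apply: eq_Rintegral => x _; rewrite ImM.
- exact: integrableZl fi.
- exact: integrableZl fr.
Qed.

Lemma CintB D f g : measurable D -> Cintegrable D f -> Cintegrable D g ->
 Cint D (fun x => f x - g x) = Cint D f - Cint D g.
Proof.
move=> mD fi gi; rewrite -mulN1r -CintZ// -CintD//; last exact: CintegrableZ.
by apply: eq_Cint => x _; rewrite mulN1r.
Qed.

Lemma CintegrableB D f g : measurable D -> Cintegrable D f -> Cintegrable D g ->
 Cintegrable D (fun x => f x - g x).
Proof.
move=> mD fi gi; apply: (@Cintegrable_eq _ (fun x => f x + (-1) * g x)) => [x|].
 by rewrite mulN1r.
by apply: CintegrableD => //; exact: CintegrableZ.
Qed.
End complex_integral.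

(** * The winding number as a line integral *)

Section curve_integrals.
Context {R : realType}.
Local Open Scope complex_scope.
Notation mu := (@lebesgue_measure R).
Implicit Types (f df : R -> R[i]) (s : seq R).

Lemma pieces_Cintegrable f (a b : R) s : a < b -> itv_partition a b s ->
 on_pieces (cpieceC f) a s -> Cintegrable mu `[a, b] f.
Proof.
move=> ab pab Cf; split; apply: (pieces_integrable ab pab);
 by apply: (on_pieces_imp _ pab Cf) => ? ? _ _ _ [].
Qed.

(** The real part is the derivative of ln |c - x|, which takes equal values at both ends; the
    imaginary part is the derivative of the lifted angle. *)
Lemma winding_integral (c : R -> R * R) dz s x n : itv_partition 0 1 s ->
 on_pieces (cpieceD (toC \o c) dz) 0 s -> c 0 = c 1 -> ~ curve01 c x ->
 winding c x n ->
 Cint mu `[0, 1] (fun t => dz t / (toC (c t) - toC x)) =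
 0 +i* (2 * pi * n%:~R).
Proof.
move=> ps Dc c01 ncx [th [cth thP] thn].
pose dd t := toC (c t) - toC x.
have dd0 t : t \in `[0, 1] -> dd t != 0.
 move=> t01; rewrite /dd -toCB toC_eq0 subr_eq0; apply/eqP => ctx.
 by apply: ncx; exists t.
have Ddd : on_pieces (fun a b => 0 <= a /\ b <= 1 /\ a < b /\ cpieceD dd dz a b) 0 s.
 apply: (on_pieces_imp _ ps Dc) => a b a0 ab b1 Dab; do 3 split => //.
 have [Dr Di] := cpieceDD Dab (cpieceD_cst (- toC x) a b).
 by split; [apply: pieceD_eq1 Dr|apply: pieceD_eq1 Di] => t //; rewrite addr0.
pose F t := 2^-1 * ln (cabs (dd t) ^+ 2).
have sub a b t : 0 <= a -> b <= 1 -> t \in `[a, b] -> t \in `[0, 1].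
 by move=> a0 b1; rewrite !in_itv/= => /andP[at_ tb];
  rewrite (le_trans a0)// (le_trans tb).
have lr (z w : R[i]) : Re (w / z) = (cabs z ^+ 2)^-1 * Re (conjc z * w).
 by rewrite invCE mulrCA ReZ mulrC [w * _]mulrC mulrC.
have DF : on_pieces (pieceD F (fun t => Re (dz t / dd t))) 0 s.
 apply: (on_pieces_imp _ ps Ddd) => a b _ _ _ [a0 [b1 [ab Dab]]].
 have Dln := @pieceD_comp R (@ln R) (fun x => x^-1) _ _ a b _ _ (pieceD_cabs2 Dab).
 apply: pieceD_eq1 (pieceDM (pieceD_cst 2^-1 a b) (Dln _ _)) => t //.
 - rewrite lr [cst 0 t]/(0 : R) [cst 2^-1 t]/(2^-1 : R) mul0r add0r.
  by rewrite mulrCA mulKf// pnatr_eq0.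
 - move=> tab; apply: is_derive1_ln; rewrite exprn_gt0// cabs_gt0 dd0//.
  exact: sub tab.
 - move=> tab; apply: cvgV; last exact: cvg_id.
  by rewrite sqrf_eq0 cabs_eq0 dd0//; exact: sub tab.
have Dth : on_pieces (pieceD th (fun t => Im (dz t / dd t))) 0 s.
 apply: (on_pieces_imp _ ps Ddd) => a b _ _ _ [a0 [b1 [ab Dab]]].
 have [[cr cr' dr] [ci ci' di]] := Dab.
 split; first exact: continuous_subspaceT.
  have := cpieceCM (cpieceD_C Dab) (cpieceD_C0 (cpieceDV _ Dab)).
  by case => // t tab; apply: dd0; exact: sub tab.
 move=> t tab; have t01 : t \in `[0, 1].
  by apply: sub (subset_itv_oo_cc tab).
 have -> : Im (dz t / dd t) = (Re (dd t) * Im (dz t) - Im (dd t) * Re (dz t)) /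
   (Re (dd t) ^+ 2 + Im (dd t) ^+ 2).
  by rewrite ImM ReV ImV cabs2; ring.
 apply: (@lift_is_derive R (fun t => Re (dd t)) (fun t => Im (dd t))).
 - exact: cth.
 - have -> : Re (dd t) +i* Im (dd t) = dd t by exact: complexP.
  exact: dd0.
 - have : \forall s \near t, s \in `]a, b[.
   exact: near_in_itvoo.
  apply: filterS => u uab.
  have -> : Re (dd u) +i* Im (dd u) = dd u by exact: complexP.
  rewrite /dd -toCB thP//; exact: sub (subset_itv_oo_cc uab).
 - exact: dr.
 - exact: di.
rewrite /Cint (pieces_ftc ltr01 ps DF) (pieces_ftc ltr01 ps Dth).
by rewrite thn /F /dd c01 subrr.
Qed.
End curve_integrals.

(** * Change of variable on the line for nonnegative functions *)

Lemma ge0_integral_mrestr d (T : measurableType d) (R : realType)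
  (m : {measure set T -> \bar R}) (D : set T) (mD : measurable D)
  (f : T -> \bar R) : measurable_fun setT f -> (forall x, (0 <= f x)%E) ->
 (\int[mrestr m mD]_x f x = \int[m]_(x in D) f x)%E.
Proof.
move=> mf f0; rewrite -(setUv D) ge0_integral_setU//; last 3 first.
- exact: measurableC.
- by rewrite setUv.
- exact/disj_setPCl.
rewrite [X in (_ + X)%E]null_set_integral//; last 3 first.
- exact: measurableC.
- exact: measurable_funTS.
- by rewrite /= /mrestr setICl measure0.
rewrite adde0; apply: eq_measure_integral => A mA AD.
by rewrite /= /mrestr setIidl.
Qed.

Section substitution.
Context {R : realType}.
Notation mu := (@lebesgue_measure R).
Notation TR := (measurableTypeR R).
Local Open Scope ereal_scope.

Lemma measurable_undergraph (W : R -> R) : measurable_fun setT W ->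
 measurable [set p : TR * TR | (0 <= p.2 < W p.1)%R].
Proof.
move=> mW; have -> : [set p : TR * TR | (0 <= p.2 < W p.1)%R] =
  ([set: TR] `*` `[0%R, +oo[%classic) `&`
  ((fun p : TR * TR => W p.1 - p.2)%R @^-1` `]0%R, +oo[%classic).
 apply/seteqP; split => -[x y] /=; rewrite !in_itv/= !andbT subr_gt0.
  by move=> /andP[? ?].
 by move=> [[_ ?] ?]; apply/andP.
apply: measurableI; first exact: measurableX.
rewrite -[X in measurable X]setTI.
have m1 : measurable_fun setT (fun p : TR * TR => W p.1).
 by apply: measurableT_comp => //; exact: measurable_fst.
have m2 : measurable_fun setT (fun p : TR * TR => p.2).
 exact: measurable_snd.
exact: (measurable_funB m1 m2).
Qed.

(* [W] is turned into a measure by taking the area under its graph, which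
  makes the right-hand side an integral against a pushforward measure. *)
Lemma ge0_integral_substitution (J : set R) (g W : R -> R) (f : R -> \bar R) :
 measurable J -> measurable_fun setT g -> measurable_fun setT W ->
 (forall x, 0 <= W x)%R ->
 (forall E, ocitv E -> mu (E `&` J) = \int[mu]_x (W x * \1_E (g x))%:E) ->
 measurable_fun setT f -> (forall x, 0 <= f x) ->
 \int[mu]_(y in J) f y = \int[mu]_x ((W x)%:E * f (g x)).
Proof.
move=> mJ mg mW W0 muE mf f0.
have mA := measurable_undergraph mW.
set A := [set p : TR * TR | _] in mA.
have mgf : measurable_fun setT (g \o fst : TR * TR -> TR).
 by apply: measurableT_comp => //; exact: measurable_fst.
(* Tonelli under the graph: the fibre over x is an interval of length W x. *)
have key (h : R -> \bar R) : measurable_fun setT h -> (forall x, 0 <= h x) ->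
  \int[(mu \x mu)%E]_(p in A) h (g p.1) = \int[mu]_x ((W x)%:E * h (g x)).
 move=> mh h0; rewrite integral_mkcond.
 rewrite fubini_tonelli1; last 2 first.
 - apply: ((measurable_restrictT (fun p => h (g p.1)) mA).1).
  by apply: measurable_funTS; apply: (measurableT_comp mh); exact: mgf.
 - by move=> p; rewrite erestrict_ge0.
 apply: eq_integral => x _; rewrite /fubini_F.
 transitivity (\int[mu]_(y in `[0%R, W x[) h (g x)).
  rewrite [RHS]integral_mkcond; apply: eq_integral => y _.
  by rewrite !patchE; congr (if _ then _ else _); rewrite !inE/= in_itv.
 rewrite integral_cst//= lebesgue_measure_itv/= lte_fin.
 have := W0 x; rewrite le_eqVlt => /predU1P[<-|->].
  by rewrite ltxx mule0 mul0e.
 by rewrite -EFinB subr0 muleC.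
pose nu2 : {measure set TR -> \bar R} :=
 measure_function_pushforward__canonical__measure_function_Measure
  (mrestr (mu \x mu)%E mA) mgf.
pose nu1 : {measure set TR -> \bar R} := mrestr mu mJ.
(* Half-open intervals are stable under intersection and generate the Borel sets, so agreement on
   them is enough. *)
have nuE E : measurable E -> nu1 E = nu2 E.
 move=> mE; apply: (@measure_unique _ R TR (@ocitv R)
  (fun k => `](- k%:R)%R, k%:R]%classic)) => //.
 - exact: ocitvI.
 - by move=> k; exact: is_ocitv.
 - exact: bigcup_itvT.
 - move=> B oB; have mB : measurable B by exact: sub_sigma_algebra.
  rewrite /nu1 /nu2 /= /pushforward /mrestr muE//.
  rewrite -(key (fun x => (\1_B x)%:E)); last 2 first.
  + by apply/measurable_EFinP; exact: measurable_indic.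
  + by move=> x; rewrite lee_fin.
  rewrite -[RHS]integral_indic//.
  by rewrite -[X in measurable X]setTI; exact (mgf measurableT B mB).
 - move=> k; apply: (@le_lt_trans _ _ (mu `](- k%:R)%R, k%:R]%classic)).
   by apply: le_measure; rewrite ?inE//; exact: measurableI.
  by rewrite /= lebesgue_measure_itv/=; case: ifP => _; rewrite ?ltry// -EFinB ltry.
rewrite -key//.
rewrite -(ge0_integral_mrestr _ mA (f := fun p => f (g p.1))); last 2 first.
- by apply: (measurableT_comp mf); exact mgf.
- by [].
transitivity (\int[nu1]_y f y); first by rewrite ge0_integral_mrestr.
transitivity (\int[nu2]_y f y).
 by apply: eq_measure_integral => B mB _; exact: nuE.
exact: (ge0_integral_pushforward mgf _ measurableT mf (fun y _ => f0 y)).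
Qed.

Lemma ge0_integral_affine (a b : R) (f : R -> \bar R) : a != 0%R ->
 measurable_fun setT f -> (forall x, 0 <= f x) ->
 \int[mu]_y f y = \int[mu]_x (`|a|%:E * f (a * x + b)%R).
Proof.
move=> a0 mf f0.
have mg : measurable_fun setT (fun x : R => a * x + b)%R.
 by apply: measurable_funD => //; exact: measurable_funM.
rewrite (@ge0_integral_substitution setT (fun x => a * x + b)%R (cst `|a|%R))//.
move=> _ [[c d] _ <-]; rewrite setIT /=.
under eq_integral do rewrite EFinM.
have mE : measurable [set x : R | (c < a * x + b <= d)%R].
 by rewrite -[X in measurable X]setTI; exact: (mg measurableT `]c, d]%classic).
have -> : (fun x : R => `|a|%:E * (\1_(`]c, d]%classic) (a * x + b)%R)%:E) =
  (fun x : R => `|a|%:E * (\1_([set x : R | (c < a * x + b <= d)%R]) x)%:E).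
 by apply/funext => x; congr (_ * (_)%:E); rewrite !indicE; congr ((nat_of_bool _)%:R).
rewrite ge0_integralZl//; last first.
 by apply/measurable_EFinP; exact: measurable_indic.
rewrite integral_indic// setIT.
have [a_lt0|a_gt0|aE] := ltgtP a 0%R; last by rewrite aE eqxx in a0.
 rewrite (_ : [set x : R | (c < a * x + b <= d)%R] = `[((d - b) / a)%R, ((c - b) / a)%R[%classic); last first.
  apply/seteqP; split => x /=; rewrite in_itv/= ler_ndivrMr// ltr_ndivlMr// [(x * a)%R]mulrC => /andP[h1 h2]; apply/andP; split; lra.
 rewrite /= !lebesgue_measure_itv/= !lte_fin ltr_nM2r ?invr_lt0//.
 rewrite ltrD2r; case: ifP => // _; last by rewrite mule0.
 rewrite -!EFinB -EFinM ltr0_norm//; congr EFin; by field.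
rewrite (_ : [set x : R | (c < a * x + b <= d)%R] = `]((c - b) / a)%R, ((d - b) / a)%R]%classic); last first.
 apply/seteqP; split => x /=; rewrite in_itv/= ler_pdivlMr// ltr_pdivrMr// [(x * a)%R]mulrC => /andP[h1 h2]; apply/andP; split; lra.
rewrite /= !lebesgue_measure_itv/= !lte_fin ltr_pM2r ?invr_gt0//.
rewrite ltrD2r; case: ifP => // _; last by rewrite mule0.
rewrite -!EFinB -EFinM gtr0_norm//; congr EFin; by field.
Qed.

Lemma ge0_integral_increasing (g dg : R -> R) (a b : R) (f : R -> \bar R) :
 (a < b)%R -> measurable_fun setT g -> measurable_fun setT dg ->
 {in `[a, b] &, {homo g : x y / (x < y)%R}} ->
 pieceD g dg a b -> (forall x, x \in `[a, b] -> 0 <= dg x)%R ->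
 measurable_fun setT f -> (forall x, 0 <= f x) ->
 \int[mu]_(y in `]g a, g b]) f y = \int[mu]_(x in `]a, b]) ((dg x)%:E * f (g x)).
Proof.
move=> ab mg mdg ig Dg dg0 mf f0.
pose W x := if x \in `]a, b] then dg x else 0%R.
have mW : measurable_fun setT W.
 have -> : W = dg \_ `]a, b]%classic.
  by apply/funext => x; rewrite patchE mem_setE.
 by apply: (measurable_restrictT _ _).1 => //; exact: measurable_funTS.
rewrite (@ge0_integral_substitution _ g W)//.
- rewrite [RHS]integral_mkcond; apply: eq_integral => x _.
 by rewrite patchE mem_setE /W; case: ifP => // _; rewrite mul0e.
- move=> x; rewrite /W; case: ifP => // /subset_itv_oc_cc; exact: dg0.
move=> _ [[c d] _ <-]; rewrite /=.
have gab : (g a < g b)%R by apply: ig => //; rewrite in_itv/= lexx ltW.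
have [cg _ _] := Dg.
(* Clamping c and d to the range of g provides preimages x1 and x2, and it changes no comparison
   with points of []g a, g b]]; the fundamental theorem then gives the measure. *)
pose cl (v : R) : R := Num.max (g a) (Num.min (g b) v).
have clB v : (g a <= cl v <= g b)%R.
 by rewrite /cl le_max lexx/= ge_max ltW//= ge_min lexx.
have ex v : exists2 x, x \in `[a, b] & g x = cl v.
 by apply: (IVT (ltW ab) cg); rewrite (min_l (ltW gab)) (max_r (ltW gab)).
have [x1 x1ab gx1] := ex c; have [x2 x2ab gx2] := ex d.
have igE x y : x \in `[a, b] -> y \in `[a, b] -> (g x < g y)%R = (x < y)%R.
 move=> xab yab; apply/idP/idP; last exact: ig.
 apply: contraTT; rewrite -!leNgt le_eqVlt => /predU1P[->//|/(ig _ _ yab xab)].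
 exact: ltW.
have clt (v y : R) : (g a < y <= g b)%R -> (v < y)%R = (cl v < y)%R.
 move=> /andP[ay yb]; rewrite /cl gt_max ay/= gt_min.
 by have -> : (g b < y)%R = false by rewrite ltNge yb.
have setE1 : `]c, d]%classic `&` `]g a, g b]%classic = `]cl c, cl d]%classic.
 apply/seteqP; split => y /=; rewrite !in_itv/=.
  move=> [/andP[cy yd] yab]; rewrite -clt// cy/= leNgt -clt// -leNgt//.
 move=> /andP[cy yd]; have /andP[ac _] := clB c; have /andP[_ db] := clB d.
 have yab : (g a < y <= g b)%R.
  by rewrite (le_lt_trans ac)//= (le_trans yd).
 by rewrite (clt c)// cy leNgt (clt d)// -leNgt yd.
have setE2 x : x \in `]a, b] -> (g x \in `]c, d]) = (x \in `]x1, x2]).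
 move=> xab; have xab' : x \in `[a, b] by exact: subset_itv_oc_cc.
 have gxab : (g a < g x <= g b)%R.
  have aab : a \in `[a, b] by rewrite in_itv/= lexx ltW.
  have bab : b \in `[a, b] by rewrite in_itv/= lexx ltW.
  move: xab; rewrite in_itv/= => /andP[ax xb].
  by rewrite igE// ax/= leNgt igE// -leNgt.
 by rewrite !in_itv/= (clt c)// -gx1 igE// leNgt (clt d)// -gx2 igE// -leNgt.
have x12ab : `]x1, x2]%classic `<=` `]a, b]%classic.
 move=> x; rewrite /= !in_itv/= => /andP[h1 h2].
 move: x1ab x2ab; rewrite !in_itv/= => /andP[h3 _] /andP[_ h4].
 by rewrite (le_lt_trans h3)//= (le_trans h2).
transitivity (\int[mu]_(x in `]x1, x2]) (dg x)%:E); last first.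
 rewrite integral_mkcond; apply: eq_integral => x _.
 rewrite patchE mem_setE /W; case: ifPn => [x12|nx12].
  have xab : x \in `]a, b] by exact: x12ab.
  by rewrite xab indicE mem_setE setE2// x12 mulr1.
 case: ifPn => [xab|_]; last by rewrite mul0r.
 by rewrite indicE mem_setE setE2// (negbTE nx12) mulr0.
rewrite setE1 /= lebesgue_measure_itv/= lte_fin -gx1 -gx2 igE//.
case: ifPn => [x12|]; last first.
 by rewrite -leNgt => x21; rewrite set_itv_ge ?integral_set0// bnd_simp -leNgt.
rewrite integral_itv_obnd_cbnd; last exact/measurable_EFinP/measurable_funTS.
rewrite (@pieceD_ftc _ g dg)//.
move: x1ab x2ab; rewrite !in_itv/= => /andP[h3 h5] /andP[h6 h4].
exact: pieceD_sub Dg.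
Qed.
End substitution.

(** * Affine and polar coordinates in the plane *)

Section plane_integrals.
Context {R : realType}.
Notation mu := (@lebesgue_measure R).
Notation TR := (measurableTypeR R).
Notation mu2 := (mu \x mu)%E.
Local Open Scope ereal_scope.
Implicit Types f : R * R -> \bar R.

Lemma fubini_plane f : measurable_fun setT f -> (forall p, 0 <= f p) ->
 \int[mu2]_p f p = \int[mu]_x \int[mu]_y f (x, y).
Proof. by move=> mf f0; rewrite fubini_tonelli1. Qed.

Lemma measurable_fun_inner f : measurable_fun setT f -> (forall p, 0 <= f p) ->
 measurable_fun setT (fun x => \int[mu]_y f (x, y)).
Proof. by move=> mf f0; exact: (@measurable_fun_fubini_tonelli_F _ _ TR TR R mu f mf f0). Qed.

Lemma ge0_integral_plane_affine (a : R) (w : R * R) f : a != 0%R ->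
 measurable_fun setT f -> (forall p, 0 <= f p) ->
 \int[mu2]_p f p =
 \int[mu2]_p (`|a|%:E * (`|a|%:E * f (a * p.1 + w.1, a * p.2 + w.2)%R)).
Proof.
move=> a0 mf f0.
have mg (b : R) : measurable_fun setT (fun x : R => a * x + b)%R.
 by apply: measurable_funD => //; exact: measurable_funM.
have mG : measurable_fun setT (fun p : R * R => (a * p.1 + w.1, a * p.2 + w.2)%R).
 by apply: measurable_fun_pair; [apply: (measurableT_comp (mg _))|apply: (measurableT_comp (mg _))];
  [exact: measurable_fst|exact: measurable_snd].
rewrite !fubini_plane//; last 2 first.
- apply: measurable_funeM; apply: measurable_funeM; exact: (measurableT_comp mf mG).
- by move=> p; rewrite !mule_ge0.
rewrite (@ge0_integral_affine _ a w.1)//; last 2 first.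
- exact: measurable_fun_inner.
- by move=> x; exact: integral_ge0.
apply: eq_integral => x _ /=.
rewrite ge0_integralZl//; last 2 first.
- apply: measurable_funeM.
 have mx : measurable_fun setT (fun y : R => (a * x + w.1, a * y + w.2)%R).
  by apply: measurable_fun_pair => //; exact: mg.
 exact: (measurableT_comp mf mx).
- by move=> y _; rewrite mule_ge0.
congr (_ * _); rewrite (@ge0_integral_affine _ a w.2)//.
exact: (measurableT_comp mf (measurable_pair1 _)).
Qed.

(** Polar coordinates with a signed radius: phi runs over an open half turn and r over the whole
    line, so the plane is swept by lines instead of rays and the Jacobian is |r|. *)
Definition polar (phi r : R) : R * R := (r * cos phi, r * sin phi)%R.

Lemma measurable_polar : measurable_fun setT (fun p : R * R => polar p.1 p.2).
Proof.
have mc : measurable_fun setT (@cos R).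
 by apply: continuous_measurable_fun; exact: continuous_cos.
have ms : measurable_fun setT (@sin R).
 by apply: continuous_measurable_fun; exact: continuous_sin.
by apply: measurable_fun_pair; apply: measurable_funM;
 [exact: measurable_snd|apply: (measurableT_comp mc); exact: measurable_fst
 |exact: measurable_snd|apply: (measurableT_comp ms); exact: measurable_fst].
Qed.

(** The substitution is made on bounded intervals; both sides pass to the limit by monotone
    convergence. *)
Lemma ge0_integral_atan (h : R -> \bar R) : measurable_fun setT h ->
 (forall x, 0 <= h x) ->
 \int[mu]_t ((1 + t ^+ 2)^-1%:E * h (atan t)) =
 \int[mu]_(phi in `](- (pi / 2))%R, (pi / 2)%R[) h phi.
Proof.
move=> mh h0.
have ma : measurable_fun setT (@atan R).
 by apply: continuous_measurable_fun => x; exact: continuous_atan.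
have d0 (t : R) : (1 + t ^+ 2 != 0)%R by rewrite gt_eqF// ltr_wpDr// sqr_ge0.
have cda : continuous (fun t : R => (1 + t ^+ 2)^-1)%R.
 move=> t; apply: cvgV => //; apply: cvgD; first exact: cvg_cst.
 by rewrite expr2; apply: cvgM; exact: cvg_id.
have mda : measurable_fun setT (fun t : R => (1 + t ^+ 2)^-1)%R.
 exact: continuous_measurable_fun.
have da0 (t : R) : (0 <= (1 + t ^+ 2)^-1)%R by rewrite invr_ge0 addr_ge0// sqr_ge0.
have E (n : nat) : \int[mu]_(t in `](- n.+1%:R)%R, n.+1%:R]) ((1 + t ^+ 2)^-1%:E * h (atan t)) =
  \int[mu]_(phi in `](atan (- n.+1%:R))%R, atan n.+1%:R]) h phi.
 rewrite (@ge0_integral_increasing _ _ (fun t : R => (1 + t ^+ 2)^-1)%R)//.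
 - by rewrite (@lt_trans _ _ 0%R)// ?oppr_lt0 ltr0n.
 - by move=> x y _ _; exact: lt_atan.
 - split.
  + by apply: continuous_subspaceT => x; exact: continuous_atan.
  + by apply: within_pieceC; exact: continuous_subspaceT.
  + by move=> t _; exact: is_derive1_atan.
have nat_ge0 (n : nat) : (0 <= n.+1%:R :> R)%R by [].
have U1 : \bigcup_n `](- n.+1%:R)%R, n.+1%:R]%classic = [set: R].
 apply/seteqP; split => // x _; exists (Num.truncn `|x|) => //=.
 have xn : (`|x| < (Num.truncn `|x|).+1%:R)%R by exact: truncnS_gt.
 by rewrite in_itv/=; move: xn; rewrite ltr_norml => /andP[-> /ltW ->].
have U2 : \bigcup_n `](atan (- n.+1%:R : R))%R, atan (n.+1%:R : R)]%classic =
  (`](- (pi / 2))%R, (pi / 2)%R[%classic : set R).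
 apply/seteqP; split => x /=.
  move=> [n _]; rewrite /= !in_itv/= => /andP[h1 h2].
  by rewrite (lt_trans (atan_gtNpi2 _) h1) (le_lt_trans h2 (atan_ltpi2 _)).
 rewrite in_itv/= => /andP[x1 x2].
 have : (\bigcup_n `](- n.+1%:R)%R, n.+1%:R]%classic) (tan x) by rewrite U1.
 move=> [n _ /=]; rewrite in_itv/= => /andP[h1 h2]; exists n => //=.
 have xE : x = atan (tan x) by rewrite tanK// in_itv/= x1 x2.
 by rewrite in_itv/= xE lt_atan//= le_atan.
have nd1 : nondecreasing_seq (fun n : nat => `](- n.+1%:R)%R, n.+1%:R]%classic : set R).
 move=> m n mn; apply/subsetPset => x /=; rewrite !in_itv/= => /andP[h1 h2].
 have mnR : (m.+1%:R <= n.+1%:R :> R)%R by rewrite ler_nat ltnS.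
 by apply/andP; split; lra.
have nd2 : nondecreasing_seq (fun n : nat => `](atan (- n.+1%:R))%R, atan n.+1%:R]%classic : set R).
 move=> m n mn; apply/subsetPset => x /=; rewrite !in_itv/= => /andP[h1 h2].
 have mnR : (m.+1%:R <= n.+1%:R :> R)%R by rewrite ler_nat ltnS.
 by rewrite (le_lt_trans _ h1) ?le_atan ?lerN2//= (le_trans h2)// le_atan.
have mfun1 : measurable_fun setT (fun t : R => (1 + t ^+ 2)^-1%:E * h (atan t)).
 apply: emeasurable_funM; first exact/measurable_EFinP.
 exact: (measurableT_comp mh ma).
have L1 : \int[mu]_(t in `](- n.+1%:R)%R, n.+1%:R]) ((1 + t ^+ 2)^-1%:E * h (atan t))
  @[n --> \oo] --> \int[mu]_t ((1 + t ^+ 2)^-1%:E * h (atan t)).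
 rewrite -U1; apply: ge0_nondecreasing_set_cvg_integral => //.
  by move=> n; exact: measurable_funTS.
 by move=> n t _; apply: mule_ge0; rewrite ?lee_fin.
have L2 : \int[mu]_(t in `](atan (- n.+1%:R))%R, atan n.+1%:R]) h t
  @[n --> \oo] --> \int[mu]_(phi in `](- (pi / 2))%R, (pi / 2)%R[) h phi.
 rewrite -U2; apply: ge0_nondecreasing_set_cvg_integral => //.
 by move=> n; exact: measurable_funTS.
move: L1; have -> := funext E => L1.
exact: (cvg_unique (@ereal_hausdorff R) L1 L2).
Qed.

(** Only one-dimensional substitutions are used: y = x t for fixed x, then, after Tonelli, x = r cos
    (atan t), then phi = atan t. The line x = 0 is null. *)
Lemma ge0_polar f : measurable_fun setT f -> (forall p, 0 <= f p) ->
 \int[mu2]_p f p =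
 \int[mu]_(phi in `](- (pi / 2))%R, (pi / 2)%R[) \int[mu]_r (`|r|%:E * f (polar phi r)).
Proof.
move=> mf f0; rewrite (fubini_plane mf f0).
pose F (p : TR * TR) := `|p.1|%:E * f (p.1, p.1 * p.2)%R.
have mabs : measurable_fun setT (fun p : TR * TR => `|p.1|%:E).
 apply/measurable_EFinP; apply: (measurableT_comp (@normr_measurable _ _)).
 exact: measurable_fst.
have mF : measurable_fun setT F.
 apply: emeasurable_funM; first exact: mabs.
 have mG : measurable_fun setT (fun p : TR * TR => (p.1, p.1 * p.2)%R : TR * TR).
  apply: measurable_fun_pair; first exact: measurable_fst.
  by apply: measurable_funM; [exact: measurable_fst|exact: measurable_snd].
 exact: (measurableT_comp mf mG).
have F0 p : 0 <= F p by rewrite mule_ge0.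
have -> : \int[mu]_x \int[mu]_y f (x, y) = \int[mu]_x \int[mu]_t F (x, t).
 apply: ge0_ae_eq_integral => //.
 - exact: measurable_fun_inner.
 - exact: (@measurable_fun_fubini_tonelli_F _ _ TR TR R mu F mF F0).
 - by move=> x _; exact: integral_ge0.
 - by move=> x _; exact: integral_ge0.
 - exists [set 0%R]; split => //; first exact: lebesgue_measure_set1.
  move=> x /= /not_implyP[_ xF]; apply: contrapT => /eqP x0; apply: xF.
  rewrite (@ge0_integral_affine _ x 0%R)//; last 1 first.
   exact: (measurableT_comp mf (measurable_pair1 _)).
  by apply: eq_integral => t _; rewrite /F/= addr0.
rewrite (@fubini_tonelli _ _ TR TR R mu mu F mF F0).
pose H phi := \int[mu]_r (`|r|%:E * f (polar phi r)).
have mP : measurable_fun setT (fun p : TR * TR => `|p.2|%:E * f (polar p.1 p.2)).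
 apply: emeasurable_funM.
  apply/measurable_EFinP; apply: (measurableT_comp (@normr_measurable _ _)).
  exact: measurable_snd.
 exact: (measurableT_comp mf measurable_polar).
have mH : measurable_fun setT H.
 apply: (@measurable_fun_fubini_tonelli_F _ _ TR TR R mu _ mP).
 by move=> p; rewrite mule_ge0.
rewrite -[RHS](@ge0_integral_atan H)//; last by move=> phi; apply: integral_ge0 => r _; rewrite mule_ge0.
apply: eq_integral => t _.
pose c := cos (atan t).
have c_gt0 : (0 < c)%R by rewrite /c cos_gt0_pihalf// atan_gtNpi2 atan_ltpi2.
have ctE : (c * t = sin (atan t))%R.
 by rewrite -{1}[t]atanK /tan mulrCA mulfV ?mulr1// gt_eqF.
have c2 : ((1 + t ^+ 2)^-1 = c ^+ 2)%R.
 by rewrite /c cos_atan exprVn sqr_sqrtr// addr_ge0// sqr_ge0.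
rewrite (@ge0_integral_affine _ c 0%R); last 3 first.
- by rewrite gt_eqF.
- exact: (measurableT_comp mF (measurable_pair2 _)).
- by move=> x; exact: F0.
rewrite /H -ge0_integralZl//; last 3 first.
- exact: (measurableT_comp mP (measurable_pair1 _)).
- by move=> x _; rewrite mule_ge0.
- by rewrite lee_fin c2 sqr_ge0.
apply: eq_integral => r _; rewrite /F/= addr0 c2.
rewrite /polar -/c -ctE !muleA -!EFinM normrM gtr0_norm//; congr (_%:E * f _).
 by ring.
by congr pair; ring.
Qed.
End plane_integrals.

(** * From nonnegative to integrable functions in a change of variables *)

Section transfer.
Context d1 d2 (T1 : measurableType d1) (T2 : measurableType d2) {R : realType}.
Variables (m1 : {measure set T1 -> \bar R}) (m2 : {measure set T2 -> \bar R}).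
Variables (phi : T2 -> T1) (W : T2 -> R).
Hypotheses (mphi : measurable_fun setT phi) (mW : measurable_fun setT W).
Hypothesis W0 : forall y, 0 <= W y.
Hypothesis transfer_ge0 : forall h : T1 -> \bar R, measurable_fun setT h ->
 (forall x, (0 <= h x)%E) ->
 (\int[m1]_x h x = \int[m2]_y ((W y)%:E * h (phi y)))%E.

Lemma integrable_transfer (f : T1 -> R) : m1.-integrable setT (EFin \o f) ->
 m2.-integrable setT (EFin \o (fun y => W y * f (phi y))) /\
 \int[m2]_y (W y * f (phi y)) = \int[m1]_x f x.
Proof.
move=> fi; have /integrableP[mf foo] := fi.
have mfr : measurable_fun setT f by apply/measurable_EFinP.
have mWf : measurable_fun setT (fun y => W y * f (phi y)).
 by apply: measurable_funM => //; exact: (measurableT_comp mfr mphi).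
split.
 apply/integrableP; split; first exact/measurable_EFinP.
 apply: le_lt_trans foo; rewrite transfer_ge0//.
  apply: ge0_le_integral => //.
  - by apply: measurableT_comp => //; exact/measurable_EFinP.
  - apply: emeasurable_funM; first exact/measurable_EFinP.
   apply: measurableT_comp => //; apply/measurable_EFinP.
   exact: (measurableT_comp mfr mphi).
  - by move=> y _ /=; rewrite normrM ger0_norm.
 exact: measurableT_comp.
rewrite /Rintegral; congr fine.
rewrite integralE [RHS]integralE !transfer_ge0//; last 2 first.
- exact: measurable_funeneg.
- exact: measurable_funepos.
congr (_ - _)%E; apply: eq_integral => y _; rewrite ?funeposE ?funenegE /=.
 by rewrite -!EFin_max -EFinM maxr_pMr// mulr0.
by rewrite -!EFin_max -EFinM -mulrN maxr_pMr// mulr0.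
Qed.

Lemma Cintegral_transfer (f : T1 -> R[i]) : Cintegrable m1 setT f ->
 Cintegrable m2 setT (fun y => (W y)%:C%C * f (phi y)) /\
 Cint m2 setT (fun y => (W y)%:C%C * f (phi y)) = Cint m1 setT f.
Proof.
move=> [/integrable_transfer[fri frE] /integrable_transfer[fii fiE]]; split.
 by split; [apply: integrable_ext fri|apply: integrable_ext fii] => y /=;
  rewrite ?ReZ ?ImZ.
rewrite /Cint -frE -fiE; congr Complex; apply: eq_Rintegral => y _.
 by rewrite ReZ.
by rewrite ImZ.
Qed.
End transfer.

(** * Measurability of complex functions *)

Section complex_measurable.
Context d (T : measurableType d) {R : realType}.
Implicit Types f g : T -> R[i].

Lemma measurable_invr : measurable_fun [set: R] (fun x : R => x^-1).
Proof.
have -> : [set: R] = [set 0] `|` ~` [set 0] by rewrite setUv.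
apply/measurable_funU; [exact: measurable_set1|exact: measurableC (measurable_set1 _)|].
split.
 exact: measurable_fun_set1.
apply: open_continuous_measurable_fun.
 by apply: closed_openC; apply: compact_closed;
  [exact: norm_hausdorff|exact: compact_set1].
move=> x; rewrite inE /= => /eqP x0; apply: cvgV; first exact: x0.
exact: cvg_id.
Qed.

Definition Cmeas f : Prop := measurable_fun setT (fun x => Re (f x)) /\
 measurable_fun setT (fun x => Im (f x)).

Lemma Cmeas_cst z : Cmeas (fun=> z).
Proof. by split; exact: measurable_cst. Qed.

Lemma CmeasD f g : Cmeas f -> Cmeas g -> Cmeas (fun x => f x + g x).
Proof.
move=> [fr fi] [gr gi]; split.
 by under eq_fun do rewrite ReD; exact: measurable_funD.
by under eq_fun do rewrite ImD; exact: measurable_funD.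
Qed.

Lemma CmeasN f : Cmeas f -> Cmeas (fun x => - f x).
Proof.
move=> [fr fi]; split.
 by under eq_fun do rewrite ReN; exact: measurableT_comp.
by under eq_fun do rewrite ImN; exact: measurableT_comp.
Qed.

Lemma CmeasM f g : Cmeas f -> Cmeas g -> Cmeas (fun x => f x * g x).
Proof.
move=> [fr fi] [gr gi]; split.
 by under eq_fun do rewrite ReM; apply: measurable_funB; exact: measurable_funM.
by under eq_fun do rewrite ImM; apply: measurable_funD; exact: measurable_funM.
Qed.

Lemma CmeasR (f : T -> R) : measurable_fun setT f -> Cmeas (fun x => (f x)%:C%C).
Proof. by move=> mf; split => //=; exact: measurable_cst. Qed.

Lemma CmeasJ f : Cmeas f -> Cmeas (fun x => conjc (f x)).
Proof.
move=> [fr fi]; split.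
 by under eq_fun do rewrite ReJ.
by under eq_fun do rewrite ImJ; exact: measurableT_comp.
Qed.

Lemma measurable_cabs f : Cmeas f -> measurable_fun setT (fun x => cabs (f x)).
Proof.
move=> [fr fi]; under eq_fun do rewrite cabsE.
have ms : measurable_fun setT (@Num.sqrt R).
 by apply: continuous_measurable_fun; exact: sqrt_continuous.
by apply: (measurableT_comp ms); apply: measurable_funD; exact: measurable_funX.
Qed.

Lemma CmeasV f : Cmeas f -> Cmeas (fun x => (f x)^-1).
Proof.
move=> mf; under eq_fun do rewrite invCE.
apply: CmeasM; last exact: CmeasJ.
apply: CmeasR; apply: (measurableT_comp measurable_invr).
by apply: measurable_funX; exact: measurable_cabs.
Qed.

Lemma Cintegrable_le (m : {measure set T -> \bar R}) f (g : T -> R) : Cmeas f ->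
 (forall x, cabs (f x) <= g x) -> m.-integrable setT (EFin \o g) ->
 Cintegrable m setT f.
Proof.
move=> [fr fi] fg gi; split; apply: (le_integrable measurableT _ _ gi).
- exact/measurable_EFinP.
- move=> x _; rewrite /= lee_fin; apply: le_trans (Re_le_cabs _) _.
 by rewrite (le_trans (fg x))// ler_norm.
- exact/measurable_EFinP.
- move=> x _; rewrite /= lee_fin; apply: le_trans (Im_le_cabs _) _.
 by rewrite (le_trans (fg x))// ler_norm.
Qed.
End complex_measurable.

Lemma Cmeas_comp d1 d2 (T1 : measurableType d1) (T2 : measurableType d2)
  {R : realType} (f : T2 -> R[i]) (h : T1 -> T2) :
 measurable_fun setT h -> Cmeas f -> Cmeas (f \o h).
Proof.
by move=> mh [fr fi]; split; [exact: (measurableT_comp fr mh)|exact: (measurableT_comp fi mh)].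
Qed.

(** * Fubini's theorem for complex functions *)

Section complex_fubini.
Context d1 d2 (T1 : measurableType d1) (T2 : measurableType d2) {R : realType}.
Variables (m1 : {sigma_finite_measure set T1 -> \bar R}).
Variables (m2 : {sigma_finite_measure set T2 -> \bar R}).

Lemma Rfubini12 (f : T1 * T2 -> R) : (m1 \x m2)%E.-integrable setT (EFin \o f) ->
 \int[m1]_x (\int[m2]_y f (x, y)) = \int[(m1 \x m2)%E]_p f p.
Proof.
move=> fi; rewrite /Rintegral -(integral12_prod_meas1 fi); congr fine.
have Fi := integrable_fubini_F fi; have /integrableP[mF _] := Fi.
apply: ae_eq_integral => //.
 by apply/measurable_EFinP; exact: measurableT_comp.
apply: filterS (integrable_ae measurableT Fi) => x /(_ I) Fx _.
by rewrite fineK.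
Qed.

Lemma Cfubini12 (f : T1 * T2 -> R[i]) : Cintegrable (m1 \x m2)%E setT f ->
 Cint m1 setT (fun x => Cint m2 setT (fun y => f (x, y))) = Cint (m1 \x m2)%E setT f.
Proof.
move=> [fr fi]; rewrite /Cint /=; congr Complex.
 exact: (Rfubini12 (f := fun p => Re (f p))).
exact: (Rfubini12 (f := fun p => Im (f p))).
Qed.

(** The inner integral is prescribed off a null set only; in the applications this set contains the
    curve, where the winding number is undefined. *)
Lemma Rfubini21_ae (f : T1 * T2 -> R) (T : T2 -> R) (N : set T2) :
 (m1 \x m2)%E.-integrable setT (EFin \o f) -> m2.-negligible N ->
 measurable_fun setT T ->
 (forall y, ~ N y -> \int[m1]_x f (x, y) = T y) ->
 \int[m2]_y T y = \int[(m1 \x m2)%E]_p f p.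
Proof.
move=> fi N0 mT fT; rewrite /Rintegral -(integral21_prod_meas1 fi); congr fine.
have mF := measurable_fubini_G fi.
apply: ae_eq_integral => //; first exact/measurable_EFinP.
have aeN : {ae m2, forall y, ~ N y}.
 by apply: negligibleS N0 => y /=; apply: contra_notP.
apply: (@filterS2 _ _ (ae_filter_ringOfSetsType m2)) aeN (ae_integrable2 fi) => y Ny fx _.
by rewrite -fT// /Rintegral fineK//; exact: integrable_fin_num.
Qed.

Lemma Cfubini21_ae (f : T1 * T2 -> R[i]) (T : T2 -> R[i]) (N : set T2) :
 Cintegrable (m1 \x m2)%E setT f -> m2.-negligible N -> Cmeas T ->
 (forall y, ~ N y -> Cint m1 setT (fun x => f (x, y)) = T y) ->
 Cint m2 setT T = Cint (m1 \x m2)%E setT f.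
Proof.
move=> [fr fi] N0 [mr mi] fT; rewrite /Cint; congr Complex.
 by apply: (Rfubini21_ae fr N0 mr) => y /fT <-.
by apply: (Rfubini21_ae fi N0 mi) => y /fT <-.
Qed.
End complex_fubini.

(** * The kernel 1 / (z - x) and potentials of radial densities *)

Section potential.
Context {R : realType}.
Notation mu := (@lebesgue_measure R).
Notation TR := (measurableTypeR R).
Notation mu2 := (mu \x mu)%E.
Local Open Scope complex_scope.

Lemma Cmeas_toC : Cmeas (toC : R * R -> R[i]).
Proof. by split; [exact: measurable_fst|exact: measurable_snd]. Qed.

(** Euclidean discs; the balls of [R * R] are squares. *)
Definition cball (rho : R) : set (R * R) := [set x | cabs (toC x) < rho].

Lemma mem_cball rho x : (x \in cball rho) = (cabs (toC x) < rho).
Proof. by apply/idP/idP => [/set_mem|? ]; [|exact: mem_set]. Qed.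

Lemma measurable_cball rho : measurable (cball rho).
Proof.
rewrite -[cball rho]setTI.
exact: (measurable_cabs Cmeas_toC measurableT (measurable_itv `]-oo, rho[)).
Qed.

Lemma Cmeas_kernel (z : R[i]) : Cmeas (fun x : R * R => (z - toC x)^-1).
Proof.
by apply/CmeasV/CmeasD; [exact: Cmeas_cst|apply/CmeasN/Cmeas_toC].
Qed.

Lemma cabsV (z : R[i]) : cabs z^-1 = (cabs z)^-1.
Proof. exact: Normc.normcV. Qed.

Lemma cabs_toC_polar phi r : cabs (toC (polar phi r)) = `|r| :> R.
Proof.
have -> : toC (polar phi r) = r%:C%C * expi phi.
 by apply: complexP; rewrite ?ReZ ?ImZ.
by rewrite Normc.normcM cabs_expi mulr1 cabsR.
Qed.

(** The substitution x -> z - x moves the pole to the origin and the disc into the disc of radius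
    rho + |z|. In polar coordinates the Jacobian |r| cancels the pole, which leaves an interval of
    length 2 (rho + |z|) for each of the angles. *)
Lemma kernel_bound (rho : R) (z : R[i]) : 0 <= rho ->
 (\int[mu2]_x (\1_(cball rho) x * (cabs (z - toC x))^-1)%:E <=
  (2 * pi * (rho + cabs z))%:E)%E.
Proof.
move=> rho0; set P := rho + cabs z.
have P0 : 0 <= P by rewrite addr_ge0// cabs_ge0.
have mind (s : R) : measurable_fun setT (\1_(cball s) : R * R -> R).
 exact: measurable_indic (measurable_cball s).
have mker w : measurable_fun setT (fun x : R * R => (cabs (w - toC x))^-1).
 apply: (measurableT_comp (measurable_invr)); apply: measurable_cabs.
 by apply: CmeasD; [exact: Cmeas_cst|apply/CmeasN/Cmeas_toC].
have i0 (s : R) x : 0 <= \1_(cball s) x :> R by rewrite indicE ler0n.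
rewrite (@ge0_integral_plane_affine _ (-1) (Re z, Im z)); last 3 first.
- by rewrite oppr_eq0 oner_neq0.
- by apply/measurable_EFinP; exact: measurable_funM.
- by move=> x; rewrite lee_fin mulr_ge0// invr_ge0 cabs_ge0.
rewrite normrN normr1.
pose h (x : R * R) : \bar R := (\1_(cball P) x * (cabs (0 - toC x))^-1)%:E.
have m2 : measurable_fun setT h.
 by apply/measurable_EFinP; exact: measurable_funM.
apply: (@le_trans _ _ (\int[mu2]_x h x)%E).
 apply: ge0_le_integral => //.
 - by move=> x _; rewrite !mul1e lee_fin mulr_ge0// invr_ge0 cabs_ge0.
 - apply: emeasurable_funM => //; apply: emeasurable_funM => //.
  apply/measurable_EFinP.
  have mh : measurable_fun setT (fun p : R * R => ((-1) * p.1 + Re z, (-1) * p.2 + Im z) : R * R).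
   apply: measurable_fun_pair; apply: measurable_funD => //; apply: measurable_funM => //.
  exact: (measurableT_comp (measurable_funM (mind rho) (mker z)) mh).
 - move=> x _; rewrite !mul1e lee_fin.
  set y : R * R := (_ + _, _).
  have -> : z - toC y = toC x.
   by apply: complexP; rewrite ?ReD ?ReN ?ImD ?ImN /=; ring.
  have -> : cabs (0 - toC x) = cabs (toC x) by rewrite sub0r cabsN.
  apply: ler_wpM2r; first by rewrite invr_ge0 cabs_ge0.
  rewrite !indicE; have [/set_mem yr|_] := boolP (y \in _); last exact: ler0n.
  have yr' : cabs (toC y) < rho := yr.
  suff xP : cabs (toC x) < P by rewrite mem_set// ler01.
  have -> : toC x = z + - toC y by apply: complexP; rewrite ?ReD ?ReN ?ImD ?ImN /=; ring.
  apply: le_lt_trans (cabs_triangle _ _) _; rewrite cabsN /P addrC ltrD2r; exact: yr'.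
rewrite ge0_polar//; last first.
 by move=> x; rewrite lee_fin mulr_ge0// invr_ge0 cabs_ge0.
apply: (@le_trans _ _ (\int[mu]_(phi in `](- (pi / 2))%R, (pi / 2)%R[) (2 * P)%:E)%E).
 apply: ge0_le_integral => //.
 - by move=> x _; apply: integral_ge0 => r _; rewrite -EFinM lee_fin mulr_ge0// mulr_ge0// invr_ge0 cabs_ge0.
 - apply: measurable_funTS.
  apply: (measurable_fun_inner (f := fun p => (`|p.2|%:E * h (polar p.1 p.2))%E)).
   apply: emeasurable_funM; first by apply/measurable_EFinP; exact: measurableT_comp.
   exact: (measurableT_comp m2 measurable_polar).
  by move=> p; rewrite -EFinM lee_fin !mulr_ge0// invr_ge0 cabs_ge0.
 - move=> phi _.
  apply: (@le_trans _ _ (\int[mu]_(r in `[(- P)%R, P]) 1%:E)%E).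
   rewrite [leRHS]integral_mkcond; apply: ge0_le_integral => //.
   + by move=> r _; rewrite -EFinM lee_fin mulr_ge0// mulr_ge0// invr_ge0 cabs_ge0.
   + apply: emeasurable_funM; first by apply/measurable_EFinP; exact: normr_measurable.
    exact: (measurableT_comp m2 (measurableT_comp measurable_polar (measurable_pair1 phi))).
   + by apply/(measurable_restrictT _ _).1 => //; exact: measurable_cst.
   + move=> r _; rewrite patchE /h sub0r cabsN cabs_toC_polar indicE.
    have -> : (polar phi r \in cball P) = (`|r| < P) by rewrite mem_cball cabs_toC_polar.
    have -> : (r \in `[- P, P]%classic) = (`|r| <= P)
     by apply/idP/idP => [/set_mem|rP]; [|apply: mem_set]; rewrite /= in_itv/= -ler_norml.
    rewrite -EFinM; case: ltrP => [/ltW ->|_]; rewrite ?mul0r ?mulr0 ?lee_fin; last by case: ifP.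
    by rewrite mul1r; have [->|r0] := eqVneq `|r| 0; rewrite ?mul0r ?mulfV// ?ler01.
  by rewrite integral_cst//= mul1e lebesgue_measure_itv/= lte_fin; case: ifPn => _; rewrite ?lee_fin; lra.
rewrite integral_cst//= lebesgue_measure_itv/= lte_fin.
have pi0 := pi_gt0 R.
rewrite ifT; last lra.
by rewrite -EFinM lee_fin; lra.
Qed.

Lemma Cintegrable_kernel (g : R * R -> R[i]) (M rho : R) (z : R[i]) : 0 <= rho -> 0 <= M ->
 Cmeas g -> (forall x, cabs (g x) <= M * \1_(cball rho) x) ->
 Cintegrable mu2 setT (fun x => g x * (z - toC x)^-1).
Proof.
move=> rho0 M0 mg gM.
pose h (x : R * R) : R := \1_(cball rho) x * (cabs (z - toC x))^-1.
have mh : measurable_fun setT h.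
 apply: measurable_funM; first exact: measurable_indic (measurable_cball rho).
 apply: (measurableT_comp (measurable_invr)); apply: measurable_cabs.
 by apply: CmeasD; [exact: Cmeas_cst|apply/CmeasN/Cmeas_toC].
have h0 x : 0 <= h x by rewrite mulr_ge0// ?invr_ge0 ?cabs_ge0// indicE ler0n.
apply: (@Cintegrable_le _ (TR * TR)%type R mu2 (fun x => g x * (z - toC x)^-1) (fun x => M * h x)).
- by apply: CmeasM => //; exact: Cmeas_kernel.
- move=> x; rewrite Normc.normcM cabsV /h mulrA; apply: ler_wpM2r => //.
 by rewrite invr_ge0 cabs_ge0.
apply/integrableP; split.
 by apply/measurable_EFinP; exact: measurable_funM.
apply: (@le_lt_trans _ _ (M%:E * \int[mu2]_x (h x)%:E)%E).
 rewrite -ge0_integralZl//.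
 - apply: ge0_le_integral => //.
  + by apply: measurableT_comp => //; apply/measurable_EFinP; exact: measurable_funM.
  + by apply: emeasurable_funM => //; exact/measurable_EFinP.
  + by move=> x _; rewrite /= ger0_norm// mulr_ge0.
 - exact/measurable_EFinP.
 - by move=> x _; rewrite lee_fin.
apply: (@le_lt_trans _ _ (M%:E * (2 * pi * (rho + cabs z))%:E)%E).
 by apply: lee_wpmul2l => //; exact: kernel_bound.
by rewrite -EFinM ltry.
Qed.

Lemma Cint_opp (f : R * R -> R[i]) : Cintegrable mu2 setT f ->
 Cintegrable mu2 setT (fun x => f (- x.1, - x.2)) /\
 Cint mu2 setT (fun x => f (- x.1, - x.2)) = Cint mu2 setT f.
Proof.
move=> fi.
have mphi : measurable_fun setT (fun x : R * R => (- x.1, - x.2) : R * R).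
 by apply: measurable_fun_pair; apply: measurableT_comp => //.
have [] := @Cintegral_transfer _ _ _ _ _ mu2 mu2 (fun x : R * R => (- x.1, - x.2)) (fun=> 1) mphi _ _ _ f fi.
- exact: measurable_cst.
- by [].
- move=> h mh h0; rewrite (@ge0_integral_plane_affine _ (-1) (0, 0))//.
 apply: eq_integral => x _; rewrite normrN normr1 !mul1e /=.
 by congr (h (_, _)); ring.
move=> fi' <-; split; last by apply: eq_Cint => x _; rewrite mul1r.
by apply: Cintegrable_eq fi' => x; rewrite mul1r.
Qed.

Definition polar_weight (p : R * R) : R := \1_(`]-(pi / 2), pi / 2[%classic) p.1 * `|p.2|.

Lemma Cint_polar (f : R * R -> R[i]) : Cintegrable mu2 setT f ->
 Cintegrable mu2 setT (fun p => (polar_weight p)%:C%C * f (polar p.1 p.2)) /\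
 Cint mu2 setT (fun p => (polar_weight p)%:C%C * f (polar p.1 p.2)) = Cint mu2 setT f.
Proof.
move=> fi.
have mW : measurable_fun setT polar_weight.
 apply: measurable_funM; first by apply: (measurableT_comp (measurable_indic (measurable_itv _))); exact: measurable_fst.
 by apply: measurableT_comp => //; exact: measurable_snd.
have W0 p : 0 <= polar_weight p by rewrite mulr_ge0// indicE ler0n.
apply: (@Cintegral_transfer _ _ _ _ _ mu2 mu2 (fun p : R * R => polar p.1 p.2) polar_weight
 measurable_polar mW W0) => // h mh h0.
have mk : measurable_fun setT (fun p : R * R => (polar_weight p)%:E * h (polar p.1 p.2))%E.
 apply: emeasurable_funM; first exact/measurable_EFinP.
 exact: (measurableT_comp mh measurable_polar).
have k0 p : (0 <= (polar_weight p)%:E * h (polar p.1 p.2))%E.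
 by rewrite mule_ge0// lee_fin.
rewrite (ge0_polar mh h0) (fubini_plane mk k0) integral_mkcond; apply: eq_integral => phi _.
rewrite patchE /polar_weight/= indicE; case: ifPn => _.
 by apply: eq_integral => r _; rewrite mul1r.
by rewrite integral0_eq// => r _; rewrite mul0r mul0e.
Qed.

Lemma Cint_itv01 (f : R -> R[i]) : Cintegrable mu `[0, 1] f ->
 Cintegrable mu setT (fun t => (\1_(`]0, 1[%classic) t)%:C%C * f t) /\
 Cint mu setT (fun t => (\1_(`]0, 1[%classic) t)%:C%C * f t) = Cint mu `[0, 1] f.
Proof.
have key (g : R -> R) : mu.-integrable `[0, 1] (EFin \o g) ->
  mu.-integrable setT (EFin \o (fun t => \1_(`]0, 1[%classic) t * g t)) /\
  \int[mu]_t (\1_(`]0, 1[%classic) t * g t) = \int[mu]_(t in `[0, 1]) g t.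
 move=> gi.
 have gE : (fun t => \1_(`]0, 1[%classic) t * g t) = g \_ `]0, 1[.
  apply/funext => t; rewrite indicE patchE; case: ifP => _; first by rewrite mul1r.
  by rewrite mul0r.
 have gi' : mu.-integrable `]0, 1[ (EFin \o g).
  by apply: integrableS gi => //; exact: subset_itv_oo_cc.
 split.
  have := gi'; rewrite integrable_mkcond//.
  by rewrite gE; apply: integrable_ext => t /=; rewrite !patchE; case: ifP.
 rewrite gE -Rintegral_mkcond Rintegral_itv_bndo_bndc// Rintegral_itv_obnd_cbnd//.
 by apply: integrableS gi => //; exact: subset_itv_oc_cc.
move=> [/key[ri rE] /key[ii iE]]; split.
 by split; [apply: integrable_ext ri|apply: integrable_ext ii] => t /=; rewrite ?ReZ ?ImZ.
rewrite /Cint -rE -iE; congr Complex; apply: eq_Rintegral => t _.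
 by rewrite ReZ.
by rewrite ImZ.
Qed.

(** The integrand is 1 minus dz / (z + w) divided by 2 pi i, so the mean is 1 minus the winding
    number of the circle of radius s about - w. *)
Lemma circle_mean (w : R[i]) (s : R) : 0 <= s -> s != cabs w ->
 Cintegrable mu `[0, 1] (fun t => w / (w + s%:C%C * expi (2 * pi * t))) /\
 Cint mu `[0, 1] (fun t => w / (w + s%:C%C * expi (2 * pi * t))) =
  (if s < cabs w then 1 else 0).
Proof.
move=> s0 sw.
pose c (t : R) : R * R := (s * cos (2 * pi * t), s * sin (2 * pi * t)).
pose x : R * R := (- Re w, - Im w).
pose dz (t : R) : R[i] := (- (2 * pi * s * sin (2 * pi * t))) +i* (2 * pi * s * cos (2 * pi * t)).
have cE t : toC (c t) = s%:C%C * expi (2 * pi * t).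
 by apply: complexP; rewrite ?ReZ ?ImZ.
have cxE t : toC (c t) - toC x = w + s%:C%C * expi (2 * pi * t).
 by rewrite cE; apply: complexP; rewrite ?ReD ?ReN ?ImD ?ImN /=; ring.
have n0 t : w + s%:C%C * expi (2 * pi * t) != 0.
 rewrite addrC addr_eq0; apply/eqP => /(congr1 (fun z : R[i] => cabs z)).
 rewrite Normc.normcM cabs_expi cabsN cabsR mulr1 ger0_norm// => /eqP.
 by rewrite (negbTE sw).
have p01 : itv_partition (0 : R) 1 [:: 1] by rewrite /itv_partition/= ltr01 eqxx.
have Dc : on_pieces (cpieceD (toC \o c) dz) 0 [:: 1].
 have dl (t : R) : is_derive t 1 (fun t : R => 2 * pi * t) (2 * pi).
  by apply: is_derive_eq; rewrite /GRing.scale/=; ring.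
 split=> //; split; split.
 - by apply: continuous_subspaceT => t; apply: cvgM; [exact: cvg_cst|];
   apply: continuous_comp; [apply: cvgM; [exact: cvg_cst|exact: cvg_id]|exact: continuous_cos].
 - apply: within_pieceC; apply: continuous_subspaceT => t; apply: cvgN; apply: cvgM; [exact: cvg_cst|].
  by apply: continuous_comp; [apply: cvgM; [exact: cvg_cst|exact: cvg_id]|exact: continuous_sin].
 - move=> t _.
  have h := @is_derive1_comp R (@cos R) (fun t : R => 2 * pi * t) t _ _ (is_derive_cos _) (dl t).
  apply: is_derive_eq (is_deriveZ s h) _.
  by rewrite /GRing.scale/=; ring.
 - by apply: continuous_subspaceT => t; apply: cvgM; [exact: cvg_cst|];
   apply: continuous_comp; [apply: cvgM; [exact: cvg_cst|exact: cvg_id]|exact: continuous_sin].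
 - apply: within_pieceC; apply: continuous_subspaceT => t; apply: cvgM; [exact: cvg_cst|].
  by apply: continuous_comp; [apply: cvgM; [exact: cvg_cst|exact: cvg_id]|exact: continuous_cos].
 - move=> t _.
  have h := @is_derive1_comp R (@sin R) (fun t : R => 2 * pi * t) t _ _ (is_derive_sin _) (dl t).
  apply: is_derive_eq (is_deriveZ s h) _.
  by rewrite /GRing.scale/=; ring.
have c01 : c 0 = c 1.
 rewrite /c mulr0 mulr1; have /= -> := congr1 (fun z : R[i] => Re z) (@expi_2pi R).
 by have /= -> := congr1 (fun z : R[i] => Im z) (@expi_2pi R); rewrite cos0 sin0.
have ncx : ~ curve01 c x.
 by case=> t _ ctx; have /eqP := n0 t; rewrite -cxE ctx subrr.
have [n wn nE] : exists2 n : int, winding c x n & 1 - n%:~R%:C%C = (if s < cabs w then 1 else 0) :> R[i].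
 case: ifP => sw'.
  have [l [cl l01] lE] := circle_lift_out s0 sw'.
  exists 0; last by rewrite subr0.
  exists l; last by rewrite l01 subrr mulr0.
  by split => // t _; rewrite toCB cxE lE.
 have ws : cabs w < s by rewrite lt_neqAle eq_sym sw leNgt sw'.
 have [l [cl l01] lE] := circle_lift_in ws.
 exists 1; last by rewrite subrr.
 exists l; last by rewrite l01 mulr1 addrC addKr.
 by split => // t _; rewrite toCB cxE lE.
have WI := winding_integral p01 Dc c01 ncx wn.
have Ii : Cintegrable mu `[0, 1] (fun t => dz t / (toC (c t) - toC x)).
 apply: (pieces_Cintegrable ltr01 p01); case: Dc => Dc _; split => //.
 apply: cpieceCM; first exact: cpieceD_C Dc.
 apply: (cpieceD_C0 (cpieceDV (df := fun t => dz t + 0) _ _)).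
  by move=> t _; rewrite cxE.
 exact: cpieceDD Dc (cpieceD_cst _ _ _).
have I1 : Cintegrable mu `[0, 1] (fun=> 1 : R[i]).
 by apply: (pieces_Cintegrable ltr01 p01); split => //; exact: cpieceC_cst.
(* This is 1 / (2 pi i). *)
pose k : R[i] := 0 +i* - (2 * pi)^-1.
have pi0 : 2 * pi != 0 :> R by rewrite mulf_neq0 ?pnatr_eq0// gt_eqF// pi_gt0.
have pn0 : pi != 0 :> R by rewrite gt_eqF// pi_gt0.
have kdz (p C S : R) : p != 0 ->
  (0 +i* - (2 * p)^-1) * (- (2 * p * s * S) +i* (2 * p * s * C)) = s%:C * (C +i* S).
 by move=> p0; apply: complexP; rewrite ?ReZ ?ImZ ?ReM ?ImM /=; field.
have kn (p a : R) : p != 0 -> (0 +i* - (2 * p)^-1) * (0 +i* (2 * p * a)) = a%:C.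
 by move=> p0; apply: complexP; rewrite ?ReZ ?ImZ ?ReM ?ImM /=; field.
have fE t : 1 - k * (dz t / (toC (c t) - toC x)) = w / (w + s%:C%C * expi (2 * pi * t)).
 rewrite cxE mulrA; have -> : k * dz t = s%:C%C * expi (2 * pi * t).
  exact: kdz.
 by rewrite -{1}(mulfV (n0 t)) -mulrBl addrK.
have Ik : Cintegrable mu `[0, 1] (fun t => k * (dz t / (toC (c t) - toC x))).
 exact: CintegrableZ.
split; first by apply: (@Cintegrable_eq _ TR R mu _ _ _ fE); exact: CintegrableB.
transitivity (Cint mu `[0, 1] (fun t => 1 - k * (dz t / (toC (c t) - toC x)))).
 by apply: eq_Cint => t _; rewrite fE.
rewrite CintB// CintZ// WI -nE; congr (_ - _).
 rewrite /Cint /Rintegral /= integral_cst//= lebesgue_measure_itv/= lte_fin ltr01.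
 by rewrite integral0 /= oppr0 addr0 mul1r.
exact: kn.
Qed.

(** With 2 pi t = 2 phi + pi a half turn of phi covers the whole circle, and the extra pi is the
    source of the minus sign. *)
Lemma half_circle_mean (w : R[i]) (s : R) : 0 <= s -> s != cabs w ->
 let f phi := (\1_(`]-(pi / 2), pi / 2[%classic) phi)%:C * (w / (w - s%:C * expi (2 * phi))) in
 Cintegrable mu setT f /\ Cint mu setT f = (if s < cabs w then pi else 0)%:C.
Proof.
move=> s0 sw f; have pi_gt0 := @pi_gt0 R.
have pn0 : pi != 0 :> R by rewrite gt_eqF.
have [ci cE] := circle_mean s0 sw.
have [gi gE] := Cint_itv01 ci.
pose phi (x : R) : R := pi^-1 * x + 2^-1.
have mphi : measurable_fun setT phi.
 by apply: measurable_funD => //; exact: measurable_funM.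
have tr : forall h : R -> \bar R, measurable_fun setT h -> (forall x, (0 <= h x)%E) ->
  (\int[mu]_x h x = \int[mu]_y ((pi^-1)%:E * h (phi y)))%E.
 move=> h mh h0; rewrite (@ge0_integral_affine _ pi^-1 2^-1)//; last by rewrite invr_neq0.
 by apply: eq_integral => x _; rewrite gtr0_norm// invr_gt0.
have pV0 : forall y : R, 0 <= pi^-1 :> R by move=> _; rewrite invr_ge0 ltW.
have [] := @Cintegral_transfer _ _ TR TR R mu mu phi (fun=> pi^-1) mphi
 (measurable_cst _) pV0 tr _ gi.
have fE (x : R) : (pi^-1)%:C * ((\1_(`]0, 1[%classic) (phi x))%:C *
  (w / (w + s%:C * expi (2 * pi * phi x)))) = (pi^-1)%:C * f x.
 congr (_ * (_ * (_ / _))).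
  rewrite !indicE; congr (_%:R)%:C; congr nat_of_bool.
  have aux : (0 < phi x < 1) = (- (pi / 2) < x < pi / 2).
   rewrite -(pmulr_rgt0 _ pi_gt0) -(ltr_pM2l pi_gt0 _ 1) mulr1.
   have -> : pi * phi x = x + pi / 2 by rewrite /phi mulrDr mulVKf.
   have -> : (- (pi / 2) < x) = (0 < x + pi / 2) by rewrite -subr_gt0 opprK.
   by have -> : (x < pi / 2) = (x + pi / 2 < pi) by rewrite -ltrBrDr {2}[pi]splitr addrK.
  by apply/idP/idP => /set_mem; rewrite /= in_itv/= => h; apply: mem_set;
   rewrite /= in_itv/=; move: h; rewrite aux.
 congr (_ + _); rewrite -mulrN; congr (_ * _).
 have -> : 2 * pi * phi x = 2 * x + pi.
  by rewrite /phi mulrDr -mulrA mulVKf// mulrAC mulfV ?mul1r// pnatr_eq0.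
 by apply: complexP; rewrite ?ReN ?ImN /= ?cosDpi ?sinDpi.
have m1 : pi%:C * (pi^-1)%:C = 1 :> R[i] by rewrite -rcM mulfV.
move=> i1 E1.
have i2 : Cintegrable mu setT (fun x => (pi^-1)%:C * f x) := @Cintegrable_eq _ TR R mu _ _ _ fE i1.
have i3 : Cintegrable mu setT (fun x => pi%:C * ((pi^-1)%:C * f x)) by exact: CintegrableZ.
have E3 x : pi%:C * ((pi^-1)%:C * f x) = f x by rewrite mulrA m1 mul1r.
split; first exact: (@Cintegrable_eq _ TR R mu _ _ _ E3 i3).
transitivity (Cint mu setT (fun x => pi%:C * ((pi^-1)%:C * f x))).
 by apply: eq_Cint => x _; rewrite E3.
rewrite CintZ//; transitivity (pi%:C * (if s < cabs w then 1 else 0) : R[i]).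
 congr (_ * _); rewrite -cE -gE -E1.
 by apply: eq_Cint => x _; rewrite -fE.
by case: ifP; rewrite ?mulr1 ?mulr0.
Qed.

(** Newton's shell argument. Adding the values at u and - u gives 1/(z - u) + 1/(z + u) = 2 z / (z^2
    - u^2), and u^2 has angle 2 phi, so [half_circle_mean] applies to z^2 and r^2. Only the radii
    |r| < |z| contribute; r = |z| and r = - |z| form a null set. *)
Lemma radial_potential (V : R -> R) (M rho : R) (z : R[i]) :
 0 <= rho -> 0 <= M -> measurable_fun setT V ->
 (forall x, cabs (V (cabs (toC x)))%:C <= M * \1_(cball rho) x) ->
 mu.-integrable `](- cabs z), (cabs z)[ (EFin \o (fun r => `|r| * V `|r|)) ->
 Cint mu2 setT (fun x => (V (cabs (toC x)))%:C * (z - toC x)^-1) =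
 (pi * \int[mu]_(r in `](- cabs z), (cabs z)[) (`|r| * V `|r|))%:C / z.
Proof.
move=> rho0 M0 mV VM Vi.
set F := fun x => _.
have mVc : Cmeas (fun x : R * R => (V (cabs (toC x)))%:C).
 by apply: CmeasR; apply: (measurableT_comp mV); apply: measurable_cabs; exact: Cmeas_toC.
have Fi : Cintegrable mu2 setT F := Cintegrable_kernel z rho0 M0 mVc VM.
have [Fi' FE'] := Cint_opp Fi.
have Gi : Cintegrable mu2 setT (fun x => F x + F (- x.1, - x.2)) by exact: CintegrableD.
have [Pi PE] := Cint_polar Gi.
pose T (r : R) : R[i] := (2 * pi)%:C / z * ((\1_(`](- cabs z), (cabs z)[%classic) r * (`|r| * V `|r|))%:C).
have mT : Cmeas T.
 apply: CmeasM; first exact: Cmeas_cst.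
 apply: CmeasR; apply: measurable_funM; first exact: measurable_indic.
 by apply: measurable_funM => //; exact: measurableT_comp.
have TE : Cint mu setT T = Cint mu2 setT (fun x => F x + F (- x.1, - x.2)).
 rewrite -PE; apply: (@Cfubini21_ae _ _ TR TR R mu mu _ T [set cabs z; - cabs z] Pi _ mT).
  apply/negligibleP; first by apply: measurableU; exact: measurable_set1.
  by apply: countable_lebesgue_measure0; apply: finite_set_countable; exact: finite_set2.
 move=> r rN.
 have rz : `|r| != cabs z.
  apply/eqP => rz; apply: rN; have := rz; case: (ger0P r) => _ rE.
   by left.
  by right; rewrite /= -rE opprK.
 have sw : r ^+ 2 != cabs (z ^+ 2).
  rewrite expr2 Normc.normcM -expr2 -[r ^+ 2]real_normK ?num_real//.
  by rewrite eqrXn2// cabs_ge0.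
 have [hi hE] := half_circle_mean (sqr_ge0 r) sw.
 transitivity (Cint mu setT (fun phi : R => ((2 * `|r| * V `|r|)%:C / z) *
  ((\1_(`]-(pi / 2), pi / 2[%classic) phi)%:C *
   (z ^+ 2 / (z ^+ 2 - (r ^+ 2)%:C * expi (2 * phi)))))).
  apply: eq_Cint => phi _.
  rewrite /F /polar_weight !cabs_toC_polar.
  have pN : toC (- (polar phi r).1, - (polar phi r).2) = - toC (polar phi r).
   by apply: complexP; rewrite ?ReN ?ImN.
  rewrite pN cabsN cabs_toC_polar opprK -mulrDr rcM.
  have [->|z0] := eqVneq z 0; first by rewrite sub0r add0r invrN invr0 !(mulr0, mul0r) addNr !mulr0.
  set u := toC (polar phi r).
  have uE : (r ^+ 2)%:C * expi (2 * phi) = u ^+ 2.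
   have -> : u = r%:C * expi phi by apply: complexP; rewrite ?ReZ ?ImZ.
   by rewrite exprMn -rcX -expi_nat mulr_natl.
  have zu : z - u != 0.
   rewrite subr_eq0; apply: contraNneq rz => ->; by rewrite cabs_toC_polar.
  have zu' : z + u != 0.
   rewrite addr_eq0; apply: contraNneq rz => ->; by rewrite cabsN cabs_toC_polar.
  rewrite uE; have -> : z ^+ 2 - u ^+ 2 = (z - u) * (z + u) by ring.
  rewrite !rcM; have -> : (2 : R)%:C = 2 by rewrite rmorph_nat.
  set a := (_ : R)%:C; set b := (_ : R)%:C; set v := (V _)%:C.
  by field; rewrite z0 zu zu'.
 rewrite CintZ// hE /T.
 have -> : (r ^+ 2 < cabs (z ^+ 2)) = (`|r| < cabs z).
  have -> : cabs (z ^+ 2) = cabs z ^+ 2 by rewrite !expr2 Normc.normcM.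
  by rewrite -[r ^+ 2]real_normK ?num_real// ltr_pXn2r// ?nnegrE ?cabs_ge0.
 rewrite indicE; have -> : (r \in `](- cabs z), (cabs z)[%classic) = (`|r| < cabs z).
  by rewrite ltr_norml; apply/idP/idP => [/set_mem|h]; [|apply: mem_set]; rewrite /= in_itv.
 case: ifP => _; last by rewrite mul0r !mulr0.
 by rewrite mul1r mulrAC [RHS]mulrAC -!rcM; congr (_%:C / z); ring.
have CTE : Cint mu setT T = (2 * pi)%:C / z * (\int[mu]_(r in `](- cabs z), (cabs z)[) (`|r| * V `|r|))%:C.
 pose h (r : R) := \1_(`](- cabs z), (cabs z)[%classic) r * (`|r| * V `|r|).
 have hE : h = (fun r => `|r| * V `|r|) \_ `](- cabs z), (cabs z)[.
  apply/funext => r; rewrite /h indicE patchE; case: ifP => _; first by rewrite mul1r.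
  by rewrite mul0r.
 have hi : Cintegrable mu setT (fun r => (h r)%:C).
  split; last exact: integrable0.
  move: Vi; rewrite [X in X -> _]integrable_mkcond//.
  set k1 := _ \_ _; have -> // : (fun x : TR => (Re (h x)%:C)%:E) = k1.
  by apply/funext => t /=; rewrite hE /k1 !patchE; case: ifP.
 rewrite CintZ//; congr (_ * _); apply: complexP => /=.
  by rewrite [RHS]Rintegral_mkcond -hE.
 by rewrite Rintegral_cst// mul0r.
have E2 : Cint mu2 setT F + Cint mu2 setT F = Cint mu setT T.
 by rewrite TE CintD// FE'.
have two0 : 2 != 0 :> R[i] by rewrite pnatr_eq0.
apply: (mulfI two0); rewrite mulr_natl mulr2n E2 CTE !rcM.
by have -> : (2 : R)%:C = 2 by [rewrite rmorph_nat]; ring.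
Qed.
End potential.

(** * The potential of a disc of constant curvature *)

Section newton.
Context {R : realType}.
Notation mu := (@lebesgue_measure R).
Notation TR := (measurableTypeR R).
Notation mu2 := (mu \x mu)%E.
Local Open Scope complex_scope.

Definition lam2 (k : R) (x : R * R) : R := 4 / (1 + k * cabs (toC x) ^+ 2) ^+ 2.

Definition Psi (k : R) (z : R[i]) : R[i] := ((1 + k * cabs z ^+ 2)^-1)%:C * conjc z.

(** [delta] keeps the denominator of the conformal factor away from 0; for k = -1 this confines the
    disc of radius rho to the open unit disc. *)
Variables (k rho delta : R).
Hypotheses (rho0 : 0 < rho) (delta0 : 0 < delta).
Hypothesis deltaP : forall r, 0 <= r -> r < rho -> delta <= 1 + k * r ^+ 2.

Let den_gt0 r : 0 <= r -> r < rho -> 0 < 1 + k * r ^+ 2.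
Proof. by move=> r0 rr; apply: lt_le_trans delta0 _; exact: deltaP. Qed.

Lemma measurable_lam2 : measurable_fun setT (lam2 k : R * R -> R).
Proof.
apply: measurable_funM => //; apply: (measurableT_comp (@measurable_invr R)).
apply: measurable_funX; apply: measurable_funD => //; apply: measurable_funM => //.
by apply: measurable_funX; apply: measurable_cabs; exact: Cmeas_toC.
Qed.

Lemma lam2_ge0 x : 0 <= lam2 k x.
Proof. by rewrite mulr_ge0// invr_ge0 sqr_ge0. Qed.

Lemma lam2_le x : cabs (toC x) < rho -> lam2 k x <= 4 / delta ^+ 2.
Proof.
move=> xr; apply: ler_wpM2l => //.
have h := deltaP (cabs_ge0 _) xr.
rewrite lef_pV2 ?posrE ?exprn_gt0//; last exact: lt_le_trans h.
by rewrite lerXn2r// nnegrE ltW// (lt_le_trans delta0).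
Qed.

Let V (r : R) : R := \1_(`]-oo, rho[%classic) r * (4 / (1 + k * r ^+ 2) ^+ 2).

Lemma pieceD_id (a b : R) : pieceD (fun x : R => x) (fun=> 1) a b.
Proof.
split; [by apply: continuous_subspaceT => t; exact: cvg_id|exact: pieceC_cst|].
by move=> t _; exact: is_derive_id.
Qed.

Lemma pieceD_norm_pos (a : R) : 0 <= a -> pieceD (@Num.norm R R) (fun=> 1) 0 a.
Proof.
move=> a0; split.
- by apply: continuous_subspaceT; exact: norm_continuous.
- exact: pieceC_cst.
move=> t; rewrite in_itv/= => /andP[t0 _].
have h : is_derive t (1 : R) (fun x : R => x) (1 : R) by exact: is_derive_id.
apply: near_eq_is_derive h; near=> s; rewrite gtr0_norm//.
by near: s; exact: lt_nbhsr.
Unshelve. all: by end_near. Qed.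

Lemma pieceD_norm_neg (a : R) : 0 <= a -> pieceD (@Num.norm R R) (fun=> -1) (- a) 0.
Proof.
move=> a0; split.
- by apply: continuous_subspaceT; exact: norm_continuous.
- exact: pieceC_cst.
move=> t; rewrite in_itv/= => /andP[_ t0].
have h : is_derive t (1 : R) (fun x : R => - x) (-1 : R) by apply: is_derive_eq.
apply: near_eq_is_derive h; near=> s; rewrite ltr0_norm//.
by near: s; exact: lt_nbhsl.
Unshelve. all: by end_near. Qed.

Lemma radial_ftc (a : R) : 0 <= a -> a < rho ->
 mu.-integrable `](- a), a[ (EFin \o (fun r => `|r| * V `|r|)) /\
 \int[mu]_(r in `](- a), a[) (`|r| * V `|r|) = 4 * a ^+ 2 / (1 + k * a ^+ 2).
Proof.
rewrite le_eqVlt => /predU1P[<- _|a0 ar].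
 rewrite oppr0 set_itv_ge ?bnd_simp ?ltxx// /Rintegral integral_set0.
 split; first exact: integrable_set0.
 by rewrite expr0n !(mulr0, mul0r).
have ale : - a < a by lra.
have ps : itv_partition (- a) a [:: 0; a] by rewrite /itv_partition/= oppr_lt0 a0 eqxx.
(* A primitive of |r| times the density, valid for both signs of r. *)
pose f (r : R) := r * `|r| * (2 / (1 + k * r ^+ 2)).
pose df (r : R) := `|r| * (4 / (1 + k * r ^+ 2) ^+ 2).
have nz r : r \in `[- a, a] -> 1 + k * r ^+ 2 != 0.
 rewrite in_itv/= -ler_norml => ra; rewrite gt_eqF// -[r ^+ 2]real_normK ?num_real//.
 by apply: den_gt0 => //; exact: le_lt_trans ra ar.
have DV c d : - a <= c -> d <= a ->
  pieceD (fun r => 2 / (1 + k * r ^+ 2)) (fun r => - (4 * k * r) / (1 + k * r ^+ 2) ^+ 2) c d.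
 move=> ac da.
 have Did := pieceD_id c d.
 have Dd := pieceDD (pieceD_cst 1 c d) (pieceDM (pieceD_cst k c d) (pieceDM Did Did)).
 have nz' t : t \in `[c, d] -> cst 1 t + cst k t * (t * t) != 0.
  rewrite in_itv/= => /andP[ct td]; rewrite -expr2 /=; apply: nz.
  by rewrite in_itv/= (le_trans ac)// (le_trans td).
 apply: pieceD_eq1 (pieceDM (pieceD_cst 2 c d) (pieceDV nz' Dd)) => t //=.
 by rewrite -expr2; ring.
have Df : on_pieces (pieceD f df) (- a) [:: 0; a].
 have Did := pieceD_id.
 have la := ltW a0; have na : - a <= 0 by rewrite oppr_le0.
 split; last split => //.
  apply: pieceD_eq (pieceDM (pieceDM (Did _ _) (pieceD_norm_neg la)) (DV _ _ (lexx _) la)).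
  move=> t; rewrite in_itv/= => /andP[at_ t0]; rewrite /df ltr0_norm//.
  have n0 : 1 + k * t ^+ 2 != 0 by apply: nz; rewrite in_itv/= ltW//= ltW// (lt_trans t0).
  by field.
 apply: pieceD_eq (pieceDM (pieceDM (Did _ _) (pieceD_norm_pos la)) (DV _ _ na (lexx _))).
 move=> t; rewrite in_itv/= => /andP[t0 ta]; rewrite /df gtr0_norm//.
 have n0 : 1 + k * t ^+ 2 != 0 by apply: nz; rewrite in_itv/= (ltW ta) andbT ltW// (lt_trans _ t0)// oppr_lt0.
 by field.
have Idf : mu.-integrable `[- a, a] (EFin \o df).
 apply: (pieces_integrable ale ps); case: Df => [[_ h1 _] [[_ h2 _] _]]; by split.
have dfV r : r \in `](- a), a[ -> `|r| * V `|r| = df r.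
 rewrite in_itv/= -ltr_norml => ra; rewrite /V /df indicE mem_set ?mul1r ?real_normK ?num_real//.
 by rewrite /= in_itv/= (lt_trans ra).
have Ioo : mu.-integrable `](- a), a[ (EFin \o df).
 by apply: integrableS Idf => //; exact: subset_itv_oo_cc.
split.
 apply: eq_integrable Ioo => // r /set_mem rI /=; by rewrite dfV.
transitivity (\int[mu]_(r in `](- a), a[) df r).
 by apply: eq_Rintegral => r /set_mem; exact: dfV.
rewrite Rintegral_itv_bndo_bndc// Rintegral_itv_obnd_cbnd//; last first.
 by apply: integrableS Idf => //; exact: subset_itv_oc_cc.
rewrite (pieces_ftc ale ps Df) /f normrN gtr0_norm// sqrrN.
have n0 : 1 + k * a ^+ 2 != 0 by apply: nz; rewrite in_itv/= lexx (ltW ale).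
by field.
Qed.

(** The mass at distance less than |z| from the origin is 4 pi |z|^2 / (1 + k |z|^2), and division
    by z gives 4 pi Psi. The outer radius rho disappears, since outer shells exert no force. *)
Lemma newton (z : R[i]) : cabs z < rho ->
 Cint mu2 setT (fun x => (\1_(cball rho) x * lam2 k x)%:C * (z - toC x)^-1) =
 (4 * pi)%:C * Psi k z.
Proof.
move=> zr.
have VE x : V (cabs (toC x)) = \1_(cball rho) x * lam2 k x.
 by rewrite /V !indicE mem_cball; congr (_%:R * _); congr nat_of_bool;
  apply/idP/idP => [/set_mem|h]; [|apply: mem_set]; rewrite /= in_itv.
have [Vi VI] := radial_ftc (cabs_ge0 z) zr.
transitivity (Cint mu2 setT (fun x => (V (cabs (toC x)))%:C * (z - toC x)^-1)).
 by apply: eq_Cint => x _; rewrite VE.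
have M0 : 0 <= 4 / delta ^+ 2 by rewrite mulr_ge0// invr_ge0 sqr_ge0.
rewrite (radial_potential (M := 4 / delta ^+ 2) (ltW rho0) M0)//.
- rewrite VI /Psi.
 have [->|z0] := eqVneq z 0.
  by rewrite invr0 mulr0; apply: complexP; rewrite ?ReM ?ImM /= !(mulr0, mul0r, subr0, oppr0, addr0).
 rewrite invCE !mulrA -!rcM; congr (_%:C * _).
 have n0 : 1 + k * cabs z ^+ 2 != 0 by rewrite gt_eqF// den_gt0// cabs_ge0.
 have n1 : cabs z != 0 by rewrite cabs_eq0.
 move: (cabs z) n0 n1 (pi : R) => c n0 n1 p; rewrite expr2 mulrA in n0.
 by field; rewrite n1 n0.
- apply: measurable_funM; first exact: measurable_indic.
 apply: measurable_funM => //; apply: (measurableT_comp (@measurable_invr R)).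
 by apply: measurable_funX; apply: measurable_funD => //; apply: measurable_funM => //; exact: measurable_funX.
- move=> x; rewrite VE cabsR ger0_norm; last by rewrite mulr_ge0 ?lam2_ge0// indicE ler0n.
 rewrite indicE.
 rewrite mem_cball.
 by case: ltP => xr; [rewrite mul1r mulr1 lam2_le|rewrite mul0r mulr0].
Qed.
End newton.

(** * Borel sets and null sets of the plane *)

Section plane_sets.
Context {R : realType}.
Notation mu := (@lebesgue_measure R).
Notation TR := (measurableTypeR R).
Notation mu2 := (mu \x mu)%E.
Local Open Scope complex_scope.

Definition box (q : R * R) (r : R) : set (R * R) :=
 `[q.1 - r, q.1 + r]%classic `*` `[q.2 - r, q.2 + r]%classic.

Lemma measurable_box q r : measurable (box q r : set (TR * TR)).
Proof. by apply: measurableX. Qed.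

Lemma mu2_box q r : 0 <= r -> mu2 (box q r) = ((2 * r) ^+ 2)%:E.
Proof.
move=> r0; rewrite product_measure1E// /= !lebesgue_measure_itv/= !lte_fin.
rewrite le_eqVlt in r0; case/predU1P: r0 => [<-|r0].
 by rewrite !subr0 !addr0 !ltxx mule0 mulr0 expr0n.
by rewrite !ifT; [rewrite -!EFinB -EFinM; congr (_%:E); ring|lra|lra].
Qed.

Lemma open_measurable2 (U : set (R * R)) : open U -> measurable (U : set (TR * TR)).
Proof.
move=> oU.
pose B (i : rat * rat * rat) : set (TR * TR) :=
 if `[< box (ratr i.1.1, ratr i.1.2) (ratr i.2) `<=` U >] then
  box (ratr i.1.1, ratr i.1.2) (ratr i.2) else set0.
have -> : U = \bigcup_i B i.
 apply/seteqP; split => [x Ux|x [i _]]; last first.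
  by rewrite /B; case: asboolP => // BU; exact: BU.
 have /nbhs_ballP[e /= e0 eU] := open_nbhs_nbhs (conj oU Ux).
 (* A rational centre within e/4 of x in each coordinate and a half side between e/4 and e/2 put x
    in the square and the square in the ball of radius e. *)
 have he : 0 < e / 4 by rewrite divr_gt0.
 have [q1 q1P] : exists q, ratr q \in `]x.1 - e / 4, x.1 + e / 4[ by apply: rat_in_itvoo; lra.
 have [q2 q2P] : exists q, ratr q \in `]x.2 - e / 4, x.2 + e / 4[ by apply: rat_in_itvoo; lra.
 have [q3 q3P] : exists q, ratr q \in `]e / 4, e / 2[ by apply: rat_in_itvoo; lra.
 move: q1P q2P q3P; rewrite !in_itv/= => /andP[a1 b1] /andP[a2 b2] /andP[a3 b3].
 exists (q1, q2, q3) => //; rewrite /B/=; case: asboolP => [_|].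
  by split; rewrite /= in_itv/=; apply/andP; split; lra.
 case=> y [/= y1 y2]; apply: eU; move: y1 y2; rewrite !in_itv/= => /andP[c1 d1] /andP[c2 d2].
 by split; rewrite /ball/= ltr_norml; apply/andP; split; lra.
apply: countable_bigcupT_measurable => [|i]; first exact: countableP.
rewrite /B.
by case: asboolP => _; [exact: measurable_box|exact: measurable0].
Qed.

(** A Lipschitz curve is covered by N squares of half side M / N, of total area 4 M^2 / N. *)
Lemma curve_null (c : R -> R * R) (M : R) : {within `[0, 1], continuous c} ->
 (forall s t, s \in `[0, 1] -> t \in `[0, 1] ->
  `|(c s).1 - (c t).1| <= M * `|s - t| /\ `|(c s).2 - (c t).2| <= M * `|s - t|) ->
 measurable (curve01 c : set (TR * TR)) /\ mu2.-negligible (curve01 c).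
Proof.
move=> cc cM.
have M0 : 0 <= M.
 have := (cM 1 0 _ _).1; rewrite !in_itv/= !lexx ler01 subr0 normr1 mulr1 => /(_ isT isT).
 exact: le_trans.
have mC : measurable (curve01 c : set (TR * TR)).
 rewrite -[curve01 c]setCK; apply: measurableC; apply: open_measurable2.
 apply: closed_openC; apply: compact_closed; first exact: norm_hausdorff.
 exact: (continuous_compact cc (@segment_compact _ _ _)).
split=> //; apply/negligibleP => //; apply/eqP; rewrite -measure_le0.
apply/lee_addgt0Pr => e e0; rewrite add0e.
pose N := (Num.truncn (4 * M ^+ 2 / e)).+1.
have N0 : 0 < N%:R :> R by rewrite ltr0n.
have frac (j : nat) : (j <= N)%N -> j%:R / N%:R \in `[(0 : R), 1].
 by move=> jN; rewrite in_itv/= divr_ge0//= ler_pdivrMr// mul1r ler_nat.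
pose B (i : nat) : set (TR * TR) := box (c (i%:R / N%:R)) (M / N%:R).
have sub : curve01 c `<=` \big[setU/set0]_(i < N) B i.
 move=> x [t /=]; rewrite in_itv/= => /andP[t0 t1] <-.
 rewrite -bigcup_mkord.
 have tN0 : 0 <= t * N%:R by rewrite mulr_ge0// ltW.
 (* The truncated index reaches N only at t = 1, which is put into the last square. *)
 have [tN|tN] := ltP (Num.truncn (t * N%:R)) N; last first.
  have {}t1 : t = 1.
   apply/eqP; rewrite eq_le t1 -(ler_pM2r N0) mul1r.
   by have := tN0; rewrite -truncn_le; apply: le_trans; rewrite ler_nat.
  rewrite t1; exists N.-1; first exact: ltnSn.
  have [] := cM 1 (N.-1%:R / N%:R); first by rewrite in_itv/= ler01 lexx.
   by apply: frac; exact: leq_pred.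
  have -> : `|1 - N.-1%:R / N%:R| = N%:R^-1 :> R.
   have -> : 1 - N.-1%:R / N%:R = N%:R^-1 :> R.
    have NE : N%:R = N.-1%:R + 1 :> R by rewrite natr1.
    move: (N.-1%:R : R) NE => a NE; have Nn : N%:R != 0 :> R by rewrite gt_eqF.
    by move: Nn; rewrite NE => Nn; field.
   by rewrite gtr0_norm// invr_gt0.
  rewrite !ler_distl => /andP[a1 b1] /andP[a2 b2].
  by split; rewrite /= in_itv/= ?a1 ?a2.
 exists (Num.truncn (t * N%:R)) => //; set j := Num.truncn _ in tN *.
 have /andP[j1 j2] := truncn_itv tN0; rewrite -/j in j1 j2.
 have [] := cM t (j%:R / N%:R); first by rewrite in_itv/= t0.
  by apply: frac; exact: ltnW.
 have jt : `|t - j%:R / N%:R| <= N%:R^-1.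
  rewrite ger0_norm; last by rewrite subr_ge0 ler_pdivrMr.
  by rewrite lerBlDr -{1}[N%:R^-1]mul1r -mulrDl ler_pdivlMr// addrC natr1 ltW.
 have jM : M * `|t - j%:R / N%:R| <= M / N%:R by apply: ler_wpM2l.
 move=> /le_trans/(_ jM) h1 /le_trans/(_ jM) h2; move: h1 h2.
 rewrite !ler_distl => /andP[a1 b1] /andP[a2 b2].
 by split; rewrite /= in_itv/= ?a1 ?a2.
apply: (@le_trans _ _ (\sum_(i < N) mu2 (B i))%E).
 apply: (@content_subadditive _ R (TR * TR)%type mu2 _ B) => //.
 by move=> i _; exact: measurable_box.
rewrite (eq_bigr (fun=> ((2 * (M / N%:R)) ^+ 2)%:E)); last first.
 by move=> i _; rewrite mu2_box// divr_ge0// ltW.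
rewrite sumEFin lee_fin sumr_const card_ord -[leLHS]mulr_natl.
have -> : N%:R * (2 * (M / N%:R)) ^+ 2 = (4 * M ^+ 2) / N%:R.
 by field; rewrite gt_eqF.
rewrite ler_pdivrMr// -ler_pdivrMl// mulrC.
by have := truncnS_gt (4 * M ^+ 2 / e); rewrite -/N => /ltW.
Qed.
End plane_sets.

(** * Exchange of an integral along the curve with one over the plane *)

Lemma ge0_prod_integrable d1 d2 (T1 : measurableType d1) (T2 : measurableType d2)
  {R : realType} (m1 : {sigma_finite_measure set T1 -> \bar R})
  (m2 : {sigma_finite_measure set T2 -> \bar R}) (h : T1 * T2 -> R) :
 measurable_fun setT h -> (forall p, 0 <= h p) ->
 (\int[m1]_x \int[m2]_y (h (x, y))%:E < +oo)%E ->
 (m1 \x m2)%E.-integrable setT (EFin \o h).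
Proof.
move=> mh h0 hoo; have mhE : measurable_fun setT (EFin \o h) by exact/measurable_EFinP.
apply/integrableP; split => //.
have -> : (\int[m1 \x m2]_p `|(EFin \o h) p| = \int[m1 \x m2]_p (EFin \o h) p)%E.
 by apply: eq_integral => p _; rewrite gee0_abs// lee_fin.
by rewrite fubini_tonelli1// => p; rewrite lee_fin.
Qed.

(** The bound [H] on the inner integrals of the dominating function gives integrability on the
    product by Tonelli's theorem. *)
Lemma Cfubini_swap d1 d2 (T1 : measurableType d1) (T2 : measurableType d2)
  {R : realType} (m1 : {sigma_finite_measure set T1 -> \bar R})
  (m2 : {sigma_finite_measure set T2 -> \bar R}) (f : T1 * T2 -> R[i])
  (h : T1 * T2 -> R) (H : T1 -> R) (T : T2 -> R[i]) (N : set T2) :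
 Cmeas f -> measurable_fun setT h -> (forall p, cabs (f p) <= h p) ->
 (forall x, \int[m2]_y (h (x, y))%:E <= (H x)%:E)%E ->
 m1.-integrable setT (EFin \o H) ->
 m2.-negligible N -> Cmeas T ->
 (forall y, ~ N y -> Cint m1 setT (fun x => f (x, y)) = T y) ->
 Cint m1 setT (fun x => Cint m2 setT (fun y => f (x, y))) = Cint m2 setT T.
Proof.
move=> mf mh fh hH Hi N0 mT fT.
have h0 p : 0 <= h p by apply: le_trans (fh p); exact: cabs_ge0.
have mhE : measurable_fun setT (EFin \o h) by exact/measurable_EFinP.
have hoo : (\int[m1]_x \int[m2]_y (h (x, y))%:E < +oo)%E.
 have /integrableP[mH Hoo] := Hi; apply: le_lt_trans Hoo.
 apply: ge0_le_integral => //.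
 - by move=> x _; apply: integral_ge0 => y _; rewrite lee_fin.
 - by apply: (@measurable_fun_fubini_tonelli_F _ _ T1 T2 R m2 _ mhE) => p; rewrite lee_fin.
 - exact: measurableT_comp.
 - by move=> x _; apply: (le_trans (hH x)); rewrite lee_fin ler_norm.
have fi := Cintegrable_le mf fh (ge0_prod_integrable mh h0 hoo).
by rewrite (Cfubini12 fi) (Cfubini21_ae fi N0 mT fT).
Qed.

Section plane_sigma_finite.
Context {R : realType}.
Notation mu := (@lebesgue_measure R).
Notation TR := (measurableTypeR R).

Let plane_sigma_finite : sigma_finite [set: TR * TR] (mu \x mu)%E.
Proof.
exists (fun n => box (0, 0) n%:R) => [|n]; last first.
 by split; [exact: measurable_box|rewrite mu2_box// ltry].
apply/seteqP; split => // x _; pose n := (Num.truncn (`|x.1| + `|x.2|)).+1.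
have xn : `|x.1| + `|x.2| < n%:R by exact: truncnS_gt.
exists n => //; split; rewrite /= in_itv/= !add0r -ler_norml; apply: ltW;
 apply: le_lt_trans xn; first by rewrite lerDl.
by rewrite lerDr.
Qed.

(** A copy of the product measure that carries a sigma-finite structure, so that Fubini's theorem
    applies to the product of the line and the plane. *)
Definition plane_measure : set (TR * TR) -> \bar R := (mu \x mu)%E.

HB.instance Definition _ := Measure.copy plane_measure (mu \x mu)%E.

HB.instance Definition _ := Measure_isSigmaFinite.Build _ _ _ plane_measure
 plane_sigma_finite.
End plane_sigma_finite.

Section curve_plane.
Context {R : realType}.
Notation mu := (@lebesgue_measure R).
Notation TR := (measurableTypeR R).
Notation mu2 := (mu \x mu)%E.
Local Open Scope complex_scope.

(** The kernel is singular along the curve, but [kernel_bound] controls its integral over the plane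
    uniformly in t, because zc is bounded. *)
Lemma fubini_curve_plane (phi zc : R -> R[i]) (g T : R * R -> R[i])
  (B Z M rho : R) (N : set (R * R)) : 0 <= B -> 0 <= M -> 0 <= rho ->
 Cmeas phi -> Cmeas zc -> (forall t, cabs (phi t) <= B * \1_(`[0, 1]%classic) t) ->
 (forall t, cabs (zc t) <= Z) ->
 Cmeas g -> (forall x, cabs (g x) <= M * \1_(cball rho) x) ->
 mu2.-negligible N -> Cmeas T ->
 (forall x, ~ N x -> Cintegrable mu setT (fun t => phi t * (zc t - toC x)^-1) /\
   Cint mu setT (fun t => phi t * (zc t - toC x)^-1) = T x) ->
 Cint mu setT (fun t => phi t * Cint mu2 setT (fun x => g x * (zc t - toC x)^-1)) =
 Cint mu2 setT (fun x => g x * T x).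
Proof.
move=> B0 M0 rho0 mphi mzc phiB zcZ mg gM N0 mT TP.
pose f (p : TR * (TR * TR)) : R[i] := phi p.1 * (g p.2 * (zc p.1 - toC p.2)^-1).
have Z0 : 0 <= Z by apply: le_trans (zcZ 0); exact: cabs_ge0.
pose i0 (t : R) : R := \1_(`[0, 1]%classic) t.
pose i1 (x : R * R) : R := \1_(cball rho) x.
have i00 t : 0 <= i0 t by rewrite /i0 indicE ler0n.
have i10 x : 0 <= i1 x by rewrite /i1 indicE ler0n.
pose ker (p : TR * (TR * TR)) : R := i1 p.2 * (cabs (zc p.1 - toC p.2))^-1.
pose h (p : TR * (TR * TR)) : R := (B * i0 p.1) * (M * ker p).
have mzc1 : Cmeas (fun p : TR * (TR * TR) => zc p.1 - toC p.2).
 apply: CmeasD; first exact: (Cmeas_comp (@measurable_fst _ _ TR (TR * TR)%type)).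
 apply: CmeasN; exact: (Cmeas_comp (@measurable_snd _ _ TR (TR * TR)%type) Cmeas_toC).
have mf : Cmeas f.
 apply: CmeasM; first exact: (Cmeas_comp (@measurable_fst _ _ TR (TR * TR)%type)).
 apply: CmeasM; first exact: (Cmeas_comp (@measurable_snd _ _ TR (TR * TR)%type)).
 exact: CmeasV.
have mi0 : measurable_fun setT i0 by exact: measurable_indic.
have mi1 : measurable_fun setT i1 by exact: measurable_indic (measurable_cball _).
have mker : measurable_fun setT ker.
 apply: measurable_funM; first exact: (measurableT_comp mi1 (@measurable_snd _ _ TR (TR * TR)%type)).
 by apply: (measurableT_comp (@measurable_invr R)); exact: measurable_cabs.
have mh : measurable_fun setT h.
 apply: measurable_funM.
  by apply: measurable_funM => //; exact: (measurableT_comp mi0 (@measurable_fst _ _ TR (TR * TR)%type)).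
 by apply: measurable_funM.
have k0 p : 0 <= ker p by rewrite mulr_ge0// invr_ge0 cabs_ge0.
have h0 p : 0 <= h p by rewrite /h; apply: mulr_ge0; apply: mulr_ge0.
pose H (t : R) : R := (B * M) * (2 * pi * (rho + Z)) * i0 t.
have hH t : (\int[mu2]_x (h (t, x))%:E <= (H t)%:E)%E.
 have kt : measurable_fun setT (fun x : TR * TR => ker (t, x)).
  exact: (measurableT_comp mker (measurable_pair1 t)).
 have -> : (\int[mu2]_x (h (t, x))%:E = \int[mu2]_x ((B * i0 t * M)%:E * (ker (t, x))%:E))%E.
  by apply: eq_integral => x _; rewrite -EFinM /h mulrA.
 rewrite ge0_integralZl//; last 3 first.
 - exact/measurable_EFinP.
 - by move=> x _; rewrite lee_fin.
 - by rewrite lee_fin !mulr_ge0.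
 rewrite /H [X in (_ <= X%:E)%E](_ : _ = (B * i0 t * M) * (2 * pi * (rho + Z))); last by ring.
 rewrite [X in (_ <= X)%E]EFinM; apply: lee_wpmul2l; first by rewrite lee_fin !mulr_ge0.
 apply: le_trans (kernel_bound (zc t) rho0) _.
 by rewrite lee_fin ler_wpM2l ?mulr_ge0 ?pi_ge0// lerD2l.
have Hi : mu.-integrable setT (EFin \o H).
 have : mu.-integrable `[0, 1] (EFin \o (fun=> (B * M) * (2 * pi * (rho + Z)))).
  have p01 : itv_partition (0 : R) 1 [:: 1] by rewrite /itv_partition/= ltr01 eqxx.
  by apply: (pieces_integrable ltr01 p01); split => //; exact: pieceC_cst.
 rewrite [X in X -> _]integrable_mkcond//.
 set k1 := _ \_ _; have -> // : EFin \o H = k1.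
 apply/funext => t; rewrite /k1 patchE /H /i0 /= indicE.
 by case: ifP; rewrite ?mulr1 ?mulr0.
have fh p : cabs (f p) <= h p.
 rewrite /f /h /ker !Normc.normcM cabsV !mulrA -[leRHS]mulrA -[leRHS]mulrA.
 rewrite [M * (_ * _)]mulrA -[leLHS]mulrA; apply: ler_pM => //.
 - exact: cabs_ge0.
 - by rewrite mulr_ge0// ?invr_ge0 cabs_ge0.
 - by apply: ler_wpM2r; [rewrite invr_ge0 cabs_ge0|exact: gM].
transitivity (Cint mu setT (fun t => Cint mu2 setT (fun x => f (t, x)))).
 by apply: eq_Cint => t _; rewrite -CintZ//; exact: (Cintegrable_kernel _ rho0 M0 mg gM).
have swap := @Cfubini_swap _ _ TR (TR * TR)%type R mu plane_measure f h H (fun x => g x * T x) N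
 mf mh fh hH Hi N0.
apply: swap.
 exact: CmeasM.
move=> x /TP[xi <-]; rewrite -CintZ//; apply: eq_Cint => t _.
by rewrite /f /= mulrCA.
Qed.
End curve_plane.

(** * Dominated convergence for complex functions *)

Section complex_dominated.
Context d (T : measurableType d) {R : realType} (m : {measure set T -> \bar R}).
Local Open Scope complex_scope.

Lemma Cint_mkcond (D : set T) (f : T -> R[i]) :
 Cint m D f = Cint m setT (fun t => (\1_D t)%:C * f t).
Proof.
rewrite /Cint !(Rintegral_mkcond m D); congr Complex; apply: eq_Rintegral => t _;
 by rewrite patchE ?ReZ ?ImZ indicE; case: ifP => _; rewrite ?mul1r ?mul0r.
Qed.

Lemma Cintegrable_mkcond (D : set T) (f : T -> R[i]) : measurable D ->
 Cintegrable m D f -> Cintegrable m setT (fun t => (\1_D t)%:C * f t).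
Proof.
move=> mD [fr fi]; split.
 move: fr; rewrite [X in X -> _]integrable_mkcond//.
 set k1 := _ \_ _; have -> // : (fun t => (Re ((\1_D t)%:C * f t))%:E) = k1.
 by apply/funext => t; rewrite /k1 patchE ReZ indicE; case: ifP; rewrite ?mul1r ?mul0r.
move: fi; rewrite [X in X -> _]integrable_mkcond//.
set k1 := _ \_ _; have -> // : (fun t => (Im ((\1_D t)%:C * f t))%:E) = k1.
by apply/funext => t; rewrite /k1 patchE ImZ indicE; case: ifP; rewrite ?mul1r ?mul0r.
Qed.

Let Rdominated (f_ : nat -> T -> R) (f g : T -> R) (N : set T) :
 (forall n, measurable_fun setT (f_ n)) -> measurable_fun setT f ->
 m.-negligible N -> (forall x, ~ N x -> f_ n x @[n --> \oo] --> f x) ->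
 (forall n x, `|f_ n x| <= g x) -> m.-integrable setT (EFin \o g) ->
 \int[m]_x f_ n x @[n --> \oo] --> \int[m]_x f x.
Proof.
move=> mf_ mf N0 fN fg gi.
have [|||||fi _ fc] := @dominated_convergence _ T R m setT measurableT
 (fun n => EFin \o f_ n) (EFin \o f) (EFin \o g).
- by move=> n; exact/measurable_EFinP.
- exact/measurable_EFinP.
- apply: negligibleS N0 => x /=; apply: contra_notP => Nx _.
 by apply: cvg_EFin; [exact: nearW|exact: fN].
- exact: gi.
- by apply: aeW => x n _; rewrite /= lee_fin.
have ffin : (\int[m]_x (f x)%:E)%E \is a fin_num by exact: integrable_fin_num.
by rewrite /Rintegral; apply: fine_cvg; rewrite fineK.
Qed.

Lemma Cdominated (f_ : nat -> T -> R[i]) (f : T -> R[i]) (g : T -> R) (N : set T) :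
 (forall n, Cmeas (f_ n)) -> Cmeas f ->
 m.-negligible N -> (forall x, ~ N x -> cvgC \oo (fun n => f_ n x) (f x)) ->
 (forall n x, cabs (f_ n x) <= g x) -> m.-integrable setT (EFin \o g) ->
 cvgC \oo (fun n => Cint m setT (f_ n)) (Cint m setT f).
Proof.
move=> mf_ [mr mi] N0 fN fg gi; split.
 apply: (Rdominated (N := N) (g := g)) => //.
 - by move=> n; have [] := mf_ n.
 - by move=> x /fN[].
 - by move=> n x; apply: le_trans (fg n x); exact: Re_le_cabs.
apply: (Rdominated (N := N) (g := g)) => //.
- by move=> n; have [] := mf_ n.
- by move=> x /fN[].
- by move=> n x; apply: le_trans (fg n x); exact: Im_le_cabs.
Qed.

Lemma Cint_ae (f g : T -> R[i]) (N : set T) : Cmeas f -> Cmeas g ->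
 m.-negligible N -> (forall x, ~ N x -> f x = g x) -> Cint m setT f = Cint m setT g.
Proof.
move=> [fr fi] [gr gi] N0 fg.
have ae (h1 h2 : T -> R) : measurable_fun setT h1 -> measurable_fun setT h2 ->
  (forall x, ~ N x -> h1 x = h2 x) -> \int[m]_x h1 x = \int[m]_x h2 x.
 move=> m1 m2 h12; rewrite /Rintegral; congr fine.
 apply: ae_eq_integral => //; try exact/measurable_EFinP.
 by apply: negligibleS N0 => x /=; apply: contra_notP => Nx _; rewrite h12.
by rewrite /Cint; congr Complex; apply: ae => // x /fg ->.
Qed.
End complex_dominated.

(** * The two-point kernel and the difference quotient of Psi *)

Section key_identity.
Context {R : realType}.
Local Open Scope complex_scope.

Definition lamC (k : R) (z : R[i]) : R := 2 / (1 + k * cabs z ^+ 2).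

Definition dq (k : R) (z w : R[i]) : R[i] := (Psi k z - Psi k w) / (z - w).

(** Since |z|^2 = z conj z, this is a rational identity in z, w, conj z and conj w taken as
    independent variables. *)
Lemma two_point_identity (k : R) (z w : R[i]) :
 1 + k * cabs z ^+ 2 != 0 -> 1 + k * cabs w ^+ 2 != 0 -> z != w ->
 conjc (z - w) / (z - w) * (lamC k z * lamC k w)%:C =
 4 * (dq k z w + k%:C * (Psi k z * Psi k w)).
Proof.
have cE (u : R[i]) : (1 + k * cabs u ^+ 2)%:C = 1 + k%:C * (u * conjc u).
 by rewrite rcD rcM mulJ.
move=> z0 w0 zw; have zw0 : z - w != 0 by rewrite subr_eq0.
have zc0 : 1 + k%:C * (z * conjc z) != 0.
 by rewrite -cE; apply: contraNneq z0 => /(congr1 (fun u : R[i] => Re u)) /= ->.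
have wc0 : 1 + k%:C * (w * conjc w) != 0.
 by rewrite -cE; apply: contraNneq w0 => /(congr1 (fun u : R[i] => Re u)) /= ->.
rewrite /lamC /dq /Psi !rcM !rcV !cE rmorphB /=.
have -> : (2 : R)%:C = 2 by rewrite rmorph_nat.
move: (conjc z) (conjc w) zc0 wc0 => u v zc0 wc0.
by field; rewrite zw0 zc0 wc0.
Qed.

Lemma cabs_Psi (k : R) (z : R[i]) : 0 < 1 + k * cabs z ^+ 2 ->
 cabs (Psi k z) = cabs z / (1 + k * cabs z ^+ 2).
Proof.
by move=> z0; rewrite Normc.normcM cabsJ cabsR gtr0_norm ?invr_gt0// mulrC.
Qed.

Lemma cabs_natr (n : nat) : cabs (n%:R : R[i]) = n%:R.
Proof. by rewrite -[n%:R]/(n%:R : R[i]) -(rmorph_nat (real_complex R)) cabsR normr_nat. Qed.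

(** Read backwards, the two-point identity expresses the difference quotient by terms whose moduli
    no longer contain z - w in a denominator. *)
Lemma dq_bound (k rho delta : R) (z w : R[i]) : `|k| <= 1 -> 0 < delta ->
 (forall r, 0 <= r -> r < rho -> delta <= 1 + k * r ^+ 2) ->
 cabs z < rho -> cabs w < rho -> cabs (dq k z w) <= (1 + rho ^+ 2) / delta ^+ 2.
Proof.
move=> k1 d0 dP zr wr.
have rho0 : 0 < rho by apply: le_lt_trans zr; exact: cabs_ge0.
have C0 : 0 <= (1 + rho ^+ 2) / delta ^+ 2 by rewrite divr_ge0// ?addr_ge0// sqr_ge0.
have [->|zw] := eqVneq z w; first by rewrite /dq !subrr mul0r cabs0.
have zd := dP _ (cabs_ge0 z) zr; have wd := dP _ (cabs_ge0 w) wr.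
have z0 : 0 < 1 + k * cabs z ^+ 2 by exact: lt_le_trans zd.
have w0 : 0 < 1 + k * cabs w ^+ 2 by exact: lt_le_trans wd.
have := two_point_identity (lt0r_neq0 z0) (lt0r_neq0 w0) zw.
set X := _ * (_ : R)%:C => XE.
have cX : cabs X = lamC k z * lamC k w.
 have zw0 : cabs (z - w) != 0 by rewrite cabs_eq0 subr_eq0.
 rewrite /X !Normc.normcM cabsV cabsJ mulfV// mul1r cabsR ger0_norm// mulr_ge0// divr_ge0// ltW//.
have dE : dq k z w = 4^-1 * X + - (k%:C * (Psi k z * Psi k w)).
 by rewrite XE mulKf ?pnatr_eq0// addrK.
rewrite dE; apply: le_trans (cabs_triangle _ _) _.
rewrite cabsN Normc.normcM cX [cabs (k%:C * _)]Normc.normcM [cabs (Psi k z * _)]Normc.normcM.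
rewrite cabsV cabs_natr cabsR (cabs_Psi z0) (cabs_Psi w0) /lamC.
move: (cabs_ge0 z) (cabs_ge0 w) zr wr z0 w0 zd wd.
set a := cabs z; set b := cabs w; set p := 1 + k * a ^+ 2; set q := 1 + k * b ^+ 2.
move=> a0 b0 ar br p0 q0 pd qd.
have -> : 4^-1 * (2 / p * (2 / q)) + `|k| * (a / p * (b / q)) = (1 + `|k| * (a * b)) / (p * q).
 by field; rewrite ?gt_eqF.
apply: ler_pM.
- by rewrite addr_ge0// !mulr_ge0.
- by rewrite invr_ge0 mulr_ge0// ltW.
- have ab : a * b <= rho ^+ 2 by rewrite expr2 ler_pM// ltW.
 by rewrite lerD2l -[leRHS]mul1r ler_pM// mulr_ge0.
- by rewrite lef_pV2 ?posrE ?mulr_gt0// ?exprn_gt0// expr2 ler_pM// ltW.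
Qed.
End key_identity.

(** * Integrability and reflections in the plane *)

Section plane_limits.
Context {R : realType}.
Notation mu := (@lebesgue_measure R).
Notation TR := (measurableTypeR R).
Notation mu2 := (mu \x mu)%E.
Local Open Scope complex_scope.

Lemma integrable_kernel (rho : R) (z : R[i]) : 0 <= rho ->
 mu2.-integrable setT (EFin \o (fun x : R * R => \1_(cball rho) x * (cabs (z - toC x))^-1)).
Proof.
move=> rho0; pose h (x : R * R) : R := \1_(cball rho) x * (cabs (z - toC x))^-1.
have mh : measurable_fun setT h.
 apply: measurable_funM; first exact: measurable_indic (measurable_cball rho).
 apply: (measurableT_comp (@measurable_invr R)); apply: measurable_cabs.
 by apply: CmeasD; [exact: Cmeas_cst|apply/CmeasN/Cmeas_toC].
have h0 x : 0 <= h x by rewrite mulr_ge0// ?invr_ge0 ?cabs_ge0// indicE ler0n.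
apply/integrableP; split; first exact/measurable_EFinP.
have -> : (\int[mu2]_x `|(EFin \o h) x| = \int[mu2]_x (h x)%:E)%E.
 by apply: eq_integral => x _ /=; rewrite ger0_norm.
by apply: le_lt_trans (kernel_bound z rho0) _; rewrite ltry.
Qed.

Lemma integrable_cball (rho M : R) : 0 < rho ->
 mu2.-integrable setT (EFin \o (fun x : R * R => M * \1_(cball rho) x)).
Proof.
move=> rho0; have mi : measurable_fun setT (\1_(cball rho) : R * R -> R) by exact: measurable_indic (measurable_cball rho).
have : mu2.-integrable setT (EFin \o (\1_(cball rho) : R * R -> R)).
 apply/integrableP; split; first exact/measurable_EFinP.
 apply: (@le_lt_trans _ _ (mu2 (box (0, 0) rho))); last by rewrite mu2_box ?ltry// ltW.
 have bE : (\int[mu2]_x (\1_(box (0%R, 0%R) rho) x)%:E = mu2 (box (0%R, 0%R) rho))%E.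
  by rewrite integral_indic ?setIT//; exact: measurable_box.
 rewrite -bE.
 apply: ge0_le_integral => //.
 - by apply: measurableT_comp => //; exact/measurable_EFinP.
 - by apply/measurable_EFinP; exact: measurable_indic (measurable_box _ _).
 - move=> x _; rewrite /= lee_fin ger0_norm; last by rewrite indicE ler0n.
  rewrite !indicE mem_cball; case: ltP => xr; last by rewrite ler0n.
  rewrite mem_set// /box/= !add0r !in_itv/= -!ler_norml; split; apply: ltW;
   apply: le_lt_trans xr; [exact: (Re_le_cabs (toC x))|exact: (Im_le_cabs (toC x))].
move=> h; have -> : EFin \o (fun x : R * R => M * \1_(cball rho) x) =
  (fun x => M%:E * (EFin \o (\1_(cball rho) : R * R -> R)) x)%E.
 by apply/funext => x /=; rewrite EFinM.
exact: integrableZl.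
Qed.

Lemma Cint_reflect (w : R * R) (f : R * R -> R[i]) : Cintegrable mu2 setT f ->
 Cintegrable mu2 setT (fun x => f (w.1 - x.1, w.2 - x.2)) /\
 Cint mu2 setT (fun x => f (w.1 - x.1, w.2 - x.2)) = Cint mu2 setT f.
Proof.
move=> fi.
have mphi : measurable_fun setT (fun x : R * R => (w.1 - x.1, w.2 - x.2) : R * R).
 by apply: measurable_fun_pair; apply: measurable_funB.
have [] := @Cintegral_transfer _ _ _ _ _ mu2 mu2 (fun x : R * R => (w.1 - x.1, w.2 - x.2)) (fun=> 1) mphi _ _ _ f fi.
- exact: measurable_cst.
- by [].
- move=> h mh h0; rewrite (@ge0_integral_plane_affine _ (-1) w)//.
 apply: eq_integral => x _; rewrite normrN normr1 !mul1e /=.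
 by congr (h (_, _)); ring.
move=> fi' <-; split; last by apply: eq_Cint => x _; rewrite mul1r.
by apply: Cintegrable_eq fi' => x; rewrite mul1r.
Qed.

Lemma negligible_reflect (w : R * R) (E : set (R * R)) :
 measurable (E : set (TR * TR)) -> mu2.-negligible E ->
 mu2.-negligible [set y | E (w.1 - y.1, w.2 - y.2)].
Proof.
move=> mE /(negligibleP _ mE) E0.
have mphi : measurable_fun setT (fun x : R * R => (w.1 - x.1, w.2 - x.2) : R * R).
 by apply: measurable_fun_pair; apply: measurable_funB.
have mE' : measurable ([set y | E (w.1 - y.1, w.2 - y.2)] : set (TR * TR)).
 by rewrite -[X in measurable X]setTI; exact: (mphi measurableT _ mE).
apply/negligibleP => //.
have i1 : (\int[mu2]_x (\1_E x)%:E = 0)%E by rewrite integral_indic// setIT.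
transitivity (\int[mu2]_x (\1_[set y | E (w.1 - y.1, w.2 - y.2)] x)%:E)%E.
 by rewrite integral_indic// setIT.
rewrite -i1 (@ge0_integral_plane_affine _ (-1) w (EFin \o (\1_E : R * R -> R))).
- apply: eq_integral => x _; rewrite normrN normr1 !mul1e /= !indicE.
 have -> : (-1 * x.1 + w.1, -1 * x.2 + w.2) = (w.1 - x.1, w.2 - x.2) by congr (_, _); ring.
 by congr (_%:R)%:E; congr nat_of_bool.
- by rewrite oppr_eq0 oner_neq0.
- by apply/measurable_EFinP; exact: measurable_indic.
- by move=> x; rewrite lee_fin indicE ler0n.
Qed.

Lemma Psi_cvg {T : Type} (F : set_system T) (k : R) (f : T -> R[i]) (l : R[i]) : Filter F ->
 1 + k * cabs l ^+ 2 != 0 -> cvgC F f l ->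
 cvgC F (fun x => Psi k (f x)) (Psi k l).
Proof.
move=> FF l0 fl; apply: cvgCM; last exact: cvgCJ.
apply: cvgCR; apply: cvgV => //; apply: cvgD; first exact: cvg_cst.
apply: cvgM; first exact: cvg_cst.
by rewrite expr2; under eq_fun do rewrite expr2; apply: cvgM; exact: cvg_cabs.
Qed.
End plane_limits.

(** * The isoperimetric inequality in the chart *)

Section core.
Context {R : realType}.
Notation mu := (@lebesgue_measure R).
Notation TR := (measurableTypeR R).
Notation mu2 := (mu \x mu)%E.
Local Open Scope complex_scope.
Variables (k rho delta : R) (c : R -> R * R) (dz : R -> R[i]) (s : seq R).
Hypotheses (k1 : `|k| <= 1) (rho0 : 0 < rho) (delta0 : 0 < delta).
Hypothesis deltaP : forall r, 0 <= r -> r < rho -> delta <= 1 + k * r ^+ 2.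
Hypotheses (ps : itv_partition 0 1 s) (Dc : on_pieces (cpieceD (toC \o c) dz) 0 s).
Hypotheses (cc : {within `[0, 1], continuous c}) (c01 : c 0 = c 1).
Hypothesis cinj : {in `[0, 1[ &, injective c}.
Hypothesis crho : forall t, t \in `[0, 1] -> cabs (toC (c t)) < rho.

(** [zc] extends the curve continuously to the line and [dz0] cuts its velocity off outside [0, 1],
    so that all integrals run over the whole line. *)
Definition zc (t : R) : R[i] := toC (c (clamp01 t)).
Definition dz0 (t : R) : R[i] := (\1_(`[0, 1]%classic) t)%:C * dz t.

Lemma mem01 (t : R) : (t \in `[0, 1]%classic) = (t \in `[0, 1]).
Proof. by apply/idP/idP => [/set_mem|h]; [|apply: mem_set]. Qed.

Lemma zc_cvg (t : R) : cvgC (nbhs t) zc (zc t).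
Proof. have h := continuous_clamp01_comp cc.
exact: (@cvgC_toC _ _ (nbhs t) (fun x => c (clamp01 x)) (c (clamp01 t)) _ (h t)). Qed.

Lemma zc_meas : Cmeas zc.
Proof.
by split; apply: continuous_measurable_fun => t; have [] := zc_cvg t.
Qed.

Lemma zc_rho t : cabs (zc t) < rho.
Proof. by apply: crho; exact: clamp01_itv. Qed.

Lemma dz_bound : exists2 B, 0 <= B & forall t, t \in `[0, 1] ->
 `|Re (dz t)| <= B /\ `|Im (dz t)| <= B.
Proof.
have Dr : on_pieces (pieceC (fun t => Re (dz t))) 0 s.
 by apply: (on_pieces_imp _ ps Dc) => a b _ _ _ /cpieceD_C[].
have Di : on_pieces (pieceC (fun t => Im (dz t))) 0 s.
 by apply: (on_pieces_imp _ ps Dc) => a b _ _ _ /cpieceD_C[].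
have [_ [M1 M1P]] := pieces_bounded ltr01 ps Dr.
have [_ [M2 M2P]] := pieces_bounded ltr01 ps Di.
exists (Num.max 0 (Num.max M1 M2)) => [|t t01]; first by rewrite le_max lexx.
by rewrite !le_max M1P// M2P// !orbT.
Qed.

Lemma dz0_meas : Cmeas dz0.
Proof.
have Dr : on_pieces (pieceC (fun t => Re (dz t))) 0 s.
 by apply: (on_pieces_imp _ ps Dc) => a b _ _ _ /cpieceD_C[].
have Di : on_pieces (pieceC (fun t => Im (dz t))) 0 s.
 by apply: (on_pieces_imp _ ps Dc) => a b _ _ _ /cpieceD_C[].
have [m1 _] := pieces_bounded ltr01 ps Dr.
have [m2 _] := pieces_bounded ltr01 ps Di.
have mI : measurable (`[0, 1]%classic : set R) by exact: measurable_itv.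
split.
 have -> : (fun t => Re (dz0 t)) = (fun t => Re (dz t)) \_ `[0, 1].
  by apply/funext => t; rewrite patchE ReZ indicE; case: ifP; rewrite ?mul1r ?mul0r.
 exact: (measurable_restrictT _ mI).1.
have -> : (fun t => Im (dz0 t)) = (fun t => Im (dz t)) \_ `[0, 1].
 by apply/funext => t; rewrite patchE ImZ indicE; case: ifP; rewrite ?mul1r ?mul0r.
exact: (measurable_restrictT _ mI).1.
Qed.

Lemma dz0_bound : exists2 B, 0 <= B & forall t, cabs (dz0 t) <= B * \1_(`[0, 1]%classic) t.
Proof.
have [B B0 BP] := dz_bound; exists (B + B) => [|t]; first by rewrite addr_ge0.
rewrite Normc.normcM cabsR indicE mem01; have [t01|_] := boolP (t \in _); last by rewrite normr0 mul0r mulr0.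
rewrite normr1 mul1r mulr1; apply: le_trans (cabs_le_ReIm _) _.
by have [h1 h2] := BP t t01; rewrite lerD.
Qed.

Lemma integrable_ind01 (B : R) :
 mu.-integrable setT (EFin \o (fun t : R => B * \1_(`[0, 1]%classic) t)).
Proof.
have : mu.-integrable `[0, 1] (EFin \o (fun=> B)).
 have p01 : itv_partition (0 : R) 1 [:: 1] by rewrite /itv_partition/= ltr01 eqxx.
 by apply: (pieces_integrable ltr01 p01); split => //; exact: pieceC_cst.
rewrite [X in X -> _]integrable_mkcond//.
set k2 := _ \_ _; have -> // : EFin \o (fun t : R => B * \1_(`[0, 1]%classic) t) = k2.
by apply/funext => t; rewrite /k2 patchE /= indicE; case: ifP; rewrite ?mulr1 ?mulr0.
Qed.

Lemma Cintegrable_curve (f : R -> R[i]) (B : R) : Cmeas f ->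
 (forall t, cabs (f t) <= B * \1_(`[0, 1]%classic) t) -> Cintegrable mu setT f.
Proof.
by move=> mf fB; exact: (@Cintegrable_le _ TR R mu f _ mf fB (integrable_ind01 B)).
Qed.

(** The bounded velocity makes the curve Lipschitz; continuity alone would not prevent positive
    area. *)
Lemma curve_negligible : measurable (curve01 c : set (TR * TR)) /\
 mu2.-negligible (curve01 c).
Proof.
have [B B0 BP] := dz_bound.
have lip (f df : R -> R) : on_pieces (pieceD f df) 0 s ->
  (forall t, t \in `[0, 1] -> `|df t| <= B) ->
  forall a b, a \in `[0, 1] -> b \in `[0, 1] -> `|f a - f b| <= B * `|a - b|.
 move=> Df dfB.
 have key a b : a < b -> a \in `[0, 1] -> b \in `[0, 1] -> `|f b - f a| <= B * `|b - a|.
  move=> ab; rewrite !in_itv/= => /andP[a0 a1] /andP[b0 b1].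
  have [s' ps' Ds'] := on_pieces_restrict (fun p q p' q' h1 h2 h3 => pieceD_sub h1 h3) ps Df a0 ab b1.
  have Cs' : on_pieces (pieceC df) a s'.
   by apply: (on_pieces_imp _ ps' Ds') => p q _ _ _ [].
  have Ci : mu.-integrable `[a, b] (EFin \o df) by exact: (pieces_integrable ab ps').
  have Ki : mu.-integrable `[a, b] (EFin \o (fun=> B)).
   have p1 : itv_partition a b [:: b] by rewrite /itv_partition/= ab eqxx.
   by apply: (pieces_integrable ab p1); split => //; exact: pieceC_cst.
  rewrite -(pieces_ftc ab ps' Ds'); apply: le_trans (le_normr_Rintegral _ Ci) _ => //.
  apply: (@le_trans _ _ (\int[mu]_(t in `[a, b]) B)).
   apply: le_Rintegral => //; first exact: integrable_norm.
   move=> t /=; rewrite in_itv/= => /andP[t1 t2]; apply: dfB.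
   by rewrite in_itv/= (le_trans a0)// (le_trans t2).
  rewrite Rintegral_cst//= lebesgue_measure_itv/= lte_fin ab -EFinB /= ger0_norm// subr_ge0 ltW//.
 move=> a b a01 b01; have [ab|ab|->] := ltgtP a b.
 - by rewrite distrC [`|a - b|]distrC key.
 - exact: key.
 - by rewrite !subrr normr0 mulr0.
apply: (curve_null (M := B) cc) => a b a01 b01; split.
 apply: (lip (fun t => (c t).1) (fun t => Re (dz t))) => // [|t /BP[]//].
 by apply: (on_pieces_imp _ ps Dc) => p q _ _ _ [].
apply: (lip (fun t => (c t).2) (fun t => Im (dz t))) => // [|t /BP[]//].
by apply: (on_pieces_imp _ ps Dc) => p q _ _ _ [].
Qed.

Lemma Psi_meas : Cmeas (fun t => Psi k (zc t)).
Proof.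
apply: CmeasM; last by apply: CmeasJ; exact: zc_meas.
apply: CmeasR; apply: (measurableT_comp (@measurable_invr R)).
apply: measurable_funD => //; apply: measurable_funM => //.
by apply: measurable_funX; apply: measurable_cabs; exact: zc_meas.
Qed.

Variables (U : set (R * R)) (a : int).
Hypotheses (oU : open U) (dU : U `&` curve01 c = set0).
Hypothesis cU : closure U `<=` U `|` curve01 c.
Hypothesis Urho : forall x, U x -> cabs (toC x) < rho.
Hypothesis windU : forall x, ~ curve01 c x -> winding c x (if x \in U then a else 0).

Let ii : R[i] := 0 +i* 1.
Let n (x : R * R) : R := (if x \in U then a else 0)%:~R.

Lemma curve_kernel (x : R * R) : ~ curve01 c x ->
 Cintegrable mu setT (fun t => dz0 t * (zc t - toC x)^-1) /\
 Cint mu setT (fun t => dz0 t * (zc t - toC x)^-1) = (2 * pi * n x)%:C * ii.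
Proof.
move=> ncx; have wx := windU ncx.
pose f t := dz t / (toC (c t) - toC x).
have I0 : Cintegrable mu `[0, 1] f.
 apply: (pieces_Cintegrable ltr01 ps); apply: (on_pieces_imp _ ps Dc) => p q p0 pq q1 Dpq.
 apply: cpieceCM; first exact: cpieceD_C Dpq.
 apply: (cpieceD_C0 (cpieceDV (df := fun t => dz t + 0) _ _)).
  move=> t; rewrite in_itv/= => /andP[pt tq]; rewrite -toCB toC_eq0 subr_eq0.
  apply/eqP => ctx; apply: ncx; exists t => //.
  by rewrite /= in_itv/= (le_trans p0)// (le_trans tq).
 exact: cpieceDD Dpq (cpieceD_cst _ _ _).
have fE t : (\1_(`[0, 1]%classic) t)%:C * f t = dz0 t * (zc t - toC x)^-1.
 rewrite /dz0 /f /zc -mulrA indicE mem01; have [t01|_] := boolP (t \in _); last by rewrite !mul0r.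
 by rewrite clamp01_id.
have J0 : Cintegrable mu setT (fun t => (\1_(`[0, 1]%classic) t)%:C * f t).
 by apply: Cintegrable_mkcond.
split; first exact: (@Cintegrable_eq _ TR R mu _ _ _ fE J0).
transitivity (Cint mu setT (fun t => (\1_(`[0, 1]%classic) t)%:C * f t)).
 by apply: eq_Cint => t _; rewrite fE.
rewrite -Cint_mkcond (winding_integral ps Dc c01 ncx wx) /n /ii.
by apply: complexP; rewrite ?ReZ ?ImZ /= ?mulr0 ?mulr1.
Qed.

Let mU : measurable (U : set (TR * TR)). Proof. exact: open_measurable2. Qed.

Definition lamU (x : R * R) : R := \1_U x * lam2 k x.
Let A : R := \int[mu2]_(x in U) lam2 k x.
Let W (x : R * R) : R := \1_(cball rho) x * lam2 k x.
Let M : R := 4 / delta ^+ 2.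
Let M0 : 0 <= M. Proof. by rewrite divr_ge0// exprn_ge0// ltW. Qed.

Lemma lamU_meas : measurable_fun setT lamU.
Proof. by apply: measurable_funM; [exact: measurable_indic|exact: measurable_lam2]. Qed.

Lemma lamU_le x : 0 <= lamU x <= M * \1_(cball rho) x.
Proof.
rewrite /lamU mulr_ge0 ?lam2_ge0 ?indicE ?ler0n//=.
have [xU|_] := boolP (x \in U); last by rewrite mul0r mulr_ge0// ler0n.
rewrite mem_cball (Urho (set_mem xU)) mul1r mulr1.
exact: (lam2_le delta0 deltaP (Urho (set_mem xU))).
Qed.

Lemma W_le x : cabs (W x)%:C <= M * \1_(cball rho) x.
Proof.
rewrite cabsR ger0_norm /W; last by rewrite mulr_ge0 ?lam2_ge0 ?indicE ?ler0n.
rewrite !indicE mem_cball; case: ltP => xr; last by rewrite mul0r mulr0.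
by rewrite mul1r mulr1; exact: (lam2_le delta0 deltaP xr).
Qed.

Lemma W_meas : Cmeas (fun x : R * R => (W x)%:C).
Proof.
by apply: CmeasR; apply: measurable_funM; [exact: measurable_indic (measurable_cball _)|exact: measurable_lam2].
Qed.

(** Multiplication by the winding number cuts the density of the disc down to the region; this is
    how U enters the line integrals. *)
Lemma Wn x : W x * n x = a%:~R * lamU x.
Proof.
rewrite /W /n /lamU !indicE; have [xU|_] := boolP (x \in U); last by rewrite !mul0r !mulr0.
by rewrite mem_cball (Urho (set_mem xU)) !mul1r mulrC.
Qed.

Lemma n_meas : measurable_fun setT (n : R * R -> R).
Proof.
have -> : (n : R * R -> R) = (fun x => a%:~R * \1_U x).
 by apply/funext => x; rewrite /n indicE; case: ifP; rewrite ?mulr1 ?mulr0.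
by apply: measurable_funM => //; exact: measurable_indic.
Qed.

Lemma Cint_lamU : Cint mu2 setT (fun x => (lamU x)%:C) = A%:C.
Proof.
apply: complexP => /=; last by rewrite Rintegral_cst// mul0r.
rewrite /A Rintegral_mkcond; apply: eq_Rintegral => x _.
by rewrite patchE /lamU indicE; case: ifP; rewrite ?mul1r ?mul0r.
Qed.

Lemma Cintegrable_lamU : Cintegrable mu2 setT (fun x => (lamU x)%:C).
Proof.
have m1 : Cmeas (fun x : R * R => (lamU x)%:C) by apply: CmeasR; exact: lamU_meas.
apply: (@Cintegrable_le _ (TR * TR)%type R mu2 _ _ m1 _ (integrable_cball M rho0)) => x.
by have /andP[h1 h2] := lamU_le x; rewrite cabsR ger0_norm.
Qed.

(** Green's formula for Psi. By [newton], Psi is 1/(4 pi) times the potential of the disc; after the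
    exchange of integrals the kernel integrates along the curve to 2 pi i n, and W n = a lamU. *)
Lemma oint_Psi : Cint mu setT (fun t => dz0 t * Psi k (zc t)) = (a%:~R * A / 2)%:C * ii.
Proof.
have [B B0 BP] := dz0_bound.
have p0 : (4 * pi)%:C != 0 :> R[i].
 by rewrite -cabs_eq0 cabsR normr_eq0 mulf_neq0 ?pnatr_eq0// gt_eqF// pi_gt0.
have E := @fubini_curve_plane R dz0 zc (fun x => (W x)%:C) (fun x => (2 * pi * n x)%:C * ii)
 B rho M rho (curve01 c) B0 M0 (ltW rho0) dz0_meas zc_meas BP (fun t => ltW (zc_rho t))
 W_meas W_le curve_negligible.2.
apply: (mulfI p0).
transitivity (Cint mu2 setT (fun x => (W x)%:C * ((2 * pi * n x)%:C * ii))).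
 rewrite -E; last 2 first.
 - apply: CmeasM; last exact: Cmeas_cst.
  by apply: CmeasR; apply: measurable_funM => //; exact: n_meas.
 - exact: curve_kernel.
 rewrite -CintZ//.
  apply: eq_Cint => t _.
  by rewrite (newton rho0 delta0 deltaP (zc_rho t)) mulrCA.
 apply: (Cintegrable_curve (B := B * (rho / delta))).
  by apply: CmeasM; [exact: dz0_meas|exact: Psi_meas].
 move=> t; rewrite Normc.normcM mulrAC; apply: ler_pM; [exact: cabs_ge0|exact: cabs_ge0|exact: BP|].
 have zd := deltaP (cabs_ge0 _) (zc_rho t).
 rewrite cabs_Psi; last exact: lt_le_trans zd.
 rewrite ler_pM ?cabs_ge0 ?invr_ge0 ?(ltW (zc_rho t))//; first exact: le_trans (ltW delta0) zd.
 by rewrite lef_pV2 ?posrE// (lt_le_trans delta0).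
transitivity (Cint mu2 setT (fun x => ((2 * pi * a%:~R)%:C * ii) * (lamU x)%:C)).
 apply: eq_Cint => x _; rewrite mulrA [RHS]mulrAC -!rcM; congr (_%:C * _).
 by rewrite -[RHS]mulrA -Wn; ring.
rewrite CintZ//; last exact: Cintegrable_lamU.
rewrite Cint_lamU mulrAC -!rcM mulrA -rcM; congr (_%:C * _).
by field.
Qed.

(** [H] is the inner integral of the part of the double integral that comes from [dq], and [P] is
    the potential of the region. *)
Let H (w : R[i]) : R[i] := Cint mu setT (fun t => dz0 t * dq k (zc t) w).
Let P (w : R[i]) : R[i] := Cint mu2 setT (fun x => (lamU x)%:C * (w - toC x)^-1).

Lemma zc_curve t x : ~ curve01 c x -> zc t - toC x != 0.
Proof.
move=> ncx; rewrite /zc -toCB toC_eq0 subr_eq0; apply/eqP => cx; apply: ncx.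
by exists (clamp01 t) => //; exact: clamp01_itv.
Qed.

Lemma curve_dist x : ~ curve01 c x -> exists2 e, 0 < e & forall t, e <= cabs (zc t - toC x).
Proof.
move=> ncx.
have oC : open (~` curve01 c).
 apply: closed_openC; apply: compact_closed; first exact: norm_hausdorff.
 exact: (continuous_compact cc (@segment_compact _ _ _)).
have /nbhs_ballP[e /= e0 eC] := open_nbhs_nbhs (conj oC ncx).
exists e => // t; rewrite leNgt; apply/negP => te.
apply: (eC (c (clamp01 t))); last by exists (clamp01 t) => //; exact: clamp01_itv.
by split; rewrite /ball/= distrC; apply: le_lt_trans te;
 [exact: (Re_le_cabs (zc t - toC x))|exact: (Im_le_cabs (zc t - toC x))].
Qed.

Lemma lamU_kernel w : Cintegrable mu2 setT (fun x => (lamU x)%:C * (w - toC x)^-1).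
Proof.
apply: (Cintegrable_kernel _ (ltW rho0) M0); first by apply: CmeasR; exact: lamU_meas.
by move=> x; have /andP[h1 h2] := lamU_le x; rewrite cabsR ger0_norm.
Qed.

Lemma T_meas : Cmeas (fun x : R * R => (2 * pi * n x)%:C * ii).
Proof.
apply: CmeasM; last exact: Cmeas_cst.
by apply: CmeasR; apply: measurable_funM => //; exact: n_meas.
Qed.

Lemma cabs_Psi_le z : cabs z < rho -> cabs (Psi k z) <= rho / delta.
Proof.
move=> zr; have zd := deltaP (cabs_ge0 _) zr.
rewrite cabs_Psi; last exact: lt_le_trans zd.
rewrite ler_pM ?cabs_ge0 ?invr_ge0 ?(ltW zr)//; first exact: le_trans (ltW delta0) zd.
by rewrite lef_pV2 ?posrE// (lt_le_trans delta0).
Qed.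

(** Partial fractions in 1 / ((z - w) (z - x)) give 2 pi i (n x - n w) / (x - w) after integration
    along the curve. By [newton] at w the term with n w is Psi w times the integral of dz / (z - w)
    and cancels the second half of the difference quotient; the term with n x is the potential of
    U. *)
Lemma H_off w : ~ curve01 c w -> cabs (toC w) < rho ->
 H (toC w) = (- (a%:~R / 2))%:C * ii * P (toC w).
Proof.
move=> ncw wr; have [e e0 eP] := curve_dist ncw; have [B B0 BP] := dz0_bound.
pose phi t := dz0 t * (zc t - toC w)^-1.
have mphi : Cmeas phi.
 apply: CmeasM; first exact: dz0_meas.
 by apply: CmeasV; apply: CmeasD; [exact: zc_meas|exact: Cmeas_cst].
have phiB t : cabs (phi t) <= B / e * \1_(`[0, 1]%classic) t.
 rewrite Normc.normcM mulrAC cabsV; apply: ler_pM => //; rewrite ?cabs_ge0 ?invr_ge0 ?cabs_ge0//.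
 by rewrite lef_pV2 ?posrE// (lt_le_trans e0).
have Be0 : 0 <= B / e by rewrite divr_ge0// ltW.
have [wi wI] := curve_kernel ncw.
pose T x := (2 * pi)%:C * ii * ((n x - n w)%:C * (toC x - toC w)^-1).
have mT : Cmeas T.
 apply: CmeasM; first exact: Cmeas_cst.
 apply: CmeasM; first by apply: CmeasR; apply: measurable_funB => //; exact: n_meas.
 by apply: CmeasV; apply: CmeasD; [exact: Cmeas_toC|exact: Cmeas_cst].
have N0 : mu2.-negligible (curve01 c `|` [set w]).
 apply: negligibleU; first exact: curve_negligible.2.
 have b0 : mu2.-negligible (box w 0).
  by apply/negligibleP; [exact: measurable_box|rewrite /= mu2_box// mulr0 expr0n].
 by apply: negligibleS b0 => x ->; split; rewrite /= in_itv/= subr0 addr0 lexx.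
have TP x : ~ (curve01 c `|` [set w]) x ->
  Cintegrable mu setT (fun t => phi t * (zc t - toC x)^-1) /\
  Cint mu setT (fun t => phi t * (zc t - toC x)^-1) = T x.
 move=> /not_orP[ncx xw].
 have xw0 : toC x - toC w != 0 by rewrite -toCB toC_eq0 subr_eq0; apply/eqP.
 have [xi xI] := curve_kernel ncx.
 have fE t : (toC x - toC w)^-1 * (dz0 t * (zc t - toC x)^-1 - dz0 t * (zc t - toC w)^-1) =
   phi t * (zc t - toC x)^-1.
  have h1 := zc_curve t ncx; have h2 := zc_curve t ncw.
  rewrite /phi; move: (zc t) (toC x) (toC w) (dz0 t) xw0 h1 h2 => z x1 w1 d xw0 h1 h2.
  by field; rewrite xw0 h1 h2.
 have di : Cintegrable mu setT (fun t => dz0 t * (zc t - toC x)^-1 - dz0 t * (zc t - toC w)^-1).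
  exact: CintegrableB.
 have Di : Cintegrable mu setT (fun t => (toC x - toC w)^-1 * (dz0 t * (zc t - toC x)^-1 - dz0 t * (zc t - toC w)^-1)).
  exact: CintegrableZ.
 split; first exact: (@Cintegrable_eq _ TR R mu _ _ _ fE Di).
 transitivity (Cint mu setT (fun t => (toC x - toC w)^-1 * (dz0 t * (zc t - toC x)^-1 - dz0 t * (zc t - toC w)^-1))).
  by apply: eq_Cint => t _; rewrite fE.
 rewrite CintZ// CintB// xI wI /T !rcM rcD rcN.
 by move: ((toC x - toC w)^-1) => q; ring.
have F := @fubini_curve_plane R phi zc (fun x => (W x)%:C) T (B / e) rho M rho _ Be0 M0 (ltW rho0)
 mphi zc_meas phiB (fun t => ltW (zc_rho t)) W_meas W_le N0 mT TP.
have p0 : (4 * pi)%:C != 0 :> R[i].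
 by rewrite -cabs_eq0 cabsR normr_eq0 mulf_neq0 ?pnatr_eq0// gt_eqF// pi_gt0.
have Wi : Cintegrable mu2 setT (fun x => (W x)%:C * (toC w - toC x)^-1).
 exact: (Cintegrable_kernel _ (ltW rho0) M0 W_meas W_le).
have WT : Cint mu2 setT (fun x => (W x)%:C * T x) =
  (2 * pi)%:C * ii * ((n w)%:C * ((4 * pi)%:C * Psi k (toC w)) - a%:~R%:C * P (toC w)).
 rewrite -(newton rho0 delta0 deltaP wr) /P.
 rewrite -CintZ// -CintZ//; last exact: lamU_kernel.
 rewrite -CintB//; [|exact: CintegrableZ|by apply: CintegrableZ => //; exact: lamU_kernel].
 rewrite -CintZ//; last first.
  by apply: CintegrableB => //; apply: CintegrableZ => //; exact: lamU_kernel.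
 apply: eq_Cint => x _; rewrite /T -(opprB (toC w)) invrN.
 have := congr1 (real_complex R) (Wn x); rewrite !rcM rcD rcN.
 move: ((toC w - toC x)^-1) => q E.
 by rewrite [a%:~R%:C * (_ * q)]mulrA -E; ring.
have phiPsi : Cintegrable mu setT (fun t => phi t * Psi k (zc t)).
 apply: (Cintegrable_curve (B := B / e * (rho / delta))).
  by apply: CmeasM => //; exact: Psi_meas.
 move=> t; rewrite Normc.normcM mulrAC; apply: ler_pM; rewrite ?cabs_ge0//.
 by apply: cabs_Psi_le; exact: zc_rho.
have phii : Cintegrable mu setT phi by exact: (Cintegrable_curve mphi phiB).
have E1 : (4 * pi)%:C * Cint mu setT (fun t => phi t * Psi k (zc t)) = Cint mu2 setT (fun x => (W x)%:C * T x).
 rewrite -F -CintZ//; apply: eq_Cint => t _.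
 by rewrite (newton rho0 delta0 deltaP (zc_rho t)) mulrCA.
have HE : H (toC w) = Cint mu setT (fun t => phi t * Psi k (zc t)) - Psi k (toC w) * Cint mu setT phi.
 rewrite -CintZ// -CintB//; last exact: CintegrableZ.
 by apply: eq_Cint => t _; rewrite /dq /phi; move: ((zc t - toC w)^-1) => q; ring.
apply: (mulfI p0); rewrite HE mulrBr E1 WT wI.
have -> : (- (a%:~R / 2))%:C = - (a%:~R%:C / 2) :> R[i] by rewrite rcN rcM rcV rmorph_nat.
have -> : (4 * pi)%:C = 4 * pi%:C :> R[i] by rewrite rcM rmorph_nat.
rewrite !rcM [(2 : R)%:C]rmorph_nat.
by field.
Qed.

(** A square has positive area, so it cannot lie inside the null set formed by the curve. *)
Lemma curve_avoid (z0 : R[i]) : cabs z0 < rho -> forall m : nat, exists w : R * R,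
 [/\ ~ curve01 c w, cabs (toC w - z0) < m.+1%:R^-1 & cabs (toC w) < rho].
Proof.
move=> zr m; pose e : R := Num.min m.+1%:R^-1 (rho - cabs z0) / 4.
have e0 : 0 < e by rewrite divr_gt0// lt_min invr_gt0 ltr0n subr_gt0 zr.
have [e1 e2] : 4 * e <= m.+1%:R^-1 /\ 4 * e <= rho - cabs z0.
 by rewrite /e mulrC divfK ?pnatr_eq0// !ge_min !lexx orbT.
have [w wb ncw] : exists2 w, box (Re z0, Im z0) e w & ~ curve01 c w.
 apply: contrapT => h.
 have sub : box (Re z0, Im z0) e `<=` curve01 c.
  by move=> w wb; apply: contrapT => ncw; apply: h; exists w.
 have bn : mu2.-negligible (box (Re z0, Im z0) e).
  have [NN [mN N0 cN]] := curve_negligible.2.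
  by exists NN; split => //; exact: subset_trans sub cN.
 move: bn => /(negligibleP _ (measurable_box _ _)); rewrite /= mu2_box ?ltW// => /eqP.
 by rewrite eqe sqrf_eq0 mulf_eq0 pnatr_eq0/= gt_eqF.
have wz : cabs (toC w - z0) < 4 * e.
 apply: le_lt_trans (cabs_le_ReIm _) _.
 case: wb => /=; rewrite !in_itv/= => /andP[a1 b1] /andP[a2 b2].
 have h1 : `|Re (toC w - z0)| <= e by rewrite ReD ReN /= ler_norml; apply/andP; split; lra.
 have h2 : `|Im (toC w - z0)| <= e by rewrite ImD ImN /= ler_norml; apply/andP; split; lra.
 by apply: le_lt_trans (lerD h1 h2) _; lra.
exists w; split => //; first exact: lt_le_trans e1.
have -> : toC w = (toC w - z0) + z0 by rewrite subrK.
apply: le_lt_trans (cabs_triangle _ _) _.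
by rewrite -ltrBrDr; exact: lt_le_trans e2.
Qed.

(** Injectivity on [[0, 1[] leaves at most one parameter besides t = 1. *)
Lemma preimage_null (z0 : R[i]) : mu.-negligible [set t | t \in `[0, 1] /\ zc t = z0].
Proof.
have fin (x y : R) : mu.-negligible [set x; y].
 apply/negligibleP; first by apply: measurableU; exact: measurable_set1.
 by apply: countable_lebesgue_measure0; apply: finite_set_countable; exact: finite_set2.
have [[t0 t0i t0z]|h] := pselect (exists2 t0, t0 \in `[0, 1[ & zc t0 = z0).
 apply: negligibleS (fin t0 1) => t /= [t01 tz].
 have [->|t1] := eqVneq t 1; [by right|left].
 have ti : t \in `[0, 1[ by move: t01; rewrite !in_itv/= lt_neqAle t1.
 have t0i' : t0 \in `[0, 1] by move: t0i; rewrite !in_itv/= => /andP[-> /ltW].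
 apply: cinj => //; have := etrans tz (esym t0z).
 rewrite /zc !clamp01_id// => /eqP; rewrite -subr_eq0 -toCB toC_eq0 subr_eq0 => /eqP//.
apply: negligibleS (fin 1 1) => t /= [t01 tz]; left.
apply/eqP; apply/negPn/negP => t1; apply: h; exists t => //.
by move: t01; rewrite !in_itv/= lt_neqAle t1.
Qed.

(** Off the curve a point is either in the open set U, where the density is continuous, or outside
    its closure, where the density vanishes nearby. *)
Lemma lamU_cvg (y z : R * R) (w_ : nat -> R * R) : ~ curve01 c (z - y) ->
 w_ m @[m --> \oo] --> z -> lamU (w_ m - y) @[m --> \oo] --> lamU (z - y).
Proof.
move=> ncy wz.
have wzy : w_ m - y @[m --> \oo] --> z - y by apply: cvgB => //; exact: cvg_cst.
have [zU|zU] := pselect (U (z - y)).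
 have nU : \forall m \near \oo, U (w_ m - y).
  by apply: wzy; exact: (open_nbhs_nbhs (conj oU zU)).
 have l0 : 1 + k * cabs (toC (z - y)) ^+ 2 != 0.
  by rewrite gt_eqF// (lt_le_trans delta0)// deltaP ?cabs_ge0// Urho.
 have cl : lam2 k (w_ m - y) @[m --> \oo] --> lam2 k (z - y).
  have cw : cvgC \oo (fun m => toC (w_ m - y)) (toC (z - y)) by exact: cvgC_toC.
  apply: cvgM; first exact: cvg_cst.
  have cd : 1 + k * cabs (toC (w_ m - y)) ^+ 2 @[m --> \oo] --> 1 + k * cabs (toC (z - y)) ^+ 2.
   apply: cvgD; first exact: cvg_cst.
   apply: cvgM; first exact: cvg_cst.
   by under eq_fun do rewrite expr2; rewrite expr2; apply: cvgM; exact: cvg_cabs.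
  apply: cvgV; first by rewrite sqrf_eq0.
  by under eq_fun do rewrite expr2; rewrite expr2; apply: cvgM.
 have -> : lamU (z - y) = lam2 k (z - y) by rewrite /lamU indicE mem_set// mul1r.
 apply: cvg_trans cl; apply: near_eq_cvg; near=> m.
 by rewrite /lamU indicE mem_set ?mul1r//; near: m.
have ncl : ~ closure U (z - y) by move=> /cU[].
have nU : \forall m \near \oo, ~ U (w_ m - y).
 have ocl : open (~` closure U) by apply: closed_openC; exact: closed_closure.
 have : \forall m \near \oo, (~` closure U) (w_ m - y).
  by apply: wzy; exact: (open_nbhs_nbhs (conj ocl ncl)).
 by apply: filterS => m h /subset_closure.
have -> : lamU (z - y) = 0 by rewrite /lamU indicE memNset// mul0r.
apply: (@cvg_trans _ ((fun=> (0 : R)) m @[m --> \oo])); last exact: cvg_cst.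
apply: near_eq_cvg; near=> m.
by rewrite /lamU indicE memNset ?mul0r//; near: m.
Unshelve. all: by end_near. Qed.

(** The pole is moved to the origin, so that w occurs only in a bounded density and dominated
    convergence applies. *)
Lemma P_reflect (w : R * R) :
 Cint mu2 setT (fun y => (lamU (w - y))%:C * (toC y)^-1) = P (toC w).
Proof.
rewrite /P -(Cint_reflect w (lamU_kernel (toC w))).2; apply: eq_Cint => y _.
have -> : (w.1 - y.1, w.2 - y.2) = w - y by case: w y => w1 w2 [y1 y2].
by rewrite toCB opprB addrCA subrr addr0.
Qed.

Lemma H_on (z0 : R[i]) : cabs z0 < rho -> H z0 = (- (a%:~R / 2))%:C * ii * P z0.
Proof.
move=> zr; have [B B0 BP] := dz0_bound.
pose zp : R * R := (Re z0, Im z0).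
have zpE : toC zp = z0 by case: z0 @zp zr.
have /choice [w_ wP] := curve_avoid zr.
have w1 m : `|(w_ m).1 - zp.1| <= cabs (toC (w_ m) - z0).
 by have := Re_le_cabs (toC (w_ m) - z0); rewrite ReD ReN.
have w2 m : `|(w_ m).2 - zp.2| <= cabs (toC (w_ m) - z0).
 by have := Im_le_cabs (toC (w_ m) - z0); rewrite ImD ImN.
have inv0 : (m.+1%:R^-1 : R) @[m --> \oo] --> (0 : R) by exact: cvg_harmonic.
have sq (f : nat -> R) (l : R) : (forall m, `|f m - l| <= cabs (toC (w_ m) - z0)) -> f m @[m --> \oo] --> l.
 move=> fl; apply/cvgrPdist_le => e e0.
 have : \forall m \near \oo, (m.+1%:R^-1 : R) <= e.
  move/cvgrPdist_le: inv0 => /(_ e e0); apply: filterS => m.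
  by rewrite sub0r normrN ger0_norm// invr_ge0.
 apply: filterS => m me; rewrite distrC; apply: le_trans (fl m) _.
 by have [_ /ltW h _] := wP m; exact: le_trans me.
have cw : w_ m @[m --> \oo] --> zp.
 have wE : (fun m => ((w_ m).1, (w_ m).2)) = w_ by apply/funext => m; case: (w_ m).
 by rewrite -wE; apply: cvg_pair_pt; exact: sq.
have ctw : cvgC \oo (fun m => toC (w_ m)) z0 by rewrite -zpE; exact: cvgC_toC.
have l0 z : cabs z < rho -> 1 + k * cabs z ^+ 2 != 0.
 by move=> h; rewrite gt_eqF// (lt_le_trans delta0)// deltaP ?cabs_ge0.
have dqm w : Cmeas (fun t => dz0 t * dq k (zc t) w).
 apply: CmeasM; first exact: dz0_meas.
 apply: CmeasM; first by apply: CmeasD; [exact: Psi_meas|exact: Cmeas_cst].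
 by apply: CmeasV; apply: CmeasD; [exact: zc_meas|exact: Cmeas_cst].
have HC : cvgC \oo (fun m => H (toC (w_ m))) (H z0).
 apply: (@Cdominated _ TR R mu _ _
  (fun t => B * ((1 + rho ^+ 2) / delta ^+ 2) * \1_(`[0, 1]%classic) t)
  [set t | t \in `[0, 1] /\ zc t = z0]).
 - by move=> m; exact: dqm.
 - exact: dqm.
 - exact: preimage_null.
 - move=> t nt; rewrite /dz0 indicE mem01.
  have [t01|_] := boolP (t \in _); last first.
   by under eq_fun do rewrite !mul0r; rewrite !mul0r; exact: cvgC_cst.
  have tz : zc t - z0 != 0 by rewrite subr_eq0; apply/eqP => h; apply: nt.
  apply: cvgCM; first exact: cvgC_cst.
  apply: cvgCM.
   by apply: cvgCB; [exact: cvgC_cst|apply: Psi_cvg => //; exact: l0].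
  by apply: cvgCV => //; apply: cvgCB => //; exact: cvgC_cst.
 - move=> m t; rewrite Normc.normcM mulrAC; apply: ler_pM; rewrite ?cabs_ge0//.
  by apply: (dq_bound k1 delta0 deltaP); [exact: zc_rho|have [] := wP m].
 - exact: integrable_ind01.
have PC : cvgC \oo (fun m => P (toC (w_ m))) (P z0).
 rewrite -zpE -P_reflect; under eq_fun do rewrite -P_reflect.
 have mf w : Cmeas (fun y : R * R => (lamU (w - y))%:C * (toC y)^-1).
  apply: CmeasM; last by apply: CmeasV; exact: Cmeas_toC.
  apply: CmeasR; apply: (measurableT_comp lamU_meas).
  have -> : (fun y : R * R => w - y) = (fun y => (w.1 - y.1, w.2 - y.2)).
   by apply/funext => y; case: w y => w1' w2' [y1 y2].
  by apply: measurable_fun_pair; apply: measurable_funB.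
 have [mC nC] := curve_negligible.
 apply: (@Cdominated _ (TR * TR)%type R mu2 _ _
  (fun y => M * (\1_(cball (rho + rho)) y * (cabs (0 - toC y))^-1))
  [set y | curve01 c (zp.1 - y.1, zp.2 - y.2)]).
 - by move=> m; exact: mf.
 - exact: mf.
 - exact: negligible_reflect.
 - move=> y ny; apply: cvgCM; last exact: cvgC_cst.
  apply: cvgCR; apply: lamU_cvg => //.
 - move=> m y; rewrite Normc.normcM cabsV cabsR sub0r cabsN mulrA.
  have /andP[h1 h2] := lamU_le (w_ m - y).
  rewrite ger0_norm// ler_wpM2r ?invr_ge0 ?cabs_ge0//; apply: le_trans h2 _.
  apply: ler_wpM2l => //; rewrite !indicE !mem_cball.
  have [_ _ wr] := wP m.
  case: (ltP (cabs (toC (w_ m - y)))) => yr; last by rewrite ler0n.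
  suff -> : cabs (toC y) < rho + rho by [].
  have -> : toC y = toC (w_ m) + - toC (w_ m - y) by rewrite toCB opprB addrC subrK.
  by apply: le_lt_trans (cabs_triangle _ _) _; rewrite cabsN ltrD.
 - have r2 : 0 <= rho + rho by rewrite addr_ge0// ltW.
  have h := integrable_kernel 0 r2.
  pose hh (y : R * R) := \1_(cball (rho + rho)) y / cabs (0 - toC y).
  have -> : EFin \o (fun y : R * R => M * hh y) = (fun x => M%:E * (EFin \o hh) x)%E.
   by apply/funext => x /=; rewrite EFinM.
  exact: integrableZl.
have eqm m : H (toC (w_ m)) = (- (a%:~R / 2))%:C * ii * P (toC (w_ m)).
 by have [h1 _ h3] := wP m; exact: H_off.
have HC2 : cvgC \oo (fun m => H (toC (w_ m))) ((- (a%:~R / 2))%:C * ii * P z0).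
 by under eq_fun do rewrite eqm; apply: cvgCM => //; exact: cvgC_cst.
case: HC HC2 => hr hi [hr2 hi2].
by apply: complexP; [exact: cvg_unique hr hr2|exact: cvg_unique hi hi2].
Qed.

(** Exchanging integrals, 1 / (z - x) integrates along the curve to 2 pi i n x; the constant is - (i
    a / 2) times 2 pi i a. *)
Lemma double_integral : Cint mu setT (fun u => dz0 u * H (zc u)) = (pi * a%:~R ^+ 2 * A)%:C.
Proof.
have [B B0 BP] := dz0_bound.
pose kap : R[i] := (- (a%:~R / 2))%:C * ii.
have gM x : cabs (kap * (lamU x)%:C) <= cabs kap * M * \1_(cball rho) x.
 have /andP[h1 h2] := lamU_le x; rewrite Normc.normcM cabsR ger0_norm// -mulrA.
 by rewrite ler_wpM2l ?cabs_ge0.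
have mg : Cmeas (fun x : R * R => kap * (lamU x)%:C).
 by apply: CmeasM; [exact: Cmeas_cst|apply: CmeasR; exact: lamU_meas].
have kM0 : 0 <= cabs kap * M by rewrite mulr_ge0// cabs_ge0.
have E := @fubini_curve_plane R dz0 zc _ (fun x => (2 * pi * n x)%:C * ii)
 B rho _ rho (curve01 c) B0 kM0 (ltW rho0) dz0_meas zc_meas BP (fun t => ltW (zc_rho t))
 mg gM curve_negligible.2 T_meas curve_kernel.
have E2 : Cint mu2 setT (fun x => kap * (lamU x)%:C * ((2 * pi * n x)%:C * ii)) =
  kap * ((2 * pi * a%:~R)%:C * ii) * A%:C.
 rewrite -Cint_lamU -CintZ//; last exact: Cintegrable_lamU.
 apply: eq_Cint => x _; rewrite [RHS]mulrAC -[LHS]mulrA -[RHS]mulrA; congr (_ * _).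
 rewrite !mulrA -!rcM; congr (_%:C * _).
 by rewrite /lamU /n indicE; case: ifP => _; rewrite ?mul0r.
transitivity (Cint mu setT (fun t => dz0 t * Cint mu2 setT (fun x => kap * (lamU x)%:C * (zc t - toC x)^-1))).
 apply: eq_Cint => u _; rewrite H_on; last exact: zc_rho.
 rewrite -/kap /P -CintZ//; last exact: lamU_kernel.
 by congr (_ * _); apply: eq_Cint => x _; rewrite mulrA.
rewrite E E2 /kap /ii; apply: complexP; rewrite ?ReM ?ImM /=; last by ring.
by field.
Qed.

Definition two_point (z w : R[i]) : R[i] := conjc (z - w) / (z - w) * (lamC k z * lamC k w)%:C.

Definition speed (t : R) : R := lamC k (zc t) * cabs (dz0 t).

(** The integrand of L^2 - J. It is the loss in bounding a real part by a modulus and by the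
    conformal factors, so it vanishes only when the kernel is aligned with both velocities. *)
Definition defect (p : R * R) : R :=
 speed p.1 * speed p.2 - Re (dz0 p.1 * (dz0 p.2 * two_point (zc p.2) (zc p.1))).

Lemma lamC_gt0 z : cabs z < rho -> 0 < lamC k z <= 2 / delta.
Proof.
move=> zr; have zd := deltaP (cabs_ge0 _) zr.
rewrite divr_gt0//=; last exact: lt_le_trans zd.
by rewrite ler_wpM2l// lef_pV2 ?posrE// (lt_le_trans delta0).
Qed.

Lemma lamC_meas (f : R * R -> R[i]) : Cmeas f -> measurable_fun setT (fun p => lamC k (f p)).
Proof.
move=> mf; apply: measurable_funM => //; apply: (measurableT_comp (@measurable_invr R)).
apply: measurable_funD => //; apply: measurable_funM => //.
by apply: measurable_funX; exact: measurable_cabs.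
Qed.

Lemma cabs_two_point z w : cabs z < rho -> cabs w < rho ->
 cabs (two_point z w) <= lamC k z * lamC k w.
Proof.
move=> zr wr; have /andP[l1 _] := lamC_gt0 zr; have /andP[l2 _] := lamC_gt0 wr.
have l0 : 0 <= lamC k z * lamC k w by rewrite mulr_ge0// ltW.
rewrite /two_point Normc.normcM Normc.normcM cabsR (ger0_norm l0) cabsV cabsJ.
have [->|zw] := eqVneq (cabs (z - w)) 0; first by rewrite invr0 mulr0 mul0r.
by rewrite mulfV// mul1r.
Qed.

Lemma speed_bound : exists2 B, 0 <= B & forall t, 0 <= speed t <= B * \1_(`[0, 1]%classic) t.
Proof.
have [B B0 BP] := dz0_bound; exists (2 / delta * B) => [|t].
 by rewrite mulr_ge0// divr_ge0// ltW.
have /andP[l1 l2] := lamC_gt0 (zc_rho t).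
rewrite /speed mulr_ge0 ?cabs_ge0 ?(ltW l1)//=.
by have := ler_pM (ltW l1) (cabs_ge0 _) l2 (BP t); rewrite mulrA.
Qed.

Let zc1_meas : Cmeas (fun p : R * R => zc p.1).
Proof. exact: (Cmeas_comp (@measurable_fst _ _ TR TR) zc_meas). Qed.
Let zc2_meas : Cmeas (fun p : R * R => zc p.2).
Proof. exact: (Cmeas_comp (@measurable_snd _ _ TR TR) zc_meas). Qed.
Let dz1_meas : Cmeas (fun p : R * R => dz0 p.1).
Proof. exact: (Cmeas_comp (@measurable_fst _ _ TR TR) dz0_meas). Qed.
Let dz2_meas : Cmeas (fun p : R * R => dz0 p.2).
Proof. exact: (Cmeas_comp (@measurable_snd _ _ TR TR) dz0_meas). Qed.

Lemma integrable_square (B : R) : mu2.-integrable setT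
 (EFin \o (fun p : R * R => B * \1_(cball 2) p)).
Proof. by apply: integrable_cball. Qed.

(** The square of parameters lies in a disc, whose indicator is already known to be integrable. *)
Lemma square_cball (p : R * R) :
 \1_(`[0, 1]%classic) p.1 * \1_(`[0, 1]%classic) p.2 <= \1_(cball 2) p :> R.
Proof.
rewrite !indicE !mem01 mem_cball.
have [p1|_] := boolP (p.1 \in _); last by rewrite mul0r ler0n.
have [p2|_] := boolP (p.2 \in _); last by rewrite mulr0 ler0n.
rewrite mulr1; suff -> : cabs (toC p) < 2 by [].
move: p1 p2; rewrite !in_itv/= => /andP[a1 b1] /andP[a2 b2].
have h : cabs (toC p) ^+ 2 < 2 ^+ 2 by rewrite cabs2 /=; nra.
by move: h; rewrite ltr_pXn2r// ?nnegrE ?cabs_ge0.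
Qed.

Lemma Cintegrable_square (f : R * R -> R[i]) (B : R) : 0 <= B -> Cmeas f ->
 (forall p, cabs (f p) <= B * (\1_(`[0, 1]%classic) p.1 * \1_(`[0, 1]%classic) p.2)) ->
 Cintegrable mu2 setT f.
Proof.
move=> B0 mf fB; apply: (@Cintegrable_le _ (TR * TR)%type R mu2 f _ mf _ (integrable_square B)) => p.
by apply: le_trans (fB p) _; apply: ler_wpM2l => //; exact: square_cball.
Qed.

Lemma dz_square (g : R * R -> R[i]) (C : R) : 0 <= C -> Cmeas g -> (forall p, cabs (g p) <= C) ->
 Cintegrable mu2 setT (fun p => dz0 p.1 * (dz0 p.2 * g p)).
Proof.
move=> C0 mg gC; have [B B0 BP] := dz0_bound.
apply: (Cintegrable_square (B := B * B * C)); first by rewrite !mulr_ge0.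
 by apply: CmeasM => //; exact: CmeasM.
move=> p; rewrite Normc.normcM [cabs (dz0 p.2 * _)]Normc.normcM.
have -> : B * B * C * (\1_(`[0, 1]%classic) p.1 * \1_(`[0, 1]%classic) p.2) =
 (B * \1_(`[0, 1]%classic) p.1) * (B * \1_(`[0, 1]%classic) p.2 * C) by ring.
by do 2 (apply: ler_pM; rewrite ?mulr_ge0 ?cabs_ge0//).
Qed.

Lemma two_point_meas : Cmeas (fun p : R * R => two_point (zc p.2) (zc p.1)).
Proof.
have md : Cmeas (fun p : R * R => zc p.2 - zc p.1) by apply: CmeasD => //; exact: CmeasN.
apply: CmeasM; first by apply: CmeasM; [exact: CmeasJ|exact: CmeasV].
by apply: CmeasR; apply: measurable_funM; exact: lamC_meas.
Qed.

Let two_point_int : Cintegrable mu2 setT (fun p => dz0 p.1 * (dz0 p.2 * two_point (zc p.2) (zc p.1))).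
Proof.
apply: (dz_square (C := 2 / delta * (2 / delta))); last move=> p.
- by rewrite mulr_ge0// divr_ge0// ltW.
- exact: two_point_meas.
apply: le_trans (cabs_two_point (zc_rho _) (zc_rho _)) _.
have /andP[l1 l2] := lamC_gt0 (zc_rho p.2); have /andP[l3 l4] := lamC_gt0 (zc_rho p.1).
by rewrite ler_pM// ltW.
Qed.

(** The difference quotient contributes 4 pi a^2 A and the product 4 k (i a A / 2)^2 = - k a^2
    A^2. *)
Lemma two_point_integral :
 Cint mu2 setT (fun p => dz0 p.1 * (dz0 p.2 * two_point (zc p.2) (zc p.1))) =
 (a%:~R ^+ 2 * A * (4 * pi - k * A))%:C.
Proof.
have Psi1 : Cmeas (fun p : R * R => Psi k (zc p.1)).
 exact: (Cmeas_comp (@measurable_fst _ _ TR TR) Psi_meas).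
have Psi2 : Cmeas (fun p : R * R => Psi k (zc p.2)).
 exact: (Cmeas_comp (@measurable_snd _ _ TR TR) Psi_meas).
have C0 : 0 <= (1 + rho ^+ 2) / delta ^+ 2 by rewrite divr_ge0// ?addr_ge0// sqr_ge0.
have dqm : Cmeas (fun p : R * R => dq k (zc p.2) (zc p.1)).
 apply: CmeasM; first by apply: CmeasD => //; exact: CmeasN.
 by apply: CmeasV; apply: CmeasD => //; exact: CmeasN.
have i1 : Cintegrable mu2 setT (fun p => dz0 p.1 * (dz0 p.2 * dq k (zc p.2) (zc p.1))).
 apply: (dz_square C0) => // p; apply: (dq_bound k1 delta0 deltaP); exact: zc_rho.
have i2 : Cintegrable mu2 setT (fun p => dz0 p.1 * (dz0 p.2 * (Psi k (zc p.2) * Psi k (zc p.1)))).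
 apply: (dz_square (C := rho / delta * (rho / delta))) => [||p].
 - by rewrite mulr_ge0// divr_ge0// ltW.
 - exact: CmeasM.
 - by rewrite Normc.normcM ler_pM ?cabs_ge0//; apply: cabs_Psi_le; exact: zc_rho.
have i3 : Cintegrable mu2 setT (fun p => 4 * (dz0 p.1 * (dz0 p.2 * dq k (zc p.2) (zc p.1))) +
  4 * k%:C * (dz0 p.1 * (dz0 p.2 * (Psi k (zc p.2) * Psi k (zc p.1))))).
 by apply: CintegrableD => //; exact: CintegrableZ.
transitivity (Cint mu setT (fun u => Cint mu setT (fun t =>
  dz0 u * (dz0 t * two_point (zc t) (zc u))))).
 by rewrite -(@Cfubini12 _ _ TR TR R mu mu _ two_point_int).
transitivity (Cint mu setT (fun u => Cint mu setT (fun t =>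
  4 * (dz0 u * (dz0 t * dq k (zc t) (zc u))) +
  4 * k%:C * (dz0 u * (dz0 t * (Psi k (zc t) * Psi k (zc u))))))).
 apply: eq_Cint => u _.
 have md : Cmeas (fun t => zc t - zc u) by apply: CmeasD; [exact: zc_meas|exact: Cmeas_cst].
 have mdq : Cmeas (fun t => dq k (zc t) (zc u)).
  by apply: CmeasM; [apply: CmeasD; [exact: Psi_meas|exact: Cmeas_cst]|exact: CmeasV].
 have mPP : Cmeas (fun t => Psi k (zc t) * Psi k (zc u)).
  by apply: CmeasM; [exact: Psi_meas|exact: Cmeas_cst].
 have mD f : Cmeas f -> Cmeas (fun t => dz0 u * (dz0 t * f t)).
  by move=> mf; apply: CmeasM; [exact: Cmeas_cst|apply: CmeasM => //; exact: dz0_meas].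
 (* The two-point identity requires distinct points; for fixed u this excludes a null set of t. *)
 apply: (@Cint_ae _ TR R mu _ _ [set t | t \in `[0, 1] /\ zc t = zc u]).
 - apply: mD; apply: CmeasM; first by apply: CmeasM; [exact: CmeasJ|exact: CmeasV].
  apply: CmeasR; apply: measurable_funM => //.
  apply: measurable_funM => //; apply: (measurableT_comp (@measurable_invr R)).
  apply: measurable_funD => //; apply: measurable_funM => //.
  by apply: measurable_funX; apply: measurable_cabs; exact: zc_meas.
 - by apply: CmeasD; (apply: CmeasM; [exact: Cmeas_cst|exact: mD]).
 - exact: preimage_null.
 - move=> t nt; have [t01|t01] := boolP (t \in `[0, 1]); last first.
   by rewrite /dz0 [\1_ _ t]indicE mem01 (negbTE t01) !(mul0r, mulr0) addr0.
  have tz : zc t != zc u by apply/eqP => h; apply: nt.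
  have l0 z : cabs z < rho -> 1 + k * cabs z ^+ 2 != 0.
   by move=> h; rewrite gt_eqF// (lt_le_trans delta0)// deltaP ?cabs_ge0.
  rewrite /two_point two_point_identity ?l0 ?zc_rho//.
  by ring.
rewrite (@Cfubini12 _ _ TR TR R mu mu _ i3) CintD//; [|exact: CintegrableZ|exact: CintegrableZ].
rewrite !CintZ//.
have -> : Cint mu2 setT (fun p => dz0 p.1 * (dz0 p.2 * dq k (zc p.2) (zc p.1))) = (pi * a%:~R ^+ 2 * A)%:C.
 rewrite -double_integral -(@Cfubini12 _ _ TR TR R mu mu _ i1); apply: eq_Cint => u _.
 transitivity (Cint mu setT (fun t => dz0 u * (dz0 t * dq k (zc t) (zc u)))); first by apply: eq_Cint.
 rewrite CintZ//; have [B B0 BP] := dz0_bound.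
 apply: (Cintegrable_curve (B := B * ((1 + rho ^+ 2) / delta ^+ 2))).
  apply: CmeasM; first exact: dz0_meas.
  apply: CmeasM; first by apply: CmeasD; [exact: Psi_meas|exact: Cmeas_cst].
  by apply: CmeasV; apply: CmeasD; [exact: zc_meas|exact: Cmeas_cst].
 move=> t; rewrite Normc.normcM mulrAC; apply: ler_pM; rewrite ?cabs_ge0//.
 by apply: (dq_bound k1 delta0 deltaP); exact: zc_rho.
have Pi : Cintegrable mu setT (fun t => dz0 t * Psi k (zc t)).
 have [B B0 BP] := dz0_bound.
 apply: (Cintegrable_curve (B := B * (rho / delta))).
  by apply: CmeasM; [exact: dz0_meas|exact: Psi_meas].
 move=> t; rewrite Normc.normcM mulrAC; apply: ler_pM; rewrite ?cabs_ge0//.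
 by apply: cabs_Psi_le; exact: zc_rho.
have -> : Cint mu2 setT (fun p => dz0 p.1 * (dz0 p.2 * (Psi k (zc p.2) * Psi k (zc p.1)))) =
  ((a%:~R * A / 2)%:C * ii) ^+ 2.
 rewrite -(@Cfubini12 _ _ TR TR R mu mu _ i2) -oint_Psi expr2 -CintZ//; apply: eq_Cint => u _.
 rewrite [RHS]mulrC -CintZ//; apply: eq_Cint => t _ /=; ring.
have -> : (4 : R[i]) = (4 : R)%:C by rewrite rmorph_nat.
rewrite /ii; apply: complexP; rewrite expr2 ?(ReD, ReM, ImM, ImD, ReZ, ImZ) /=; last by ring.
by field.
Qed.

Let L : R := \int[mu]_t speed t.

Let speed_meas : measurable_fun setT speed.
Proof.
apply: measurable_funM; last by apply: measurable_cabs; exact: dz0_meas.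
apply: measurable_funM => //; apply: (measurableT_comp (@measurable_invr R)).
apply: measurable_funD => //; apply: measurable_funM => //.
by apply: measurable_funX; apply: measurable_cabs; exact: zc_meas.
Qed.

Let speed_int : mu.-integrable setT (EFin \o speed).
Proof.
have [B B0 BP] := speed_bound.
apply: (le_integrable measurableT _ _ (integrable_ind01 B)); first exact/measurable_EFinP.
move=> t _; have /andP[h1 h2] := BP t.
by rewrite /= lee_fin !ger0_norm// (le_trans h1).
Qed.

Let speed2_int : mu2.-integrable setT (EFin \o (fun p => speed p.1 * speed p.2)).
Proof.
have [B B0 BP] := speed_bound.
apply: (le_integrable measurableT _ _ (integrable_square (B * B))).
 apply/measurable_EFinP; apply: measurable_funM.
  exact: (measurableT_comp speed_meas (@measurable_fst _ _ TR TR)).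
 exact: (measurableT_comp speed_meas (@measurable_snd _ _ TR TR)).
move=> p _; have /andP[h1 h2] := BP p.1; have /andP[h3 h4] := BP p.2.
have hh := ler_pM h1 h3 h2 h4.
have n1 : 0 <= speed p.1 * speed p.2 by exact: mulr_ge0.
rewrite /= lee_fin (ger0_norm n1) ger0_norm; last by rewrite mulr_ge0 ?mulr_ge0// indicE ler0n.
apply: le_trans hh _; rewrite mulrACA; apply: ler_wpM2l; first exact: mulr_ge0.
exact: square_cball.
Qed.

Lemma defect_ge0 p : 0 <= defect p.
Proof.
rewrite /defect subr_ge0; apply: le_trans (ler_norm _) _; apply: le_trans (Re_le_cabs _) _.
rewrite Normc.normcM [cabs (dz0 p.2 * _)]Normc.normcM /speed.
have h := cabs_two_point (zc_rho p.2) (zc_rho p.1).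
have -> : lamC k (zc p.1) * cabs (dz0 p.1) * (lamC k (zc p.2) * cabs (dz0 p.2)) =
 cabs (dz0 p.1) * (cabs (dz0 p.2) * (lamC k (zc p.2) * lamC k (zc p.1))) by ring.
by apply: ler_wpM2l; rewrite ?cabs_ge0//; apply: ler_wpM2l; rewrite ?cabs_ge0.
Qed.

Lemma defect_int : mu2.-integrable setT (EFin \o defect) /\
 \int[mu2]_p defect p = L ^+ 2 - a%:~R ^+ 2 * A * (4 * pi - k * A).
Proof.
have [i1 _] := two_point_int.
split.
 have -> : EFin \o defect = ((EFin \o (fun p : R * R => speed p.1 * speed p.2)%R) \-
   (fun p : R * R => (Re (dz0 p.1 * (dz0 p.2 * two_point (zc p.2) (zc p.1))))%:E))%E.
  by apply/funext => p /=; rewrite EFinB.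
 exact: integrableB.
rewrite /defect RintegralB//.
have -> : \int[mu2]_p (speed p.1 * speed p.2) = L ^+ 2.
 rewrite -(@Rfubini12 _ _ TR TR R mu mu _ speed2_int) expr2.
 transitivity (\int[mu]_u (speed u * L)); last by rewrite RintegralZr.
 by apply: eq_Rintegral => u _; rewrite /L -RintegralZl.
by have := congr1 (fun z : R[i] => Re z) two_point_integral; rewrite /Cint /= => ->.
Qed.

Lemma isoperimetric_ineq : a%:~R ^+ 2 * A * (4 * pi - k * A) <= L ^+ 2.
Proof.
rewrite -subr_ge0 -defect_int.2; apply: Rintegral_ge0 => p _; exact: defect_ge0.
Qed.

(** A positive value at a point of continuity would give a positive lower bound on a square around
    it, hence a positive integral. *)
Lemma defect_eq0 (p : R * R) : L ^+ 2 = a%:~R ^+ 2 * A * (4 * pi - k * A) ->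
 defect q @[q --> p] --> defect p -> defect p = 0.
Proof.
move=> LE cp; apply/eqP; rewrite eq_le defect_ge0 andbT leNgt; apply/negP => d0.
have [di dE] := defect_int.
have : \forall q \near p, defect p / 2 < defect q.
 have np : nbhs (defect p) [set y | defect p / 2 < y] by apply: lt_nbhsr; lra.
 exact: (cp _ np).
move=> /nbhs_ballP[e /= e0 eP].
have e20 : 0 < e / 2 by rewrite divr_gt0.
pose h (q : R * R) : R := defect p / 2 * \1_(box p (e / 2)) q.
have hd q : h q <= defect q.
 rewrite /h indicE; have [/set_mem qb|_] := boolP (q \in _); last by rewrite mulr0 defect_ge0.
 rewrite mulr1 ltW//; apply: eP; case: qb; rewrite /= !in_itv/= => /andP[a1 b1] /andP[a2 b2].
 by split; rewrite /ball/= ltr_norml; apply/andP; split; lra.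
have hi : (\int[mu2]_q (h q)%:E = (defect p / 2 * (e ^+ 2))%:E)%E.
 under eq_integral do rewrite EFinM.
 rewrite ge0_integralZl//; [|by apply/measurable_EFinP; exact: measurable_indic (measurable_box _ _)|by rewrite lee_fin; lra].
 rewrite integral_indic//; last exact: measurable_box.
 by rewrite setIT /= mu2_box ?ltW// -EFinM mulrC [2 * _]mulrC divfK ?pnatr_eq0// mulrC.
have : (\int[mu2]_q (h q)%:E <= \int[mu2]_q (defect q)%:E)%E.
 apply: ge0_le_integral => //.
 - by move=> q _; rewrite lee_fin mulr_ge0 ?indicE ?ler0n//; lra.
 - apply/measurable_EFinP; apply: measurable_funM => //.
  exact: measurable_indic (measurable_box _ _).
 - by have /integrableP[] := di.
 - by move=> q _; rewrite lee_fin.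
have dfin : (\int[mu2]_q (defect q)%:E)%E \is a fin_num by exact: integrable_fin_num.
rewrite hi -(fineK dfin) lee_fin.
have -> : fine (\int[mu2]_q (defect q)%:E)%E = 0 by rewrite -[LHS]/(\int[mu2]_p defect p) dE LE subrr.
by rewrite leNgt mulr_gt0// ?exprn_gt0//; lra.
Qed.
End core.

(** * Smooth functions of one variable *)

Section smooth_functions.
Context {R : realType}.

(** Induction on the order is replaced by a family closed under differentiation; affine,
    trigonometric and exponential functions with free coefficients form such families. *)
Lemma smooth1_family (F : set (R -> R)) :
 (forall f, F f -> exists2 g, F g & forall t : R, is_derive t (1 : R) f (g t)) ->
 forall f, F f -> smooth1 f.
Proof.
move=> FP f Ff n; have : F (derive1n n f).
 elim: n => [//|n IH]; have [g Fg gP] := FP _ IH.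
 suff -> : derive1n n.+1 f = g by [].
 by apply/funext => t; rewrite derive1nS derive1E; have [_ ->] := gP t.
by move=> /FP[g _ gP] t; have [] := gP t.
Qed.

Lemma smooth1_affine (a b : R) : smooth1 (fun t : R => a * t + b).
Proof.
apply: (smooth1_family (F := [set f | exists p q : R, f = fun t => p * t + q])); last by exists a, b.
move=> _ [p [q ->]]; exists (fun t : R => 0 * t + p); first by exists 0, p.
by move=> t; apply: is_derive_eq; rewrite /GRing.scale/=; ring.
Qed.

Lemma smooth1_trig (a p q b : R) : smooth1 (fun t : R => p * cos (a * t) + q * sin (a * t) + b).
Proof.
apply: (smooth1_family (F := [set f | exists p q b : R, f = fun t => p * cos (a * t) + q * sin (a * t) + b])); last by exists p, q, b.
move=> _ [p' [q' [b' ->]]].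
exists (fun t : R => (q' * a) * cos (a * t) + (- (p' * a)) * sin (a * t) + 0); first by exists (q' * a), (- (p' * a)), 0.
move=> t.
have dl : is_derive t (1 : R) (fun t : R => a * t) a by apply: is_derive_eq; rewrite /GRing.scale/=; ring.
have h1 := @is_derive1_comp R (@cos R) (fun t : R => a * t) t _ _ (is_derive_cos _) dl.
have h2 := @is_derive1_comp R (@sin R) (fun t : R => a * t) t _ _ (is_derive_sin _) dl.
have h3 := is_deriveD (is_deriveD (is_deriveZ p' h1) (is_deriveZ q' h2)) (is_derive_cst b' t 1).
apply: is_derive_eq h3 _; rewrite /GRing.scale/=; ring.
Qed.

Lemma smooth1_exp (a p q b : R) : smooth1 (fun t : R => p * expR (a * t) + q * expR (- a * t) + b).
Proof.
apply: (smooth1_family (F := [set f | exists p q b : R, f = fun t => p * expR (a * t) + q * expR (- a * t) + b])); last by exists p, q, b.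
move=> _ [p' [q' [b' ->]]].
exists (fun t : R => (p' * a) * expR (a * t) + (- (q' * a)) * expR (- a * t) + 0); first by exists (p' * a), (- (q' * a)), 0.
move=> t.
have dl (e : R) : is_derive t (1 : R) (fun t : R => e * t) e by apply: is_derive_eq; rewrite /GRing.scale/=; ring.
have h1 := @is_derive1_comp R (@expR R) (fun t : R => a * t) t _ _ (is_derive_expR _) (dl a).
have h2 := @is_derive1_comp R (@expR R) (fun t : R => - a * t) t _ _ (is_derive_expR _) (dl (- a)).
have h3 := is_deriveD (is_deriveD (is_deriveZ p' h1) (is_deriveZ q' h2)) (is_derive_cst b' t 1).
apply: is_derive_eq h3 _; rewrite /GRing.scale/=; ring.
Qed.

Lemma smooth1_deriv (f : R -> R) : smooth1 f ->
 continuous f /\ continuous (derive1 f) /\ forall t : R, is_derive t (1 : R) f (derive1 f t).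
Proof.
move=> sf; split; [|split].
- move=> t; apply: differentiable_continuous; apply/derivable1_diffP; exact: (sf 0%N t).
- move=> t; apply: differentiable_continuous; apply/derivable1_diffP; exact: (sf 1%N t).
- by move=> t; split; [exact: (sf 0%N t)|rewrite derive1E].
Qed.

Lemma pieceD_smooth (f g : R -> R) (a b : R) : {within `[a, b], continuous f} ->
 smooth1 g -> {in `[a, b], f =1 g} -> pieceD f (derive1 f) a b.
Proof.
move=> cf /smooth1_deriv[cg [cg' dg]] fg.
have fgo t : t \in `]a, b[ -> \near t, g t = f t.
 move=> tab; near=> u; rewrite fg//; apply: subset_itv_oo_cc.
 near: u; exact: near_in_itvoo.
have df t : t \in `]a, b[ -> is_derive t 1 f (derive1 g t).
 by move=> /fgo h; apply: near_eq_is_derive h (dg t).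
have dE t : t \in `]a, b[ -> derive1 f t = derive1 g t.
 by move=> /df[_ <-]; rewrite derive1E.
split => //; last by move=> t tab; rewrite dE//; exact: df.
exists (derive1 g); [exact: continuous_subspaceT|exact: dE].
Unshelve. all: by end_near. Qed.
End smooth_functions.

(** * Integrals that ignore the break points *)

Section pieces_integral.
Context {R : realType}.
Notation mu := (@lebesgue_measure R).

Lemma on_pieces_off (P : R -> Prop) (a b : R) s : itv_partition a b s ->
 on_pieces (fun p q => forall t, t \in `]p, q[ -> P t) a s ->
 forall t, t \in `[a, b] -> t \notin a :: s -> P t.
Proof.
elim: s a => [|q s IH] a.
 move=> [_ /= /eqP <-] _ t; rewrite in_itv/= -eq_le => /eqP <-.
 by rewrite inE eqxx.
move=> /itv_partition_cons ps' [Pq Ps'] t; rewrite in_itv/= => /andP[at_ tb].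
rewrite inE negb_or => /andP[ta tq]; have [qt|qt] := leP q t.
 by apply: (IH q) => //; rewrite in_itv/= qt.
by apply: Pq; rewrite in_itv/= qt andbT lt_neqAle eq_sym ta.
Qed.

Lemma Rintegral_pieces (f g : R -> R) s : itv_partition 0 1 s ->
 measurable_fun setT (fun t : R => \1_(`[0, 1]%classic) t * f t) ->
 measurable_fun setT (fun t : R => \1_(`[0, 1]%classic) t * g t) ->
 on_pieces (fun p q => forall t, t \in `]p, q[ -> f t = g t) 0 s ->
 \int[mu]_(t in `[0, 1]) f t = \int[mu]_(t in `[0, 1]) g t.
Proof.
move=> ps mf mg fg.
have mk (h : R -> R) : \int[mu]_(t in `[0, 1]) h t = \int[mu]_t (\1_(`[0, 1]%classic) t * h t).
 rewrite Rintegral_mkcond; apply: eq_Rintegral => t _.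
 by rewrite patchE indicE; case: ifP; rewrite ?mul1r ?mul0r.
rewrite !mk; have f0 : mu.-negligible [set` 0 :: s].
 elim: (0 :: s) => [|x l IH]; first by apply: negligibleS (@negligible_set0 _ _ _ mu) => x.
 have x0 : mu.-negligible [set x].
  by apply/negligibleP; [exact: measurable_set1|exact: lebesgue_measure_set1].
 apply: negligibleS (negligibleU x0 IH) => y /=; rewrite inE => /orP[/eqP ->|]; by [left|right].
rewrite /Rintegral; congr fine; apply: ae_eq_integral => //; try exact/measurable_EFinP.
apply: negligibleS f0 => t /=; apply: contra_notP => ts _; congr EFin.
rewrite indicE mem01; have [t01|_] := boolP (t \in _); last by rewrite !mul0r.
congr (_ * _); apply: (on_pieces_off ps fg t01); exact/negP.
Qed.
End pieces_integral.

(** * The stereographic chart and arc length in it *)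

Section chart.
Context {R : realType}.
Notation mu := (@lebesgue_measure R).
Notation TR := (measurableTypeR R).
Local Open Scope complex_scope.
Implicit Types (k : R) (x : R * R * R) (z : R * R).

(** Projection from (0, 0, -1) to the plane z = 0: stereographic on the sphere, the Poincare disc
    for k = -1, and halving of both coordinates for k = 0. *)
Definition chart x : R * R := (x.1.1 / (1 + x.2), x.1.2 / (1 + x.2)).

Definition emb k z : R * R * R :=
 ((lamC k (toC z) * z.1, lamC k (toC z) * z.2), lamC k (toC z) - 1).

Lemma cabs2_toC z : cabs (toC z) ^+ 2 = z.1 ^+ 2 + z.2 ^+ 2.
Proof. exact: cabs2. Qed.

Lemma chart_emb k z : 0 < 1 + k * cabs (toC z) ^+ 2 -> chart (emb k z) = z.
Proof.
move=> z0; have l0 : lamC k (toC z) != 0.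
 by rewrite mulf_neq0 ?invr_neq0 ?gt_eqF.
by case: z l0 {z0} => a b l0; rewrite /chart /emb /= addrC subrK; congr (_, _); rewrite mulrAC mulfV// mul1r.
Qed.

Lemma emb_surface k z : [\/ k = -1, k = 0 | k = 1] -> 0 < 1 + k * cabs (toC z) ^+ 2 ->
 surface k (emb k z) /\ 0 < 1 + (emb k z).2.
Proof.
move=> hk z0; have lE : lamC k (toC z) * (1 + k * cabs (toC z) ^+ 2) = 2.
 by rewrite /lamC divfK// gt_eqF.
have l0 : 0 < lamC k (toC z) by rewrite divr_gt0.
split; last by rewrite /= addrC subrK.
split=> /=.
 have -> : (lamC k (toC z) - 1) ^+ 2 + k * ((lamC k (toC z) * z.1) ^+ 2 + (lamC k (toC z) * z.2) ^+ 2) =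
  lamC k (toC z) * (lamC k (toC z) * (1 + k * cabs (toC z) ^+ 2)) - 2 * lamC k (toC z) + 1.
  by rewrite cabs2_toC; ring.
 by rewrite lE; ring.
have r0 := sqr_ge0 (cabs (toC z)).
case: hk => [kE|kE|->] // _; move: lE z0 l0; rewrite kE.
 move: (lamC _ _) (cabs (toC z) ^+ 2) r0 => l r r0 lE z0 l0; nra.
by rewrite mul0r addr0 mulr1 => -> _ _; lra.
Qed.

Lemma chart_surface k x : [\/ k = -1, k = 0 | k = 1] -> surface k x -> 0 < 1 + x.2 ->
 [/\ 1 + k * cabs (toC (chart x)) ^+ 2 = 2 / (1 + x.2), lamC k (toC (chart x)) = 1 + x.2
  & emb k (chart x) = x].
Proof.
move=> hk [xE xpos] x0.
have h : 1 + k * cabs (toC (chart x)) ^+ 2 = 2 / (1 + x.2).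
 rewrite cabs2_toC /chart /=.
 have e : k * (x.1.1 ^+ 2 + x.1.2 ^+ 2) = (1 - x.2) * (1 + x.2).
  by transitivity (1 - x.2 ^+ 2); [rewrite -xE; ring|ring].
 have x0' : 1 + x.2 != 0 by rewrite gt_eqF.
 have -> : 1 + k * ((x.1.1 / (1 + x.2)) ^+ 2 + (x.1.2 / (1 + x.2)) ^+ 2) =
  1 + k * (x.1.1 ^+ 2 + x.1.2 ^+ 2) / (1 + x.2) ^+ 2 by field.
 by rewrite e; field.
have lE : lamC k (toC (chart x)) = 1 + x.2 by rewrite /lamC h invf_div mulrC divfK ?pnatr_eq0.
split=> //; rewrite /emb lE /chart.
case: x x0 {h lE xE xpos} => [[a b] d] /= x0; have x0' : 1 + d != 0 by rewrite gt_eqF.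
by congr (_, _, _); [rewrite mulrC divfK|rewrite mulrC divfK|rewrite addrAC subrr add0r].
Qed.

Section curve.
Variables (k : R) (c : R -> R * R * R).
Hypotheses (hk : [\/ k = -1, k = 0 | k = 1]) (cin : curve_in k c).
Hypothesis cpos : forall t, t \in `[0, 1] -> 0 < 1 + (c t).2.

Definition cz (t : R) : R * R := chart (c t).

(** The quotient rule applied to [chart]. *)
Definition dzc (t : R) : R[i] :=
 let v := velocity c t in
 (v.1.1 / (1 + (c t).2) - (c t).1.1 * v.2 / (1 + (c t).2) ^+ 2) +i*
 (v.1.2 / (1 + (c t).2) - (c t).1.2 * v.2 / (1 + (c t).2) ^+ 2).

Lemma curve_coord_cont : [/\ {within `[0, 1], continuous (fun t => (c t).1.1)},
 {within `[0, 1], continuous (fun t => (c t).1.2)} & {within `[0, 1], continuous (fun t => (c t).2)}].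
Proof.
have [cc _ _] := cin.
have f1 (f : R * R * R -> R) : continuous f -> {within `[0, 1], continuous (fun t => f (c t))}.
 by move=> cf t; apply: (@cvg_comp _ _ _ c f _ (nbhs (c t))); [exact: cc|exact: cf].
split.
- apply: (f1 (fun x => x.1.1)) => x.
 by apply: (@cvg_comp _ _ _ fst fst _ (nbhs x.1)); exact: cvg_fst.
- apply: (f1 (fun x => x.1.2)) => x.
 by apply: (@cvg_comp _ _ _ fst snd _ (nbhs x.1)); [exact: cvg_fst|exact: cvg_snd].
- by apply: (f1 (fun x => x.2)) => x; exact: cvg_snd.
Qed.

Lemma cz_pieces : exists2 s, itv_partition 0 1 s & on_pieces (fun a b =>
 [/\ pieceD (fun t => (c t).1.1) (fun t => (velocity c t).1.1) a b,
   pieceD (fun t => (c t).1.2) (fun t => (velocity c t).1.2) a b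
  & pieceD (fun t => (c t).2) (fun t => (velocity c t).2) a b]) 0 s.
Proof.
have [_ [s [ps sP]] _] := cin; exists s => //.
have [c1 c2 c3] := curve_coord_cont.
pose Q a b := exists g : R -> R * R * R, smooth g /\ {in `[a, b], c =1 g}.
have Qs : on_pieces Q 0 s by apply: on_pieces_nth.
apply: (on_pieces_imp _ ps Qs) => a b a0 ab b1 [g [[g1 g2 g3] cg]].
have sub : `[a, b] `<=` `[0, 1]%classic.
 by move=> t /=; rewrite !in_itv/= => /andP[ta tb]; rewrite (le_trans a0)// (le_trans tb).
split.
- apply: (pieceD_smooth _ g1); first exact: continuous_subspaceW sub c1.
 by move=> t /cg ->.
- apply: (pieceD_smooth _ g2); first exact: continuous_subspaceW sub c2.
 by move=> t /cg ->.
- apply: (pieceD_smooth _ g3); first exact: continuous_subspaceW sub c3.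
 by move=> t /cg ->.
Qed.

Lemma cz_cpieces : exists2 s, itv_partition 0 1 s &
 on_pieces (cpieceD (toC \o cz) dzc) 0 s /\
 on_pieces (fun a b => forall t, t \in `]a, b[ ->
  Num.sqrt (metric k (velocity c t) (velocity c t)) = lamC k (toC (cz t)) * cabs (dzc t)) 0 s.
Proof.
have [s ps sP] := cz_pieces; exists s => //.
have [_ _ csurf] := cin.
split; apply: (on_pieces_imp _ ps sP) => a b a0 ab b1 [d1 d2 d3].
 have ab01 t : t \in `[a, b] -> t \in `[0, 1].
  by rewrite !in_itv/= => /andP[ta tb]; rewrite (le_trans a0)// (le_trans tb).
 have dd := pieceDD (pieceD_cst 1 a b) d3.
 have nz t : t \in `[a, b] -> cst 1 t + (c t).2 != 0.
  by move=> /ab01 /cpos h; rewrite gt_eqF.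
 have dV := pieceDV nz dd.
 split.
  apply: pieceD_eq1 (pieceDM d1 dV) => t //=.
  by rewrite /cst /= add0r; ring.
 apply: pieceD_eq1 (pieceDM d2 dV) => t //=.
 by rewrite /cst /= add0r; ring.
have oo01 t : t \in `]a, b[ -> t \in `[0, 1].
 by rewrite !in_itv/= => /andP[/ltW ta /ltW tb]; rewrite (le_trans a0)//= (le_trans tb).
move=> t tab; have t01 := oo01 t tab.
have [_ _ /(_ t tab) D1] := d1; have [_ _ /(_ t tab) D2] := d2; have [_ _ /(_ t tab) D3] := d3.
have xs := csurf t t01; have x0 := cpos t01.
have [h1 h2 h3] := chart_surface hk xs x0.
(* Tangency: the derivative of the equation of the surface along the curve. *)
have rel : (c t).2 * (velocity c t).2 + k * ((c t).1.1 * (velocity c t).1.1 + (c t).1.2 * (velocity c t).1.2) = 0.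
 pose f u := (c u).2 ^+ 2 + k * ((c u).1.1 ^+ 2 + (c u).1.2 ^+ 2).
 have D : is_derive t 1 f (2 * ((c t).2 * (velocity c t).2 + k * ((c t).1.1 * (velocity c t).1.1 + (c t).1.2 * (velocity c t).1.2))).
  have E := is_deriveD (is_deriveX 2 D3) (is_deriveZ k (is_deriveD (is_deriveX 2 D1) (is_deriveX 2 D2))).
  by apply: (@is_derive_eq _ _ _ f _ _ _ _ E); rewrite /GRing.scale/= expr1; ring.
 have D' : is_derive t 1 f 0.
  apply: (near_eq_is_derive _ (is_derive_cst (1 : R) t 1)).
  near=> u; rewrite /f /=; have [|-> //] := csurf u.
  have : u \in `]a, b[ by near: u; exact: near_in_itvoo.
  exact: oo01.
 have [_ e1] := D; have [_ e2] := D'; move: e1; rewrite e2 => /esym/eqP.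
 by rewrite mulf_eq0 pnatr_eq0/= => /eqP.
rewrite h2.
have [xE xp] := xs.
have c0 : 0 <= (1 + (c t).2) * cabs (dzc t) by rewrite mulr_ge0 ?cabs_ge0// ltW.
rewrite -[RHS]ger0_norm// -sqrtr_sqr; congr Num.sqrt.
rewrite exprMn cabs2 /dzc /metric.
move: (c t) (velocity c t) xE xp x0 rel => x v xE xp x0 rel {h1 h2 h3 xs c0 D1 D2 D3} /=.
have x0' : 1 + x.2 != 0 by rewrite gt_eqF.
(* Conformality of the chart with denominators cleared; tangency and the equation of the surface
   eliminate the mixed terms. *)
have key : (v.1.1 * v.1.1 + v.1.2 * v.1.2 + k * (v.2 * v.2)) * (1 + x.2) ^+ 2 =
  (v.1.1 * (1 + x.2) - x.1.1 * v.2) ^+ 2 + (v.1.2 * (1 + x.2) - x.1.2 * v.2) ^+ 2.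
 have -> : (v.1.1 * (1 + x.2) - x.1.1 * v.2) ^+ 2 + (v.1.2 * (1 + x.2) - x.1.2 * v.2) ^+ 2 =
  (v.1.1 * v.1.1 + v.1.2 * v.1.2) * (1 + x.2) ^+ 2 -
  2 * (1 + x.2) * v.2 * (x.1.1 * v.1.1 + x.1.2 * v.1.2) + v.2 ^+ 2 * (x.1.1 ^+ 2 + x.1.2 ^+ 2) by ring.
 move: (x.1.1 * v.1.1 + x.1.2 * v.1.2) (x.1.1 ^+ 2 + x.1.2 ^+ 2) rel xE => S Q rel xE.
 case: hk => kE; move: rel xE xp; rewrite kE => rel xE xp.
 - have -> : S = x.2 * v.2 by lra.
  by have -> : Q = x.2 ^+ 2 - 1; [lra|ring].
 - have x1 : x.2 = 1 by have := xp (fun h => (elimF eqP (lt_eqF ltr01)) h); nra.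
  have v0 : v.2 = 0 by move: rel; rewrite x1; lra.
  by rewrite v0; ring.
 - have -> : S = - (x.2 * v.2) by lra.
  by have -> : Q = 1 - x.2 ^+ 2; [lra|ring].
apply: (mulIf (_ : (1 + x.2) ^+ 2 != 0)); first by rewrite expf_neq0.
by rewrite key; field.
Unshelve. all: by end_near. Qed.

Lemma cz_cont : {within `[0, 1], continuous cz}.
Proof.
have [c1 c2 c3] := curve_coord_cont.
have h3 : {within `[0, 1], continuous (fun t => (1 + (c t).2)^-1)}.
 have cf : {within `[0, 1], continuous (fun t => 1 + (c t).2)}.
  by move=> t; apply: cvgD; [exact: cvg_cst|exact: c3].
 apply: (@within_continuous_comp _ _ _ _ (fun t => 1 + (c t).2) (fun x : R => x^-1)) cf => _ /set_mem[t t01 <-].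
 by apply: cvgV; [rewrite gt_eqF// cpos|exact: cvg_id].
move=> t; apply: cvg_pair_pt; apply: cvgM.
- exact: c1.
- exact: h3.
- exact: c2.
- exact: h3.
Qed.

Lemma arc_meas : measurable_fun setT (fun t : R =>
 \1_(`[0, 1]%classic) t * Num.sqrt (metric k (velocity c t) (velocity c t))).
Proof.
have [s ps sP] := cz_pieces.
have Cs : on_pieces (pieceC (fun t => Num.sqrt (metric k (velocity c t) (velocity c t)))) 0 s.
 apply: (on_pieces_imp _ ps sP) => a b _ _ _ [[_ d1 _] [_ d2 _] [_ d3 _]].
 apply: (@pieceC_comp _ (@Num.sqrt R)); first exact: sqrt_continuous.
 by apply: pieceCD; [apply: pieceCD; exact: pieceCM|apply: pieceCM; [exact: pieceC_cst|exact: pieceCM]].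
have [m _] := pieces_bounded ltr01 ps Cs.
have mI : measurable (`[0, 1]%classic : set R) by exact: measurable_itv.
have -> : (fun t => \1_(`[0, 1]%classic) t * Num.sqrt (metric k (velocity c t) (velocity c t))) =
 (fun t => Num.sqrt (metric k (velocity c t) (velocity c t))) \_ `[0, 1].
 by apply/funext => t; rewrite patchE indicE; case: ifP; rewrite ?mul1r ?mul0r.
exact: (measurable_restrictT _ mI).1.
Qed.

Lemma speed_measurable (s : seq R) : itv_partition 0 1 s ->
 on_pieces (cpieceD (toC \o cz) dzc) 0 s -> measurable_fun setT (speed k cz dzc).
Proof.
move=> ps Dc; apply: measurable_funM; last by apply: measurable_cabs; exact: (dz0_meas ps Dc).
apply: measurable_funM => //; apply: (measurableT_comp (@measurable_invr R)).
apply: measurable_funD => //; apply: measurable_funM => //.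
by apply: measurable_funX; apply: measurable_cabs; exact: (zc_meas cz_cont).
Qed.

Lemma arc_length_speed (s : seq R) : itv_partition 0 1 s ->
 on_pieces (cpieceD (toC \o cz) dzc) 0 s ->
 on_pieces (fun a b => forall t, t \in `]a, b[ ->
  Num.sqrt (metric k (velocity c t) (velocity c t)) = lamC k (toC (cz t)) * cabs (dzc t)) 0 s ->
 arc_length k c = \int[mu]_t speed k cz dzc t.
Proof.
move=> ps Dc sP; rewrite /arc_length.
have mspeed := speed_measurable ps Dc.
have mI : measurable_fun setT (\1_(`[0, 1]%classic) : R -> R) by exact: measurable_indic.
rewrite (Rintegral_pieces (g := speed k cz dzc) ps arc_meas)//.
- rewrite Rintegral_mkcond; apply: eq_Rintegral => t _; rewrite patchE mem01.
 have [//|t01] := boolP (t \in _).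
 by rewrite /speed /dz0 indicE mem01 (negbTE t01) mul0r cabs0 mulr0.
- exact: measurable_funM.
- apply: (on_pieces_imp _ ps sP) => a b a0 ab b1 h t tab; rewrite h//.
 have t01 : t \in `[0, 1].
  by move: tab; rewrite !in_itv/= => /andP[/ltW ta /ltW tb]; rewrite (le_trans a0)//= (le_trans tb).
 by rewrite /speed /zc /dz0 clamp01_id// indicE mem01 t01 mul1r.
Qed.
End curve.
End chart.

(** * From the equality condition to a full circle *)

Section circle_image.
Context {R : realType}.
Local Open Scope complex_scope.
Variables (c : R -> R * R) (dz : R -> R[i]) (s : seq R) (t0 : R) (T : R[i]).
Hypotheses (ps : itv_partition 0 1 s) (Dc : on_pieces (cpieceD (toC \o c) dz) 0 s).
Hypotheses (c01 : c 0 = c 1) (cinj : {in `[0, 1[ &, injective c}).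
Hypotheses (t00 : 0 < t0) (t01 : t0 < 1) (T0 : T != 0).
Hypothesis dre : is_derive t0 (1 : R) (fun t => (c t).1) (Re T).
Hypothesis dim : is_derive t0 (1 : R) (fun t => (c t).2) (Im T).
Hypothesis flat : on_pieces (fun p q => forall u, u \in `]p, q[ -> u != t0 ->
 Im (T * dz u * conjc (toC (c u) - toC (c t0)) ^+ 2) = 0) 0 s.

Let zeta u : R[i] := toC (c u) - toC (c t0).
(** Inversion at [c t0], normalized by the velocity: circles through that point with tangent [T]
    become horizontal lines. *)
Let q u : R[i] := T / zeta u.

Let zeta0 u : u \in `[0, 1] -> u != t0 -> zeta u != 0.
Proof.
rewrite in_itv/= => /andP[u0 u1] ut; rewrite /zeta -toCB toC_eq0 subr_eq0; apply/eqP => cu.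
have t0i : t0 \in `[0, 1[ by rewrite in_itv/= ltW.
have [u1'|u1'] := eqVneq u 1.
 move: cu; rewrite u1' -c01 => cu.
 have z0 : (0 : R) \in `[0, 1[ by rewrite in_itv/= lexx ltr01.
 by have := cinj z0 t0i cu => e; move: t00; rewrite -e ltxx.
have ui : u \in `[0, 1[ by rewrite in_itv/= u0 lt_neqAle u1' u1.
by move/eqP: ut; apply; exact: cinj.
Qed.

Let piece_q a b : 0 <= a -> a < b -> b <= 1 -> (b < t0) || (t0 < a) ->
 exists2 s', itv_partition a b s' & on_pieces (cpieceD q (fun u => - (T * dz u) / zeta u ^+ 2)) a s' /\
  on_pieces (fun p q => forall u, u \in `]p, q[ -> Im (T * dz u * conjc (zeta u) ^+ 2) = 0) a s'.
Proof.
move=> a0 ab b1 bt.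
pose Q p q := cpieceD (toC \o c) dz p q /\ (forall u, u \in `]p, q[ -> u != t0 ->
 Im (T * dz u * conjc (toC (c u) - toC (c t0)) ^+ 2) = 0).
have Qs : on_pieces Q 0 s by exact: on_pieces_and.
have [s' ps' Ds'] : exists2 s', itv_partition a b s' & on_pieces Q a s'.
 apply: (on_pieces_restrict _ ps Qs a0 ab b1) => p r p' r' h1 h2 h3 [[d1 d2] d3]; split.
  by split; [exact: pieceD_sub d1|exact: pieceD_sub d2].
 move=> u; rewrite in_itv/= => /andP[pu ur]; apply: d3.
 by rewrite in_itv/= (le_lt_trans h1)//= (lt_le_trans ur).
have ut u : a <= u -> u <= b -> u != t0.
 move=> au ub; apply/eqP => e; move: bt; rewrite -e => /orP[|]; rewrite ltNge.
  by rewrite ub.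
 by rewrite au.
exists s' => //; split; apply: (on_pieces_imp _ ps' Ds') => p r ap pr rb [d1 d2].
 have dzt : cpieceD zeta (fun u => dz u + 0) p r by apply: cpieceDD d1 (cpieceD_cst _ _ _).
 have nz u : u \in `[p, r] -> zeta u != 0.
  rewrite in_itv/= => /andP[pu ur]; apply: zeta0.
   by rewrite in_itv/= (le_trans a0) ?(le_trans ap)//= (le_trans ur)// (le_trans rb).
  by apply: ut; [exact: le_trans pu|exact: le_trans rb].
 have [e1 e2] := cpieceDM (cpieceD_cst T p r) (cpieceDV nz dzt).
 by split; [apply: pieceD_eq1 e1|apply: pieceD_eq1 e2] => u //; congr (_ _); rewrite mul0r add0r addr0; ring.
move=> u up; apply: d2 => //; apply: ut; move: up; rewrite in_itv/= => /andP[/ltW pu /ltW ur].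
 exact: le_trans pu.
exact: le_trans rb.
Qed.

(** The derivative of q is - T dz / zeta^2, a real multiple of T dz conj(zeta)^2, whose imaginary
    part is 0 by [flat]. The interval must avoid t0, where q has its pole. *)
Let Im_const a b : 0 <= a -> a < b -> b <= 1 -> (b < t0) || (t0 < a) -> Im (q a) = Im (q b).
Proof.
move=> a0 ab b1 bt; have [s' ps' [Ds' Fs']] := piece_q a0 ab b1 bt.
have D0 : on_pieces (pieceD (fun u => Im (q u)) (fun=> 0)) a s'.
 apply: (on_pieces_imp _ ps' (on_pieces_and Ds' Fs')) => p r ap pr rb [[_ d] f].
 apply: pieceD_eq d => u up /=.
 have u01 : u \in `[0, 1].
  move: up; rewrite !in_itv/= => /andP[/ltW pu /ltW ur].
  by rewrite (le_trans a0) ?(le_trans ap)//= (le_trans ur)// (le_trans rb).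
 have ut : u != t0.
  move: up; rewrite !in_itv/= => /andP[/ltW pu /ltW ur]; apply/eqP => e; move: bt; rewrite -e.
  by rewrite !ltNge (le_trans ur rb) (le_trans ap pu).
 have z0 := zeta0 u01 ut.
 have -> : - (T * dz u) / zeta u ^+ 2 = (- (cabs (zeta u) ^- 4))%:C * (T * dz u * conjc (zeta u) ^+ 2).
  have zz : zeta u * conjc (zeta u) = (cabs (zeta u) ^+ 2)%:C by exact: mulJ.
  have zc0 : conjc (zeta u) != 0 by rewrite -cabs_eq0 cabsJ cabs_eq0.
  have -> : (- (cabs (zeta u) ^- 4))%:C = - ((zeta u * conjc (zeta u)) ^+ 2)^-1.
   by rewrite zz -rcX -rcV -rcN -exprM.
  by move: (conjc (zeta u)) zc0 => w w0; field; rewrite z0 w0.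
 by rewrite ImZ f// mulr0.
have := pieces_ftc ab ps' D0; rewrite Rintegral_cst// mul0r => /esym/eqP.
by rewrite subr_eq0 => /eqP ->.
Qed.

Let Re_cont a b : 0 <= a -> a < b -> b <= 1 -> (b < t0) || (t0 < a) ->
 {within `[a, b], continuous (fun u => Re (q u))}.
Proof.
move=> a0 ab b1 bt; have [s' ps' [Ds' _]] := piece_q a0 ab b1 bt.
pose Q p r := {within `[p, r], continuous (fun u => Re (q u))}.
have Qs : on_pieces Q a s' by apply: (on_pieces_imp _ ps' Ds') => p r _ _ _ [[]].
apply: (on_pieces_glue (Q := Q) _ ab ps' Qs) => p r w pr rw h1 h2; rewrite /Q (itvcc_setU pr rw).
by apply: withinU_continuous => //; exact: itv_closed.
Qed.

(** zeta (t0 + h) / h tends to T, so (u - t0) q u tends to 1 and Re q has opposite infinite limits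
    on the two sides of t0. *)
Let near_t0 : exists2 e, 0 < e & forall u, `|t0 - u| < e -> u != t0 -> 2^-1 < (u - t0) * Re (q u).
Proof.
pose dq (h : R) : R[i] := (h^-1)%:C * zeta (h + t0).
have cdq : cvgC (0 : R)^' dq T.
 have [d1 e1] := dre; have [d2 e2] := dim.
 have c1 : h^-1 *: ((c (h *: (1 : R) + t0)).1 - (c t0).1) @[h --> (0 : R)^'] --> Re T by rewrite -e1; exact: d1.
 have c2 : h^-1 *: ((c (h *: (1 : R) + t0)).2 - (c t0).2) @[h --> (0 : R)^'] --> Im T by rewrite -e2; exact: d2.
 split.
  apply: cvg_trans c1; apply: near_eq_cvg; near=> h.
  by rewrite /dq ReZ /zeta ReD ReN /GRing.scale/= mulr1.
 apply: cvg_trans c2; apply: near_eq_cvg; near=> h.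
 by rewrite /dq ImZ /zeta ImD ImN /GRing.scale/= mulr1.
have cq : cvgC (0 : R)^' (fun h => T * (dq h)^-1) 1.
 by rewrite -(mulfV T0); apply: cvgCM; [exact: cvgC_cst|exact: cvgCV].
have [cr _] := cq.
have np : nbhs (Re (1 : R[i])) [set y : R | 2^-1 < y].
 by apply: lt_nbhsr => /=; rewrite invf_lt1// ltr1n.
have /nbhs_ballP[e /= e0 eP] := cr _ np.
exists e => // u ue ut; have := eP (u - t0).
rewrite /ball/= sub0r opprB => /(_ ue); rewrite subr_eq0 => /(_ ut).
rewrite /dq subrK invfM mulrCA -/(q u) -rcV invrK.
by rewrite ReZ.
Unshelve. all: by end_near. Qed.

(** Im q is constant on each side of t0, and c 0 = c 1 makes the two constants equal: the inverted
    curve lies on a horizontal line. By the intermediate value theorem Re q takes every real value,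
    so no point of the circle is missed. *)
Lemma circle_image : exists2 C, C != 0 & forall z : R * R, curve01 c z <->
 Im (T * conjc (toC z - toC (c t0))) = C * cabs (toC z - toC (c t0)) ^+ 2.
Proof.
have z01 : (0 : R) \in `[0, 1] by rewrite in_itv/= lexx ler01.
have tn : 0 != t0 by rewrite lt_eqF.
have q01 : q 0 = q 1 by rewrite /q /zeta c01.
have ImE u : u \in `[0, 1] -> u != t0 -> Im (q u) = Im (q 0).
 rewrite in_itv/= => /andP[u0 u1] ut; have [ult|ugt|e] := ltgtP u t0; last by rewrite e eqxx in ut.
  by have [->//|un] := eqVneq u 0; rewrite (@Im_const 0 u)// ?ult// lt_neqAle eq_sym un.
 by have [->|un] := eqVneq u 1; [rewrite q01|rewrite q01 (@Im_const u 1)// ?ugt ?orbT// lt_neqAle un].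
have surj x : exists2 u, u \in `[0, 1] & u != t0 /\ Re (q u) = x.
 have [e /= e0 eP] : exists2 e, 0 < e & forall u, `|t0 - u| < e -> u != t0 -> 2^-1 < (u - t0) * Re (q u).
  exact: near_t0.
 (* At distance d from t0 the bound (u - t0) Re q > 1/2 gives |Re q| > 2 (|x| + 1), which lies
    beyond x. *)
 pose d := Num.min (Num.min (t0 / 2) ((1 - t0) / 2)) (Num.min (e / 2) ((4 * (`|x| + 1))^-1)).
 have x1 : 0 < 4 * (`|x| + 1) by rewrite mulr_gt0// ltr_wpDl.
 have d0 : 0 < d by rewrite !lt_min !divr_gt0 ?subr_gt0//= invr_gt0.
 have [d1 [d2 [d3 d4]]] : d <= t0 / 2 /\ d <= (1 - t0) / 2 /\ d <= e / 2 /\ d <= (4 * (`|x| + 1))^-1.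
  by rewrite /d; split; [|split; [|split]]; rewrite !ge_min lexx ?orbT.
 have dx : d * (`|x| + 1) <= 4^-1.
  apply: le_trans (ler_wpM2r _ d4) _; first by rewrite addr_ge0.
  by rewrite invfM -mulrA mulVf ?mulr1// gt_eqF// ltr_wpDl.
 have [xle|xge] := leP x (Re (q 0)).
  pose t1 := t0 - d.
  have t1P : 0 < t1 /\ t1 < t0 by rewrite /t1; split; lra.
  have [t10 t1t] := t1P.
  have := eP t1; rewrite /t1 opprB addrC subrK => /(_ _ _).
  have dn : `|d| < e by rewrite gtr0_norm//; lra.
  have t1n : t0 - d != t0 by rewrite lt_eqF//; lra.
  move=> /(_ dn t1n); rewrite addrC addKr => hq.
  have ft1 : Re (q t1) <= x.
   have : - x <= `|x| by rewrite -normrN ler_norm.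
   by rewrite /t1; move: hq dx d0; move: (Re (q (t0 - d))) `|x| => f n; nra.
  have ct : {within `[0, t1], continuous (fun u => Re (q u))} by apply: Re_cont => //; rewrite ?t1t//; lra.
  have mm : Num.min (Re (q 0)) (Re (q t1)) <= x <= Num.max (Re (q 0)) (Re (q t1)).
   by rewrite ge_min ft1 orbT le_max xle.
  have [u] := @IVT _ (fun u => Re (q u)) 0 t1 x (ltW t10) ct mm.
  rewrite in_itv/= => /andP[u0 ut1] ux; exists u; first by rewrite in_itv/= u0; lra.
  by split=> //; rewrite lt_eqF//; lra.
 pose t1 := t0 + d.
 have [t10 t1t] : t1 < 1 /\ t0 < t1 by rewrite /t1; split; lra.
 have t1n : t0 + d != t0 by rewrite gt_eqF//; lra.
 have dn : `|t0 - (t0 + d)| < e by rewrite opprD addrA subrr sub0r normrN gtr0_norm//; lra.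
 have := eP _ dn t1n; rewrite addrAC subrr add0r => hq.
 have ft1 : x <= Re (q t1).
  have : x <= `|x| by rewrite ler_norm.
  by rewrite /t1; move: hq dx d0; move: (Re (q (t0 + d))) `|x| => f n; nra.
 have ct : {within `[t1, 1], continuous (fun u => Re (q u))} by apply: Re_cont => //; rewrite ?t1t ?orbT//; lra.
 have xge' : Re (q 1) <= x by rewrite -q01 ltW.
 have mm : Num.min (Re (q t1)) (Re (q 1)) <= x <= Num.max (Re (q t1)) (Re (q 1)).
  by rewrite ge_min xge' orbT le_max ft1.
 have [u] := @IVT _ (fun u => Re (q u)) t1 1 x (ltW t10) ct mm.
 rewrite in_itv/= => /andP[u0 ut1] ux; exists u; first by rewrite in_itv/= ut1 andbT; lra.
 by split=> //; rewrite gt_eqF//; lra.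
pose C := Im (q 0).
have imq (w : R[i]) : w != 0 -> Im (T / w) = Im (T * conjc w) / cabs w ^+ 2.
 move=> w0; rewrite invCE mulrCA ImZ mulrC.
 by [].
(* If C were 0, a parameter with Re q = 0 would give q = 0, although T is not 0. *)
have C0 : C != 0.
 apply/eqP => CE; have [u u01 [ut ux]] := surj 0.
 have : q u = 0 by apply: complexP; rewrite ?ux // ImE.
 by move/eqP; rewrite mulf_eq0 invr_eq0 (negbTE T0) (negbTE (zeta0 u01 ut)).
exists C => // z; split.
 case=> u u01 <-; have {}u01 : u \in `[0, 1] by [].
 have [->|ut] := eqVneq u t0; first by rewrite subrr cabs0 expr0n mulr0; apply/eqP; rewrite rmorph0 mulr0.
 have z0 := zeta0 u01 ut; have := ImE u u01 ut; rewrite /q imq// -/C /zeta => <-.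
 by rewrite divfK// sqrf_eq0 cabs_eq0.
move=> zE; have [e|zn] := eqVneq (toC z) (toC (c t0)).
 exists t0; first by rewrite /= in_itv/= !ltW.
 by move/eqP: e; rewrite -subr_eq0 -toCB toC_eq0 subr_eq0 => /eqP ->.
have w0 : toC z - toC (c t0) != 0 by rewrite subr_eq0.
have [u u01 [ut ux]] := surj (Re (T / (toC z - toC (c t0)))).
have e : q u = T / (toC z - toC (c t0)).
 by apply: complexP => //; rewrite ImE// -/C [RHS]imq// zE mulfK// sqrf_eq0 cabs_eq0.
exists u => //; have z0 := zeta0 u01 ut.
have : zeta u = toC z - toC (c t0).
 by move: e; rewrite /q => /(mulfI T0) /invr_inj.
by rewrite /zeta => /addIr /eqP; rewrite -subr_eq0 -toCB toC_eq0 subr_eq0 => /eqP.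
Qed.
End circle_image.

(** * Riemannian distance from the north pole, and affine isometries *)

Section distance.
Context {R : realType}.
Notation mu := (@lebesgue_measure R).
Implicit Types (k : R) (x p : R * R * R).

Lemma curve_pieces k c : curve_in k c -> exists2 s, itv_partition 0 1 s & on_pieces (fun a b =>
 [/\ pieceD (fun t => (c t).1.1) (fun t => (velocity c t).1.1) a b,
   pieceD (fun t => (c t).1.2) (fun t => (velocity c t).1.2) a b
  & pieceD (fun t => (c t).2) (fun t => (velocity c t).2) a b]) 0 s.
Proof. by move=> cin; exact: cz_pieces cin. Qed.

Lemma curve_constraint k c a b : curve_in k c -> 0 <= a -> b <= 1 ->
 pieceD (fun t => (c t).1.1) (fun t => (velocity c t).1.1) a b ->
 pieceD (fun t => (c t).1.2) (fun t => (velocity c t).1.2) a b ->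
 pieceD (fun t => (c t).2) (fun t => (velocity c t).2) a b ->
 forall t, t \in `]a, b[ ->
 (c t).2 * (velocity c t).2 + k * ((c t).1.1 * (velocity c t).1.1 + (c t).1.2 * (velocity c t).1.2) = 0.
Proof.
move=> [_ _ csurf] a0 b1 d1 d2 d3 t tab.
have oo01 u : u \in `]a, b[ -> u \in `[0, 1].
 by rewrite !in_itv/= => /andP[/ltW ta /ltW tb]; rewrite (le_trans a0)//= (le_trans tb).
have [_ _ /(_ t tab) D1] := d1; have [_ _ /(_ t tab) D2] := d2; have [_ _ /(_ t tab) D3] := d3.
pose f u := (c u).2 ^+ 2 + k * ((c u).1.1 ^+ 2 + (c u).1.2 ^+ 2).
have D : is_derive t 1 f (2 * ((c t).2 * (velocity c t).2 + k * ((c t).1.1 * (velocity c t).1.1 + (c t).1.2 * (velocity c t).1.2))).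
 have E := is_deriveD (is_deriveX 2 D3) (is_deriveZ k (is_deriveD (is_deriveX 2 D1) (is_deriveX 2 D2))).
 by apply: (@is_derive_eq _ _ _ f _ _ _ _ E); rewrite /GRing.scale/= expr1; ring.
have D' : is_derive t 1 f 0.
 apply: (near_eq_is_derive _ (is_derive_cst (1 : R) t 1)).
 near=> u; rewrite /f /=; have [|-> //] := csurf u.
 have : u \in `]a, b[ by near: u; exact: near_in_itvoo.
 exact: oo01.
have [_ e1] := D; have [_ e2] := D'; move: e1; rewrite e2 => /esym/eqP.
by rewrite mulf_eq0 pnatr_eq0/= => /eqP.
Unshelve. all: by end_near. Qed.

Lemma arc_integrable k c : curve_in k c ->
 mu.-integrable `[0, 1] (EFin \o (fun t => Num.sqrt (metric k (velocity c t) (velocity c t)))).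
Proof.
move=> cin; have [s ps sP] := curve_pieces cin.
apply: (pieces_integrable ltr01 ps).
apply: (on_pieces_imp _ ps sP) => a b _ _ _ [[_ d1 _] [_ d2 _] [_ d3 _]].
apply: (@pieceC_comp _ (@Num.sqrt R)); first exact: sqrt_continuous.
by apply: pieceCD; [apply: pieceCD; exact: pieceCM|apply: pieceCM; [exact: pieceC_cst|exact: pieceCM]].
Qed.

(** Lower bounds for distances are obtained from functions of slope at most 1 on the surface. *)
Lemma calibration k c (h h' : R -> R) : curve_in k c ->
 (exists2 s, itv_partition 0 1 s & on_pieces (fun a b => pieceD h h' a b /\
  forall t, t \in `]a, b[ -> h' t <= Num.sqrt (metric k (velocity c t) (velocity c t))) 0 s) ->
 h 1 - h 0 <= arc_length k c.
Proof.
move=> cin [s ps sP].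
have Dh : on_pieces (pieceD h h') 0 s by apply: (on_pieces_imp _ ps sP) => a b _ _ _ [].
have Ch : on_pieces (pieceC h') 0 s by apply: (on_pieces_imp _ ps Dh) => a b _ _ _ [].
pose sp t := Num.sqrt (metric k (velocity c t) (velocity c t)).
(* The comparison holds inside the pieces only; the minimum satisfies it everywhere and agrees with
   h' off the break points. *)
pose g t := Num.min (h' t) (sp t).
have mI : measurable (`[0, 1]%classic : set R) by exact: measurable_itv.
have mh' : measurable_fun (`[0, 1]%classic : set R) h' by have [] := pieces_bounded ltr01 ps Ch.
have msp : measurable_fun (`[0, 1]%classic : set R) sp.
 by have /integrableP[m _] := arc_integrable cin; exact/measurable_EFinP.
have mk (f : R -> R) : measurable_fun (`[0, 1]%classic : set R) f -> measurable_fun setT (fun t : R => \1_(`[0, 1]%classic) t * f t).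
 move=> mf; have -> : (fun t => \1_(`[0, 1]%classic) t * f t) = f \_ `[0, 1].
  by apply/funext => t; rewrite patchE indicE; case: ifP; rewrite ?mul1r ?mul0r.
 exact: (measurable_restrictT _ mI).1.
have mg : measurable_fun (`[0, 1]%classic : set R) g by exact: measurable_minr.
have gE : \int[mu]_(t in `[0, 1]) h' t = \int[mu]_(t in `[0, 1]) g t.
 apply: (Rintegral_pieces ps); [exact: mk|exact: mk|].
 apply: (on_pieces_imp _ ps sP) => a b _ _ _ [_ hs] t /hs ht.
 by rewrite /g; apply/esym/min_idPl.
rewrite -(pieces_ftc ltr01 ps Dh) gE /arc_length.
have ih' : mu.-integrable `[0, 1] (EFin \o h') by exact: (pieces_integrable ltr01 ps).
have isp := arc_integrable cin.
apply: le_Rintegral => //; last by move=> t _; rewrite /g ge_min lexx orbT.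
have ib : mu.-integrable `[0, 1] ((EFin \o (Num.norm \o h')) \+ (EFin \o (Num.norm \o sp)))%E.
 by apply: integrableD => //; [exact: (integrable_norm ih')|exact: (integrable_norm isp)].
apply: le_integrable ib => //; first exact/measurable_EFinP.
move=> t _ /=; rewrite lee_fin [leRHS]ger0_norm ?addr_ge0// /g; case: (leP (h' t) (sp t)) => _.
 by rewrite lerDl.
by rewrite lerDr.
Qed.

Lemma riem_dist_eq k p q (D : R) :
 (forall c, curve_in k c -> c 0 = p -> c 1 = q -> D <= arc_length k c) ->
 (exists c, [/\ curve_in k c, c 0 = p, c 1 = q & arc_length k c = D]) ->
 riem_dist k p q = D.
Proof.
move=> lb [c [cin c0 c1 cD]]; apply/eqP; rewrite eq_le; apply/andP; split.
 rewrite -cD; apply: ge_inf; last by exists c.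
 by exists D => _ [c' [h1 h2 h3] <-]; exact: lb.
apply: lb_le_inf; first by exists (arc_length k c), c.
by move=> _ [c' [h1 h2 h3] <-]; exact: lb.
Qed.

Lemma smooth_curve k (g : R -> R * R * R) : smooth g ->
 (forall t, t \in `[0, 1] -> surface k (g t)) -> curve_in k g.
Proof.
move=> [g1 g2 g3] gs; split => //.
- have [c1 _] := smooth1_deriv g1; have [c2 _] := smooth1_deriv g2; have [c3 _] := smooth1_deriv g3.
 have gE : g = (fun t => ((g t).1.1, (g t).1.2, (g t).2)) by apply/funext => t; case: (g t) => [[]].
 apply: continuous_subspaceT => t; rewrite gE.
 by apply: cvg_pair_pt; [apply: cvg_pair_pt; [exact: c1|exact: c2]|exact: c3].
- exists [:: 1]; split; first by rewrite /itv_partition/= ltr01 eqxx.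
 by case=> // _; exists g.
Qed.

Lemma arc_length_const k (g : R -> R * R * R) (D : R) : 0 <= D ->
 (forall t, metric k (velocity g t) (velocity g t) = D ^+ 2) -> arc_length k g = D.
Proof.
move=> D0 gD; rewrite /arc_length; under eq_Rintegral do rewrite gD sqrtr_sqr ger0_norm//.
by rewrite Rintegral_cst//= lebesgue_measure_itv/= lte_fin ltr01 -EFinB /= subr0 mulr1.
Qed.

Definition north : R * R * R := ((0, 0), 1).

Definition rad x : R := Num.sqrt (x.1.1 ^+ 2 + x.1.2 ^+ 2).

Lemma rad_dir x : exists e : R * R, [/\ e.1 ^+ 2 + e.2 ^+ 2 = 1, x.1.1 = rad x * e.1 & x.1.2 = rad x * e.2].
Proof.
have [r0|r0] := eqVneq (rad x) 0.
 have : x.1.1 ^+ 2 + x.1.2 ^+ 2 = 0.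
  by move/eqP: r0; rewrite sqrtr_eq0 => h; apply/eqP; rewrite eq_le h addr_ge0 ?sqr_ge0.
 have h1 := sqr_ge0 x.1.1; have h2 := sqr_ge0 x.1.2 => h.
 have /eqP : x.1.1 ^+ 2 = 0 by lra.
 have /eqP : x.1.2 ^+ 2 = 0 by lra.
 rewrite !sqrf_eq0 => /eqP -> /eqP ->; exists (1, 0).
 by rewrite r0 /= expr1n expr0n/= addr0 !mul0r.
exists (x.1.1 / rad x, x.1.2 / rad x); rewrite /= ![rad x * _]mulrC !divfK//; split => //.
rewrite !expr_div_n -mulrDl; have -> : rad x ^+ 2 = x.1.1 ^+ 2 + x.1.2 ^+ 2.
 by rewrite sqr_sqrtr// addr_ge0 ?sqr_ge0.
rewrite mulfV//; apply: contraNneq r0 => h; by rewrite /rad h sqrtr0.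
Qed.

Lemma rad_ge0 x : 0 <= rad x. Proof. exact: sqrtr_ge0. Qed.

Lemma rad2 x : rad x ^+ 2 = x.1.1 ^+ 2 + x.1.2 ^+ 2.
Proof. by rewrite sqr_sqrtr// addr_ge0 ?sqr_ge0. Qed.

(** The calibrating function is the coordinate in the direction of x. *)
Lemma dist_flat x : surface 0 x -> riem_dist 0 north x = rad x.
Proof.
move=> [xE xpos]; have x2 : x.2 = 1.
 by have := xpos (fun h => elimF eqP (lt_eqF ltr01) h); move: xE; rewrite mul0r addr0 => h1 h2; nra.
have [e [e1 ex ey]] := rad_dir x.
apply: riem_dist_eq => [c cin c0 c1|].
 have [s ps sP] := curve_pieces cin.
 have -> : rad x = (e.1 * (c 1).1.1 + e.2 * (c 1).1.2) - (e.1 * (c 0).1.1 + e.2 * (c 0).1.2).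
  rewrite c0 c1 /= ex ey; transitivity (rad x * (e.1 ^+ 2 + e.2 ^+ 2)); first by rewrite e1 mulr1.
  by ring.
 apply: (calibration (h := fun t => e.1 * (c t).1.1 + e.2 * (c t).1.2)
  (h' := fun t => (0 * (c t).1.1 + e.1 * (velocity c t).1.1) + (0 * (c t).1.2 + e.2 * (velocity c t).1.2)) cin).
 exists s => //; apply: (on_pieces_imp _ ps sP) => a b a0 ab b1 [d1 d2 d3]; split.
  by apply: pieceDD; apply: pieceDM => //; exact: pieceD_cst.
 move=> t _; rewrite !mul0r !add0r /metric mul0r addr0.
 apply: le_trans (ler_norm _) _; rewrite -sqrtr_sqr; apply: ler_wsqrtr.
 move: (velocity c t).1 => v.
 have -> : v.1 * v.1 + v.2 * v.2 = (v.1 ^+ 2 + v.2 ^+ 2) * (e.1 ^+ 2 + e.2 ^+ 2) by rewrite e1; ring.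
 have := sqr_ge0 (e.1 * v.2 - e.2 * v.1); nra.
pose g (t : R) : R * R * R := ((rad x * e.1 * t + 0, rad x * e.2 * t + 0), 0 * t + 1).
have sg : smooth g by split; exact: smooth1_affine.
have vg t : velocity g t = ((rad x * e.1, rad x * e.2), 0).
 have D (a b : R) : derive1 (fun t : R => a * t + b) t = a.
  have h : is_derive t (1 : R) (fun t : R => a * t + b) a by apply: is_derive_eq; rewrite /GRing.scale/=; ring.
  by rewrite derive1E; have [_ ->] := h.
 by rewrite /velocity /g /= !D.
exists g; split.
- apply: smooth_curve => // t _; split => [|_] /=; last by rewrite mul0r add0r.
 by rewrite !mul0r add0r addr0 expr1n.
- by rewrite /g !mulr0 !addr0 add0r.
- by rewrite /g !mulr1 !addr0 -ex -ey add0r -x2; case: (x) => [[]].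
- apply: arc_length_const => [|t]; first exact: rad_ge0.
 by rewrite vg /metric /= -[RHS]mulr1 -e1; ring.
Qed.

Lemma is_derive_lin (a t : R) : is_derive t (1 : R) (fun t : R => a * t) a.
Proof. by apply: is_derive_eq; rewrite /GRing.scale/=; ring. Qed.

Lemma derive1_trig (a p q b t : R) :
 derive1 (fun t : R => p * cos (a * t) + q * sin (a * t) + b) t = a * (q * cos (a * t) - p * sin (a * t)).
Proof.
have h1 := @is_derive1_comp R (@cos R) (fun t : R => a * t) t _ _ (is_derive_cos _) (is_derive_lin a t).
have h2 := @is_derive1_comp R (@sin R) (fun t : R => a * t) t _ _ (is_derive_sin _) (is_derive_lin a t).
have h3 := is_deriveD (is_deriveD (is_deriveZ p h1) (is_deriveZ q h2)) (is_derive_cst b t 1).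
rewrite derive1E; have [_ h] := h3; transitivity ('D_1 (p \*: (cos \o (fun t : R => a * t)) + q \*: (sin \o (fun t : R => a * t)) + cst b) t) => //.
by rewrite h /GRing.scale/=; ring.
Qed.

Lemma derive1_expo (a p q b t : R) :
 derive1 (fun t : R => p * expR (a * t) + q * expR (- a * t) + b) t = a * (p * expR (a * t) - q * expR (- a * t)).
Proof.
have h1 := @is_derive1_comp R (@expR R) (fun t : R => a * t) t _ _ (is_derive_expR _) (is_derive_lin a t).
have h2 := @is_derive1_comp R (@expR R) (fun t : R => - a * t) t _ _ (is_derive_expR _) (is_derive_lin (- a) t).
have h3 := is_deriveD (is_deriveD (is_deriveZ p h1) (is_deriveZ q h2)) (is_derive_cst b t 1).
rewrite derive1E; have [_ h] := h3; transitivity ('D_1 (p \*: (expR \o (fun t : R => a * t)) + q \*: (expR \o (fun t : R => - a * t)) + cst b) t) => //.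
by rewrite h /GRing.scale/=; ring.
Qed.

(** The natural calibration acos z is not differentiable at the poles. The height is scaled by cos
    eta, which keeps it inside ]-1, 1[ at the price of an error eta, and eta tends to 0. *)
Lemma dist_sphere x : surface 1 x -> riem_dist 1 north x = acos x.2.
Proof.
move=> [xE _]; have xE' : x.2 ^+ 2 + rad x ^+ 2 = 1 by rewrite rad2 -xE mul1r.
have [x1 x2] : -1 <= x.2 /\ x.2 <= 1 by have := sqr_ge0 (rad x); split; nra.
have xi : x.2 \in `[-1, 1] by rewrite in_itv/= x1.
have D0 : 0 <= acos x.2 by apply: acos_ge0; rewrite x1.
have [e [e1 ex ey]] := rad_dir x.
apply: riem_dist_eq => [c cin c0 c1|].
 have [s ps sP] := curve_pieces cin; have [_ _ csurf] := cin.
 have key eta : 0 < eta -> eta < pi / 2 -> acos (cos eta * x.2) <= arc_length 1 c + eta.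
  move=> eta0 etap; have pip := pi_gt0 R.
  have ce : 0 < cos eta by apply: cos_gt0_pihalf; rewrite etap andbT; lra.
  have ce1 : cos eta < 1.
   by rewrite -(@cos0 R) ltr_cos ?in_itv/= ?lexx ?pi_ge0//; rewrite ?(ltW eta0)//=; lra.
  have etaE : acos (cos eta * (c 0).2) = eta.
   by rewrite c0 /= mulr1 cosK// in_itv/= (ltW eta0); lra.
  rewrite -lerBlDr -{2}etaE -c1.
  pose f t := cos eta * (c t).2.
  have fb t : t \in `[0, 1] -> -1 < f t < 1.
   move=> /csurf[cE _]; have h1 := sqr_ge0 (c t).1.1; have h2 := sqr_ge0 (c t).1.2.
   have [a1 a2] : -1 <= (c t).2 /\ (c t).2 <= 1 by split; nra.
   by rewrite /f; apply/andP; split; nra.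
  apply: (calibration (h := fun t => acos (f t))
   (h' := fun t => - (Num.sqrt (1 - f t ^+ 2))^-1 * (0 * (c t).2 + cos eta * (velocity c t).2)) cin).
  exists s => //; apply: (on_pieces_imp _ ps sP) => a b a0 ab b1 [d1 d2 d3].
  have ab01 t : t \in `[a, b] -> t \in `[0, 1].
   by rewrite !in_itv/= => /andP[ta tb]; rewrite (le_trans a0)// (le_trans tb).
  have sq t : t \in `[a, b] -> 0 < 1 - f t ^+ 2.
   by move=> /ab01 /fb /andP[h1 h2]; nra.
  split.
   apply: (@pieceD_comp _ (@acos R) (fun y => - (Num.sqrt (1 - y ^+ 2))^-1) f) => [t tab|t tab|].
   - by apply: is_derive1_acos; exact: (fb t (ab01 t tab)).
   - apply: cvgN; apply: cvgV; first by rewrite sqrtr_eq0 -ltNge sq.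
    apply: (@cvg_comp _ _ _ (fun y : R => 1 - y ^+ 2) (@Num.sqrt R) _ (nbhs (1 - f t ^+ 2))).
     apply: cvgB; first exact: cvg_cst.
     by rewrite expr2; under eq_fun do rewrite expr2; apply: cvgM; exact: cvg_id.
    exact: sqrt_continuous.
   - by apply: pieceDM => //; exact: pieceD_cst.
  move=> t tab; have tab' := subset_itv_oo_cc tab; have t01 := ab01 t tab'.
  have rel := curve_constraint cin a0 b1 d1 d2 d3 tab.
  have [cE _] := csurf t t01; have := sq t tab'; have := fb t t01.
  rewrite /f /metric mul0r add0r.
  move: (c t) (velocity c t) cE rel => y v cE rel /andP[f1 f2] s0.
  have S0 : 0 < Num.sqrt (1 - (cos eta * y.2) ^+ 2) by rewrite sqrtr_gt0.
  rewrite mulNr -mulrN mulrC ler_pdivrMr// -sqrtrM.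
   apply: le_trans (ler_norm _) _; rewrite -sqrtr_sqr; apply: ler_wsqrtr.
   have C2 : 0 <= (v.1.1 * y.1.2 - v.1.2 * y.1.1) ^+ 2 by exact: sqr_ge0.
   (* Tangency and the Cauchy-Schwarz inequality: the vertical speed is at most the sine of the
      polar distance times the speed. *)
   have V3 : v.2 ^+ 2 <= (1 - y.2 ^+ 2) * (v.1.1 ^+ 2 + v.1.2 ^+ 2 + v.2 ^+ 2).
    have e3 : y.2 * v.2 = - (y.1.1 * v.1.1 + y.1.2 * v.1.2) by lra.
    have e4 : y.1.1 ^+ 2 + y.1.2 ^+ 2 = 1 - y.2 ^+ 2 by lra.
    have e5 : (y.2 * v.2) ^+ 2 = (y.1.1 * v.1.1 + y.1.2 * v.1.2) ^+ 2 by rewrite e3 sqrrN.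
    rewrite -e4; nra.
   have n0 : 0 <= v.1.1 ^+ 2 + v.1.2 ^+ 2 + v.2 ^+ 2 by rewrite !addr_ge0 ?sqr_ge0.
   have c2 : 0 < cos eta ^+ 2 <= 1 by apply/andP; split; nra.
   have e6 : cos eta ^+ 2 * (1 - y.2 ^+ 2) <= 1 - (cos eta * y.2) ^+ 2.
    by rewrite exprMn; move: c2 => /andP[_ c2]; nra.
   have -> : (- (cos eta * v.2)) ^+ 2 = cos eta ^+ 2 * v.2 ^+ 2 by ring.
   have -> : v.1.1 * v.1.1 + v.1.2 * v.1.2 + 1 * (v.2 * v.2) = v.1.1 ^+ 2 + v.1.2 ^+ 2 + v.2 ^+ 2 by ring.
   move: c2 => /andP[c2 _]; apply: le_trans (ler_wpM2l (ltW c2) V3) _.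
   by rewrite mulrA mulrC; apply: ler_wpM2l.
  have -> : v.1.1 * v.1.1 + v.1.2 * v.1.2 + 1 * (v.2 * v.2) = v.1.1 ^+ 2 + v.1.2 ^+ 2 + v.2 ^+ 2 by ring.
  by rewrite !addr_ge0 ?sqr_ge0.
 have L0 : 0 <= arc_length 1 c by apply: Rintegral_ge0 => t _; exact: sqrtr_ge0.
 have [Lp|Lp] := leP pi (arc_length 1 c).
  by apply: le_trans Lp; apply: acos_lepi; rewrite x1.
 have pip := pi_gt0 R.
 (* Applying cos to the bound turns it into F eta >= 0, which passes to the limit at 0 because F is
    continuous. *)
 pose F (eta : R) := cos eta * x.2 - cos (arc_length 1 c + eta).
 have Fpos eta : 0 < eta -> eta < pi / 2 -> eta < pi - arc_length 1 c -> 0 <= F eta.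
  move=> h1 h2 h3; have := key eta h1 h2.
  have ce : -1 <= cos eta * x.2 <= 1.
   have cc1 := cos_le1 eta; have cc2 : 0 < cos eta by apply: cos_gt0_pihalf; rewrite h2 andbT; lra.
   by apply/andP; split; nra.
  move=> hh; rewrite /F subr_ge0 leNgt; apply/negP => lt.
  have : cos (acos (cos eta * x.2)) < cos (arc_length 1 c + eta) by rewrite acosK// in_itv.
  have m1 : acos (cos eta * x.2) \in `[0, pi] by rewrite in_itv/= acos_ge0// acos_lepi.
  have m2 : arc_length 1 c + eta \in `[0, pi] by rewrite in_itv/=; apply/andP; split; lra.
  by rewrite (ltr_cos m2 m1) ltNge hh.
 have cF : F y @[y --> (0 : R)^'+] --> F 0.
  apply: cvg_at_right_filter; apply: cvgB.
   by apply: cvgM; [exact: continuous_cos|exact: cvg_cst].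
  apply: (@cvg_comp _ _ _ (fun y : R => arc_length 1 c + y) (@cos R) _ (nbhs (arc_length 1 c + 0))).
   by apply: cvgD; [exact: cvg_cst|exact: cvg_id].
  exact: continuous_cos.
 have F0 : 0 <= F 0.
  rewrite leNgt; apply/negP => F0n.
  have n0 : nbhs (F 0) [set y | y < 0] by exact: lt_nbhsl.
  have nF : \forall y \near (0 : R)^'+, F y < 0 by exact: (cF _ n0).
  near (0 : R)^'+ => y.
  have yF : F y < 0 by near: y.
  have y0 : 0 < y by near: y; exact: nbhs_right_gt.
  have y1 : y < pi / 2 by near: y; apply: nbhs_right_lt; lra.
  have y2 : y < pi - arc_length 1 c by near: y; apply: nbhs_right_lt; rewrite subr_gt0.
  by have := Fpos y y0 y1 y2; lra.
 have := F0; rewrite /F cos0 mul1r addr0 subr_ge0 => h.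
 rewrite leNgt; apply/negP => lt; have : cos (acos x.2) < cos (arc_length 1 c).
  have m1 : acos x.2 \in `[0, pi] by rewrite in_itv/= D0 acos_lepi// x1.
  have m2 : arc_length 1 c \in `[0, pi] by rewrite in_itv/= L0 ltW.
  by rewrite (ltr_cos m2 m1).
 by rewrite acosK// ltNge h.
pose D := acos x.2.
have cD : cos D = x.2 by rewrite acosK.
have sD : sin D = rad x.
 by rewrite /D sin_acos ?x1// -[RHS]ger0_norm ?rad_ge0// -sqrtr_sqr; congr Num.sqrt; lra.
pose g (t : R) : R * R * R := ((0 * cos (D * t) + e.1 * sin (D * t) + 0, 0 * cos (D * t) + e.2 * sin (D * t) + 0),
 1 * cos (D * t) + 0 * sin (D * t) + 0).
have sg : smooth g by split; exact: smooth1_trig.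
have e1' : e.1 * e.1 + e.2 * e.2 = 1 by rewrite -!expr2.
exists g; split.
- apply: smooth_curve => // t _; split => [/=|//].
 have := cos2Dsin2 (D * t); move: (cos (D * t)) (sin (D * t)) => C S h.
 transitivity (C ^+ 2 + S ^+ 2 * (e.1 ^+ 2 + e.2 ^+ 2)); first by ring.
 by rewrite e1 mulr1.
- by rewrite /g !mulr0 !cos0 !sin0 /north; congr (_, _, _); ring.
- rewrite /g !mulr1 cD sD .
 transitivity ((x.1.1, x.1.2), x.2); last by case: (x) => [[]].
 by congr (_, _, _); rewrite ?ex ?ey; ring.
- apply: arc_length_const => // t; rewrite /velocity /metric /g /= !derive1_trig.
 have := cos2Dsin2 (D * t); move: (cos (D * t)) (sin (D * t)) => C S h.
 transitivity (D ^+ 2 * (C ^+ 2 * (e.1 * e.1 + e.2 * e.2) + S ^+ 2)); first by ring.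
 by rewrite e1' mulr1 h mulr1.
Unshelve. all: by end_near. Qed.

Definition arsinh (u : R) : R := ln (u + Num.sqrt (1 + u ^+ 2)).

Lemma arsinh_pos (u : R) : 0 < u + Num.sqrt (1 + u ^+ 2).
Proof.
have h : `|u| < Num.sqrt (1 + u ^+ 2).
 by rewrite -sqrtr_sqr ltr_sqrt; [rewrite ltrDr|rewrite ltr_pwDl// sqr_ge0].
by have := ler_norm (- u); rewrite normrN; lra.
Qed.

Lemma is_derive_arsinh (u : R) : is_derive u (1 : R) arsinh (Num.sqrt (1 + u ^+ 2))^-1.
Proof.
have q0 : 0 < 1 + u ^+ 2 by rewrite ltr_pwDl// sqr_ge0.
have s0 : 0 < Num.sqrt (1 + u ^+ 2) by rewrite sqrtr_gt0.
have d1 : is_derive u (1 : R) (fun u : R => 1 + u ^+ 2) (2 * u).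
 have h := is_deriveD (is_derive_cst (1 : R) u 1) (is_deriveX 2 (is_derive_id u (1 : R))).
 by apply: (@is_derive_eq _ _ _ (fun u : R => 1 + u ^+ 2) _ _ _ _ h); rewrite /GRing.scale/= expr1; ring.
have d2 := @is_derive1_comp R (@Num.sqrt R) (fun u : R => 1 + u ^+ 2) u _ _ (is_derive1_sqrt q0) d1.
have d3 := is_deriveD (is_derive_id u (1 : R)) d2.
have d4 := @is_derive1_comp R (@ln R) (fun u : R => u + Num.sqrt (1 + u ^+ 2)) u _ _ (is_derive1_ln (arsinh_pos u)) d3.
apply: (@is_derive_eq _ _ _ arsinh _ _ _ _ d4).
have := arsinh_pos u; move: s0; move: (Num.sqrt (1 + u ^+ 2)) => S s0 us.
by rewrite /GRing.scale/=; field; rewrite !gt_eqF// mulr_gt0.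
Qed.

(** The calibrating function is arsinh of the coordinate in the direction of x, the signed distance
    to a geodesic through the north pole. Unlike the distance itself it is smooth at the pole. *)
Lemma dist_hyp x : surface (-1) x -> riem_dist (-1) north x = ln (x.2 + rad x).
Proof.
move=> [xE xpos]; have x0 : 0 < x.2 by apply: xpos => h; have : (0 : R) < 1 := ltr01; lra.
have xE' : x.2 ^+ 2 = 1 + rad x ^+ 2 by rewrite rad2 -xE; ring.
have r0 := rad_ge0 x.
have x1 : 1 <= x.2 by have := sqr_ge0 (rad x); nra.
have [e [e1 ex ey]] := rad_dir x.
have e1' : e.1 * e.1 + e.2 * e.2 = 1 by rewrite -!expr2.
have xs : Num.sqrt (1 + rad x ^+ 2) = x.2 by rewrite -xE' sqrtr_sqr gtr0_norm.
apply: riem_dist_eq => [c cin c0 c1|].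
 have [s ps sP] := curve_pieces cin; have [_ _ csurf] := cin.
 pose u t := e.1 * (c t).1.1 + e.2 * (c t).1.2.
 have u1 : u 1 = rad x.
  by rewrite /u c1 ex ey; transitivity (rad x * (e.1 * e.1 + e.2 * e.2)); [ring|rewrite e1' mulr1].
 have -> : ln (x.2 + rad x) = arsinh (u 1) - arsinh (u 0).
  rewrite u1 /arsinh xs [rad x + _]addrC /u c0 /= !mulr0 addr0 expr0n/= addr0 sqrtr1 add0r ln1 subr0//.
 apply: (@calibration _ c (fun t => arsinh (u t)) (fun t => (Num.sqrt (1 + u t ^+ 2))^-1 *
   ((0 * (c t).1.1 + e.1 * (velocity c t).1.1) + (0 * (c t).1.2 + e.2 * (velocity c t).1.2))) cin).
 exists s => //; apply: (on_pieces_imp _ ps sP) => a b a0 ab b1 [d1 d2 d3]; split.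
  apply: (@pieceD_comp _ arsinh (fun y => (Num.sqrt (1 + y ^+ 2))^-1) u) => [t tab|t tab|].
  - exact: is_derive_arsinh.
  - apply: cvgV; first by rewrite sqrtr_eq0 -ltNge ltr_pwDl// sqr_ge0.
   apply: (@cvg_comp _ _ _ (fun y : R => 1 + y ^+ 2) (@Num.sqrt R) _ (nbhs (1 + u t ^+ 2))).
    apply: cvgD; first exact: cvg_cst.
    by rewrite expr2; under eq_fun do rewrite expr2; apply: cvgM; exact: cvg_id.
   exact: sqrt_continuous.
  - by apply: pieceDD; apply: pieceDM => //; exact: pieceD_cst.
 move=> t tab.
 have rel := curve_constraint cin a0 b1 d1 d2 d3 tab.
 have t01 : t \in `[0, 1].
  by move: tab; rewrite !in_itv/= => /andP[/ltW ta /ltW tb]; rewrite (le_trans a0)//= (le_trans tb).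
 have [cE cpos] := csurf t t01.
 rewrite /u /metric !mul0r !add0r.
 move: (c t) (velocity c t) cE cpos rel => y v cE cpos rel.
 pose U := e.1 * y.1.1 + e.2 * y.1.2; pose w := e.1 * y.1.2 - e.2 * y.1.1.
 pose p := e.1 * v.1.1 + e.2 * v.1.2; pose q := e.1 * v.1.2 - e.2 * v.1.1.
 rewrite -/U -/p.
 have q0 : 0 < 1 + U ^+ 2 by rewrite ltr_pwDl// sqr_ge0.
 have s0 : 0 < Num.sqrt (1 + U ^+ 2) by rewrite sqrtr_gt0.
 have vv : v.1.1 * v.1.1 + v.1.2 * v.1.2 = p ^+ 2 + q ^+ 2.
  by transitivity ((v.1.1 * v.1.1 + v.1.2 * v.1.2) * (e.1 * e.1 + e.2 * e.2)); [rewrite e1' mulr1|rewrite /p /q; ring].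
 have yy : y.2 ^+ 2 = 1 + U ^+ 2 + w ^+ 2.
  transitivity (1 + (y.1.1 ^+ 2 + y.1.2 ^+ 2) * (e.1 * e.1 + e.2 * e.2)); last by rewrite /U /w; ring.
  by rewrite e1' mulr1 -[in RHS]cE; ring.
 have yv : y.2 * v.2 = U * p + w * q.
  transitivity ((y.1.1 * v.1.1 + y.1.2 * v.1.2) * (e.1 * e.1 + e.2 * e.2)); last by rewrite /U /w /p /q; ring.
  by rewrite e1' mulr1; lra.
 rewrite mulrC ler_pdivrMr// -sqrtrM; last first.
  have y20 : 0 < y.2 ^+ 2 by rewrite yy -addrA ltr_pwDl// addr_ge0 ?sqr_ge0.
  rewrite -(pmulr_lge0 _ y20).
  have -> : (v.1.1 * v.1.1 + v.1.2 * v.1.2 + -1 * (v.2 * v.2)) * y.2 ^+ 2 =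
   (v.1.1 * v.1.1 + v.1.2 * v.1.2) * y.2 ^+ 2 - (y.2 * v.2) ^+ 2 by ring.
  rewrite vv yv yy.
  have -> : (p ^+ 2 + q ^+ 2) * (1 + U ^+ 2 + w ^+ 2) - (U * p + w * q) ^+ 2 =
   p ^+ 2 + q ^+ 2 + (p * w - q * U) ^+ 2 by ring.
  by rewrite !addr_ge0 ?sqr_ge0.
 apply: le_trans (ler_norm _) _; rewrite -sqrtr_sqr; apply: ler_wsqrtr.
 have y20 : 0 < y.2 ^+ 2 by rewrite yy -addrA ltr_pwDl// addr_ge0 ?sqr_ge0.
 rewrite -(ler_pM2r y20) vv.
 have -> : (p ^+ 2 + q ^+ 2 + -1 * (v.2 * v.2)) * (1 + U ^+ 2) * y.2 ^+ 2 =
  (1 + U ^+ 2) * ((p ^+ 2 + q ^+ 2) * y.2 ^+ 2 - (y.2 * v.2) ^+ 2) by ring.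
 (* The difference of the two sides is the square of q - U (p w - q U). *)
 rewrite yv yy; have := sqr_ge0 (q - U * (p * w - q * U)); rewrite -subr_ge0 => h.
 rewrite -subr_ge0; apply: le_trans h _; rewrite subr0 le_eqVlt; apply/orP; left; apply/eqP; ring.
pose D := ln (x.2 + rad x).
have xr0 : 0 < x.2 + rad x by lra.
have eD : expR D = x.2 + rad x by rewrite /D lnK.
have eN : expR (- D) = x.2 - rad x.
 rewrite expRN eD; apply: (mulfI (lt0r_neq0 xr0)); rewrite mulfV ?gt_eqF//.
 by transitivity (x.2 ^+ 2 - rad x ^+ 2); [rewrite xE'; ring|ring].
have D0 : 0 <= D by rewrite ln_ge0//; lra.
pose g (t : R) : R * R * R := ((e.1 / 2 * expR (D * t) + - (e.1 / 2) * expR (- D * t) + 0, e.2 / 2 * expR (D * t) + - (e.2 / 2) * expR (- D * t) + 0),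
 2^-1 * expR (D * t) + 2^-1 * expR (- D * t) + 0).
have sg : smooth g by split; exact: smooth1_exp.
have ee t : expR (D * t) * expR (- D * t) = 1 by rewrite -expRD mulNr subrr expR0.
exists g; split.
- apply: smooth_curve => // t _; split => [/=|_ /=]; last first.
  by rewrite addr0 -mulrDr mulr_gt0 ?addr_gt0 ?expR_gt0// invr_gt0.
 have := ee t; move: (expR (D * t)) (expR (- D * t)) => E F EF.
 transitivity (((E + F) ^+ 2 - (E - F) ^+ 2 * (e.1 * e.1 + e.2 * e.2)) / 4); first by field.
 by rewrite e1' mulr1; transitivity (E * F); [field|].
- by rewrite /g !mulr0 !expR0 /north; congr (_, _, _); field.
- rewrite /g !mulr1 eD eN .
 transitivity ((x.1.1, x.1.2), x.2); last by case: (x) => [[]].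
 by congr (_, _, _); rewrite ?ex ?ey; field.
- apply: arc_length_const => // t; rewrite /velocity /metric /g /= !derive1_expo.
 have := ee t; move: (expR (D * t)) (expR (- D * t)) => E F EF.
 transitivity (D ^+ 2 * (((E + F) ^+ 2 * (e.1 * e.1 + e.2 * e.2)) - (E - F) ^+ 2) / 4); first by field.
 by rewrite e1' mulr1; transitivity (D ^+ 2 * (E * F)); [field|rewrite EF mulr1].
Qed.

Definition dot (a x : R * R * R) : R := a.1.1 * x.1.1 + a.1.2 * x.1.2 + a.2 * x.2.

Lemma smooth1_lin (f1 f2 f3 : R -> R) (a b d e : R) : smooth1 f1 -> smooth1 f2 -> smooth1 f3 ->
 smooth1 (fun t => a * f1 t + b * f2 t + d * f3 t + e).
Proof.
move=> s1 s2 s3.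
apply: (smooth1_family (F := [set f | exists n (a b d e : R), f = fun t : R =>
  a * derive1n n f1 t + b * derive1n n f2 t + d * derive1n n f3 t + e])); last by exists 0%N, a, b, d, e.
move=> _ [n [a' [b' [d' [e' ->]]]]].
exists (fun t => a' * derive1n n.+1 f1 t + b' * derive1n n.+1 f2 t + d' * derive1n n.+1 f3 t + 0).
 by exists n.+1, a', b', d', 0.
move=> t.
have D f : smooth1 f -> is_derive t (1 : R) (derive1n n f) (derive1n n.+1 f t).
 by move=> sf; split; [exact: sf|rewrite derive1nS derive1E].
have h := is_deriveD (is_deriveD (is_deriveD (is_deriveZ a' (D _ s1)) (is_deriveZ b' (D _ s2))) (is_deriveZ d' (D _ s3))) (is_derive_cst e' t 1).
exact: h.
Qed.

Section isometry.
Variables (k : R) (A1 A2 A3 o : R * R * R).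

Definition lin x : R * R * R := ((dot A1 x, dot A2 x), dot A3 x).
Definition aff x : R * R * R := ((dot A1 x + o.1.1, dot A2 x + o.1.2), dot A3 x + o.2).

Hypothesis surf : forall x, surface k x -> surface k (aff x).
Hypothesis isom : forall v, metric k (lin v) (lin v) = metric k v v.

Lemma aff_curve c : curve_in k c -> curve_in k (aff \o c) /\ arc_length k (aff \o c) = arc_length k c.
Proof.
move=> cin; have [cc [s [ps sP]] csurf] := cin.
have cT : curve_in k (aff \o c).
 split.
 - have [c1 c2 c3] := curve_coord_cont cin.
  have L (a : R * R * R) (b : R) : {within `[0, 1], continuous (fun t => dot a (c t) + b)}.
   move=> t; apply: cvgD; last exact: cvg_cst.
   by apply: cvgD; [apply: cvgD|]; apply: cvgM; (exact: cvg_cst || exact: c1 || exact: c2 || exact: c3).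
  by move=> t; apply: cvg_pair_pt; [apply: cvg_pair_pt|]; exact: L.
 - exists s; split => // i /sP[g [[g1 g2 g3] cg]]; exists (aff \o g); split.
   by split; exact: smooth1_lin.
  by move=> t /cg h; rewrite /= h.
 - by move=> t /csurf; exact: surf.
split; first exact: cT.
have [s' ps' sP'] := curve_pieces cin.
rewrite /arc_length; apply: (Rintegral_pieces ps'); [exact: arc_meas cT|exact: arc_meas cin|].
apply: (on_pieces_imp _ ps' sP') => a b a0 ab b1 [[_ _ d1] [_ _ d2] [_ _ d3]] t tab.
suff -> : velocity (aff \o c) t = lin (velocity c t) by rewrite isom.
have D (u : R * R * R) (b' : R) : derive1 (fun t => dot u (c t) + b') t = dot u (velocity c t).
 have h := is_deriveD (is_deriveD (is_deriveD (is_deriveZ u.1.1 (d1 t tab)) (is_deriveZ u.1.2 (d2 t tab))) (is_deriveZ u.2 (d3 t tab))) (is_derive_cst b' t 1).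
 rewrite derive1E; have [_ e] := h; rewrite -[RHS]addr0; exact: e.
by rewrite /velocity /lin /aff /= !D.
Qed.
End isometry.

(** Composition with T and with its inverse matches the curves of the two infima, with equal
    lengths. *)
Lemma aff_isometry k (T T' : R * R * R -> R * R * R) :
 (forall c, curve_in k c -> curve_in k (T \o c) /\ arc_length k (T \o c) = arc_length k c) ->
 (forall c, curve_in k c -> curve_in k (T' \o c) /\ arc_length k (T' \o c) = arc_length k c) ->
 cancel T T' -> cancel T' T -> forall p q, riem_dist k (T p) (T q) = riem_dist k p q.
Proof.
move=> hT hT' TK T'K p q; rewrite /riem_dist; congr inf; apply/seteqP; split.
 move=> _ [c [cin c0 c1] <-]; have [h1 h2] := hT' c cin.
 exists (T' \o c); [split; [exact: h1|by rewrite /= c0 TK|by rewrite /= c1 TK]|exact: h2].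
move=> _ [c [cin c0 c1] <-]; have [h1 h2] := hT c cin.
exists (T \o c); [split; [exact: h1|by rewrite /= c0|by rewrite /= c1]|exact: h2].
Qed.
End distance.

(** * From the graph chart to the stereographic chart *)

Section area_chart.
Context {R : realType}.
Notation mu := (@lebesgue_measure R).
Notation TR := (measurableTypeR R).
Notation mu2 := (mu \x mu)%E.
Implicit Types (k b : R) (w z : R * R) (F : R * R -> \bar R).

Definition norm2 z : R := z.1 ^+ 2 + z.2 ^+ 2.

Lemma norm2_cabs z : norm2 z = cabs (toC z) ^+ 2.
Proof. by rewrite cabs2_toC. Qed.

Lemma norm2_ge0 z : 0 <= norm2 z.
Proof. by rewrite addr_ge0 ?sqr_ge0. Qed.

Lemma norm2_polar phi r : norm2 (polar phi r) = r ^+ 2.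
Proof.
rewrite /norm2 /polar /= !exprMn -mulrDr; have := cos2Dsin2 phi => ->.
by rewrite mulr1.
Qed.

Lemma measurable_norm2 : measurable_fun setT (norm2 : TR * TR -> R).
Proof. by apply: measurable_funD; apply: measurable_funX. Qed.

Definition scale_pt (f : R * R -> R) z : R * R := (z.1 * f z, z.2 * f z).

Lemma measurable_scale_pt (f : R * R -> R) : measurable_fun setT (f : TR * TR -> R) ->
 measurable_fun setT (scale_pt f : TR * TR -> TR * TR).
Proof.
by move=> mf; apply: measurable_fun_pair; apply: measurable_funM.
Qed.

Definition hgt k z : R := Num.sqrt (1 - k * norm2 z).

Lemma measurable_hgt k : measurable_fun setT (hgt k : TR * TR -> R).
Proof.
apply: (measurableT_comp (continuous_measurable_fun (@sqrt_continuous R))); apply: measurable_funB => //.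
by apply: measurable_funM => //; exact: measurable_norm2.
Qed.

Lemma measurable_inv_hgt k : measurable_fun setT ((fun z => (1 + hgt k z)^-1) : TR * TR -> R).
Proof.
apply: (measurableT_comp (@measurable_invr R)); apply: measurable_funD => //.
exact: measurable_hgt.
Qed.

(** The radius in the graph chart of a point at radius r in the stereographic chart; [dsg] is its
    derivative. *)
Definition sg k (r : R) : R := 2 * r / (1 + k * r ^+ 2).
Definition dsg k (r : R) : R := 2 * (1 - k * r ^+ 2) / (1 + k * r ^+ 2) ^+ 2.

Section radial.
Variables (k b : R).
Hypotheses (hk : [\/ k = -1, k = 0 | k = 1]) (b0 : 0 < b).
Hypotheses (kb1 : 0 <= 1 - k * b ^+ 2) (kb2 : 0 < 1 + k * b ^+ 2).

Let sqb r : r \in `[- b, b] -> r ^+ 2 <= b ^+ 2.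
Proof. by rewrite in_itv/= => /andP[h1 h2]; nra. Qed.

Let den r : r \in `[- b, b] -> 0 < 1 + k * r ^+ 2.
Proof.
move=> /sqb h; have h0 := sqr_ge0 r; have hb := sqr_ge0 b.
by case: hk kb2 => ->; rewrite ?mulN1r ?mul0r ?mul1r; lra.
Qed.

Let num r : r \in `[- b, b] -> 0 <= 1 - k * r ^+ 2.
Proof.
move=> /sqb h; have h0 := sqr_ge0 r; have hb := sqr_ge0 b.
by case: hk kb1 => ->; rewrite ?mulN1r ?mul0r ?mul1r; lra.
Qed.

Lemma sg_incr : {in `[- b, b] &, {homo sg k : x y / x < y}}.
Proof.
move=> x y xb yb xy; rewrite /sg ltr_pdivrMr ?den// mulrAC ltr_pdivlMr ?den// -subr_gt0.
have -> : 2 * y * (1 + k * x ^+ 2) - 2 * x * (1 + k * y ^+ 2) = 2 * (y - x) * (1 - k * (x * y)) by ring.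
rewrite mulr_gt0//; first by rewrite mulr_gt0// subr_gt0.
move: xb yb; rewrite !in_itv/= => /andP[x1 x2] /andP[y1 y2].
have h1 : - b ^+ 2 <= x * y by nra.
have h2 : x * y < b ^+ 2 by nra.
by case: hk kb1 kb2 => ->; rewrite ?mulN1r ?mul0r ?mul1r; lra.
Qed.

Lemma pieceD_sg : pieceD (sg k) (dsg k) (- b) b.
Proof.
have cq r : {for r, continuous (fun r : R => 1 + k * r ^+ 2)}.
 apply: cvgD; first exact: cvg_cst.
 by apply: cvgM; [exact: cvg_cst|rewrite expr2; under eq_fun do rewrite expr2; apply: cvgM; exact: cvg_id].
have cn r : {for r, continuous (fun r : R => 2 * (1 - k * r ^+ 2))}.
 apply: cvgM; first exact: cvg_cst.
 apply: cvgB; first exact: cvg_cst.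
 by apply: cvgM; [exact: cvg_cst|rewrite expr2; under eq_fun do rewrite expr2; apply: cvgM; exact: cvg_id].
split.
- apply: (@within_continuous_comp _ _ _ _ (fun r : R => r) (sg k)); last first.
  by apply: continuous_subspaceT => t; exact: cvg_id.
 move=> _ /set_mem[t tb <-].
 apply: cvgM; first by apply: cvgM; [exact: cvg_cst|exact: cvg_id].
 by apply: cvgV; [rewrite gt_eqF// den|exact: cq].
- exists (dsg k) => //; apply: (@within_continuous_comp _ _ _ _ (fun r : R => r) (dsg k)); last first.
  by apply: continuous_subspaceT => t; exact: cvg_id.
 move=> _ /set_mem[t tb <-].
 apply: cvgM; first exact: cn.
 apply: cvgV; first by rewrite expf_neq0// gt_eqF// den.
 by rewrite expr2; under eq_fun do rewrite expr2; apply: cvgM; exact: cq.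
- move=> t /subset_itv_oo_cc tb; have d0 : 1 + k * t ^+ 2 != 0 by rewrite gt_eqF// den.
 have h1 : is_derive t (1 : R) (fun r : R => 1 + k * r ^+ 2) (k * (2 * t)).
  have h := is_deriveD (is_derive_cst (1 : R) t 1) (is_deriveZ k (is_deriveX 2 (is_derive_id t (1 : R)))).
  by apply: (@is_derive_eq _ _ _ (fun r : R => 1 + k * r ^+ 2) _ _ _ _ h); rewrite /GRing.scale/= expr1; ring.
 have h2 := is_deriveV (f := fun r : R => 1 + k * r ^+ 2) d0 h1.
 have h3 := is_deriveM (is_deriveZ 2 (is_derive_id t (1 : R))) h2.
 apply: (@is_derive_eq _ _ _ (sg k) _ _ _ _ h3); rewrite /GRing.scale/= /GRing.scale/= /dsg.
 by field.
Qed.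

Lemma hgt_sg phi r : r \in `[- b, b] ->
 hgt k (polar phi (sg k r)) = (1 - k * r ^+ 2) / (1 + k * r ^+ 2).
Proof.
move=> rb; have d0 : 1 + k * r ^+ 2 != 0 by rewrite gt_eqF// den.
rewrite /hgt norm2_polar; have -> : 1 - k * sg k r ^+ 2 = ((1 - k * r ^+ 2) / (1 + k * r ^+ 2)) ^+ 2.
 by rewrite /sg; field.
by rewrite sqrtr_sqr ger0_norm// divr_ge0 ?num// ltW// den.
Qed.

Lemma chart_sg phi r : r \in `[- b, b] ->
 scale_pt (fun z => (1 + hgt k z)^-1) (polar phi (sg k r)) = polar phi r.
Proof.
move=> rb; have d0 : 1 + k * r ^+ 2 != 0 by rewrite gt_eqF// den.
rewrite /scale_pt hgt_sg//.
have -> : 1 + (1 - k * r ^+ 2) / (1 + k * r ^+ 2) = 2 / (1 + k * r ^+ 2) by field.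
by rewrite /polar /sg /=; congr (_, _); field; rewrite d0.
Qed.

Let sgN : sg k (- b) = - sg k b.
Proof. by rewrite /sg sqrrN mulrN mulNr. Qed.

Let sgb0 : 0 < sg k b.
Proof. by rewrite /sg divr_gt0// mulr_gt0. Qed.

Lemma measurable_sg : measurable_fun setT (sg k).
Proof.
apply: measurable_funM; first exact: measurable_funM.
apply: (measurableT_comp (@measurable_invr R)); apply: measurable_funD => //.
by apply: measurable_funM => //; apply: measurable_funX.
Qed.

Lemma measurable_dsg : measurable_fun setT (dsg k).
Proof.
apply: measurable_funM.
 by apply: measurable_funM => //; apply: measurable_funB => //; apply: measurable_funM => //; apply: measurable_funX.
apply: (measurableT_comp (@measurable_invr R)); apply: measurable_funX; apply: measurable_funD => //.
by apply: measurable_funM => //; apply: measurable_funX.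
Qed.

Let disc_ind b' : measurable_fun setT ((fun z => if norm2 z < b' ^+ 2 then 1 else 0) : TR * TR -> R).
Proof.
apply: measurable_fun_if => //.
by apply: measurable_fun_ltr => //; exact: measurable_norm2.
Qed.

(** In polar coordinates both charts preserve the lines through the origin, so the substitution r ->
    [sg k r] on each line suffices. On the sphere the condition b <= 1 restricts to the upper
    hemisphere. *)
Lemma upper_chart F : measurable_fun setT F -> (forall z, 0 <= F z)%E ->
 (\int[mu2]_w (((if (norm2 w < sg k b ^+ 2)%R then 1 else 0) / hgt k w)%:E *
   F (scale_pt (fun z => (1 + hgt k z)^-1)%R w)) =
  \int[mu2]_z (((if (norm2 z < b ^+ 2)%R then 1 else 0) * lam2 k z)%:E * F z))%E.
Proof.
move=> mF F0.
have mpsi := measurable_scale_pt (measurable_inv_hgt k).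
pose G w := (((if norm2 w < sg k b ^+ 2 then 1 else 0) / hgt k w)%:E *
   F (scale_pt (fun z => (1 + hgt k z)^-1)%R w))%E.
pose H z := (((if norm2 z < b ^+ 2 then 1 else 0) * lam2 k z)%:E * F z)%E.
have mG : measurable_fun setT (G : TR * TR -> \bar R).
 apply: emeasurable_funM; last exact: measurableT_comp.
 apply/measurable_EFinP; apply: measurable_funM; first exact: disc_ind.
 by apply: (measurableT_comp (@measurable_invr R)); exact: measurable_hgt.
have mH : measurable_fun setT (H : TR * TR -> \bar R).
 apply: emeasurable_funM => //.
 apply/measurable_EFinP; apply: measurable_funM; first exact: disc_ind.
 exact: measurable_lam2.
have G0 w : (0 <= G w)%E.
 by apply: mule_ge0 => //; rewrite lee_fin divr_ge0 ?sqrtr_ge0//; case: ifP.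
have H0 z : (0 <= H z)%E.
 by apply: mule_ge0 => //; rewrite lee_fin mulr_ge0 ?lam2_ge0//; case: ifP.
rewrite -/G -/H (ge0_polar mG G0) (ge0_polar mH H0).
apply: eq_integral => phi _.
have mp : measurable_fun setT (polar phi : TR -> TR * TR).
 by apply: measurable_fun_pair; exact: measurable_funM.
have mf : measurable_fun setT (fun r : TR => `|r|%:E * G (polar phi r))%E.
 apply: emeasurable_funM; last exact: measurableT_comp.
 by apply/measurable_EFinP; exact: (@normr_measurable _ setT).
have f0 r : (0 <= `|r|%:E * G (polar phi r))%E by rewrite mule_ge0// lee_fin.
have cut (b' : R) (X : R -> \bar R) : 0 < b' -> (forall r, ~~ (r ^+ 2 < b' ^+ 2) -> X r = 0%E) ->
 (\int[mu]_r X r = \int[mu]_(r in `](- b')%R, b'%R]) X r)%E.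
 move=> b'0 X0; rewrite [RHS]integral_mkcond; apply: eq_integral => r _.
 rewrite patchE; case: ifPn => // /negP h; apply: X0; apply/negP => r2; apply: h.
 by apply/mem_set; rewrite /= in_itv/=; apply/andP; split; nra.
rewrite (cut (sg k b))//; last first.
 by move=> r hr; rewrite /G norm2_polar (negbTE hr) mul0r mul0e mule0.
rewrite (cut b)//; last first.
 by move=> r hr; rewrite /H norm2_polar (negbTE hr) mul0r mul0e mule0.
rewrite -sgN (ge0_integral_increasing _ measurable_sg measurable_dsg sg_incr pieceD_sg)//; last 2 first.
- by rewrite (lt_trans _ b0)// oppr_lt0.
- move=> r rb; rewrite divr_ge0 ?exprn_ge0//; last by rewrite ltW// den.
 by rewrite mulr_ge0// num.
apply: eq_integral => r /set_mem/= rb'.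
have rb : r \in `[- b, b] by move: rb'; rewrite !in_itv/= => /andP[/ltW -> ->].
have d0 : 1 + k * r ^+ 2 != 0 by rewrite gt_eqF// den.
rewrite /G /H !norm2_polar chart_sg// hgt_sg//.
have bb : b \in `[- b, b] by rewrite in_itv/= lexx andbT (le_trans _ (ltW b0))// oppr_le0 ltW.
have -> : (sg k r ^+ 2 < sg k b ^+ 2) = (r ^+ 2 < b ^+ 2).
 have sg2 u : sg k u ^+ 2 = 4 * u ^+ 2 / (1 + k * u ^+ 2) ^+ 2 by rewrite /sg expr_div_n exprMn; congr (_ * _ / _); ring.
 apply/idP/idP => h.
  rewrite ltNge; apply/negP => h'; have e : r ^+ 2 = b ^+ 2 by apply/eqP; rewrite eq_le h' sqb.
  by move: h; rewrite !sg2 e ltxx.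
 have rn : `|r| < b by have h3 := b0; rewrite ltNge; apply/negP => h'; move: h; rewrite -(real_normK (num_real r)) => h4; nra.
 have rnb : `|r| \in `[- b, b] by rewrite in_itv/= (ltW rn) andbT (le_trans _ (normr_ge0 r))// oppr_le0 ltW.
 have := sg_incr rnb bb rn.
 have : 0 <= sg k `|r| by rewrite divr_ge0 ?mulr_ge0// ltW// den.
 have -> : sg k r ^+ 2 = sg k `|r| ^+ 2 by rewrite !sg2 real_normK// num_real.
 by move=> h1 h2; nra.
have [rlt|rge] := ltP (r ^+ 2) (b ^+ 2); last by rewrite !mul0r !mul0e !mule0.
have n0 : 1 - k * r ^+ 2 != 0.
 rewrite gt_eqF//; have hr := sqr_ge0 r.
 by case: hk kb1 => ->; rewrite ?mulN1r ?mul0r ?mul1r; lra.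
rewrite !muleA -!EFinM; congr (_%:E * _)%E.
rewrite /lam2 -norm2_cabs norm2_polar /dsg /sg normrM normfV (ger0_norm (ltW (den rb))) normrM ger0_norm//.
by field; rewrite d0 n0.
Qed.
End radial.

Lemma integral_lam2_disc k (a : R) : [\/ k = -1, k = 0 | k = 1] -> 0 < a -> (k = -1 -> a < 1) ->
 (\int[mu2]_z ((if (norm2 z < a ^+ 2)%R then 1 else 0) * lam2 k z)%:E =
  (4 * pi * a ^+ 2 / (1 + k * a ^+ 2))%:E)%E.
Proof.
move=> hk a0 ak.
pose rho := if k == -1 then (a + 1) / 2 else a + 1.
have arho : a < rho by rewrite /rho; case: eqP => [/ak|_]; lra.
have rho0 : 0 < rho by exact: lt_trans arho.
pose delta := if k == -1 then 1 - rho ^+ 2 else 1.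
have d0 : 0 < delta.
 by rewrite /delta /rho; case: eqP => [/ak a1|//]; rewrite subr_gt0; nra.
have dP r : 0 <= r -> r < rho -> delta <= 1 + k * r ^+ 2.
 move=> r0 rr; rewrite /delta; case: hk => kE; rewrite kE ?eqxx.
 - by rewrite mulN1r; nra.
 - by rewrite mul0r addr0; case: ifP => // _; rewrite gerBl sqr_ge0.
 - rewrite ifF; first by rewrite mul1r lerDl sqr_ge0.
  by apply/eqP => h; have : (0 : R) < 1 := ltr01; lra.
have [i1 i2] := radial_ftc d0 dP (ltW a0) arho.
rewrite ge0_polar; last 2 first.
- apply/measurable_EFinP; apply: measurable_funM; last exact: measurable_lam2.
 apply: measurable_fun_if => //.
 by apply: measurable_fun_ltr => //; exact: measurable_norm2.
- by move=> z; rewrite lee_fin mulr_ge0 ?lam2_ge0//; case: ifP.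
rewrite (eq_integral (cst (4 * a ^+ 2 / (1 + k * a ^+ 2))%:E)); last first.
 move=> phi _; rewrite -i2 /Rintegral fineK; last exact: integrable_fin_num i1.
 rewrite [RHS]integral_mkcond; apply: eq_integral => r _; rewrite patchE norm2_polar /lam2 -norm2_cabs norm2_polar.
 have -> : (r \in `](- a), a[%classic) = (r ^+ 2 < a ^+ 2).
  rewrite mem_setE in_itv/=; apply/idP/idP => [/andP[h1 h2]|h]; first by nra.
  by apply/andP; split; nra.
 case: ifP => [ra|_]; last by rewrite mul0r mule0.
 rewrite -EFinM; congr (_%:E); rewrite mul1r; congr (_ * _).
 have ra' : `|r| < rho by apply: le_lt_trans arho; rewrite ler_norml; apply/andP; split; nra.
 by rewrite indicE mem_set ?in_itv//= mul1r real_normK// num_real.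
rewrite integral_cst//= lebesgue_measure_itv/= lte_fin.
rewrite ifT; last by have := pi_gt0 R; lra.
rewrite -EFinB -EFinM; congr (_%:E).
by rewrite opprK -splitr; ring.
Qed.
End area_chart.

(** * Invariance of spherical area under rotations *)

Section area_rotation.
Context {R : realType}.
Notation mu := (@lebesgue_measure R).
Notation TR := (measurableTypeR R).
Notation mu2 := (mu \x mu)%E.
Implicit Types (x : R * R * R) (E : set (R * R * R)).

Definition rel_open (k : R) E : Prop :=
 E `<=` surface k /\ forall x, E x -> exists2 e, 0 < e & forall y, ball x e y -> surface k y -> E y.

Lemma rel_open_preimage k E (O : set (R * R)) (g : R * R -> R * R * R) : rel_open k E -> open O ->
 (forall q, O q -> {for q, continuous g}) -> (forall q, O q -> surface k (g q)) -> open (O `&` g @^-1` E).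
Proof.
move=> [_ Eo] oO cg gs; rewrite openE => q [Oq Eq]; have [e e0 eP] := Eo _ Eq.
have n1 : nbhs q O by exact: open_nbhs_nbhs.
have n2 : nbhs q (g @^-1` ball (g q) e) by apply: (cg q Oq); exact: nbhsx_ballx.
by apply: filterS (filterI n1 n2) => y [Oy By]; split => //; exact: eP By (gs _ Oy).
Qed.

Lemma integral_off2 (a b : R) (f g : R -> \bar R) : measurable_fun setT f -> measurable_fun setT g ->
 (forall x : R, x != a -> x != b -> f x = g x) -> (\int[mu]_x f x = \int[mu]_x g x)%E.
Proof.
move=> mf mg fg; apply: ae_eq_integral => //.
exists ([set a] `|` [set b]); split.
- by apply: measurableU; exact: measurable_set1.
- apply/eqP; rewrite -measure_le0; apply: le_trans (measureU2 _ _ _) _; try exact: measurable_set1.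
 rewrite le_eqVlt; apply/orP; left; apply/eqP; rewrite -[RHS]adde0.
 by congr (_ + _)%E; exact: lebesgue_measure_set1.
- move=> x /= /not_implyP[_ h]; have [->|xa] := eqVneq x a; first by left.
 have [->|xb] := eqVneq x b; first by right.
 by exfalso; apply: h; exact: fg.
Qed.

(** Cylindrical coordinates about the first axis. *)
Definition sph (q : R * R) : R * R * R :=
 ((q.1, Num.sqrt (1 - q.1 ^+ 2) * sin q.2), Num.sqrt (1 - q.1 ^+ 2) * cos q.2).

Lemma continuous_sph : continuous sph.
Proof.
have c1 : continuous (fun q : R * R => Num.sqrt (1 - q.1 ^+ 2)).
 move=> q; apply: (@cvg_comp _ _ _ (fun q : R * R => 1 - q.1 ^+ 2) (@Num.sqrt R) _ (nbhs (1 - q.1 ^+ 2))); last exact: sqrt_continuous.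
 apply: cvgB; first exact: cvg_cst.
 by rewrite expr2; under eq_fun do rewrite expr2; apply: cvgM; exact: cvg_fst.
move=> q; apply: cvg_pair_pt; first apply: cvg_pair_pt; first exact: cvg_fst.
- apply: cvgM; first exact: c1.
 by apply: (@cvg_comp _ _ _ snd (@sin R) _ (nbhs q.2)); [exact: cvg_snd|exact: continuous_sin].
- apply: cvgM; first exact: c1.
 by apply: (@cvg_comp _ _ _ snd (@cos R) _ (nbhs q.2)); [exact: cvg_snd|exact: continuous_cos].
Qed.

Lemma sph_surface q : q.1 ^+ 2 < 1 -> surface 1 (sph q).
Proof.
move=> q1; split => //=.
rewrite !exprMn sqr_sqrtr; last by lra.
have := cos2Dsin2 q.2; move: (cos _) (sin _) => C S h.
by transitivity (q.1 ^+ 2 + (1 - q.1 ^+ 2) * (C ^+ 2 + S ^+ 2)); [ring|rewrite h; ring].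
Qed.

Definition strip : set (R * R) := [set q | q.1 ^+ 2 < 1].

Lemma open_strip : open strip.
Proof.
apply: (@open_comp _ _ (fun q : R * R => q.1 ^+ 2) [set y | y < 1]); last exact: open_lt.
move=> q _; apply: (@cvg_comp _ _ _ fst (fun y : R => y ^+ 2) _ (nbhs q.1)); first exact: cvg_fst.
exact: exprn_continuous.
Qed.

Definition indE E x : R := if `[< E x >] then 1 else 0.

Definition disc1 : set (R * R) := [set w | 1 * (w.1 ^+ 2 + w.2 ^+ 2) < 1].

Lemma open_disc1 : open disc1.
Proof.
apply: (@open_comp _ _ (fun q : R * R => 1 * (q.1 ^+ 2 + q.2 ^+ 2)) [set y | y < 1]); last exact: open_lt.
move=> q _; apply: cvgM; first exact: cvg_cst.
by apply: cvgD; rewrite expr2; under eq_fun do rewrite expr2; apply: cvgM; (exact: cvg_fst || exact: cvg_snd).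
Qed.

Lemma continuous_height : continuous (@height R 1).
Proof.
move=> q; apply: (@cvg_comp _ _ _ (fun q : R * R => 1 - 1 * (q.1 ^+ 2 + q.2 ^+ 2)) (@Num.sqrt R) _ (nbhs (1 - 1 * (q.1 ^+ 2 + q.2 ^+ 2)))); last exact: sqrt_continuous.
apply: cvgB; first exact: cvg_cst.
apply: cvgM; first exact: cvg_cst.
by apply: cvgD; rewrite expr2; under eq_fun do rewrite expr2; apply: cvgM; (exact: cvg_fst || exact: cvg_snd).
Qed.

Definition dens E (w : R * R) : R :=
 if `[< disc1 w >] then (indE E (w, height 1 w) + indE E (w, - height 1 w)) / height 1 w else 0.

Lemma measurable_ind2 (A : set (R * R)) : open A ->
 measurable_fun setT ((fun q => if `[< A q >] then 1 else 0) : TR * TR -> R).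
Proof.
move=> oA; have -> : (fun q => if `[< A q >] then 1 else 0) = \1_A :> (TR * TR -> R).
 by apply/funext => q; rewrite indicE; case: asboolP => h; [rewrite mem_set|rewrite memNset].
by apply: measurable_indic; exact: open_measurable2.
Qed.

Lemma dens_ge0 E w : 0 <= dens E w.
Proof.
rewrite /dens /indE; case: ifP => // _; rewrite divr_ge0 ?sqrtr_ge0//.
by apply: addr_ge0; case: ifP.
Qed.

Lemma measurable_dens E : rel_open 1 E -> measurable_fun setT (dens E : TR * TR -> R).
Proof.
move=> Eo.
have surf (s : R) w : s ^+ 2 = 1 -> disc1 w -> surface 1 (w, s * height 1 w).
 move=> s1 wd; split => //=; rewrite exprMn s1 mul1r sqr_sqrtr; first by ring.
 by rewrite subr_ge0 ltW.
have m (s : R) : s ^+ 2 = 1 -> measurable_fun setT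
  ((fun w => if `[< (disc1 `&` (fun w => (w, s * height 1 w)) @^-1` E) w >] then 1 else 0) : TR * TR -> R).
 move=> s1; apply: measurable_ind2; apply: rel_open_preimage Eo open_disc1 _ (fun w => surf s w s1) => w _.
 apply: cvg_pair_pt; first exact: cvg_id.
 by apply: cvgM; [exact: cvg_cst|exact: continuous_height].
have mh : measurable_fun setT ((fun w => (height 1 w)^-1) : TR * TR -> R).
 exact: (measurableT_comp (@measurable_invr R) (measurable_hgt 1)).
have -> : dens E = (fun w => ((if `[< (disc1 `&` (fun w => (w, 1 * height 1 w)) @^-1` E) w >] then 1 else 0) +
  (if `[< (disc1 `&` (fun w => (w, -1 * height 1 w)) @^-1` E) w >] then 1 else 0)) * (height 1 w)^-1).
 apply/funext => w; rewrite /dens /indE; case: asboolP => wd; last first.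
  by rewrite !asboolF ?addr0 ?mul0r//= => -[].
 congr ((_ + _) * _).
  case: asboolP => h; first by rewrite asboolT//=; split; rewrite //= mul1r.
  by rewrite asboolF//= mul1r => -[].
 case: asboolP => h; first by rewrite asboolT//=; split; rewrite //= mulN1r.
 by rewrite asboolF//= mulN1r => -[].
apply: measurable_funM => //; apply: measurable_funD; apply: m; rewrite ?sqrrN expr1n//.
Qed.

Lemma areaE E : area 1 E = (\int[mu2]_w (dens E w)%:E)%E.
Proof.
rewrite /area integral_mkcond; apply: eq_integral => w _.
rewrite patchE /dens /indE !indicE.
have memb (T : Type) (A : set T) (y : T) : (y \in A) = `[< A y >].
 by apply/idP/asboolP => [/set_mem|/mem_set].
rewrite memb; case: asboolP => // wd; congr (_%:E).
by rewrite !memb; congr ((_ + _) / _); case: asboolP.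
Qed.

(** Archimedes' theorem: the area element is dx d psi. For fixed x, y = rho sin psi turns dy / z
    into d psi on the upper graph, and psi -> pi - psi accounts for the lower one. *)
Lemma area_cyl E : rel_open 1 E ->
 area 1 E = (\int[mu]_(x in `](-1)%R, 1%R[) \int[mu]_(psi in `](- (pi / 2))%R, (3 * (pi / 2))%R]) (indE E (sph (x, psi)))%:E)%E.
Proof.
move=> Eo; rewrite areaE fubini_plane; last 2 first.
- by apply/measurable_EFinP; exact: measurable_dens.
- by move=> w; rewrite lee_fin dens_ge0.
rewrite [RHS]integral_mkcond; apply: eq_integral => x _; rewrite patchE mem_setE in_itv/=.
have pip := pi_gt0 R.
case: ifPn => [/andP[x1 x2]|xn]; last first.
 rewrite (eq_integral (cst 0%E)) ?integral0// => y _; rewrite /dens asboolF//= => h.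
 by move/negP: xn; apply; move: h; rewrite /disc1 /= mul1r => h; have hy := sqr_ge0 y; apply/andP; split; nra.
have x21 : x ^+ 2 < 1 by nra.
pose rho := Num.sqrt (1 - x ^+ 2).
have rho0 : 0 < rho by rewrite sqrtr_gt0 subr_gt0.
have rho2 : rho ^+ 2 = 1 - x ^+ 2 by rewrite sqr_sqrtr// subr_ge0 ltW.
have mx : measurable_fun setT ((fun y => (x, y)) : TR -> TR * TR).
 by apply: measurable_fun_pair => //; exact: measurable_cst.
have mf : measurable_fun setT (fun y : R => (dens E (x, y))%:E).
 by apply/measurable_EFinP; exact: (measurableT_comp (measurable_dens Eo) mx).
pose J psi := indE E (sph (x, psi)).
have mJ : measurable_fun setT (J : TR -> R).
 have mS : measurable_fun setT ((fun q => if `[< (strip `&` sph @^-1` E) q >] then 1 else 0) : TR * TR -> R).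
  apply: measurable_ind2; apply: rel_open_preimage Eo open_strip _ _ => q qs; first exact: continuous_sph.
  exact: sph_surface.
 have -> : J = (fun y => if `[< (strip `&` sph @^-1` E) (x, y) >] then 1 else 0).
  apply/funext => y; rewrite /J /indE; case: asboolP => h; first by rewrite asboolT.
  by rewrite asboolF// => -[].
 exact: (measurableT_comp mS mx).
have J0 psi : 0 <= J psi by rewrite /J /indE; case: ifP.
transitivity (\int[mu]_(y in `](- rho)%R, rho]) (dens E (x, y))%:E)%E.
 rewrite [RHS]integral_mkcond; apply: eq_integral => y _; rewrite patchE.
 case: ifPn => // /negP h; rewrite /dens asboolF//= => yd; apply: h.
 by move: yd; rewrite /disc1 /= mul1r => yd; apply/mem_set; rewrite /= in_itv/=; apply/andP; split; nra.
pose g (psi : R) := rho * sin psi; pose dg (psi : R) := rho * cos psi.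
have g1 : g (pi / 2) = rho by rewrite /g sin_pihalf mulr1.
have g2 : g (- (pi / 2)) = - rho by rewrite /g sinN sin_pihalf mulrN mulr1.
have msin : measurable_fun setT (@sin R) by apply: continuous_measurable_fun; exact: continuous_sin.
have mcos : measurable_fun setT (@cos R) by apply: continuous_measurable_fun; exact: continuous_cos.
rewrite -{1}g2 -{1}g1 (ge0_integral_increasing (g := g) (dg := dg)) //; first last.
- by move=> y; rewrite lee_fin dens_ge0.
- by move=> psi; rewrite in_itv/= => hp; rewrite mulr_ge0 ?(ltW rho0)// cos_ge0_pihalf.
- split.
 + by apply: continuous_subspaceT => t; apply: cvgM; [exact: cvg_cst|exact: continuous_sin].
 + by exists dg => //; apply: continuous_subspaceT => t; apply: cvgM; [exact: cvg_cst|exact: continuous_cos].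
 + move=> t _; have h := is_deriveZ rho (is_derive_sin t); exact: h.
- move=> p q pb qb pq; rewrite /g ltr_pM2l//.
 have ms u : u \in `[- (pi / 2), pi / 2] -> sin u = cos (pi / 2 - u).
  by move=> _; rewrite cosB cos_pihalf sin_pihalf mul0r mul1r add0r.
 rewrite !ms//; move: pb qb; rewrite !in_itv/= => /andP[p1 p2] /andP[q1 q2].
 have m1 : pi / 2 - p \in `[0, pi] by rewrite in_itv/=; apply/andP; split; lra.
 have m2 : pi / 2 - q \in `[0, pi] by rewrite in_itv/=; apply/andP; split; lra.
 by rewrite (ltr_cos m2 m1); lra.
- exact: measurable_funM.
- exact: measurable_funM.
- by lra.
transitivity (\int[mu]_(psi in `](- (pi / 2))%R, (pi / 2)%R]) ((J psi)%:E + (J (pi - psi))%:E))%E.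
 have mJ' : measurable_fun setT (fun psi : R => J (pi - psi)).
  by apply: (measurableT_comp mJ); exact: measurable_funB.
 rewrite [LHS]integral_mkcond [RHS]integral_mkcond.
 apply: (@integral_off2 (pi / 2) (pi / 2)).
 - apply: (measurable_restrictT _ _).1 => //; apply: measurable_funTS.
  apply: emeasurable_funM; first by apply/measurable_EFinP; exact: measurable_funM.
  by apply: (measurableT_comp mf); exact: measurable_funM.
 - apply: (measurable_restrictT _ _).1 => //; apply: measurable_funTS.
  by apply: emeasurable_funD; exact/measurable_EFinP.
 - move=> psi pn _; rewrite !patchE mem_setE; case: ifP => //; rewrite in_itv/= => /andP[p1 p2].
  have p3 : psi < pi / 2 by rewrite lt_neqAle pn.
  have c0 : 0 < cos psi by apply: cos_gt0_pihalf; rewrite p1.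
  rewrite -EFinD -EFinM; congr (_%:E).
  have hE : height 1 (x, g psi) = rho * cos psi.
   rewrite /height /= /g; have -> : 1 - 1 * (x ^+ 2 + (rho * sin psi) ^+ 2) = (rho * cos psi) ^+ 2.
    have := cos2Dsin2 psi; move: (cos psi) (sin psi) => C S h.
    by rewrite !exprMn rho2; transitivity (1 - x ^+ 2 - (1 - x ^+ 2) * S ^+ 2); [ring|rewrite -[X in X - _ - _]h; nra].
   by rewrite sqrtr_sqr gtr0_norm// mulr_gt0.
  rewrite /dens hE asboolT; last first.
   rewrite /disc1 /= /g mul1r exprMn rho2; have := cos2Dsin2 psi.
   have : 0 < cos psi ^+ 2 by rewrite exprn_gt0.
   move: (cos psi ^+ 2) (sin psi ^+ 2) => C S C0 h; nra.
  rewrite /dg mulrC divfK; last by rewrite gt_eqF// mulr_gt0.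
  have -> : J (pi - psi) = indE E ((x, g psi), - (rho * cos psi)).
   have e1 : sin (pi - psi) = sin psi by rewrite sinB sinpi cospi; ring.
   have e2 : cos (pi - psi) = - cos psi by rewrite cosB sinpi cospi; ring.
   by rewrite /J /sph /= -/rho e1 e2 mulrN.
  by [].
rewrite ge0_integralD//; last 4 first.
- by move=> *; rewrite lee_fin.
- by apply: measurable_funTS; exact/measurable_EFinP.
- by move=> *; rewrite lee_fin.
- by apply: measurable_funTS; apply/measurable_EFinP; apply: (measurableT_comp mJ); exact: measurable_funB.
have -> : (\int[mu]_(psi in `](- (pi / 2))%R, (pi / 2)%R]) (J (pi - psi))%:E =
  \int[mu]_(psi in `](pi / 2)%R, (3 * (pi / 2))%R]) (J psi)%:E)%E.
 rewrite [RHS]integral_mkcond (@ge0_integral_affine _ (-1) pi); last 3 first.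
 - by rewrite oppr_eq0 oner_eq0.
 - by apply: (measurable_restrictT _ _).1 => //; apply: measurable_funTS; exact/measurable_EFinP.
 - by move=> y; rewrite patchE; case: ifP => // _; rewrite lee_fin.
 rewrite [LHS]integral_mkcond; apply: (@integral_off2 (- (pi / 2)) (pi / 2)).
 - apply: (measurable_restrictT _ _).1 => //; apply: measurable_funTS.
  by apply/measurable_EFinP; apply: (measurableT_comp mJ); exact: measurable_funB.
 - apply: measurable_funeM; apply: (measurableT_comp (_ : measurable_fun setT (_ \_ _))).
   by apply: (measurable_restrictT _ _).1 => //; apply: measurable_funTS; exact/measurable_EFinP.
  by apply: measurable_funD => //; exact: measurable_funM.
 - move=> psi p1 p2; rewrite !patchE !mem_setE !in_itv/= normrN1 mul1e mulN1r.
  have -> : - psi + pi = pi - psi by ring.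
  have -> : (- (pi / 2) < psi <= pi / 2) = (pi / 2 < pi - psi <= 3 * (pi / 2)).
   apply/idP/idP => /andP[h1 h2].
    have h3 : psi < pi / 2 by rewrite lt_neqAle p2.
    by apply/andP; split; lra.
   have h3 : - (pi / 2) < psi by rewrite lt_neqAle eq_sym p1/=; lra.
   by apply/andP; split; lra.
  by [].
rewrite -ge0_integral_setU//; last 3 first.
- by apply: measurable_funTS; exact/measurable_EFinP.
- by move=> *; rewrite lee_fin.
- apply/disj_setPS => y [] /=; rewrite !in_itv/= => /andP[_ h1] /andP[h2 _]; lra.
congr (integral _ _ _); apply/seteqP; split => y /=; rewrite !in_itv/=.
 by case=> /andP[h1 h2]; apply/andP; split; lra.
by move=> /andP[h1 h2]; have [h3|h3] := leP y (pi / 2); [left|right]; apply/andP; split; lra.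
Qed.

Lemma periodic_shift (J : R -> R) (theta : R) : measurable_fun setT J -> (forall y, 0 <= J y) ->
 (forall y, J (y + 2 * pi) = J y) -> 0 <= theta <= 2 * pi ->
 (\int[mu]_(y in `](- (pi / 2))%R, (3 * (pi / 2))%R]) (J (y + theta))%:E =
  \int[mu]_(y in `](- (pi / 2))%R, (3 * (pi / 2))%R]) (J y)%:E)%E.
Proof.
move=> mJ J0 Jp /andP[t0 t1]; have pip := pi_gt0 R.
have mJE : measurable_fun setT (fun y : R => (J y)%:E) by exact/measurable_EFinP.
have shift (a b t : R) : (\int[mu]_(y in `]a, b]) (J (y + t))%:E = \int[mu]_(y in `](a + t)%R, (b + t)%R]) (J y)%:E)%E.
 rewrite [RHS]integral_mkcond (@ge0_integral_affine _ 1 t); last 3 first.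
 - exact: oner_neq0.
 - by apply: (measurable_restrictT _ _).1 => //; exact: measurable_funTS.
 - by move=> y; rewrite patchE; case: ifP => // _; rewrite lee_fin.
 rewrite [LHS]integral_mkcond; apply: eq_integral => y _.
 by rewrite !patchE !mem_setE !in_itv/= normr1 mul1e mul1r ltrD2r lerD2r.
have cut (a b d : R) : a <= b -> b <= d ->
 (\int[mu]_(y in `]a, d]) (J y)%:E = \int[mu]_(y in `]a, b]) (J y)%:E + \int[mu]_(y in `]b, d]) (J y)%:E)%E.
 move=> ab bd; rewrite -ge0_integral_setU//; last 3 first.
 - exact: measurable_funTS.
 - by move=> *; rewrite lee_fin.
 - apply/disj_setPS => y [] /=; rewrite !in_itv/= => /andP[_ h1] /andP[h2 _]; lra.
 congr (integral _ _ _); apply/seteqP; split => y /=; rewrite !in_itv/=.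
  by move=> /andP[h1 h2]; have [h3|h3] := leP y b; [left|right]; apply/andP; split; lra.
 by case=> /andP[h1 h2]; apply/andP; split; lra.
rewrite shift (cut _ (3 * (pi / 2))); [|lra|lra].
rewrite [RHS](cut _ (- (pi / 2) + theta)); [|lra|lra].
rewrite addeC; congr (_ + _)%E.
have -> : 3 * (pi / 2) = - (pi / 2) + 2 * pi :> R by lra.
have -> : - (pi / 2) + 2 * pi + theta = - (pi / 2) + theta + 2 * pi :> R by ring.
by rewrite -(shift _ _ (2 * pi)); apply: eq_integral => y _; rewrite Jp.
Qed.

(** Together with [swap12], rotations about this single axis carry any point of the sphere to a
    pole. *)
Definition rotx (theta : R) x : R * R * R :=
 ((x.1.1, x.1.2 * cos theta - x.2 * sin theta), x.1.2 * sin theta + x.2 * cos theta).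

Definition swap12 x : R * R * R := ((x.1.2, x.1.1), x.2).

(** In the coordinates of [sph] the rotation is a shift of psi, and the integral over a full period
    is invariant under shifts. *)
Lemma area_rotx E theta : rel_open 1 E -> rel_open 1 (rotx theta @^-1` E) -> 0 <= theta <= 2 * pi ->
 area 1 (rotx theta @^-1` E) = area 1 E.
Proof.
move=> Eo Eo' tt; rewrite (area_cyl Eo) (area_cyl Eo'); apply: eq_integral => x; rewrite mem_setE in_itv/= => /andP[x1 x2].
pose J psi := indE E (sph (x, psi)).
have tp : 0 <= 2 * pi - theta <= 2 * pi by move: tt => /andP[h1 h2]; apply/andP; split; lra.
have Jp y : J (y + 2 * pi) = J y.
 have e1 : sin (y + 2 * pi) = sin y by rewrite (sinD y (2 * pi)) [2 * pi]mulr_natl sin2pi cos2pi; ring.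
 have e2 : cos (y + 2 * pi) = cos y by rewrite (cosD y (2 * pi)) [2 * pi]mulr_natl sin2pi cos2pi; ring.
 by rewrite /J /sph /= e1 e2.
have mJ : measurable_fun setT (J : TR -> R).
 have mx : measurable_fun setT ((fun y => (x, y)) : TR -> TR * TR).
  by apply: measurable_fun_pair => //; exact: measurable_cst.
 have mS : measurable_fun setT ((fun q => if `[< (strip `&` sph @^-1` E) q >] then 1 else 0) : TR * TR -> R).
  apply: measurable_ind2; apply: rel_open_preimage Eo open_strip _ _ => q qs; first exact: continuous_sph.
  exact: sph_surface.
 have -> : J = (fun y => if `[< (strip `&` sph @^-1` E) (x, y) >] then 1 else 0).
  apply/funext => y; rewrite /J /indE; case: asboolP => h; last by rewrite asboolF// => -[].
  by rewrite asboolT//; split => //; rewrite /strip /=; nra.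
 exact: (measurableT_comp mS mx).
have J0 psi : 0 <= J psi by rewrite /J /indE; case: ifP.
rewrite -(periodic_shift mJ J0 Jp tp); apply: eq_integral => psi _; congr (_%:E).
have -> : J (psi + (2 * pi - theta)) = J (psi - theta) by rewrite -(Jp (psi - theta)); congr J; ring.
rewrite /J /indE; suff -> : sph (x, psi - theta) = rotx theta (sph (x, psi)) by [].
rewrite /sph /rotx /= sinB cosB.
by congr (_, _, _); ring.
Qed.

(** The density of the graph chart is symmetric in x and y, so Tonelli's theorem suffices. *)
Lemma area_swap E : rel_open 1 E -> rel_open 1 (swap12 @^-1` E) -> area 1 (swap12 @^-1` E) = area 1 E.
Proof.
move=> Eo Eo'; rewrite !areaE.
have mf := measurable_dens Eo.
have f0 (w : R * R) : (0 <= (dens E w)%:E)%E by rewrite lee_fin dens_ge0.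
have mfE : measurable_fun setT (EFin \o dens E : TR * TR -> \bar R) by exact/measurable_EFinP.
rewrite [RHS](fubini_plane mfE f0) fubini_plane; last 2 first.
- by apply/measurable_EFinP; exact: measurable_dens.
- by move=> w; rewrite lee_fin dens_ge0.
rewrite [RHS](@fubini_tonelli _ _ TR TR R mu mu _ mfE f0).
apply: eq_integral => x _; apply: eq_integral => y _; congr (_%:E).
rewrite /dens /height /indE /disc1 /= [y ^+ 2 + x ^+ 2]addrC.
by [].
Qed.
End area_rotation.

(** * Area of a subset of the surface, computed in the stereographic chart *)

Section area_in_chart.
Context {R : realType}.
Notation mu := (@lebesgue_measure R).
Notation TR := (measurableTypeR R).
Notation mu2 := (mu \x mu)%E.
Implicit Types (k : R) (w z : R * R) (E W G : set (R * R * R)).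

Definition chart_set k E : set (R * R) := [set z | 0 < 1 + k * norm2 z /\ E (emb k z)].

Definition ind (D : set (R * R)) z : R := if `[< D z >] then 1 else 0.

Lemma ind_ge0 D z : 0 <= ind D z.
Proof. by rewrite /ind; case: ifP. Qed.

Lemma measurable_ind D : measurable (D : set (TR * TR)) -> measurable_fun setT (ind D : TR * TR -> R).
Proof.
move=> mD; have -> : ind D = \1_D.
 by apply/funext => z; rewrite indicE /ind; case: asboolP => h; [rewrite mem_set|rewrite memNset].
exact: measurable_indic.
Qed.

Lemma surface_height k w : k * norm2 w < 1 -> surface k (w, hgt k w) /\ 0 < hgt k w.
Proof.
move=> wk; have h0 : 0 < hgt k w by rewrite sqrtr_gt0 subr_gt0.
split=> //; split => //=; rewrite sqr_sqrtr ?subr_ge0 ?ltW// /norm2; ring.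
Qed.

Lemma chart_set_chart k E x : [\/ k = -1, k = 0 | k = 1] -> surface k x -> 0 < 1 + x.2 ->
 chart_set k E (chart x) <-> E x.
Proof.
move=> hk xs x0; have [e1 _ e3] := chart_surface hk xs x0.
rewrite /chart_set /= e3 norm2_cabs e1 divr_gt0//.
by split => [[]|].
Qed.

Lemma emb_norm2 k z : norm2 (emb k z).1 = 4 * norm2 z / (1 + k * norm2 z) ^+ 2.
Proof. by rewrite /emb /norm2 /= /lamC -norm2_cabs /norm2 -exprVn; ring. Qed.

(** For these k the surface is a single graph, so [upper_chart] on the disc of radius M covers the
    whole set. *)
Lemma area_chart_lt k E (M : R) : k = -1 \/ k = 0 -> E `<=` surface k ->
 measurable (chart_set k E : set (TR * TR)) -> 0 < M -> (k = -1 -> M < 1) ->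
 (forall z, chart_set k E z -> norm2 z < M ^+ 2) ->
 area k E = (\int[mu2]_z (ind (chart_set k E) z * lam2 k z)%:E)%E.
Proof.
move=> hk Es mD M0 kM DM.
have hk3 : [\/ k = -1, k = 0 | k = 1] by case: hk; [constructor 1|constructor 2].
have M20 : 0 < M ^+ 2 by rewrite exprn_gt0.
have M21 : k = -1 -> M ^+ 2 < 1 by move=> /kM; nra.
have kn1 : k <> 1 by have : (0 : R) < 1 := ltr01; case: hk => ->; lra.
have b1 : 0 <= 1 - k * M ^+ 2 by case: hk => ->; rewrite ?mulN1r ?mul0r; lra.
have b2 : 0 < 1 + k * M ^+ 2.
 by case: hk => kE; rewrite kE ?mulN1r ?mul0r ?addr0//; have := M21 kE; lra.
have mF : measurable_fun setT ((fun z => (ind (chart_set k E) z)%:E) : TR * TR -> \bar R).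
 by apply/measurable_EFinP; exact: measurable_ind.
have := upper_chart hk3 M0 b1 b2 mF (fun z => ind_ge0 (chart_set k E) z).
move=> up; transitivity (\int[mu2]_z (((if (norm2 z < M ^+ 2)%R then 1 else 0) * lam2 k z)%:E * (ind (chart_set k E) z)%:E))%E; last first.
 apply: eq_integral => z _; rewrite -EFinM; congr (_%:E); rewrite /ind.
 by case: asboolP => [/DM ->|_]; [rewrite mulr1|rewrite mulr0 mul0r].
rewrite -up /area integral_mkcond; apply: eq_integral => w _; rewrite patchE.
have wk : k * norm2 w < 1.
 by have := norm2_ge0 w; case: hk => ->; rewrite ?mulN1r ?mul0r//; lra.
rewrite mem_set//=; have [ws h0] := surface_height wk.
rewrite -[height k w]/(hgt k w) -EFinM; congr (_%:E).
have -> : \1_E (w, - hgt k w) = 0 :> R.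
 by rewrite indicE memNset// => /Es[_ /(_ kn1)] /=; lra.
rewrite addr0 indicE.
have h1 : 0 < 1 + hgt k w by lra.
have cE := chart_set_chart E hk3 ws h1.
rewrite /ind -[scale_pt _ w]/(chart (w, hgt k w)).
case: asboolP => hD; last first.
 by rewrite memNset ?mul0r ?mulr0// => /cE.
have Ew := cE.1 hD; rewrite mem_set// mulr1.
rewrite ifT//; have [_ _ eE] := chart_surface hk3 ws h1.
have -> : norm2 w = norm2 (emb k (chart (w, hgt k w))).1 by rewrite eE.
have nM := DM _ hD; have nd := hD.1; have n0 := norm2_ge0 (chart (w, hgt k w)).
rewrite emb_norm2 /sg expr_div_n exprMn.
move: (norm2 (chart _)) n0 nM nd => n n0 nM nd; move: (M ^+ 2) M20 M21 b2 nM => m m0 m1 b2 nM.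
rewrite ltr_pdivrMr ?exprn_gt0// mulrAC ltr_pdivlMr ?exprn_gt0// -subr_gt0.
have -> : 2 ^+ 2 * m * (1 + k * n) ^+ 2 - 4 * n * (1 + k * m) ^+ 2 = 4 * ((m - n) * (1 - k ^+ 2 * (m * n))) by ring.
rewrite !mulr_gt0 ?subr_gt0//; case: hk => kE; rewrite kE ?expr0n ?mul0r//= sqrrN expr1n mul1r.
by have := m1 kE; nra.
Qed.

(** Inversion in the unit circle, which is the exchange of the two hemispheres seen in the chart. *)
Definition inv_pt z : R * R := scale_pt (fun z => (norm2 z)^-1) z.

Lemma inv_pt_polar phi r : r != 0 -> inv_pt (polar phi r) = polar phi r^-1.
Proof.
by move=> r0; rewrite /inv_pt /scale_pt norm2_polar /polar /=; congr (_, _); field.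
Qed.

(** The measure with density |r| lam2 on a line through the origin is invariant under r -> 1/r, so
    the part with |r| > 1 may be folded into |r| < 1. *)
Lemma inversion_radial (D : set (R * R)) (M phi : R) : measurable (D : set (TR * TR)) -> 0 < M ->
 (forall z, D z -> norm2 z < M ^+ 2) ->
 let q r := `|r| * (ind D (polar phi r) * lam2 1 (polar phi r)) in
 let p r := `|r| * ((if norm2 (polar phi r) == 0 then 0 else ind D (inv_pt (polar phi r))) * lam2 1 (polar phi r)) in
 (\int[mu]_r ((if (r ^+ 2 < 1)%R then 1 else 0)%:E * (q r)%:E) +
  \int[mu]_r ((if (r ^+ 2 < 1)%R then 1 else 0)%:E * (p r)%:E) = \int[mu]_r (q r)%:E)%E.
Proof.
move=> mD M0 DM q p.
(* The set stays within radius N, so its inverse stays outside radius b = 1/N and the substitution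
   avoids 0. *)
pose N := M + 1; pose b := N^-1.
have N1 : 1 < N by rewrite /N; lra.
have N0 : 0 < N by lra.
have b0 : 0 < b by rewrite invr_gt0.
have b1 : b < 1 by rewrite invf_lt1.
have qE r : q r = `|r| * ind D (polar phi r) * (4 / (1 + r ^+ 2) ^+ 2).
 by rewrite /q /lam2 -norm2_cabs norm2_polar mul1r mulrA.
have pE r : r != 0 -> p r = `|r| * ind D (polar phi r^-1) * (4 / (1 + r ^+ 2) ^+ 2).
 move=> r0; rewrite /p norm2_polar sqrf_eq0 (negbTE r0) inv_pt_polar//.
 by rewrite /lam2 -norm2_cabs norm2_polar mul1r mulrA.
have Dz r : N <= `|r| -> ind D (polar phi r) = 0.
 move=> rN; rewrite /ind asboolF// => /DM; rewrite norm2_polar -(real_normK (num_real r)).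
 by move: rN; rewrite /N; nra.
have q0 r : 0 <= q r by rewrite qE !mulr_ge0 ?ind_ge0// invr_ge0 exprn_ge0// addr_ge0 ?sqr_ge0.
have p0 r : 0 <= p r.
 by rewrite /p mulr_ge0// mulr_ge0 ?lam2_ge0//; case: ifP => // _; exact: ind_ge0.
have mp : measurable_fun setT (polar phi : TR -> TR * TR).
 by apply: measurable_fun_pair; exact: measurable_funM.
have mn := @normr_measurable R setT.
have mL : measurable_fun setT (fun r : R => lam2 1 (polar phi r)).
 exact: (measurableT_comp (@measurable_lam2 R 1) mp).
have mq : measurable_fun setT q.
 apply: measurable_funM => //; apply: measurable_funM => //.
 exact: (measurableT_comp (measurable_ind mD) mp).
have minv : measurable_fun setT (inv_pt : TR * TR -> TR * TR).
 apply: measurable_scale_pt; apply: (measurableT_comp (@measurable_invr R)); exact: measurable_norm2.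
have mpp : measurable_fun setT p.
 apply: measurable_funM => //; apply: measurable_funM => //.
 apply: measurable_fun_if => //.
 - by apply: measurable_fun_eqr => //; exact: (measurableT_comp measurable_norm2 mp).
 - apply: measurable_funTS; apply: (measurableT_comp (measurable_ind mD)).
  exact: (measurableT_comp minv mp).
have msq : measurable_fun setT (fun r : R => if r ^+ 2 < 1 then 1 else 0 : R).
 by apply: measurable_fun_if => //; apply: measurable_fun_ltr => //; exact: measurable_funX.
have mE (f : R -> R) : measurable_fun setT f -> measurable_fun setT (fun r : R => (f r)%:E).
 by move=> mf; exact/measurable_EFinP.
have mr (A : set R) (f : R -> R) : measurable A -> measurable_fun setT f ->
  measurable_fun setT ((fun r : R => (f r)%:E) \_ A).
 by move=> mA mf; apply: (measurable_restrictT _ _).1 => //; apply: measurable_funTS; exact: mE.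
have mpN : measurable_fun setT (fun r : R => p (- r)).
 by apply: (measurableT_comp mpp); exact: measurable_funN.
(* The increasing map r -> - 1/r is used in place of r -> 1/r, hence the argument - r. *)
have inv (a d : R) : a < d -> 0 \notin `[a, d] ->
 (\int[mu]_(y in `](- a^-1)%R, (- d^-1)%R]) (q y)%:E = \int[mu]_(r in `]a, d]) (p (- r))%:E)%E.
 move=> ad n0.
 have nz r : r \in `[a, d] -> r != 0 by move=> h; apply: contraNneq n0 => <-.
 have a0 : a != 0 by apply: nz; rewrite in_itv/= lexx ltW.
 have d0 : d != 0 by apply: nz; rewrite in_itv/= lexx andbT ltW.
 have sgn r : r \in `[a, d] -> 0 < a * r /\ 0 < r * d.
  move=> rb; move: rb n0; rewrite !in_itv/= negb_and -!ltNge => /andP[h1 h2] /orP[h|h].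
   by split; apply: mulr_gt0; lra.
  by split; rewrite -mulrNN; apply: mulr_gt0; lra.
 rewrite (ge0_integral_increasing (g := fun r => - r^-1) (dg := fun r => (r ^+ 2)^-1)) //; first last.
 - exact: mE.
 - by move=> r _; rewrite invr_ge0 sqr_ge0.
 - split.
  + apply: (@within_continuous_comp _ _ _ _ (fun r : R => r) (fun r : R => - r^-1)); last first.
    by apply: continuous_subspaceT => t; exact: cvg_id.
   by move=> _ /set_mem[t tb <-]; apply: cvgN; apply: cvgV; [exact: nz|exact: cvg_id].
  + exists (fun r => (r ^+ 2)^-1) => //; apply: (@within_continuous_comp _ _ _ _ (fun r : R => r) (fun r : R => (r ^+ 2)^-1)); last first.
    by apply: continuous_subspaceT => t; exact: cvg_id.
   move=> _ /set_mem[t tb <-]; apply: cvgV; first by rewrite sqrf_eq0 nz.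
   exact: exprn_continuous.
  + move=> t /subset_itv_oo_cc tb; have t0 := nz t tb.
   have h := is_deriveN (is_deriveV (f := fun r : R => r) t0 (is_derive_id t (1 : R))).
   apply: (@is_derive_eq _ _ _ (fun r : R => - r^-1) _ _ _ _ h); rewrite /GRing.scale/=.
   by field.
 - move=> x y xb yb xy; have [h1 h2] := sgn x xb; have [h3 h4] := sgn y yb.
  have x0 := nz x xb; have y0 := nz y yb.
  rewrite ltrN2 -subr_gt0; have -> : x^-1 - y^-1 = (y - x) / (x * y) by field; rewrite x0 y0.
  rewrite divr_gt0 ?subr_gt0//.
  move: n0; rewrite in_itv/= negb_and -!ltNge; move: xb yb; rewrite !in_itv/= => /andP[x1 x2] /andP[y1 y2] /orP[h|h]; nra.
 - by apply: (measurableT_comp (@measurable_invr R)); exact: measurable_funX.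
 - by apply: measurable_funN; exact: measurable_invr.
 apply: eq_integral => r /set_mem/=; rewrite in_itv/= => /andP[r1 r2].
 have r0 : r != 0 by apply: nz; rewrite in_itv/= r2 (ltW r1).
 rewrite -EFinM; congr (_%:E); rewrite qE pE ?oppr_eq0// !normrN normfV invrN sqrrN.
 have s0 : `|r| != 0 by rewrite normr_eq0.
 rewrite sqrrN exprVn -!(real_normK (num_real r)); field.
 by rewrite s0 gt_eqF //= ltr_wpDl ?sqr_ge0// ltr01.
have -> : (\int[mu]_r ((if (r ^+ 2 < 1)%R then 1 else 0)%:E * (q r)%:E) = \int[mu]_(r in `](-1)%R, 1%R]) (q r)%:E)%E.
 rewrite [RHS]integral_mkcond; apply: (@integral_off2 _ 1 1).
 - by apply: emeasurable_funM; exact: mE.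
 - exact: mr.
 - move=> r r1 _; rewrite patchE mem_setE in_itv/=.
  have -> : (-1 < r <= 1) = (r ^+ 2 < 1).
   apply/idP/idP => [/andP[h1 h2]|h]; last by apply/andP; split; nra.
   by have h3 : r < 1 by [rewrite lt_neqAle r1]; nra.
  by case: ifP; rewrite ?mul1e ?mul0e.
have -> : (\int[mu]_r ((if (r ^+ 2 < 1)%R then 1 else 0)%:E * (p r)%:E) =
  \int[mu]_(r in `](-1)%R, (- b)%R]) (p (- r))%:E + \int[mu]_(r in `]b, 1%R]) (p (- r))%:E)%E.
 rewrite (@ge0_integral_affine _ (-1) 0); last 3 first.
 - by rewrite oppr_eq0 oner_eq0.
 - by apply: emeasurable_funM; exact: mE.
 - by move=> r; rewrite mule_ge0 ?lee_fin//; case: ifP.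
 rewrite -ge0_integral_setU//; last 3 first.
 - by apply: measurable_funTS; exact: mE.
 - by move=> *; rewrite lee_fin.
 - apply/disj_setPS => y [] /=; rewrite !in_itv/= => /andP[_ h1] /andP[h2 _]; lra.
 rewrite [RHS]integral_mkcond; apply: (@integral_off2 _ 1 1).
 - apply: measurable_funeM; apply: emeasurable_funM; apply: mE.
   by apply: (measurableT_comp msq); apply: measurable_funD => //; exact: measurable_funM.
  by apply: (measurableT_comp mpp); apply: measurable_funD => //; exact: measurable_funM.
 - by apply: mr => //; exact: measurableU.
 - move=> r r1 _; rewrite normrN1 mul1e mulN1r addr0 sqrrN patchE.
  have [r2|r2] := ltP (r ^+ 2) 1; last first.
   rewrite mul0e memNset//= !in_itv/= => -[/andP[h1 h2]|/andP[h1 h2]]; first by nra.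
   by have h3 : r < 1 by [rewrite lt_neqAle r1]; nra.
  rewrite mul1e; case: ifPn => // /negP h.
  have rb : `|r| <= b.
   rewrite leNgt; apply/negP => h'; apply: h; apply/mem_set => /=; rewrite !in_itv/=.
   have [r3|r3] := leP 0 r.
    by right; move: h'; rewrite ger0_norm// => ->; nra.
   left; move: h'; rewrite ltr0_norm// => h'; apply/andP; split; first by nra.
   by lra.
  congr (_%:E); have [->|r0] := eqVneq r 0; first by rewrite /p oppr0 normr0 mul0r.
  rewrite pE ?oppr_eq0// Dz ?mulr0 ?mul0r// normfV normrN.
  by rewrite -[N]invrK lef_pV2// posrE ?normr_gt0.
have e1 := @inv (-1) (- b) _ _; have e2 := @inv b 1 _ _.
rewrite -e1 -?e2; last 4 first.
- exact: b1.
- by rewrite in_itv/= negb_and -!ltNge b0.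
- by rewrite ltrN2.
- by rewrite in_itv/= negb_and -!ltNge oppr_lt0 b0 orbT.
rewrite !invrN !opprK invr1 /b invrK.
rewrite addeC -addeA -ge0_integral_setU//; last 3 first.
- by apply: measurable_funTS; exact: mE.
- by move=> *; rewrite lee_fin.
- apply/disj_setPS => y [] /=; rewrite !in_itv/= => /andP[_ h1] /andP[h2 _]; lra.
rewrite -ge0_integral_setU//; last 4 first.
- exact: measurableU.
- by apply: measurable_funTS; exact: mE.
- by move=> *; rewrite lee_fin.
- apply/disj_setPS => y [] /=; rewrite !in_itv/= => /andP[h1 h2] [/andP[h3 h4]|/andP[h3 h4]]; lra.
rewrite integral_mkcond; apply: eq_integral => r _; rewrite patchE; case: ifPn => // /negP h.
congr (_%:E); rewrite qE Dz ?mulr0 ?mul0r//; rewrite leNgt; apply/negP => h'; apply: h; apply/mem_set => /=.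
rewrite !in_itv/=; move: h'; rewrite ltr_norml => /andP[h1 h2].
have [h3|h3] := leP r (-1); first by right; left; apply/andP; split; lra.
have [h4|h4] := leP r 1; first by right; right; apply/andP; split; lra.
by left; apply/andP; split; lra.
Qed.

(** The upper hemisphere is the unit disc of the chart and the lower one is brought there by
    inversion; [inversion_radial] adds the two contributions. *)
Lemma area_chart_sphere E (M : R) : E `<=` surface 1 -> ~ E ((0, 0), -1) ->
 measurable (chart_set 1 E : set (TR * TR)) -> 0 < M ->
 (forall z, chart_set 1 E z -> norm2 z < M ^+ 2) ->
 area 1 E = (\int[mu2]_z (ind (chart_set 1 E) z * lam2 1 z)%:E)%E.
Proof.
move=> Es ES mD M0 DM.
have hk3 : [\/ (1 : R) = -1, (1 : R) = 0 | (1 : R) = 1] by constructor 3.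
have b1 : (0 : R) <= 1 - 1 * 1 ^+ 2 by rewrite expr1n mul1r subrr.
have b2 : (0 : R) < 1 + 1 * 1 ^+ 2 by rewrite expr1n mul1r; lra.
set D := chart_set 1 E in mD DM *.
pose F z := if norm2 z == 0 then 0 else ind D (inv_pt z).
have F0 z : 0 <= F z by rewrite /F; case: ifP => // _; exact: ind_ge0.
have minv : measurable_fun setT (inv_pt : TR * TR -> TR * TR).
 apply: measurable_scale_pt; apply: (measurableT_comp (@measurable_invr R)); exact: measurable_norm2.
have mF : measurable_fun setT (F : TR * TR -> R).
 apply: measurable_fun_if => //.
 - by apply: measurable_fun_eqr => //; exact: measurable_norm2.
 - by apply: measurable_funTS; exact: (measurableT_comp (measurable_ind mD) minv).
have mi := measurable_ind mD.
have mFE : measurable_fun setT ((fun z => (F z)%:E) : TR * TR -> \bar R) by exact/measurable_EFinP.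
have miE : measurable_fun setT ((fun z => (ind D z)%:E) : TR * TR -> \bar R) by exact/measurable_EFinP.
have sg1 : sg (1 : R) 1 ^+ 2 = 1 by rewrite /sg expr1n !mulr1 divff ?expr1n// pnatr_eq0.
have mif (b' : R) : measurable_fun setT ((fun z => if norm2 z < b' then 1 else 0) : TR * TR -> R).
 by apply: measurable_fun_if => //; apply: measurable_fun_ltr => //; exact: measurable_norm2.
have mw (f : R * R -> R) : measurable_fun setT (f : TR * TR -> R) ->
  measurable_fun setT ((fun w => ((if norm2 w < sg 1 1 ^+ 2 then 1 else 0) / hgt 1 w)%:E *
   (f (scale_pt (fun z => (1 + hgt 1 z)^-1)%R w))%:E)%E : TR * TR -> \bar R).
 move=> mf; apply: emeasurable_funM; apply/measurable_EFinP.
  apply: measurable_funM; first exact: mif.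
  by apply: (measurableT_comp (@measurable_invr R)); exact: measurable_hgt.
 apply: (measurableT_comp mf); apply: measurable_scale_pt; exact: measurable_inv_hgt.
have mz (f : R * R -> R) : measurable_fun setT (f : TR * TR -> R) ->
  measurable_fun setT ((fun z => ((if norm2 z < 1 ^+ 2 then 1 else 0) * lam2 1 z)%:E * (f z)%:E)%E : TR * TR -> \bar R).
 move=> mf; apply: emeasurable_funM; apply/measurable_EFinP => //.
 by apply: measurable_funM; [exact: mif|exact: measurable_lam2].
have pw (f : R * R -> R) : (forall z, 0 <= f z) -> forall w, (0 <= ((if norm2 w < sg 1 1 ^+ 2 then 1 else 0) / hgt 1 w)%:E *
   (f (scale_pt (fun z => (1 + hgt 1 z)^-1)%R w))%:E)%E.
 by move=> f0 w; rewrite mule_ge0 ?lee_fin// divr_ge0 ?sqrtr_ge0//; case: ifP.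
have pz (f : R * R -> R) : (forall z, 0 <= f z) -> forall z, (0 <= ((if norm2 z < 1 ^+ 2 then 1 else 0) * lam2 1 z)%:E * (f z)%:E)%E.
 by move=> f0 z; rewrite mule_ge0 ?lee_fin// mulr_ge0 ?lam2_ge0//; case: ifP.
transitivity (\int[mu2]_w (((if (norm2 w < sg 1 1 ^+ 2)%R then 1 else 0) / hgt 1 w)%:E *
   (ind D (scale_pt (fun z => (1 + hgt 1 z)^-1)%R w))%:E) +
  \int[mu2]_w (((if (norm2 w < sg 1 1 ^+ 2)%R then 1 else 0) / hgt 1 w)%:E *
   (F (scale_pt (fun z => (1 + hgt 1 z)^-1)%R w))%:E))%E.
 transitivity (\int[mu2]_w (((if (norm2 w < sg 1 1 ^+ 2)%R then 1 else 0) / hgt 1 w)%:E *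
   (ind D (scale_pt (fun z => (1 + hgt 1 z)^-1)%R w))%:E + ((if (norm2 w < sg 1 1 ^+ 2)%R then 1 else 0) / hgt 1 w)%:E *
   (F (scale_pt (fun z => (1 + hgt 1 z)^-1)%R w))%:E))%E; last first.
  rewrite ge0_integralD//.
  - by move=> w _; exact: pw (ind_ge0 D) w.
  - exact: mw.
  - by move=> w _; exact: pw F0 w.
  - exact: mw.
 rewrite /area integral_mkcond; apply: eq_integral => w _; rewrite patchE sg1.
 have [wk|wk] := ltP (norm2 w) 1; last first.
  by rewrite !mul0r !mul0e adde0 memNset//= mul1r; apply/negP; rewrite -leNgt.
 rewrite mem_set//=; last by rewrite mul1r.
 rewrite -[height 1 w]/(hgt 1 w) -!EFinM -EFinD; congr (_%:E).
 have wk1 : 1 * norm2 w < 1 by rewrite mul1r.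
 have [ws h0] := surface_height wk1.
 have h1 : 0 < 1 + hgt 1 w by lra.
 have cE := chart_set_chart E hk3 ws h1.
 rewrite mulrDl mul1r; congr (_ + _); rewrite mulrC; congr (_ * _).
  rewrite indicE /ind -[scale_pt _ w]/(chart (w, hgt 1 w)).
  by case: asboolP => hD; [rewrite mem_set//; exact/cE|rewrite memNset// => /cE].
 have hh : hgt 1 w ^+ 2 = 1 - norm2 w by rewrite sqr_sqrtr mul1r// subr_ge0 ltW.
 have hle : hgt 1 w <= 1 by have := norm2_ge0 w; nra.
 rewrite indicE /F; set h := hgt 1 w in hh hle h0 h1 *.
 have nE : norm2 (scale_pt (fun z => (1 + hgt 1 z)^-1) w) = (1 - h) / (1 + h).
  rewrite /norm2 /scale_pt /= -/h !exprMn -mulrDl -[_ + _]/(norm2 w).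
  have -> : norm2 w = (1 - h) * (1 + h) by transitivity (1 - h ^+ 2); [rewrite hh; ring|ring].
  by field; rewrite gt_eqF.
 (* At h = 1 the point w is the origin, where [F] takes the value 0; the point below it is the south
    pole, which E omits. *)
 rewrite nE; have [e|hn] := eqVneq h 1.
  rewrite e subrr mul0r eqxx; have n0 : norm2 w = 0 by move: hh; rewrite e; lra.
  rewrite memNset// => EN; apply: ES; have := sqr_ge0 w.1; have := sqr_ge0 w.2.
  move: n0; rewrite /norm2 => n0 h3 h4.
  have /eqP : w.1 ^+ 2 = 0 by lra.
  have /eqP : w.2 ^+ 2 = 0 by lra.
  rewrite !sqrf_eq0 => /eqP w2 /eqP w1; move: EN; rewrite (surjective_pairing w) w1 w2.
  by [].
 have hlt : h < 1 by rewrite lt_neqAle hn.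
 rewrite mulf_eq0 invr_eq0 subr_eq0 eq_sym (negbTE hn) (gt_eqF h1) /=.
 have ws' : surface 1 (w, - h).
  by split => //=; have [+ _] := ws; rewrite /= sqrrN.
 have h1' : 0 < 1 + - h by lra.
 have cE' := chart_set_chart E hk3 ws' h1'.
 have -> : inv_pt (scale_pt (fun z => (1 + hgt 1 z)^-1) w) = chart (w, - h).
  rewrite /inv_pt {1}/scale_pt nE /scale_pt /chart /= -/h.
  by congr (_, _); field; rewrite (gt_eqF h1) gt_eqF.
 by rewrite /ind; case: asboolP => hD; [rewrite mem_set//; exact/cE'|rewrite memNset// => /cE'].
have u1 := upper_chart hk3 ltr01 b1 b2 miE (fun z => ind_ge0 D z).
have u2 := upper_chart hk3 ltr01 b1 b2 mFE F0.
rewrite u1 u2 {u1 u2}.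
have mg : measurable_fun setT ((fun z => (ind D z * lam2 1 z)%:E) : TR * TR -> \bar R).
 by apply/measurable_EFinP; apply: measurable_funM => //; exact: measurable_lam2.
have g0 z : (0 <= (ind D z * lam2 1 z)%:E)%E by rewrite lee_fin mulr_ge0 ?ind_ge0 ?lam2_ge0.
rewrite (ge0_polar (mz _ mi) (pz _ (ind_ge0 D))) (ge0_polar (mz _ mF) (pz _ F0)) (ge0_polar mg g0).
have inner (f : R * R -> \bar R) : measurable_fun setT (f : TR * TR -> \bar R) -> (forall z, 0 <= f z)%E ->
  measurable_fun setT (fun phi : R => \int[mu]_r (`|r|%:E * f (polar phi r)))%E.
 move=> mf f0; apply: (@measurable_fun_inner R (fun p => `|p.2|%:E * f (polar p.1 p.2))%E).
  apply: emeasurable_funM; last exact: (measurableT_comp mf (@measurable_polar R)).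
  by apply/measurable_EFinP; exact: (measurableT_comp (@normr_measurable R setT)).
 by move=> p; rewrite mule_ge0 ?lee_fin.
rewrite -ge0_integralD//; last 4 first.
- by move=> phi _; apply: integral_ge0 => r _; rewrite mule_ge0 ?lee_fin//; exact: pz (ind_ge0 D) _.
- by apply: measurable_funTS; apply: inner (mz _ mi) (pz _ (ind_ge0 D)).
- by move=> phi _; apply: integral_ge0 => r _; rewrite mule_ge0 ?lee_fin//; exact: pz F0 _.
- by apply: measurable_funTS; apply: inner (mz _ mF) (pz _ F0).
apply: eq_integral => phi _.
transitivity (\int[mu]_r (`|r| * (ind D (polar phi r) * lam2 1 (polar phi r)))%:E)%E; last first.
 by apply: eq_integral => r _; rewrite EFinM.
have e (i l f n : R) : n * (i * l * f) = i * (n * (f * l)) by ring.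
have := inversion_radial phi mD M0 DM => /= <-; congr (_ + _)%E; apply: eq_integral => r _;
 by rewrite norm2_polar expr1n -!EFinM e /F ?norm2_polar.
Qed.

Lemma area_sphere : area 1 (surface (1 : R)) = (4 * pi)%:E.
Proof.
have hk3 : [\/ (1 : R) = -1, (1 : R) = 0 | (1 : R) = 1] by constructor 3.
have b1 : (0 : R) <= 1 - 1 * 1 ^+ 2 by rewrite expr1n mul1r subrr.
have b2 : (0 : R) < 1 + 1 * 1 ^+ 2 by rewrite expr1n mul1r; lra.
have sg1 : sg (1 : R) 1 ^+ 2 = 1 by rewrite /sg expr1n !mulr1 divff ?expr1n// pnatr_eq0.
have m2 : measurable_fun setT ((fun=> 2%:E) : TR * TR -> \bar R) by exact: measurable_cst.
have p2 z : (0 <= (fun=> 2%:E) z :> \bar R)%E by rewrite lee_fin.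
have u := upper_chart hk3 ltr01 b1 b2 m2 p2.
have md : measurable_fun setT ((fun z => ((if norm2 z < 1 ^+ 2 then 1 else 0) * lam2 1 z)%:E) : TR * TR -> \bar R).
 apply/measurable_EFinP; apply: measurable_funM; last exact: measurable_lam2.
 by apply: measurable_fun_if => //; apply: measurable_fun_ltr => //; exact: measurable_norm2.
have lt1 : (1 : R) = -1 -> (1 : R) < 1.
 move=> h; exfalso; have h2 : (1 + 1 : R) = 0 by rewrite {1}h addNr.
 by move/eqP: h2; rewrite -[1 + 1]/(2%:R) pnatr_eq0.
have := @integral_lam2_disc R 1 2 hk3.
transitivity (\int[mu2]_z (((if (norm2 z < 1 ^+ 2)%R then 1 else 0) * lam2 1 z)%:E * 2%:E))%E.
 rewrite -u areaE; apply: eq_integral => w _; rewrite sg1 /dens /indE -EFinM; congr (_%:E).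
 rewrite /disc1 /= -[w.1 ^+ 2 + _]/(norm2 w) mul1r.
 have [wk|wk] := ltP (norm2 w) 1; last by rewrite asboolF ?mul0r//; apply/negP; rewrite -leNgt.
 have wk1 : 1 * norm2 w < 1 by rewrite mul1r.
 have [ws h0] := surface_height wk1.
 have ws' : surface 1 (w, - height 1 w).
  by split => //=; have [+ _] := ws; rewrite /= sqrrN.
 by rewrite !asboolT// mul1r mulrC.
rewrite ge0_integralZr//; last by move=> z _; rewrite lee_fin mulr_ge0 ?lam2_ge0//; case: ifP.
rewrite (integral_lam2_disc hk3 ltr01 lt1) -EFinM; congr (_%:E).
by rewrite !expr1n !mulr1; field.
Qed.

(** The densities add up to that of the sphere, which also yields the measurability of the density
    of G by subtraction. *)
Lemma area_split E W G : rel_open 1 E -> rel_open 1 W -> area 1 G = 0%E ->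
 (forall x, surface 1 x -> indE E x + indE W x + indE G x = 1) ->
 (area 1 E + area 1 W = (4 * pi)%:E)%E.
Proof.
move=> Eo Wo G0 EWG.
have So : rel_open 1 (surface (1 : R)) by split => // x _; exists 1.
have dE w : dens E w + dens W w + dens G w = dens (surface 1) w.
 rewrite /dens; case: asboolP => wd; last by rewrite !addr0.
 have wk : 1 * norm2 w < 1 by exact: wd.
 have [ws h0] := surface_height wk.
 have ws' : surface 1 (w, - height 1 w).
  by split => //=; have [+ _] := ws; rewrite /= sqrrN.
 rewrite -!mulrDl; congr (_ / _).
 have e1 : indE E (w, height 1 w) + indE W (w, height 1 w) + indE G (w, height 1 w) = 1 := EWG _ ws.
 have e2 := EWG _ ws'.
 have -> : indE (surface 1) (w, height 1 w) = 1 by rewrite /indE asboolT.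
 have -> : indE (surface 1) (w, - height 1 w) = 1 by rewrite /indE asboolT.
 by lra.
have mG : measurable_fun setT (dens G : TR * TR -> R).
 have -> : dens G = (fun w => dens (surface 1) w - dens E w - dens W w).
  by apply/funext => w; rewrite -dE; ring.
 by apply: measurable_funB; [apply: measurable_funB|]; exact: measurable_dens.
rewrite -area_sphere -[LHS]adde0 -G0 !areaE.
have mE (H : set (R * R * R)) : measurable_fun setT (dens H : TR * TR -> R) ->
 measurable_fun setT ((fun w => (dens H w)%:E) : TR * TR -> \bar R) by move=> h; exact/measurable_EFinP.
rewrite -ge0_integralD//; last 4 first.
- by move=> w _; rewrite lee_fin dens_ge0.
- by apply: mE; exact: measurable_dens.
- by move=> w _; rewrite lee_fin dens_ge0.
- by apply: mE; exact: measurable_dens.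
rewrite -ge0_integralD//; last 4 first.
- by move=> w _; rewrite adde_ge0// lee_fin dens_ge0.
- by apply: emeasurable_funD; apply: mE; exact: measurable_dens.
- by move=> w _; rewrite lee_fin dens_ge0.
- exact: mE.
by apply: eq_integral => w _; rewrite -!EFinD dE.
Qed.
End area_in_chart.

(** * Coordinates and central projection onto the surface *)

Section coordinates.
Context {R : realType}.
Notation mu := (@lebesgue_measure R).
Notation TR := (measurableTypeR R).
Notation mu2 := (mu \x mu)%E.
Implicit Types (x y p : R * R * R) (z : R * R).

Lemma cont11 : continuous (fun p : R * R * R => p.1.1).
Proof. by move=> p; apply: (@cvg_comp _ _ _ fst fst _ (nbhs p.1)); exact: cvg_fst. Qed.

Lemma cont12 : continuous (fun p : R * R * R => p.1.2).
Proof. by move=> p; apply: (@cvg_comp _ _ _ fst snd _ (nbhs p.1)); [exact: cvg_fst|exact: cvg_snd]. Qed.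

Lemma cont2 : continuous (fun p : R * R * R => p.2).
Proof. by move=> p; exact: cvg_snd. Qed.

Lemma cvg_sqr {T : Type} (F : set_system T) (f : T -> R) (l : R) : Filter F ->
 f x @[x --> F] --> l -> (f x) ^+ 2 @[x --> F] --> l ^+ 2.
Proof. by move=> FF h; rewrite expr2; under eq_fun do rewrite expr2; exact: cvgM. Qed.

Lemma continuous_norm2 : continuous (@norm2 R).
Proof. by move=> z; apply: cvgD; apply: cvg_sqr; [exact: cvg_fst|exact: cvg_snd]. Qed.

Definition qform (k : R) p : R := p.2 ^+ 2 + k * (p.1.1 ^+ 2 + p.1.2 ^+ 2).

Lemma continuous_qform k : continuous (qform k).
Proof.
move=> p; apply: cvgD; first by apply: cvg_sqr; exact: cont2.
apply: cvgM; first exact: cvg_cst.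
by apply: cvgD; apply: cvg_sqr; [exact: cont11|exact: cont12].
Qed.

(** Central projection. It fixes the surface, so it carries short segments of space between points
    of the surface to paths in the surface. *)
Definition nrm (k : R) p : R * R * R :=
 ((p.1.1 / Num.sqrt (qform k p), p.1.2 / Num.sqrt (qform k p)), p.2 / Num.sqrt (qform k p)).

Lemma continuous_nrm k p : 0 < qform k p -> {for p, continuous (nrm k)}.
Proof.
move=> q0; have h : (Num.sqrt (qform k y))^-1 @[y --> p] --> (Num.sqrt (qform k p))^-1.
 apply: cvgV; first by rewrite sqrtr_eq0 -ltNge.
 apply: (@cvg_comp _ _ _ (qform k) (@Num.sqrt R) _ (nbhs (qform k p))); first exact: continuous_qform.
 exact: sqrt_continuous.
apply: cvg_pair_pt; first apply: cvg_pair_pt.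
- by apply: cvgM => //; exact: cont11.
- by apply: cvgM => //; exact: cont12.
- by apply: cvgM => //; exact: cont2.
Qed.

Lemma nrm_surface k p : 0 < qform k p -> (k <> 1 -> 0 < p.2) -> surface k (nrm k p).
Proof.
move=> q0 p2; have s0 : 0 < Num.sqrt (qform k p) by rewrite sqrtr_gt0.
split => /=; last by move=> /p2 h; rewrite divr_gt0.
rewrite !expr_div_n -mulrDl mulrA -mulrDl -/(qform k p) sqr_sqrtr ?ltW//.
by rewrite mulfV// gt_eqF.
Qed.

Lemma nrm_id k p : surface k p -> nrm k p = p.
Proof.
by move=> [pE _]; rewrite /nrm /qform pE sqrtr1 !divr1; case: p {pE} => [[]].
Qed.
End coordinates.

(** * Components of the complement of the curve *)

Section topology.
Context {R : realType}.
Variables (k : R) (c : R -> R * R * R).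
Hypotheses (hk : [\/ k = -1, k = 0 | k = 1]) (cin : curve_in k c).
Notation G := (curve_image c).

Lemma curve_image_compact : compact G.
Proof. by have [cc _ _] := cin; apply: continuous_compact => //; exact: segment_compact. Qed.

Lemma curve_image_closed : closed G.
Proof. by apply: compact_closed; [exact: norm_hausdorff|exact: curve_image_compact]. Qed.

Notation comp x := (connected_component (surface k `\` G) x).

(** A nearby point of the surface is joined to y by the central projection of a segment, which
    avoids the closed curve. *)
Lemma comp_rel_open x : rel_open k (comp x).
Proof.
split; first by move=> y /connected_component_sub [].
move=> y Uy; have [ys yG] := connected_component_sub Uy.
have q1 : qform k y = 1 by have [] := ys.
have n1 : nbhs y [set p | 0 < qform k p].
 have n0 : nbhs (qform k y) [set r : R | 0 < r].
  by rewrite q1; apply: open_nbhs_nbhs; split; [exact: open_gt|exact: ltr01].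
 exact: (@continuous_qform R k y _ n0).
have n2 : nbhs y [set p : R * R * R | k <> 1 -> 0 < p.2].
 have [k1|/eqP k1] := eqVneq k 1; first by apply: filterS filterT => p _.
 have [_ /(_ k1) y2] := ys.
 have : nbhs y [set p : R * R * R | 0 < p.2].
  have n0 : nbhs y.2 [set r : R | 0 < r] by apply: open_nbhs_nbhs; split => //; exact: open_gt.
  exact: (@cont2 R y _ n0).
 by apply: filterS => p h _.
have n3 : nbhs y (nrm k @^-1` (~` G)).
 have q0 : 0 < qform k y by rewrite q1 ltr01.
 have n0 : nbhs (nrm k y) (~` G).
  rewrite nrm_id//; apply: open_nbhs_nbhs; split => //.
  by apply: closed_openC; exact: curve_image_closed.
 exact: (@continuous_nrm R k y q0 _ n0).
have nn : nbhs y ([set p | 0 < qform k p] `&` ([set p : R * R * R | k <> 1 -> 0 < p.2] `&` (nrm k @^-1` (~` G)))).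
 exact: filterI n1 (filterI n2 n3).
move: nn => /nbhs_ballP[e /= e0 eP].
exists e => // y' By' ys'.
pose g (t : R) : R * R * R := ((y.1.1 + t * (y'.1.1 - y.1.1), y.1.2 + t * (y'.1.2 - y.1.2)), y.2 + t * (y'.2 - y.2)).
have gB t : t \in `[0, 1] -> ball y e (g t).
 rewrite in_itv/= => /andP[t0 t1]; move: By' => [[b1 b2] b3].
 have h (a b : R) : `|a - b| < e -> `|a - (a + t * (b - a))| < e.
  have -> : a - (a + t * (b - a)) = t * (a - b) by ring.
  by rewrite normrM (ger0_norm t0); apply: le_lt_trans; rewrite ler_piMl.
 split; first split.
 - exact: (h y.1.1 y'.1.1 b1).
 - exact: (h y.1.2 y'.1.2 b2).
 - exact: (h y.2 y'.2 b3).
have gc : continuous g.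
 have h (a b : R) : continuous (fun t : R => a + t * b).
  by move=> t; apply: cvgD; [exact: cvg_cst|apply: cvgM; [exact: cvg_id|exact: cvg_cst]].
 by move=> t; apply: cvg_pair_pt; [apply: cvg_pair_pt|]; exact: h.
have z01 : (0 : R) \in `[0, 1] by rewrite in_itv/= lexx ler01.
have o01 : (1 : R) \in `[0, 1] by rewrite in_itv/= lexx ler01.
have g0 : g 0 = y by rewrite /g !mul0r !addr0; case: (y) => [[]].
have g1 : g 1 = y' by rewrite /g !mul1r !(addrC _ (_ - _)) !subrK; case: (y') => [[]].
rewrite (same_connected_component Uy).
apply: (@connected_component_max _ _ ((nrm k \o g) @` `[0, 1]%classic)).
- by exists 0 => //=; rewrite g0 nrm_id.
- move=> _ [t t01 <-]; have [h1 [h2 h3]] := eP _ (gB t t01).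
 by split => //=; exact: nrm_surface.
- apply: connected_continuous_connected; first exact: segment_connected.
 apply: (@within_continuous_comp _ _ _ _ g (nrm k)); last by apply: continuous_subspaceT.
 move=> _ /set_mem[t t01 <-]; apply: continuous_nrm.
 by have [] := eP _ (gB t t01).
- by exists 1 => //=; rewrite g1 nrm_id.
Qed.

Lemma comp_closure x y : closure (comp x) y -> surface k y -> ~ G y -> comp x y.
Proof.
move=> cy ys yG; have [_ /(_ y)] := comp_rel_open y.
have yy : comp y y by exact: connected_component_refl.
move=> /(_ yy)[e e0 eP]; have [z [xz Bz]] := cy _ (nbhsx_ballx y e e0).
have [zs _] := connected_component_sub xz.
have yz := eP z Bz zs.
by rewrite (same_connected_component xz) -(same_connected_component yz).
Qed.

(** A point of this set has a neighbourhood inside its own component, which is disjoint from that of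
    x. *)
Lemma rest_rel_open x : rel_open k [set y | [/\ surface k y, ~ comp x y & ~ G y]].
Proof.
split => [y []//|y [ys yx yG]].
have yy : comp y y by exact: connected_component_refl.
have [_ /(_ y yy)[e e0 eP]] := comp_rel_open y.
exists e => // y' By' ys'; have yy' := eP y' By' ys'.
have [_ y'G] := connected_component_sub yy'; split => // xy'.
by apply: yx; rewrite (same_connected_component xy') -(same_connected_component yy').
Qed.

Lemma rest_closure x y : closure [set y | [/\ surface k y, ~ comp x y & ~ G y]] y -> surface k y ->
 ~ G y -> ~ comp x y.
Proof.
move=> cy ys yG xy; have [_ /(_ y xy)[e e0 eP]] := comp_rel_open x.
have [z [[zs nz _] Bz]] := cy _ (nbhsx_ballx y e e0).
by apply: nz; exact: eP.
Qed.
End topology.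

(** * The chart computation for one side of the curve *)

Section side.
Context {R : realType}.
Notation mu := (@lebesgue_measure R).
Notation TR := (measurableTypeR R).
Notation mu2 := (mu \x mu)%E.
Variables (k : R) (c : R -> R * R * R) (E : set (R * R * R)) (M : R).
Hypotheses (hk : [\/ k = -1, k = 0 | k = 1]) (cin : curve_in k c) (csc : simple_closed c).
Notation G := (curve_image c).
(** [E] stands for a component of the complement or, on the sphere, for everything outside a
    component and the curve. The conditions ask for its boundary to lie on the curve and for its
    chart image to be bounded. *)
Hypotheses (Eo : rel_open k E) (Ene : E !=set0).
Hypothesis Ecl : forall y, closure E y -> surface k y -> ~ G y -> E y.
Hypothesis EG : forall y, E y -> ~ G y.
Hypotheses (M0 : 0 < M) (kM : k = -1 -> M < 1).
Hypothesis EM : forall y, E y \/ G y -> 0 < 1 + y.2 /\ norm2 (chart y) < M ^+ 2.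

Let V := chart_set k E.

Lemma cpos t : t \in `[0, 1] -> 0 < 1 + (c t).2.
Proof. by move=> t01; have [] := EM (or_intror (ex_intro2 _ _ t t01 erefl : G (c t))). Qed.

Lemma cz_lt t : t \in `[0, 1] -> cabs (toC (cz c t)) < M.
Proof.
move=> t01; have [_] := EM (or_intror (ex_intro2 _ _ t t01 erefl : G (c t))).
by rewrite norm2_cabs /cz => h; rewrite -(@ltr_pXn2r _ 2)// nnegrE ?cabs_ge0// ltW.
Qed.

Lemma chart_setM z : V z -> norm2 z < M ^+ 2.
Proof.
move=> [z0 Ez]; have [_] := EM (or_introl Ez).
by rewrite chart_emb -?norm2_cabs.
Qed.

Lemma continuous_emb z : 0 < 1 + k * norm2 z -> {for z, continuous (emb k)}.
Proof.
move=> z0.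
have h : lamC k (toC w) @[w --> z] --> lamC k (toC z).
 rewrite /lamC -norm2_cabs; under eq_fun do rewrite -norm2_cabs.
 apply: cvgM; first exact: cvg_cst.
 apply: cvgV; first by rewrite gt_eqF.
 apply: cvgD; first exact: cvg_cst.
 by apply: cvgM; [exact: cvg_cst|exact: continuous_norm2].
apply: cvg_pair_pt; first apply: cvg_pair_pt.
- by apply: cvgM => //; exact: cvg_fst.
- by apply: cvgM => //; exact: cvg_snd.
- by apply: cvgB => //; exact: cvg_cst.
Qed.

Lemma open_domain : open [set z : R * R | 0 < 1 + k * norm2 z].
Proof.
apply: (@open_comp _ _ (fun z : R * R => 1 + k * norm2 z) [set y | 0 < y]); last exact: open_gt.
move=> z _; apply: cvgD; first exact: cvg_cst.
by apply: cvgM; [exact: cvg_cst|exact: continuous_norm2].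
Qed.

Lemma emb_surf z : 0 < 1 + k * norm2 z -> surface k (emb k z).
Proof. by rewrite norm2_cabs => /(emb_surface hk)[]. Qed.

Lemma open_chart_set : open V.
Proof.
have := rel_open_preimage Eo open_domain (fun z => @continuous_emb z) emb_surf.
by congr open; apply/seteqP; split => z.
Qed.

Let mV : measurable (V : set (TR * TR)).
Proof. by apply: open_measurable2; exact: open_chart_set. Qed.

Lemma side_area : area k E = (\int[mu2]_(x in V) lam2 k x)%:E.
Proof.
have -> : area k E = (\int[mu2]_z (ind V z * lam2 k z)%:E)%E.
 have Es := Eo.1; have VM := chart_setM.
 case: hk => kE.
 - by apply: (area_chart_lt _ Es mV M0 kM VM); left.
 - by apply: (area_chart_lt _ Es mV M0 kM VM); right.
 - move: Es mV VM (EM); rewrite /V kE => Es mV' VM EM'; apply: (area_chart_sphere Es _ mV' M0 VM) => ES.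
  by have [+ _] := EM' _ (or_introl ES); rewrite /= subrr ltxx.
rewrite /Rintegral fineK.
 rewrite [RHS]integral_mkcond; apply: eq_integral => z _; rewrite patchE /ind.
 by case: asboolP => h; [rewrite mem_set// mul1r|rewrite memNset// mul0r].
have l0 z : (0 <= (lam2 k z)%:E)%E by rewrite lee_fin lam2_ge0.
rewrite ge0_fin_numE; last by apply: integral_ge0 => z _; exact: l0.
have := integral_lam2_disc hk M0 kM => dE.
apply: (@le_lt_trans _ _ (\int[mu2]_z ((if (norm2 z < M ^+ 2)%R then 1 else 0) * lam2 k z)%:E)%E); last by rewrite dE ltry.
rewrite integral_mkcond; apply: ge0_le_integral => //.
- by move=> z _; rewrite patchE; case: ifP => // _; exact: l0.
- apply: (measurable_restrictT _ _).1 => //; apply: measurable_funTS.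
 by apply/measurable_EFinP; exact: measurable_lam2.
- apply/measurable_EFinP; apply: measurable_funM; last exact: measurable_lam2.
 by apply: measurable_fun_if => //; apply: measurable_fun_ltr => //; exact: measurable_norm2.
- move=> z _; rewrite patchE; case: ifPn => [/set_mem/chart_setM zM|_]; first by rewrite zM mul1r.
 by rewrite lee_fin mulr_ge0 ?lam2_ge0//; case: ifP.
Qed.

Lemma curve01_cz z : curve01 (cz c) z <-> exists2 x, G x & chart x = z.
Proof.
split => [[t t01 <-]|[_ [t t01 <-] <-]]; last by exists t.
by exists (c t) => //; exists t.
Qed.

Lemma curve_emb x : G x -> emb k (chart x) = x.
Proof.
move=> Gx; have [x0 _] := EM (or_intror Gx).
have xs : surface k x by case: Gx => t t01 <-; have [_ _] := cin; exact.
by have [] := chart_surface hk xs x0.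
Qed.

Lemma chart_set_disj : V `&` curve01 (cz c) = set0.
Proof.
rewrite -subset0 => z [[_ Ez] /curve01_cz[x Gx xz]].
by apply: (EG Ez); rewrite -xz curve_emb.
Qed.

Lemma chart_set_closure : closure V `<=` V `|` curve01 (cz c).
Proof.
move=> z cz0.
(* Limit points stay in the closed disc of radius M, where [emb] is still continuous. *)
have zM : norm2 z <= M ^+ 2.
 rewrite leNgt; apply/negP => h.
 have n : nbhs z [set w | M ^+ 2 < norm2 w].
  have n0 : nbhs (norm2 z) [set r : R | M ^+ 2 < r] by apply: open_nbhs_nbhs; split => //; exact: open_gt.
  exact: (@continuous_norm2 R z _ n0).
 by have [w [/chart_setM h1 /= h2]] := cz0 _ n; move: (lt_trans h1 h2); rewrite ltxx.
have z0 : 0 < 1 + k * norm2 z.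
 have n0 := norm2_ge0 z.
 case: hk => kE; rewrite kE ?mul0r ?mul1r ?mulN1r; [|lra|lra].
 by have m2 : M ^+ 2 < 1 by [have h1 := kM kE; have h2 := M0; nra]; lra.
have zs := emb_surf z0.
have ce : closure E (emb k z).
 move=> B /(continuous_emb z0) nB; have [w [[_ Ew] Bw]] := cz0 _ nB.
 by exists (emb k w).
have [Gz|nG] := pselect (G (emb k z)); last by left; split => //; exact: Ecl.
by right; apply/curve01_cz; exists (emb k z) => //; rewrite chart_emb// -norm2_cabs.
Qed.

Lemma chart_set_bounded : bounded_set V.
Proof.
exists M; split; first exact: num_real.
move=> x Mx z /chart_setM zM.
have h1 := sqr_ge0 z.1; have h2 := sqr_ge0 z.2; move: zM; rewrite /norm2 => zM.
have h3 := M0; rewrite /= prod_normE ge_max !ler_norml; apply/andP; split; apply/andP; split; nra.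
Qed.

Lemma chart_set_nonempty : V !=set0.
Proof.
have [x Ex] := Ene; have xs := Eo.1 _ Ex; have [x0 _] := EM (or_introl Ex).
by exists (chart x); apply/(chart_set_chart E hk xs x0).
Qed.

Lemma cz_simple : cz c 0 = cz c 1 /\ {in `[0, 1[ &, injective (cz c)}.
Proof.
have [c01 ci] := csc; split; first by rewrite /cz c01.
move=> u v u0 v0 uv; apply: ci => //.
have i01 t : t \in `[0, 1[ -> G (c t).
 by rewrite in_itv/= => /andP[t0 /ltW t1]; exists t => //=; rewrite in_itv/= t0.
by rewrite -(curve_emb (i01 u u0)) -(curve_emb (i01 v v0)) -/(cz c u) uv.
Qed.

Lemma side_core : exists s (a : int), [/\ itv_partition 0 1 s,
 on_pieces (cpieceD (toC \o cz c) (dzc c)) 0 s,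
 1 <= a%:~R ^+ 2 :> R,
 a%:~R ^+ 2 * (\int[mu2]_(x in V) lam2 k x) * (4 * pi - k * \int[mu2]_(x in V) lam2 k x) <= arc_length k c ^+ 2 &
 arc_length k c ^+ 2 = a%:~R ^+ 2 * (\int[mu2]_(x in V) lam2 k x) * (4 * pi - k * \int[mu2]_(x in V) lam2 k x) ->
 forall p, defect k (cz c) (dzc c) q @[q --> p] --> defect k (cz c) (dzc c) p -> defect k (cz c) (dzc c) p = 0].
Proof.
have [s ps [Dc Sc]] := cz_cpieces hk cin cpos.
have [cz01 czi] := cz_simple.
have czc := cz_cont cin cpos.
have [a a0 wind] := jordan_winding czc cz01 czi open_chart_set chart_set_nonempty chart_set_bounded
 chart_set_disj chart_set_closure.
have k1 : `|k| <= 1 by case: hk => ->; rewrite ?normrN1 ?normr0 ?normr1.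
(* A lower bound of 1 + k r^2 on the disc of radius M, which depends on M only for k = -1. *)
pose delta := if k == -1 then 1 - M ^+ 2 else 1.
have d0 : 0 < delta by rewrite /delta; case: eqP => [/kM m1|_]; [have h3 := M0; nra|exact: ltr01].
have dP r : 0 <= r -> r < M -> delta <= 1 + k * r ^+ 2.
 move=> r0 rM; rewrite /delta; case: eqP => kE; first by have h3 := M0; rewrite kE mulN1r; nra.
 by case: hk => [//|->|->]; rewrite ?mul0r ?addr0// mul1r lerDl sqr_ge0.
have VM x : V x -> cabs (toC x) < M.
 by move=> /chart_setM; rewrite norm2_cabs => h; rewrite -(@ltr_pXn2r _ 2)// nnegrE ?cabs_ge0// ltW.
have LE := arc_length_speed cin cpos ps Dc Sc.
exists s, a; split => //.
- by rewrite -(rmorphXn (intmul 1)) /= -[1]/(1%:~R) ler_int -gtz0_ge1 exprn_even_gt0.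
- rewrite LE; exact: (isoperimetric_ineq k1 M0 d0 dP ps Dc czc cz01 czi cz_lt open_chart_set chart_set_closure VM wind).
- rewrite LE => h p; exact: (defect_eq0 k1 M0 d0 dP ps Dc czc cz01 czi cz_lt open_chart_set chart_set_closure VM wind h).
Qed.
End side.

(** * The equality case *)

Section equality.
Context {R : realType}.
Notation mu := (@lebesgue_measure R).
Local Open Scope complex_scope.
Variables (k : R) (c : R -> R * R * R) (s : seq R).
Hypotheses (hk : [\/ k = -1, k = 0 | k = 1]) (cin : curve_in k c) (csc : simple_closed c).
Hypothesis cpos : forall t, t \in `[0, 1] -> 0 < 1 + (c t).2.
Hypotheses (ps : itv_partition 0 1 s) (Dc : on_pieces (cpieceD (toC \o cz c) (dzc c)) 0 s).
Hypothesis Lpos : 0 < arc_length k c.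
Hypothesis flat : forall p, defect k (cz c) (dzc c) q @[q --> p] --> defect k (cz c) (dzc c) p ->
 defect k (cz c) (dzc c) p = 0.

(** Points inside the pieces, where [dzc] is the derivative and is continuous; the defect is
    continuous at pairs of distinct points of this kind. *)
Let regular (t : R) := [/\ 0 < t, t < 1, is_derive t (1 : R) (fun t => (cz c t).1) (Re (dzc c t)),
 is_derive t (1 : R) (fun t => (cz c t).2) (Im (dzc c t)) & cvgC (nbhs t) (dzc c) (dzc c t)].

Let interior_cvg (f : R -> R) a b t : pieceC f a b -> t \in `]a, b[ -> f u @[u --> t] --> f t.
Proof.
move=> [g cg fg] tab; have ab : a < b by move: tab; rewrite in_itv/= => /andP[]; exact: lt_trans.
have [ci _ _] := (continuous_within_itvP g ab).1 cg.
rewrite (fg t tab); apply: cvg_trans (ci t tab); apply: near_eq_cvg; near=> u.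
by rewrite fg//; near: u; exact: near_in_itvoo.
Unshelve. all: by end_near. Qed.

Let pieces_regular : on_pieces (fun a b => forall t, t \in `]a, b[ -> regular t) 0 s.
Proof.
apply: (on_pieces_imp _ ps Dc) => a b a0 ab b1 [[_ r1 r2] [_ i1 i2]] t tab.
split.
- by move: tab; rewrite in_itv/= => /andP[h _]; exact: le_lt_trans h.
- by move: tab; rewrite in_itv/= => /andP[_ h]; exact: lt_le_trans h b1.
- exact: r2.
- exact: i2.
- by split; [apply: (interior_cvg r1 tab)|apply: (interior_cvg i1 tab)].
Qed.

(** A curve at rest inside every piece has length 0. *)
Let exists_moving : exists2 t0, regular t0 & dzc c t0 != 0.
Proof.
apply: contrapT => no.
have still : on_pieces (fun a b => forall t, t \in `]a, b[ -> dzc c t = 0) 0 s.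
 apply: (on_pieces_imp _ ps pieces_regular) => a b _ _ _ h t tab; apply/eqP; apply/negPn/negP => n.
 by apply: no; exists t => //; exact: h.
have [s' ps' [Dc' Sc']] := cz_cpieces hk cin cpos.
have LE : arc_length k c = \int[mu]_t speed k (cz c) (dzc c) t by exact: (arc_length_speed cin cpos ps' Dc' Sc').
suff : arc_length k c = 0 by move=> h; move: Lpos; rewrite h ltxx.
rewrite LE; have -> : \int[mu]_t speed k (cz c) (dzc c) t = \int[mu]_(t in `[0, 1]) speed k (cz c) (dzc c) t.
 rewrite [RHS]Rintegral_mkcond; apply: eq_Rintegral => t _; rewrite patchE mem01.
 by case: ifPn => // n; rewrite /speed /dz0 indicE mem01 (negbTE n) mul0r cabs0 mulr0.
have ms := speed_measurable cin cpos ps Dc.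
have -> : \int[mu]_(t in `[0, 1]) speed k (cz c) (dzc c) t = \int[mu]_(t in `[0, 1]) cst 0 t.
 apply: (Rintegral_pieces ps).
 - by apply: measurable_funM => //; exact: measurable_indic.
 - by apply: measurable_funM.
 - by apply: (on_pieces_imp _ ps still) => a b _ _ _ h t /h e; rewrite /speed /dz0 e mulr0 cabs0 mulr0.
by rewrite Rintegral_cst//= mul0r.
Qed.

Let dz0_cvg t : regular t -> cvgC (nbhs t) (dz0 (dzc c)) (dz0 (dzc c) t) /\ dz0 (dzc c) t = dzc c t.
Proof.
move=> [t0 t1 _ _ [cr ci]].
have tt : t \in `]0, 1[ by rewrite in_itv/= t0.
have e u : u \in `]0, 1[ -> dz0 (dzc c) u = dzc c u.
 by rewrite in_itv/= => /andP[/ltW u0 /ltW u1]; rewrite /dz0 indicE mem01 in_itv/= u0 u1 mul1r.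
split; last exact: e.
rewrite e//; split.
- apply: cvg_trans cr; apply: near_eq_cvg; near=> u; rewrite e//; near: u; exact: near_in_itvoo.
- apply: cvg_trans ci; apply: near_eq_cvg; near=> u; rewrite e//; near: u; exact: near_in_itvoo.
Unshelve. all: by end_near. Qed.

Let den t : t \in `[0, 1] -> 0 < 1 + k * cabs (toC (cz c t)) ^+ 2.
Proof.
move=> t01; have [_ _ cs] := cin; have [-> _ _] := chart_surface hk (cs t t01) (cpos t01).
by rewrite divr_gt0// cpos.
Qed.

Let czC t : t \in `[0, 1] -> zc (cz c) t = toC (cz c t).
Proof. by move=> t01; rewrite /zc clamp01_id. Qed.

Let cvg_lam t : cvgC (nbhs t) (zc (cz c)) (zc (cz c) t) /\
 lamC k (zc (cz c) u) @[u --> t] --> lamC k (zc (cz c) t).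
Proof.
have h := zc_cvg (cz_cont cin cpos) t; split => //.
apply: cvgM; first exact: cvg_cst.
apply: cvgV; first by rewrite gt_eqF// /zc den// clamp01_itv.
apply: cvgD; first exact: cvg_cst.
by apply: cvgM; [exact: cvg_cst|apply: cvg_sqr; exact: cvg_cabs].
Qed.

Let cz_neq u v : u \in `]0, 1[ -> v \in `]0, 1[ -> u != v -> toC (cz c u) - toC (cz c v) != 0.
Proof.
move=> u01 v01; apply: contraNneq => /eqP; rewrite -toCB toC_eq0 subr_eq0 => /eqP e.
have [_ ci] := csc.
have i (t : R) : t \in `]0, 1[ -> (t \in `[0, 1[) /\ (t \in `[0, 1]).
 by rewrite !in_itv/= => /andP[/ltW -> h]; rewrite h (ltW h).
have [u1 u2] := i u u01; have [v1 v2] := i v v01.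
have [_ _ cs] := cin.
apply/eqP/ci => //; have [_ _ <-] := chart_surface hk (cs u u2) (cpos u2).
by have [_ _ <-] := chart_surface hk (cs v v2) (cpos v2); rewrite -/(cz c u) e.
Qed.

(** The defect vanishes at (t0, u), so the product of the kernel with both velocities equals its
    modulus. As conj z / z = conj z^2 / |z|^2, the number T D conj z^2 is real, which is the
    hypothesis [flat] of [circle_image]. *)
Lemma flat_circle : exists (z0 : R * R) (T : R[i]) (C : R), [/\ T != 0, C != 0 & forall z,
 curve01 (cz c) z <-> Im (T * conjc (toC z - toC z0)) = C * cabs (toC z - toC z0) ^+ 2].
Proof.
have [t0 rt0 T0] := exists_moving; have [t00 t01 d1 d2 cT] := rt0.
have t0i : t0 \in `]0, 1[ by rewrite in_itv/= t00.
have [c01 ci] := csc.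
have czi : {in `[0, 1[ &, injective (cz c)}.
 move=> u v u0 v0 uv; apply: ci => //; have [_ _ cs] := cin.
 have i (t : R) : t \in `[0, 1[ -> t \in `[0, 1] by rewrite !in_itv/= => /andP[-> /ltW ->].
 have [_ _ <-] := chart_surface hk (cs u (i u u0)) (cpos (i u u0)).
 by have [_ _ <-] := chart_surface hk (cs v (i v v0)) (cpos (i v v0)); rewrite -/(cz c u) uv.
suff fl : on_pieces (fun p q => forall u, u \in `]p, q[ -> u != t0 ->
  Im (dzc c t0 * dzc c u * conjc (toC (cz c u) - toC (cz c t0)) ^+ 2) = 0) 0 s.
 have cz01 : cz c 0 = cz c 1 by rewrite /cz c01.
 have [C C0 CP] := circle_image ps Dc cz01 czi t00 t01 T0 d1 d2 fl.
 by exists (cz c t0), (dzc c t0), C.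
apply: (on_pieces_imp _ ps pieces_regular) => p q _ _ _ h u upq ut.
have ru := h u upq; have [u0 u1 _ _ _] := ru.
have ui : u \in `]0, 1[ by rewrite in_itv/= u0.
have cl (t : R) : t \in `]0, 1[ -> t \in `[0, 1] by rewrite !in_itv/= => /andP[/ltW -> /ltW ->].
have z0 := cz_neq ui t0i ut.
have [dT eT] := dz0_cvg rt0; have [dU eU] := dz0_cvg ru.
have [zT lT] := cvg_lam t0; have [zU lU] := cvg_lam u.
have f1 : @fst R R q0 @[q0 --> (t0, u)] --> t0 by exact: cvg_fst.
have f2 : @snd R R q0 @[q0 --> (t0, u)] --> u by exact: cvg_snd.
have l1 : lamC k (zc (cz c) q0.1) @[q0 --> (t0, u)] --> lamC k (zc (cz c) t0).
 exact: (@cvg_comp _ _ _ fst (fun t => lamC k (zc (cz c) t)) _ (nbhs t0) _ f1 lT).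
have l2 : lamC k (zc (cz c) q0.2) @[q0 --> (t0, u)] --> lamC k (zc (cz c) u).
 exact: (@cvg_comp _ _ _ snd (fun t => lamC k (zc (cz c) t)) _ (nbhs u) _ f2 lU).
have D1 : cvgC (nbhs (t0, u)) (fun q0 : R * R => dz0 (dzc c) q0.1) (dz0 (dzc c) t0) by exact: cvgC_comp f1 dT.
have D2 : cvgC (nbhs (t0, u)) (fun q0 : R * R => dz0 (dzc c) q0.2) (dz0 (dzc c) u) by exact: cvgC_comp f2 dU.
have Z1 : cvgC (nbhs (t0, u)) (fun q0 : R * R => zc (cz c) q0.1) (zc (cz c) t0) by exact: cvgC_comp f1 zT.
have Z2 : cvgC (nbhs (t0, u)) (fun q0 : R * R => zc (cz c) q0.2) (zc (cz c) u) by exact: cvgC_comp f2 zU.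
have zE : zc (cz c) u - zc (cz c) t0 = toC (cz c u) - toC (cz c t0) by rewrite !czC ?cl.
have FF : Filter (nbhs (t0, u)) by exact: nbhs_filter.
have Z3 := cvgCB FF Z2 Z1.
have cont : defect k (cz c) (dzc c) q0 @[q0 --> (t0, u)] --> defect k (cz c) (dzc c) (t0, u).
 have z0' : zc (cz c) u - zc (cz c) t0 != 0 by rewrite zE.
 apply: cvgB.
  by apply: cvgM; apply: cvgM => //; exact: cvg_cabs.
 have [] := cvgCM FF D1 (cvgCM FF D2 (cvgCM FF (cvgCM FF (cvgCJ FF Z3) (cvgCV FF z0' Z3)) (cvgCR FF (cvgM l2 l1)))).
 by [].
have := flat cont; rewrite /defect /speed -[(t0, u).1]/t0 -[(t0, u).2]/u eT eU /two_point zE.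
set T := dzc c t0; set D := dzc c u; set z := toC (cz c u) - toC (cz c t0).
have l1p : 0 < lamC k (zc (cz c) t0) by rewrite divr_gt0// czC ?den ?cl.
have l2p : 0 < lamC k (zc (cz c) u) by rewrite divr_gt0// czC ?den ?cl.
move: (lamC _ _) l1p (lamC _ _) l2p => a a0 b b0 /eqP; rewrite subr_eq0 => /eqP.
have r0 : 0 < cabs z by rewrite cabs_gt0.
have zi : conjc z / z = conjc z ^+ 2 * ((cabs z ^+ 2)^-1)%:C.
 by rewrite invCE; ring.
rewrite zi; set W := T * (D * _) => WE.
have W1 : W = (T * D * conjc z ^+ 2) * ((cabs z ^+ 2)^-1 * (b * a))%:C.
 by rewrite /W rmorphM /=; ring.
set X := T * D * conjc z ^+ 2 in W1 *.
have XC : cabs X = cabs T * cabs D * cabs z ^+ 2.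
 by rewrite /X expr2 !Normc.normcM -/cabs cabsJ expr2.
have ReX : Re W = Re X * ((cabs z ^+ 2)^-1 * (b * a)) by rewrite W1 ReM /= mulr0 subr0.
have XR : Re X = cabs X.
 have n0 : (cabs z ^+ 2)^-1 * (b * a) != 0 by rewrite !mulf_neq0// ?invr_eq0 ?expf_neq0 ?gt_eqF.
 apply: (mulIf n0); rewrite -ReX -WE XC; field.
 by rewrite gt_eqF.
by have := cabs2 X; rewrite -XR => /eqP; rewrite -subr_eq0 opprD addNKr oppr_eq0 sqrf_eq0 => /eqP.
Qed.
End equality.

(** * Circles of the chart as plane sections *)

Section plane_section.
Context {R : realType}.
Local Open Scope complex_scope.
Implicit Types (x p : R * R * R).

Definition form (k : R) p x : R := p.2 * x.2 + k * (p.1.1 * x.1.1 + p.1.2 * x.1.2).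

(** For k = 1 and k = -1 the number r is the sine or hyperbolic sine of the geodesic radius and the
    root is its cosine or hyperbolic cosine; on the sphere the nonnegative root means that the
    radius is at most pi / 2. *)
Definition sect (k : R) p (r : R) x : Prop :=
 if k == 0 then (x.1.1 - p.1.1) ^+ 2 + (x.1.2 - p.1.2) ^+ 2 = r ^+ 2
 else form k p x = Num.sqrt (1 - k * r ^+ 2).

(** For k = 0 the chart only halves coordinates. Otherwise a circle of the chart is a plane section,
    and the centre is the unit normal of the plane, chosen on the surface. *)
Lemma chart_circle_section (k : R) (G : set (R * R * R)) (z0 : R * R) (T : R[i]) (C : R) :
 [\/ k = -1, k = 0 | k = 1] -> T != 0 -> C != 0 ->
 (forall x, G x -> surface k x /\ 0 < 1 + x.2) ->
 (forall z, (exists2 x, G x & chart x = z) <->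
   Im (T * conjc (toC z - toC z0)) = C * cabs (toC z - toC z0) ^+ 2) ->
 exists p r, [/\ surface k p, 0 < r, k = 1 -> r <= 1 & forall x, surface k x -> G x <-> sect k p r x].
Proof.
move=> hk T0 C0 Gs GE.
pose t1 := Re T; pose t2 := Im T; pose a1 := z0.1; pose a2 := z0.2.
pose Eq (z : R * R) := t2 * (z.1 - a1) - t1 * (z.2 - a2) = C * ((z.1 - a1) ^+ 2 + (z.2 - a2) ^+ 2).
have GE' z : (exists2 x, G x & chart x = z) <-> Eq z.
 rewrite GE cabs2 /Eq /t1 /t2 /a1 /a2; case: (T) => u v; case: (z) => x y; case: (z0) => b1 b2 /=.
 by split => h; rewrite -h /=; ring.
have tau : 0 < t1 ^+ 2 + t2 ^+ 2 by rewrite -cabs2 exprn_gt0// cabs_gt0.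
have GC x : surface k x -> 0 < 1 + x.2 -> G x <-> Eq (chart x).
 move=> xs x0; rewrite -GE'; split => [Gx|[y Gy yx]]; first by exists x.
 have [ys y0] := Gs _ Gy; have [_ _ <-] := chart_surface hk xs x0; have [_ _ e] := chart_surface hk ys y0.
 by rewrite -yx e.
have [k0|kn0] := eqVneq k 0.
 exists ((2 * a1 + t2 / C, 2 * a2 - t1 / C), 1), (Num.sqrt (t1 ^+ 2 + t2 ^+ 2) / `|C|); split.
 - by split => [|_]/=; [rewrite k0 mul0r addr0 expr1n|exact: ltr01].
 - by rewrite divr_gt0 ?sqrtr_gt0// normr_gt0.
 - by rewrite k0 => /eqP; rewrite eq_sym oner_eq0.
 - move=> x xs; have x1 : x.2 = 1.
   have [xE xpos] := xs; have x0 : 0 < x.2 by apply: xpos; rewrite k0 => /eqP; rewrite eq_sym oner_eq0.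
   by move: xE; rewrite k0 mul0r addr0 => h; nra.
  rewrite GC//; last by rewrite x1; lra.
  rewrite /sect k0 eqxx /= expr_div_n sqr_sqrtr ?ltW// real_normK ?num_real// /Eq /chart /= x1.
  have -> : x.1.1 / (1 + 1) - a1 = (x.1.1 - 2 * a1) / 2 by field.
  have -> : x.1.2 / (1 + 1) - a2 = (x.1.2 - 2 * a2) / 2 by field.
  have -> : x.1.1 - (2 * a1 + t2 / C) = (x.1.1 - 2 * a1) - t2 / C by ring.
  have -> : x.1.2 - (2 * a2 - t1 / C) = (x.1.2 - 2 * a2) + t1 / C by ring.
  move: (x.1.1 - 2 * a1) (x.1.2 - 2 * a2) => u v.
  have e : C / 4 * ((u - t2 / C) ^+ 2 + (v + t1 / C) ^+ 2 - (t1 ^+ 2 + t2 ^+ 2) / C ^+ 2) =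
   C * ((u / 2) ^+ 2 + (v / 2) ^+ 2) - (t2 * (u / 2) - t1 * (v / 2)) by field.
  have c4 : C / 4 != 0 by rewrite mulf_neq0.
  split => h.
   by apply/eqP; rewrite -subr_eq0; apply/eqP/(mulfI c4); rewrite e -h subrr mulr0.
  by apply/esym/eqP; rewrite -subr_eq0 -e h subrr mulr0.
have k2 : k ^+ 2 = 1 by case: hk kn0 => ->; rewrite ?eqxx// ?sqrrN expr1n.
pose e := t2 * a1 - t1 * a2 + C * (a1 ^+ 2 + a2 ^+ 2).
pose n1 := t2 + 2 * C * a1; pose n2 := 2 * C * a2 - t1.
(* The circle equation multiplied by 1 + x.2; the equation of the surface makes it affine in x. *)
pose Pl x := n1 * x.1.1 + n2 * x.1.2 - (1 + x.2) * e - C * k * (1 - x.2).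
have GPl x : surface k x -> G x <-> Pl x = 0.
 move=> xs; have [x0|x0] := ltP 0 (1 + x.2).
  rewrite GC//; have x0n : 1 + x.2 != 0 by rewrite gt_eqF.
  have [xE _] := xs; have rE : x.1.1 ^+ 2 + x.1.2 ^+ 2 = k * (1 - x.2) * (1 + x.2).
   transitivity (k ^+ 2 * (x.1.1 ^+ 2 + x.1.2 ^+ 2)); first by rewrite k2 mul1r.
   by transitivity (k * (1 - x.2 ^+ 2)); [rewrite -xE; ring|ring].
  have cE : ((x.1.1 / (1 + x.2)) ^+ 2 + (x.1.2 / (1 + x.2)) ^+ 2) * (1 + x.2) = k * (1 - x.2).
   by rewrite !expr_div_n -mulrDl rE; field.
  have key : Pl x = (1 + x.2) * ((t2 * ((chart x).1 - a1) - t1 * ((chart x).2 - a2)) - C * (((chart x).1 - a1) ^+ 2 + ((chart x).2 - a2) ^+ 2)).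
   rewrite /chart /=; transitivity (n1 * x.1.1 + n2 * x.1.2 - (1 + x.2) * e - C * (((x.1.1 / (1 + x.2)) ^+ 2 + (x.1.2 / (1 + x.2)) ^+ 2) * (1 + x.2))).
    by rewrite cE /Pl; ring.
   by rewrite /n1 /n2 /e; field.
  rewrite key /Eq; split => [->|/eqP]; first by rewrite subrr mulr0.
  by rewrite mulf_eq0 (negbTE x0n) /= subr_eq0 => /eqP.
 split => [/Gs[_]|]; first by rewrite ltNge x0.
 have kE : k = 1.
  by apply: contrapT => kn; have [_ /(_ kn)] := xs; lra.
 have [xE _] := xs; move: xE; rewrite kE mul1r => xE.
 have h1 := sqr_ge0 x.1.1; have h2 := sqr_ge0 x.1.2.
 have x2 : x.2 = -1 by nra.
 have e0 : x.1.1 ^+ 2 + x.1.2 ^+ 2 = 0 by move: xE; rewrite x2; lra.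
 have /eqP : x.1.1 ^+ 2 = 0 by lra.
 have /eqP : x.1.2 ^+ 2 = 0 by lra.
 rewrite !sqrf_eq0 /Pl kE x2 => /eqP -> /eqP -> h; exfalso; move/eqP: C0; apply; lra.
pose be := e + C * k; pose P3 := C * k - e.
pose tt := t1 ^+ 2 + t2 ^+ 2.
pose q := be ^+ 2 + k * tt.
have nE : n1 ^+ 2 + n2 ^+ 2 = tt + 4 * (C * e) by rewrite /n1 /n2 /tt /e; ring.
have qE : q = P3 ^+ 2 + k * ((k * n1) ^+ 2 + (k * n2) ^+ 2).
 rewrite !exprMn k2 !mul1r nE /q /be /P3.
 have -> : (C * k - e) ^+ 2 = (e + C * k) ^+ 2 - k * (4 * (C * e)) by ring.
 by ring.
(* For k = -1 the normal must be timelike and point to the upper sheet. This follows because the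
   whole circle, including its point farthest from the origin, lies in the unit disc. *)
have hyp : k = -1 -> 0 < q /\ 0 < be * P3.
 move=> kE; pose tau' := Num.sqrt tt; pose nu := Num.sqrt (n1 ^+ 2 + n2 ^+ 2).
 have tau0 : 0 < tau' by rewrite sqrtr_gt0.
 have tau2 : tau' ^+ 2 = tt by rewrite sqr_sqrtr// ltW.
 have nu0 : 0 <= nu by exact: sqrtr_ge0.
 have nu2 : nu ^+ 2 = n1 ^+ 2 + n2 ^+ 2 by rewrite sqr_sqrtr// addr_ge0 ?sqr_ge0.
 have inside z : Eq z -> z.1 ^+ 2 + z.2 ^+ 2 < 1.
  move=> /GE'[x Gx xz]; have [xs x0] := Gs _ Gx; have [h _ _] := chart_surface hk xs x0.
  have : 0 < 1 + k * cabs (toC (chart x)) ^+ 2 by rewrite h divr_gt0.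
  by rewrite cabs2_toC xz kE; lra.
 have onc (u v : R) : (2 * C * u - n1) ^+ 2 + (2 * C * v - n2) ^+ 2 = tt -> Eq (u, v).
  rewrite /n1 /n2 /tt /Eq /= => h.
  have : 4 * C * (C * ((u - a1) ^+ 2 + (v - a2) ^+ 2) - (t2 * (u - a1) - t1 * (v - a2))) = 0.
   by move: h => /eqP; rewrite -subr_eq0 => /eqP <-; ring.
  move=> /eqP; rewrite !mulf_eq0 pnatr_eq0 (negbTE C0) /= subr_eq0 => /eqP -> //.
 have far : (nu + tau') ^+ 2 < 4 * C ^+ 2.
  have [nz|nz] := eqVneq nu 0.
   have n10 : n1 = 0 by have := sqr_ge0 n1; have := sqr_ge0 n2; move: nu2; rewrite nz => *; apply/eqP; rewrite -sqrf_eq0; apply/eqP; lra.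
   have n20 : n2 = 0 by have := sqr_ge0 n1; have := sqr_ge0 n2; move: nu2; rewrite nz => *; apply/eqP; rewrite -sqrf_eq0; apply/eqP; lra.
   have /inside /= : Eq (tau' / (2 * C), 0).
    apply: onc; rewrite n10 n20 -tau2; field; exact: C0.
   rewrite expr0n addr0 nz add0r expr_div_n ltr_pdivrMr ?mul1r; last by rewrite exprn_even_gt0//= mulf_neq0.
   by rewrite exprMn; lra.
  (* The centre (n1, n2) / (2 C) moved away from the origin by the radius tau' / (2 |C|). *)
  have /inside /= : Eq (n1 * (nu + tau') / (2 * C * nu), n2 * (nu + tau') / (2 * C * nu)).
   apply: onc; transitivity ((n1 ^+ 2 + n2 ^+ 2) * tau' ^+ 2 / nu ^+ 2); first by field; rewrite ?nz ?C0.
   by rewrite -nu2 tau2; field.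
  rewrite !expr_div_n -mulrDl ltr_pdivrMr ?mul1r; last by rewrite exprn_even_gt0//= !mulf_neq0.
  rewrite !exprMn -mulrDl -nu2 => h.
  have : nu ^+ 2 * (nu + tau') ^+ 2 < nu ^+ 2 * (4 * C ^+ 2) by move: h; lra.
  by rewrite ltr_pM2l// exprn_even_gt0.
 pose cc := `|C|; have cc0 : 0 < cc by rewrite normr_gt0.
 have cc2 : cc ^+ 2 = C ^+ 2 by rewrite real_normK// num_real.
 have far' : nu + tau' < 2 * cc by move: far; rewrite -cc2; nra.
 have e4 : 4 * (C * e) = nu ^+ 2 - tau' ^+ 2 by rewrite nu2 nE tau2; ring.
 have beE : 4 * C * be = nu ^+ 2 - tau' ^+ 2 - 4 * C ^+ 2 by rewrite /be kE -e4; ring.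
 have P3E : 4 * C * P3 = - (4 * C ^+ 2 + nu ^+ 2 - tau' ^+ 2).
  have P3E : 4 * C * P3 = - (4 * C ^+ 2 + 4 * (C * e)) by rewrite /P3 kE; ring.
  by rewrite P3E e4; ring.
 have A1 : 4 * cc * tau' < 4 * C ^+ 2 + tau' ^+ 2 - nu ^+ 2 by rewrite -cc2; nra.
 have A2 : 0 < 4 * C ^+ 2 + nu ^+ 2 - tau' ^+ 2 by rewrite -cc2; nra.
 have C16 : 0 < 16 * C ^+ 2 by rewrite mulr_gt0// exprn_even_gt0.
 split.
  rewrite -(pmulr_rgt0 _ C16) /q kE.
  have -> : 16 * C ^+ 2 * (be ^+ 2 + -1 * tt) = (4 * C * be) ^+ 2 - (4 * cc * tau') ^+ 2.
   by rewrite !exprMn cc2 tau2; ring.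
  rewrite beE; have := mulr_gt0 cc0 tau0; nra.
 rewrite -(pmulr_rgt0 _ C16); have -> : 16 * C ^+ 2 * (be * P3) = (4 * C * be) * (4 * C * P3) by ring.
 rewrite beE P3E; have := mulr_gt0 cc0 tau0; nra.
have q0 : 0 < q.
 case: hk => kE; [by have [] := hyp kE|by rewrite kE eqxx in kn0|].
 by rewrite /q kE mul1r ltr_wpDl ?sqr_ge0.
pose sq := Num.sqrt q; have sq0 : 0 < sq by rewrite sqrtr_gt0.
have sq2 : sq ^+ 2 = q by rewrite sqr_sqrtr// ltW.
(* The normal is determined up to sign; this choice makes the constant term nonnegative, as the root
   in [sect] requires. *)
pose sg0 : R := if 0 <= be then 1 else -1.
have sg2 : sg0 ^+ 2 = 1 by rewrite /sg0; case: ifP; rewrite ?sqrrN expr1n.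
have sgn0 : sg0 != 0 by rewrite -sqrf_eq0 sg2 oner_eq0.
have sgbe : sg0 * be = `|be|.
 by rewrite /sg0; case: (leP 0 be) => h; [rewrite mul1r ger0_norm|rewrite mulN1r ltr0_norm].
have r2 : 1 - k * (Num.sqrt tt / sq) ^+ 2 = (be / sq) ^+ 2.
 rewrite !expr_div_n sqr_sqrtr ?ltW// sq2 /q; field.
 by rewrite gt_eqF.
exists ((sg0 * (k * n1) / sq, sg0 * (k * n2) / sq), sg0 * P3 / sq), (Num.sqrt tt / sq); split.
- split => /=.
  transitivity (sg0 ^+ 2 * (P3 ^+ 2 + k * ((k * n1) ^+ 2 + (k * n2) ^+ 2)) / sq ^+ 2); first by field; rewrite gt_eqF.
  by rewrite sg2 -qE sq2 mul1r mulfV// gt_eqF.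
 move=> kn1; have kE : k = -1 by case: hk => // h; rewrite h eqxx in kn0.
 have [_ h] := hyp kE; rewrite divr_gt0// /sg0; case: (leP 0 be) => hb; first by rewrite mul1r; nra.
 by rewrite mulN1r; nra.
- by rewrite divr_gt0// sqrtr_gt0.
- move=> kE; rewrite ler_pdivrMr// mul1r /sq; apply: ler_wsqrtr.
 by rewrite /q kE mul1r lerDr sqr_ge0.
- move=> x xs; rewrite (GPl x xs) /sect (negbTE kn0) r2 sqrtr_sqr normrM normfV (gtr0_norm sq0) -sgbe.
 have fE : form k ((sg0 * (k * n1) / sq, sg0 * (k * n2) / sq), sg0 * P3 / sq) x = sg0 / sq * (be + Pl x).
  have -> : be + Pl x = P3 * x.2 + k ^+ 2 * (n1 * x.1.1 + n2 * x.1.2) by rewrite k2 /be /Pl /P3; ring.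
  by rewrite /form /=; ring.
 have n0 : sg0 / sq != 0 by rewrite mulf_neq0// invr_eq0 gt_eqF.
 rewrite fE; have -> : sg0 * be / sq = sg0 / sq * be by ring.
 split => [->|/(mulfI n0) h]; first by rewrite addr0.
 by apply: (addrI be); rewrite h addr0.
Qed.
End plane_section.

(** * Moving a centre to the north pole, and round circles *)

Section isometries.
Context {R : realType}.
Notation mu := (@lebesgue_measure R).
Notation TR := (measurableTypeR R).
Notation mu2 := (mu \x mu)%E.
Implicit Types (k s : R) (x p : R * R * R).

Definition preserves k (T : R * R * R -> R * R * R) : Prop :=
 (forall c, curve_in k c -> curve_in k (T \o c) /\ arc_length k (T \o c) = arc_length k c) /\
 (forall x, surface k x -> surface k (T x)).

Lemma aff_preserves k (A1 A2 A3 o : R * R * R) :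
 (forall x, surface k x -> surface k (aff A1 A2 A3 o x)) ->
 (forall v, metric k (lin A1 A2 A3 v) (lin A1 A2 A3 v) = metric k v v) ->
 preserves k (aff A1 A2 A3 o).
Proof. by move=> h1 h2; split; [move=> c cin; exact: (aff_curve h1 h2 cin)|exact: h1]. Qed.

Lemma surface0 x : surface 0 x <-> x.2 = 1.
Proof.
split => [[xE xpos]|xE].
 have x0 : 0 < x.2 by apply: xpos => /eqP; rewrite eq_sym oner_eq0.
 by move: xE; rewrite mul0r addr0 => h; nra.
by split; rewrite xE ?mul0r ?addr0 ?expr1n// => _; exact: ltr01.
Qed.

(** The reversed Cauchy-Schwarz inequality on the upper sheet; it shows that the reflection in
    [to_north] does not exchange the sheets. *)
Lemma surface_form_gt0 x p : surface (-1) x -> surface (-1) p -> 0 < form (-1) p x.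
Proof.
have n1 : (-1 : R) <> 1 by move=> h; have h2 : (1 + 1 : R) = 0 by [rewrite -{1}h addNr]; move/eqP: h2; rewrite -[1 + 1]/(2%:R) pnatr_eq0.
move=> [xE /(_ n1) x0] [pE /(_ n1) p0]; rewrite /form mulN1r subr_gt0.
have xp : 0 < p.2 * x.2 by exact: mulr_gt0.
rewrite ltNge; apply/negP => h.
have e1 : p.1.1 ^+ 2 + p.1.2 ^+ 2 = p.2 ^+ 2 - 1 by rewrite -pE; ring.
have e2 : x.1.1 ^+ 2 + x.1.2 ^+ 2 = x.2 ^+ 2 - 1 by rewrite -xE; ring.
have cs : (p.1.1 * x.1.1 + p.1.2 * x.1.2) ^+ 2 <= (p.2 ^+ 2 - 1) * (x.2 ^+ 2 - 1).
 rewrite -e1 -e2; have := sqr_ge0 (p.1.1 * x.1.2 - p.1.2 * x.1.1); nra.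
have h1 : (p.2 * x.2) ^+ 2 <= (p.1.1 * x.1.1 + p.1.2 * x.1.2) ^+ 2 by nra.
have h2 : 1 <= p.2 ^+ 2 by have := sqr_ge0 p.1.1; have := sqr_ge0 p.1.2; lra.
have h3 : 1 <= x.2 ^+ 2 by have := sqr_ge0 x.1.1; have := sqr_ge0 x.1.2; lra.
move: h1 cs; rewrite exprMn => h1 cs; have h4 := le_trans h1 cs.
have : (p.2 ^+ 2 - 1) * (x.2 ^+ 2 - 1) = p.2 ^+ 2 * x.2 ^+ 2 - p.2 ^+ 2 - x.2 ^+ 2 + 1 by ring.
lra.
Qed.

(* For k <> 0, T is the reflection exchanging p and the north pole; when p is
  the north pole, 1 - p.2 = 0 and the junk value of the division makes T the
  identity. *)
Lemma to_north k p : [\/ k = -1, k = 0 | k = 1] -> surface k p -> exists T T',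
 [/\ preserves k T, preserves k T', cancel T T', cancel T' T & T p = north /\
  forall x r, surface k x -> 0 < r -> (k = 1 -> r <= 1) ->
   (sect k p r x <-> rad (T x) = r /\ 0 <= (T x).2)].
Proof.
move=> hk ps.
have [k0|kn0] := eqVneq k 0.
 move: ps; rewrite k0 => /surface0 p2.
 pose T (a b : R) := aff ((1, 0), 0) ((0, 1), 0) ((0, 0), 1) ((a, b), 0) : R * R * R -> R * R * R.
 have TE a b x : T a b x = ((x.1.1 + a, x.1.2 + b), x.2).
  by rewrite /T /aff /dot /=; congr (_, _, _); ring.
 have Tp a b : preserves 0 (T a b).
  apply: aff_preserves => [x /surface0 x2|v]; first by apply/surface0; rewrite -/(T a b) TE.
  by rewrite /metric /lin /dot /=; ring.
 exists (T (- p.1.1) (- p.1.2)), (T p.1.1 p.1.2); split => //.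
 - by move=> x; rewrite !TE /= !subrK; case: (x) => [[]].
 - by move=> x; rewrite !TE /= !addrK; case: (x) => [[]].
 - split; first by rewrite TE !subrr p2.
  move=> x r /surface0 x2 r0 _; rewrite /sect eqxx TE /= x2 /rad /=.
  split => [->|[<- _]]; first by rewrite sqrtr_sqr gtr0_norm.
  by rewrite sqr_sqrtr// addr_ge0 ?sqr_ge0.
have k2 : k ^+ 2 = 1 by case: hk kn0 => ->; rewrite ?eqxx// ?sqrrN expr1n.
have [pE ppos] := ps.
(* Coefficient of the reflection along v = p - [north]: the metric square of v is 2 k (1 - p.2), and
   1 / k = k. *)
pose ka := k / (1 - p.2).
have kaE : ka * (k * (1 - p.2)) = 1 \/ [/\ ka = 0, p.1.1 = 0, p.1.2 = 0 & p.2 = 1].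
 have [e|n] := eqVneq p.2 1; last first.
  left; rewrite /ka; have n' : 1 - p.2 != 0 by rewrite subr_eq0 eq_sym.
  by transitivity (k ^+ 2); [field|].
 right; rewrite /ka e subrr invr0 mulr0; move: pE; rewrite e expr1n => pE.
 have h : p.1.1 ^+ 2 + p.1.2 ^+ 2 = 0.
  by apply: (mulfI kn0); rewrite mulr0; lra.
 have h1 := sqr_ge0 p.1.1; have h2 := sqr_ge0 p.1.2.
 have /eqP : p.1.1 ^+ 2 = 0 by lra.
 have /eqP : p.1.2 ^+ 2 = 0 by lra.
 by rewrite !sqrf_eq0 => /eqP -> /eqP ->.
have ppE : p.1.1 ^+ 2 + p.1.2 ^+ 2 = k * (1 - p.2 ^+ 2).
 by transitivity (k ^+ 2 * (p.1.1 ^+ 2 + p.1.2 ^+ 2)); [rewrite k2 mul1r|rewrite -pE; ring].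
pose in1 x := x.1.1 * p.1.1 + x.1.2 * p.1.2 + k * (x.2 * (p.2 - 1)).
pose T := aff ((1 - ka * (p.1.1 * p.1.1), - (ka * (p.1.1 * p.1.2))), - (ka * (p.1.1 * (k * (p.2 - 1)))))
 ((- (ka * (p.1.2 * p.1.1)), 1 - ka * (p.1.2 * p.1.2)), - (ka * (p.1.2 * (k * (p.2 - 1)))))
 ((- (ka * ((p.2 - 1) * p.1.1)), - (ka * ((p.2 - 1) * p.1.2))), 1 - ka * ((p.2 - 1) * (k * (p.2 - 1)))) ((0, 0), 0).
have TE x : T x = ((x.1.1 - ka * in1 x * p.1.1, x.1.2 - ka * in1 x * p.1.2), x.2 - ka * in1 x * (p.2 - 1)).
 by rewrite /T /aff /dot /in1 /=; congr (_, _, _); ring.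
have ee : p.1.1 ^+ 2 + p.1.2 ^+ 2 + k * (p.2 - 1) ^+ 2 = 2 * (k * (1 - p.2)) by rewrite ppE; ring.
have inT x : in1 (T x) = - in1 x.
 have -> : in1 (T x) = in1 x - ka * in1 x * (p.1.1 ^+ 2 + p.1.2 ^+ 2 + k * (p.2 - 1) ^+ 2).
  by rewrite TE /in1 /=; ring.
 rewrite ee; case: kaE => [h|[-> h1 h2 h3]].
  by transitivity (in1 x - 2 * in1 x * (ka * (k * (1 - p.2)))); [ring|rewrite h; ring].
 by rewrite /in1 h1 h2 h3; ring.
have TT : cancel T T.
 move=> x; rewrite [LHS]TE inT TE /=; case: (x) => [[a b] d] /=; congr (_, _, _); ring.
have met v : metric k (T v) (T v) = metric k v v.
 have -> : metric k (T v) (T v) = metric k v v - 2 * ka * in1 v ^+ 2 +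
   ka ^+ 2 * in1 v ^+ 2 * (p.1.1 ^+ 2 + p.1.2 ^+ 2 + k * (p.2 - 1) ^+ 2).
  by rewrite TE /metric /in1 /=; ring.
 rewrite ee; case: kaE => [h|[-> h1 h2 h3]].
  by transitivity (metric k v v - 2 * ka * in1 v ^+ 2 * (1 - ka * (k * (1 - p.2)))); [ring|rewrite h; ring].
 by ring.
have T2 x : (T x).2 = form k p x.
 rewrite TE /=; case: kaE => [h|[-> h1 h2 h3]]; last by rewrite /form h1 h2 h3; ring.
 transitivity (x.2 + k * (ka * (k * (1 - p.2))) * in1 x - (k ^+ 2 - 1) * ka * in1 x * (1 - p.2)); first by ring.
 rewrite h k2 subrr !mul0r subr0 mulr1 /form /in1.
 by transitivity (x.2 + k * (x.1.1 * p.1.1 + x.1.2 * p.1.2) + k ^+ 2 * (x.2 * (p.2 - 1))); [ring|rewrite k2; ring].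
have qm x : x.2 ^+ 2 + k * (x.1.1 ^+ 2 + x.1.2 ^+ 2) = k * metric k x x.
 rewrite /metric; transitivity (k ^+ 2 * x.2 ^+ 2 + k * (x.1.1 ^+ 2 + x.1.2 ^+ 2)); [by rewrite k2 mul1r|by ring].
have Ts x : surface k x -> surface k (T x).
 move=> xs; have [xE xpos] := xs; split; first by rewrite qm met -qm.
 move=> kn1; have kE : k = -1 by case: hk => // h; rewrite h eqxx in kn0.
 by rewrite T2; move: xs ps; rewrite kE => xs ps'; exact: surface_form_gt0.
have Tp : preserves k T.
 apply: aff_preserves => [//|v].
 have := met v; rewrite /T /aff /= !addr0; exact.
exists T, T; split => //; split.
 rewrite TE; have -> : in1 p = k * (1 - p.2).
  by rewrite /in1; transitivity (p.1.1 ^+ 2 + p.1.2 ^+ 2 + k * (p.2 * (p.2 - 1))); [ring|rewrite ppE; ring].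
 rewrite /north; case: kaE => [->|[-> h1 h2 h3]]; last by rewrite h1 h2 h3; congr (_, _, _); ring.
 by congr (_, _, _); ring.
move=> x r xs r0 r1; have [txE txpos] := Ts x xs.
rewrite /sect (negbTE kn0) -T2.
have rE : rad (T x) ^+ 2 = k * (1 - (T x).2 ^+ 2).
 rewrite rad2; transitivity (k ^+ 2 * ((T x).1.1 ^+ 2 + (T x).1.2 ^+ 2)); first by rewrite k2 mul1r.
 by rewrite -txE; ring.
have d0 : 0 <= 1 - k * r ^+ 2.
 case: hk => kE; [by rewrite kE mulN1r opprK addr_ge0 ?sqr_ge0|by rewrite kE eqxx in kn0|].
 by rewrite kE mul1r; have := r1 kE; nra.
have rr := rad_ge0 (T x).
split => [h|[h1 h2]].
 have h2 : (T x).2 ^+ 2 = 1 - k * r ^+ 2 by rewrite h sqr_sqrtr.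
 split; last by rewrite h sqrtr_ge0.
 have e : rad (T x) ^+ 2 = r ^+ 2.
  by rewrite rE h2; transitivity (k ^+ 2 * r ^+ 2); [ring|rewrite k2 mul1r].
 by apply/eqP; rewrite -(@eqrXn2 _ 2)// ?ltW//; apply/eqP.
rewrite -(ger0_norm h2) -sqrtr_sqr; congr Num.sqrt.
by rewrite -h1 rE; transitivity (1 - k ^+ 2 * (1 - (T x).2 ^+ 2)); [rewrite k2; ring|ring].
Qed.

Lemma sinh_inj : injective (@sinh R).
Proof.
have h (x y : R) : x < y -> sinh x < sinh y.
 move=> xy; rewrite /sinh ltr_pM2r ?invr_gt0// ltrB// ltr_expR//.
 by rewrite ltrN2.
by move=> x y e; case: (ltgtP x y) => // /h; rewrite e ltxx.
Qed.

Lemma sinh_arsinh (u : R) : sinh (arsinh u) = u.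
Proof.
have p := arsinh_pos u; rewrite /sinh expRN /arsinh lnK//.
have q0 : 0 <= 1 + u ^+ 2 by rewrite addr_ge0 ?sqr_ge0.
have := sqr_sqrtr q0; move: p; move: (Num.sqrt _) => w p w2.
have p0 : u + w != 0 by rewrite gt_eqF.
apply: (mulIf p0); apply: (@mulfI _ 2); first by [].
transitivity ((u + w) ^+ 2 - 1); first by field.
by transitivity (u ^+ 2 + 2 * u * w + w ^+ 2 - 1); [ring|rewrite w2; ring].
Qed.

Lemma asinhE (u : R) : asinh u = arsinh u.
Proof.
apply: sinh_inj; rewrite sinh_arsinh.
by apply: (getPex (P := [set x | sinh x = u])); exists (arsinh u); exact: sinh_arsinh.
Qed.

(** On the sphere [rad] is the sine of the distance and does not separate the hemispheres; the sign
    of x.2 selects the one where the distance is at most pi / 2, the range of asin s. *)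
Lemma dist_north_eq k s x : [\/ k = -1, k = 0 | k = 1] -> surface k x -> 0 < s -> (k = 1 -> s <= 1) ->
 riem_dist k north x = AS k s <-> rad x = s /\ 0 <= x.2.
Proof.
move=> hk xs s0 s1; have r0 := rad_ge0 x.
have n11 : (-1 : R) == 1 = false.
 by apply/eqP => h; have h2 : (1 + 1 : R) = 0 by [rewrite -{1}h addNr]; move/eqP: h2; rewrite -[1 + 1]/(2%:R) pnatr_eq0.
case: hk => kE; move: xs s1; rewrite kE => xs s1.
- rewrite (dist_hyp xs) /AS n11 eqxx asinhE.
 have [xE xpos] := xs; have x0 : 0 < x.2 by apply: xpos; apply/eqP; rewrite n11.
 have -> : ln (x.2 + rad x) = arsinh (rad x).
  rewrite /arsinh addrC; congr (ln (_ + _)); rewrite -[LHS]gtr0_norm// -sqrtr_sqr; congr Num.sqrt.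
  by rewrite rad2 -xE; ring.
 split => [h|[-> _]//]; split; last exact: ltW.
 by rewrite -(sinh_arsinh (rad x)) h sinh_arsinh.
- have o0 : (0 : R) == 1 = false by rewrite eq_sym oner_eq0.
 have o1 : (0 : R) == -1 = false by rewrite eq_sym oppr_eq0 oner_eq0.
 rewrite (dist_flat xs) /AS o0 o1; move/surface0: xs => ->.
 by split => [->|[]].
- rewrite (dist_sphere xs) /AS eqxx; have {}s1 := s1 erefl.
 have [xE _] := xs; move: xE; rewrite mul1r -rad2 => xE.
 have sI : s \in `[-1, 1] by rewrite in_itv/= s1 andbT; lra.
 have xI : x.2 \in `[-1, 1] by rewrite in_itv/=; apply/andP; split; nra.
 have as0 : 0 <= asin s.
  rewrite leNgt; apply/negP => h; have := asinK sI => e.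
  have : sin (asin s) < 0.
   have a1 := asin_geNpi2; have : - (pi / 2) <= asin s by apply: asin_geNpi2; move: sI; rewrite in_itv.
   move=> h2; rewrite -oppr_gt0 -sinN; apply: sin_gt0_pi; apply/andP; split; first by lra.
   by have := pi_gt0 R; lra.
  by rewrite e; lra.
 have asp : asin s <= pi / 2 by apply: asin_lepi2; move: sI; rewrite in_itv.
 have cs : cos (asin s) = Num.sqrt (1 - s ^+ 2) by apply: cos_asin; move: sI; rewrite in_itv.
 have pp := pi_gt0 R.
 split => [h|[h1 h2]].
  have x2 : x.2 = Num.sqrt (1 - s ^+ 2) by rewrite -cs -h acosK.
  split; last by rewrite x2 sqrtr_ge0.
  have x22 : x.2 ^+ 2 = 1 - s ^+ 2 by rewrite x2 sqr_sqrtr//; nra.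
  by apply/eqP; rewrite -(@eqrXn2 _ 2)// ?ltW//; apply/eqP; lra.
 have -> : x.2 = cos (asin s).
  by rewrite cs -(ger0_norm h2) -sqrtr_sqr; congr Num.sqrt; rewrite -h1; lra.
 by rewrite cosK// in_itv/= as0; lra.
Qed.

Lemma exists_angle (u v s : R) : 0 < s -> u ^+ 2 + v ^+ 2 = s ^+ 2 ->
 exists2 t, t \in `[0, 1] & u = s * cos (2 * pi * t) /\ v = s * sin (2 * pi * t).
Proof.
move=> s0 uv; have pp := pi_gt0 R.
have sn : s != 0 by rewrite gt_eqF.
have us : -1 <= u / s <= 1.
 by rewrite ler_pdivlMr// ler_pdivrMr// mulN1r mul1r; have := sqr_ge0 v; move=> h; apply/andP; split; nra.
pose th := acos (u / s).
have th0 : 0 <= th by exact: acos_ge0.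
have thp : th <= pi by exact: acos_lepi.
have cth : s * cos th = u by rewrite /th acosK ?in_itv//= mulrC divfK.
have sth : s * sin th = `|v|.
 rewrite /th sin_acos// -(gtr0_norm s0) -sqrtr_sqr -sqrtrM ?sqr_ge0// -sqrtr_sqr; congr Num.sqrt.
 rewrite sqrtr_sqr gtr0_norm// expr_div_n mulrBr mulr1 mulrC divfK ?expf_neq0//.
 by rewrite -uv; ring.
have p2 : 2 * pi != 0 :> R by rewrite gt_eqF// mulr_gt0.
have [v0|v0] := leP 0 v.
 exists (th / (2 * pi)).
  rewrite in_itv/=; apply/andP; split; first by rewrite divr_ge0// ltW// mulr_gt0.
  by rewrite ler_pdivrMr ?mulr_gt0//; lra.
 have e : 2 * pi * (th / (2 * pi)) = th by rewrite mulrC divfK.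
 by rewrite e cth sth ger0_norm.
exists (1 - th / (2 * pi)).
 rewrite in_itv/=; apply/andP; split.
  by rewrite subr_ge0 ler_pdivrMr ?mulr_gt0//; lra.
 by rewrite gerBl divr_ge0// ltW// mulr_gt0.
have -> : 2 * pi * (1 - th / (2 * pi)) = 2 * pi - th by rewrite mulrBr mulr1 [2 * pi * (th / _)]mulrC divfK.
have e1 : cos (2 * pi - th) = cos th by rewrite cosB [2 * pi]mulr_natl sin2pi cos2pi; ring.
have e2 : sin (2 * pi - th) = - sin th by rewrite sinB [2 * pi]mulr_natl sin2pi cos2pi; ring.
by rewrite e1 e2 mulrN cth sth ltr0_norm// opprK.
Qed.

(** The zero terms keep every coordinate in the shape covered by [smooth1_trig] and
    [derive1_trig]. *)
Definition round (s b t : R) : R * R * R :=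
 ((s * cos (2 * pi * t) + 0 * sin (2 * pi * t) + 0, 0 * cos (2 * pi * t) + s * sin (2 * pi * t) + 0),
  0 * cos (2 * pi * t) + 0 * sin (2 * pi * t) + b).

Lemma roundE s b t : round s b t = ((s * cos (2 * pi * t), s * sin (2 * pi * t)), b).
Proof. by rewrite /round; congr (_, _, _); ring. Qed.

Lemma round_curve k s b : 0 < s -> b ^+ 2 + k * s ^+ 2 = 1 -> 0 <= b -> (k <> 1 -> 0 < b) ->
 (k = 0 -> b = 1) ->
 [/\ curve_in k (round s b), simple_closed (round s b), arc_length k (round s b) = 2 * pi * s &
  forall x, surface k x -> curve_image (round s b) x <-> rad x = s /\ 0 <= x.2].
Proof.
move=> s0 bs b0 bpos kb; have pp := pi_gt0 R.
have surf t : surface k (round s b t).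
 rewrite roundE; split => //=; rewrite !exprMn -mulrDr.
 by have := cos2Dsin2 (2 * pi * t) => ->; rewrite mulr1.
split.
- by apply: smooth_curve => //; split; exact: smooth1_trig.
- split.
  by rewrite !roundE mulr0 mulr1 cos0 sin0 [2 * pi]mulr_natl sin2pi cos2pi.
 move=> u v; rewrite !in_itv/= => /andP[u0 u1] /andP[v0 v1]; rewrite !roundE => -[].
 have sn : s != 0 by rewrite gt_eqF.
 move=> /(mulfI sn) c1 /(mulfI sn) s1.
 have [|n nE] := @expi_eq R (2 * pi * u) (2 * pi * v); first by rewrite /expi c1 s1.
 have e : u = v + n%:~R.
  have p2 : 2 * pi != 0 :> R by rewrite gt_eqF// mulr_gt0.
  by apply: (mulfI p2); rewrite nE; ring.
 have n0 : n = 0.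
  have h1 : (n%:~R : R) < 1%:~R by rewrite mulr1z; lra.
  have h2 : ((-1)%:~R : R) < n%:~R by rewrite mulrN1z; lra.
  move: h1 h2; rewrite !ltr_int; case: n {nE e} => [[|m]|m] //; by case: m.
 by rewrite e n0 addr0.
- apply: arc_length_const => [|t]; first by rewrite !mulr_ge0 ?ltW.
 rewrite /velocity /metric /round /= !derive1_trig.
 have := cos2Dsin2 (2 * pi * t); move: (cos _) (sin _) => C S h.
 transitivity ((2 * pi * s) ^+ 2 * (C ^+ 2 + S ^+ 2)); first by ring.
 by rewrite h mulr1.
- move=> x xs; split.
  move=> [t _ <-]; rewrite roundE /rad /=; split => //.
  rewrite !exprMn -mulrDr; have := cos2Dsin2 (2 * pi * t) => ->.
  by rewrite mulr1 sqrtr_sqr gtr0_norm.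
 move=> [xr x0]; have xr2 : x.1.1 ^+ 2 + x.1.2 ^+ 2 = s ^+ 2 by rewrite -rad2 xr.
 have [t t01 [e1 e2]] := exists_angle s0 xr2.
 exists t => //; rewrite roundE -e1 -e2.
 have [xE _] := xs; have xb : x.2 ^+ 2 = b ^+ 2 by move: xE; rewrite xr2; lra.
 have -> : b = x.2 by apply/eqP; rewrite -(@eqrXn2 _ 2)// eq_sym; apply/eqP.
 by case: (x) => [[]].
Qed.

(** h is the height of a cap about the north pole, of area 2 pi h by Archimedes. The same formula
    holds for k = -1, and for k = 0 with h half the squared radius. *)
Lemma round_encloses k A : [\/ k = -1, k = 0 | k = 1] -> 0 < A -> (k = 1 -> A <= 2 * pi) ->
 let h := A / (2 * pi) in
 encloses k (round (Num.sqrt (h * (2 - k * h))) (1 - k * h)) A.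
Proof.
move=> hk A0 A1 h; have pp := pi_gt0 R.
have p2 : 0 < 2 * pi :> R by rewrite mulr_gt0.
have h0 : 0 < h by rewrite divr_gt0.
have h1 : k = 1 -> h <= 1 by move=> /A1; rewrite /h ler_pdivrMr// mul1r.
have d0 : 0 < 2 - k * h.
 by case: hk => kE; rewrite kE ?mul0r ?mulN1r ?mul1r; [lra|lra|have := h1 kE; lra].
have hE : 2 * pi * h = A by rewrite /h mulrC divfK// gt_eqF.
clearbody h; pose s := Num.sqrt (h * (2 - k * h)); rewrite -/s.
have s2 : s ^+ 2 = h * (2 - k * h) by rewrite sqr_sqrtr// mulr_ge0// ltW.
have s0 : 0 < s by rewrite sqrtr_gt0 mulr_gt0.
have b0 : 0 <= 1 - k * h by case: hk => kE; rewrite kE ?mul0r ?mulN1r ?mul1r; [lra|lra|have := h1 kE; lra].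
have bpos : k <> 1 -> 0 < 1 - k * h by case: hk => kE; rewrite kE ?mul0r ?mulN1r ?mul1r => // _; lra.
have bs : (1 - k * h) ^+ 2 + k * s ^+ 2 = 1 by rewrite s2; ring.
have kb : k = 0 -> 1 - k * h = 1 by move=> ->; rewrite mul0r subr0.
have [cin csc _ im] := round_curve s0 bs b0 bpos kb.
set c := round s (1 - k * h) in cin csc im *.
(* The height below the pole for k = 1, above it for k = -1, and half the squared distance for k =
   0: one function whose level sets are the circles about [north]. *)
pose tau x := (1 - x.2) * k + (1 - k ^+ 2) * (x.1.1 ^+ 2 + x.1.2 ^+ 2) / 2.
have tauE x : surface k x -> [/\ 0 <= tau x, x.2 = 1 - k * tau x & x.1.1 ^+ 2 + x.1.2 ^+ 2 = tau x * (2 - k * tau x)].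
 move=> xs; have h2 := sqr_ge0 x.1.1; have h3 := sqr_ge0 x.1.2; have [xE xpos] := xs.
 have n11 : (-1 : R) <> 1 by move=> e; have e2 : (1 + 1 : R) = 0 by [rewrite -{1}e addNr]; move/eqP: e2; rewrite -[1 + 1]/(2%:R) pnatr_eq0.
 move: xs xE xpos; rewrite /tau; case: hk => kE; rewrite kE => xs xE xpos.
 - have x0 := xpos n11; split; [nra|ring|nra].
 - have x21 : x.2 = 1 by exact/surface0.
  rewrite x21; split.
  + by rewrite subrr mul0r expr0n/= subr0 mul1r add0r divr_ge0// addr_ge0 ?sqr_ge0.
  + by rewrite mul0r subr0.
  + by field.
 - split; [nra|ring|nra].
have im' x : surface k x -> curve_image c x <-> tau x = h.
 move=> xs; have [t0 x2 r2] := tauE x xs; rewrite (im x xs).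
 split => [[xr x0]|th]; last first.
  by rewrite x2 th; split => //; rewrite /rad r2 th.
 have {}xr : rad x ^+ 2 = h * (2 - k * h) by rewrite xr.
 move: xr; rewrite rad2 r2 => e.
 have : (tau x - h) * (2 - k * (tau x + h)) = 0.
  by transitivity (tau x * (2 - k * tau x) - h * (2 - k * h)); [ring|rewrite e subrr].
 move=> /eqP; rewrite mulf_eq0 => /orP[|]; first by rewrite subr_eq0 => /eqP.
 rewrite subr_eq0 => /eqP e2; move: x0; rewrite x2.
 case: hk => kE; move: e2; rewrite kE ?mul0r ?mulN1r ?mul1r => e2; [lra|lra|].
 by have := h1 kE; lra.
have ns : surface k (@north R).
 by split; rewrite /= ?expr1n ?expr0n/= ?addr0 ?mulr0 ?addr0// => _; exact: ltr01.
have tn : tau (@north R) = 0 by rewrite /tau /north /= !expr0n/=; ring.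
have nU : (surface k `\` curve_image c) (@north R).
 by split => // /(im' _ ns); rewrite tn => e; move: h0; rewrite -e ltxx.
exists (@north R) => //; set U := connected_component _ _.
have nn : U (@north R) by exact: connected_component_refl.
have ctau : continuous tau.
 move=> x; apply: cvgD.
  by apply: cvgM; [apply: cvgB; [exact: cvg_cst|exact: cont2]|exact: cvg_cst].
 apply: cvgM; last exact: cvg_cst.
 apply: cvgM; first exact: cvg_cst.
 by apply: cvgD; apply: cvg_sqr; [exact: cont11|exact: cont12].
have k3 : k ^+ 3 = k by case: hk => ->; rewrite ?expr0n ?expr1n// exprS sqrrN expr1n mulr1.
have tau_emb z : 0 < 1 + k * norm2 z -> tau (emb k z) = 2 * norm2 z / (1 + k * norm2 z).
 move=> z0; have e := emb_norm2 k z; rewrite /tau -[(emb k z).1.1 ^+ 2 + (emb k z).1.2 ^+ 2]/(norm2 (emb k z).1) e.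
 have -> : (emb k z).2 = 2 / (1 + k * norm2 z) - 1 by rewrite /emb /= /lamC -norm2_cabs.
 move: (norm2 z) z0 => n z0; have z1 : 1 + k * n != 0 by rewrite gt_eqF.
 apply: (mulIf z1); apply: (mulIf z1).
 transitivity (2 * k ^+ 2 * n * (1 + k * n) + 2 * (1 - k ^+ 2) * n); first by field.
 transitivity (2 * n + 2 * k ^+ 3 * n ^+ 2); first by ring.
 by rewrite k3; field.
(* tau equals h only on the curve, so tau < h is open and closed in the component. Conversely such
   points are joined to the pole along rays of the chart, on which tau grows with the radius. *)
have UE : U = [set x | surface k x /\ tau x < h].
 apply/seteqP; split => [x Ux|x [xs xh]].
  have xs : surface k x by have [] := connected_component_sub Ux.
  split => //; suff : (U `&` [set x | tau x < h]) x by case.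
  have Uc : connected U by exact: component_connected.
  rewrite (Uc (U `&` [set x | tau x < h]))//.
  - by exists (@north R); split => //=; rewrite tn.
  - exists [set x | tau x < h] => //.
   by apply: (@open_comp _ _ tau [set y | y < h]); [move=> y _; exact: ctau|exact: open_lt].
  - exists [set x | tau x <= h].
    by apply: (@closed_comp _ _ tau [set y | y <= h]); [move=> y _; exact: ctau|exact: closed_le].
   apply/seteqP; split => y [Uy /= yh]; split => //=; first exact: ltW.
   have [ys yc] := connected_component_sub Uy.
   by rewrite lt_neqAle yh andbT; apply/eqP => /(im' _ ys).
 have [t0 x2 r2] := tauE x xs.
 have x0 : 0 < 1 + x.2.
  rewrite x2; case: hk => kE; rewrite kE ?mul0r ?mulN1r ?mul1r; [lra|lra|].
  by have := h1 kE; lra.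
 have [e1 _ e3] := chart_surface hk xs x0.
 pose g (t : R) := scale_pt (fun=> t) (chart x).
 have gn t : norm2 (g t) = t ^+ 2 * norm2 (chart x) by rewrite /norm2 /g /scale_pt /=; ring.
 have n0 := norm2_ge0 (chart x).
 have d1 : 0 < 1 + k * norm2 (chart x) by rewrite norm2_cabs e1 divr_gt0.
 have gd t : t \in `[0, 1] -> 0 < 1 + k * norm2 (g t).
  rewrite in_itv/= => /andP[ta tb]; rewrite gn.
  have t2 : t ^+ 2 <= 1 by nra.
  have t3 := sqr_ge0 t; case: hk d1 => ->; rewrite ?mul0r ?mulN1r ?mul1r => d1; nra.
 have gt t : t \in `[0, 1] -> tau (emb k (g t)) < h.
  move=> t01; rewrite tau_emb ?gd//; apply: le_lt_trans xh.
  rewrite -e3 (tau_emb _ d1) ler_pdivrMr ?gd// mulrAC ler_pdivlMr//.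
  move: t01; rewrite gn in_itv/= => /andP[ta tb]; have t2 : t ^+ 2 <= 1 by nra.
  rewrite -subr_ge0.
  have -> : 2 * norm2 (chart x) * (1 + k * (t ^+ 2 * norm2 (chart x))) -
   2 * (t ^+ 2 * norm2 (chart x)) * (1 + k * norm2 (chart x)) = 2 * norm2 (chart x) * (1 - t ^+ 2) by ring.
  by rewrite !mulr_ge0// subr_ge0.
 have cg : continuous g.
  by move=> t; apply: cvg_pair_pt; apply: cvgM; (exact: cvg_cst || exact: cvg_id).
 have g0 : emb k (g 0) = @north R.
  have -> : g 0 = (0, 0) by rewrite /g /scale_pt !mulr0.
  have n00 : norm2 (0, 0) = 0 :> R by rewrite /norm2 /= !expr0n /= addr0.
  have l0 : lamC k (toC (0, 0)) = 2 by rewrite /lamC -norm2_cabs n00 mulr0 addr0 divr1.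
  have e2 : 2 - 1 = 1 :> R by ring.
  by rewrite /emb l0 /= !mulr0 e2.
 have g1 : emb k (g 1) = x by rewrite /g /scale_pt !mulr1 -surjective_pairing e3.
 apply: (@connected_component_max _ _ ((emb k \o g) @` `[0, 1]%classic)).
 - by exists 0 => //=; rewrite in_itv/= lexx ler01.
 - move=> _ [t t01 <-]; have es : surface k (emb k (g t)) by apply: emb_surf => //; exact: gd.
  by split => //= /(im' _ es) e; have := gt t t01; rewrite e ltxx.
 - apply: connected_continuous_connected; first exact: segment_connected.
  apply: (@within_continuous_comp _ _ _ _ g (emb k)); last exact: continuous_subspaceT.
  by move=> _ /set_mem[t t01 <-]; apply: continuous_emb; exact: gd.
 - by exists 1 => //=; rewrite in_itv/= ler01 lexx.
have UM x : U x -> [/\ `|x.1.1| <= 2 + h, `|x.1.2| <= 2 + h & `|x.2| <= 2 + h].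
 rewrite UE => -[/tauE[t0 x2 r2] xh].
 have h2 := sqr_ge0 x.1.1; have h3 := sqr_ge0 x.1.2.
 have r3 : x.1.1 ^+ 2 + x.1.2 ^+ 2 <= (2 + h) ^+ 2.
  rewrite r2; case: hk => ->; rewrite ?mul0r ?mulN1r ?mul1r; nra.
 split; rewrite ler_norml; apply/andP; split; [nra|nra|nra|nra| |];
  rewrite x2; case: hk => ->; rewrite ?mul0r ?mulN1r ?mul1r; lra.
split.
 move=> _; pose I : set R := `[- (2 + h), 2 + h]%classic.
 have cI : compact ((I `*` I) `*` I) by apply: compact_setX; [apply: compact_setX|]; exact: segment_compact.
 have clI : closed ((I `*` I) `*` I) by apply: compact_closed => //; exact: norm_hausdorff.
 apply: (subclosed_compact _ cI); first exact: closed_closure.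
 rewrite [X in _ `<=` X](closure_id _).1//; apply: closure_subset => x /UM[e1 e2 e3].
 by split; [split|]; rewrite /I /= in_itv/= -ler_norml.
(* Radius of the circle in the chart: tau = 2 n / (1 + k n) at squared radius n, and this is h at n
   = h / (2 - k h). *)
pose R0 := Num.sqrt (h / (2 - k * h)).
have R02 : R0 ^+ 2 = h / (2 - k * h) by rewrite sqr_sqrtr// divr_ge0// ltW.
have R00 : 0 < R0 by rewrite sqrtr_gt0 divr_gt0.
have R01 : k = -1 -> R0 < 1.
 move=> kE; have : R0 ^+ 2 < 1 by rewrite R02 ltr_pdivrMr// kE mul1r; lra.
 by nra.
have DE z : chart_set k U z <-> norm2 z < R0 ^+ 2.
 rewrite /chart_set UE /= R02 ltr_pdivlMr//; have n0 := norm2_ge0 z.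
 split => [[z0 [_]]|zl].
  by rewrite tau_emb// ltr_pdivrMr//; lra.
 have z0 : 0 < 1 + k * norm2 z.
  case: hk => kE; rewrite kE ?mul0r ?mulN1r ?mul1r; [|lra|lra].
  by move: zl; rewrite kE mulN1r opprK; nra.
 split => //; split; first exact: emb_surf.
 by rewrite tau_emb// ltr_pdivrMr//; lra.
have DE' : chart_set k U = [set z | norm2 z < R0 ^+ 2].
 by apply/seteqP; split => z; move/DE.
have mD : measurable (chart_set k U : set (TR * TR)).
 rewrite DE'; apply: open_measurable2.
 apply: (@open_comp _ _ (@norm2 R) [set y | y < R0 ^+ 2]); last exact: open_lt.
 by move=> z _; exact: continuous_norm2.
have Us : U `<=` surface k by rewrite UE => x [].
have DM z : chart_set k U z -> norm2 z < R0 ^+ 2 by move/DE.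
have -> : area k U = (\int[mu2]_z (ind (chart_set k U) z * lam2 k z)%:E)%E.
 case: hk => kE.
 - by apply: (area_chart_lt _ Us mD R00 R01 DM); left.
 - by apply: (area_chart_lt _ Us mD R00 R01 DM); right.
 - have US : ~ U ((0, 0), -1).
   rewrite UE => -[xs xh]; have [t0 x2 _] := tauE _ xs.
   by move: x2 xh; rewrite /= kE mul1r; have := h1 kE; lra.
  have gen (k' : R) (U' : set (R * R * R)) : k' = 1 -> U' `<=` surface k' -> ~ U' ((0, 0), -1) ->
   measurable (chart_set k' U' : set (TR * TR)) -> (forall z, chart_set k' U' z -> norm2 z < R0 ^+ 2) ->
   area k' U' = (\int[mu2]_z (ind (chart_set k' U') z * lam2 k' z)%:E)%E.
   by move=> -> Us' US' mD' DM'; exact: (area_chart_sphere Us' US' mD' R00 DM').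
  exact: (gen k U kE Us US mD DM).
transitivity (\int[mu2]_z ((if (norm2 z < R0 ^+ 2)%R then 1 else 0) * lam2 k z)%:E)%E.
 apply: eq_integral => z _; rewrite /ind DE'; congr (_ * _)%:E.
 by case: asboolP => /= [->//|/negP/negbTE ->].
rewrite (integral_lam2_disc hk R00 R01) R02; congr (_%:E).
have d1 : 2 - k * h != 0 by rewrite gt_eqF.
have -> : 1 + k * (h / (2 - k * h)) = 2 / (2 - k * h) by field.
have -> : 4 * pi * (h / (2 - k * h)) / (2 / (2 - k * h)) = 2 * pi * h by field.
exact: hE.
Qed.
End isometries.

(** * The isoperimetric inequality on the three surfaces *)

Section isoperimetry.
Context {R : realType}.
Notation mu := (@lebesgue_measure R).
Notation TR := (measurableTypeR R).
Notation mu2 := (mu \x mu)%E.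
Implicit Types (k A B M : R) (c : R -> R * R * R) (x p : R * R * R) (E : set (R * R * R)).

Definition image_section k c : Prop := exists p r, [/\ surface k p, 0 < r, k = 1 -> r <= 1 &
 forall x, surface k x -> (curve_image c x <-> sect k p r x)].

Definition isoperimetric k A c : Prop :=
 A * (4 * pi - k * A) <= arc_length k c ^+ 2 /\
 (arc_length k c ^+ 2 = A * (4 * pi - k * A) -> image_section k c).

Notation comp k c x := (connected_component (surface k `\` curve_image c) x).

Lemma curve_image_surface k c x : curve_in k c -> curve_image c x -> surface k x.
Proof. by move=> [_ _ cs] [t t01 <-]; exact: cs. Qed.

Lemma arc_length_ge0 k c : 0 <= arc_length k c.
Proof. by apply: Rintegral_ge0 => t _; exact: sqrtr_ge0. Qed.

(** The factor a^2 >= 1 may be dropped. If L^2 = q, then a^2 q <= L^2 = q forces equality in the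
    sharper inequality as well, and the equality case applies. *)
Lemma side_isoperimetric k c E M B :
 [\/ k = -1, k = 0 | k = 1] -> curve_in k c -> simple_closed c -> rel_open k E -> E !=set0 ->
 (forall y, closure E y -> surface k y -> ~ curve_image c y -> E y) ->
 (forall y, E y -> ~ curve_image c y) -> 0 < M -> (k = -1 -> M < 1) ->
 (forall y, E y \/ curve_image c y -> 0 < 1 + y.2 /\ norm2 (chart y) < M ^+ 2) ->
 area k E = B%:E -> 0 < B * (4 * pi - k * B) -> isoperimetric k B c.
Proof.
move=> hk cin csc Eo Ene Ecl EG M0 kM EM aE q0.
have sa : area k E = (\int[mu2]_(x in chart_set k E) lam2 k x)%:E.
 exact: (side_area hk Eo M0 kM EM).
have BE : \int[mu2]_(x in chart_set k E) lam2 k x = B.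
 by move: sa; rewrite aE => -[<-].
have [s [a [ps Dc a1 ineq eqn]]] := side_core hk cin csc Eo Ene Ecl EG M0 kM EM.
move: ineq eqn; rewrite BE -mulrA; set q := B * (4 * pi - k * B) in q0 *.
set aa := a%:~R ^+ 2 in a1 *; move=> ineq eqn.
have qa : q <= aa * q by rewrite ler_pMl.
split; first exact: le_trans ineq.
move=> Lq0; have Lq : arc_length k c ^+ 2 = q := Lq0; have aq : arc_length k c ^+ 2 = aa * q by apply/eqP; rewrite eq_le ineq andbT Lq.
have fl := eqn aq.
have Lp : 0 < arc_length k c.
 rewrite lt_neqAle arc_length_ge0 andbT eq_sym; apply/eqP => L0.
 by move: q0; rewrite -Lq L0 expr0n/= ltxx.
have cp t : t \in `[0, 1] -> 0 < 1 + (c t).2.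
 by move=> t01; have [] := EM (c t) (or_intror (ex_intro2 _ _ t t01 erefl)).
have [z0 [T [C [T0 C0 CP]]]] := flat_circle hk cin csc cp ps Dc Lp fl.
have Gs x : curve_image c x -> surface k x /\ 0 < 1 + x.2.
 by move=> Gx; split; [exact: curve_image_surface Gx|have [] := EM x (or_intror Gx)].
apply: (chart_circle_section (z0 := z0) hk T0 C0 Gs) => z; apply: (iff_trans _ (CP z)).
split => [[_ [t t01 <-] <-]|[t t01 <-]]; first by exists t.
by exists (c t) => //; exists t.
Qed.

Lemma norm_coords x : [/\ `|x.1.1| <= `|x|, `|x.1.2| <= `|x| & `|x.2| <= `|x|].
Proof. by rewrite !prod_normE !le_max !lexx /= !orbT. Qed.

Lemma isoperimetric_neq1 k c A : k = -1 \/ k = 0 -> 0 < A -> admissible k A c -> isoperimetric k A c.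
Proof.
move=> hk A0 [cin csc [x xU [cU aU]]].
have kn1 : k <> 1.
 case: hk => -> /eqP; last by rewrite eq_sym oner_eq0.
 by rewrite eq_sym -subr_eq0 opprK -[1 + 1]/(2%:R) pnatr_eq0.
have hk3 : [\/ k = -1, k = 0 | k = 1] by case: hk; [constructor 1|constructor 2].
have bU := compact_bounded (cU kn1).
have bG := compact_bounded (curve_image_compact cin).
have [B B0 BP] : exists2 B, 0 < B & forall y, comp k c x y \/ curve_image c y -> `|y| <= B.
 case: bU => N1 [_ H1]; case: bG => N2 [_ H2].
 exists (Num.max 0 (Num.max N1 N2) + 1).
  by rewrite ltr_wpDl// le_max lexx.
 have l1 : N1 < Num.max 0 (Num.max N1 N2) + 1 by rewrite ltr_pwDr// !le_max lexx orbT.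
 have l2 : N2 < Num.max 0 (Num.max N1 N2) + 1 by rewrite ltr_pwDr// !le_max lexx !orbT.
 by move=> y [Uy|Gy]; [apply: (H1 _ l1); exact: subset_closure|exact: (H2 _ l2)].
have Ys y : comp k c x y \/ curve_image c y -> surface k y.
 by move=> [/connected_component_sub[]//|]; exact: curve_image_surface.
have pos y : comp k c x y \/ curve_image c y -> 0 < y.2 by move=> /Ys[_]; exact.
(* For k = -1 the squared chart radius is 1 - 2 / (1 + y.2) with y.2 <= B; for k = 0 it is a quarter
   of the squared norm. *)
pose M2 := if k == -1 then 1 - (1 + B)^-1 else B ^+ 2.
have B1 : 0 < 1 + B by lra.
have iB : (1 + B)^-1 < 1 by rewrite invf_lt1//; lra.
have M20 : 0 < M2 by rewrite /M2; case: ifP => _; [rewrite subr_gt0|rewrite exprn_gt0].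
pose M := Num.sqrt M2; have M0 : 0 < M by rewrite sqrtr_gt0.
have M2E : M ^+ 2 = M2 by rewrite sqr_sqrtr// ltW.
have kM : k = -1 -> M < 1.
 move=> kE; have iB0 : 0 < (1 + B)^-1 by rewrite invr_gt0.
 have : M ^+ 2 < 1 by rewrite M2E /M2 kE eqxx; lra.
 by nra.
have EM y : comp k c x y \/ curve_image c y -> 0 < 1 + y.2 /\ norm2 (chart y) < M ^+ 2.
 move=> yy; have y0 := pos y yy; have ys := Ys y yy; have yB := BP y yy.
 have y1 : 0 < 1 + y.2 by lra.
 split => //; have [h _ _] := chart_surface hk3 ys y1.
 have [n1 n2 n3] := norm_coords y.
 rewrite M2E /M2; case: hk => kE.
  rewrite kE eqxx; move: h; rewrite kE -norm2_cabs mulN1r => h.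
  have y2B : y.2 <= B by apply: le_trans yB; apply: le_trans n3; exact: ler_norm.
  have : (1 + B)^-1 <= (1 + y.2)^-1 by rewrite lef_pV2// ?posrE//; lra.
  have : 0 < (1 + y.2)^-1 by rewrite invr_gt0.
  by lra.
 move: ys; rewrite kE => /surface0 y21.
 rewrite ifF; last by rewrite eq_sym oppr_eq0 oner_eq0.
 rewrite /norm2 /chart /= y21.
 have b1 : y.1.1 ^+ 2 <= B ^+ 2 by rewrite -(real_normK (num_real y.1.1)); have := normr_ge0 y.1.1; have := le_trans n1 yB; nra.
 have b2 : y.1.2 ^+ 2 <= B ^+ 2 by rewrite -(real_normK (num_real y.1.2)); have := normr_ge0 y.1.2; have := le_trans n2 yB; nra.
 have BB : 0 < B ^+ 2 by rewrite exprn_gt0.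
 have -> : (y.1.1 / (1 + 1)) ^+ 2 + (y.1.2 / (1 + 1)) ^+ 2 = (y.1.1 ^+ 2 + y.1.2 ^+ 2) / 4 by field.
 by lra.
have q0 : 0 < A * (4 * pi - k * A).
 have pp := pi_gt0 R; rewrite mulr_gt0//; case: hk => ->; rewrite ?mulN1r ?mul0r; lra.
apply: (side_isoperimetric hk3 cin csc (comp_rel_open cin x) _ _ _ M0 kM EM aU q0).
- by exists x; exact: connected_component_refl.
- by move=> y; exact: comp_closure.
- by move=> y /connected_component_sub[].
Qed.

(** The chart image of the curve is Lipschitz, hence null; the bound in the chart keeps the curve
    away from the south pole. *)
Lemma area_curve_sphere c M : curve_in 1 c -> 0 < M ->
 (forall y, curve_image c y -> 0 < 1 + y.2 /\ norm2 (chart y) < M ^+ 2) ->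
 area 1 (curve_image c) = 0%E.
Proof.
move=> cin M0 GM.
have hk : [\/ (1 : R) = -1, (1 : R) = 0 | (1 : R) = 1] by constructor 3.
have cp t : t \in `[0, 1] -> 0 < 1 + (c t).2.
 by move=> t01; have [] := GM (c t) (ex_intro2 _ _ t t01 erefl).
have Gs := fun x => @curve_image_surface 1 c x cin.
have GE : chart_set 1 (curve_image c) = curve01 (cz c).
 apply/seteqP; split => z.
  move=> [z0 [t t01 e]]; exists t => //; rewrite /cz e chart_emb//.
  by rewrite -norm2_cabs.
 move=> [t t01 <-]; have Gt : curve_image c (c t) by exists t.
 exact/(chart_set_chart (curve_image c) hk (Gs _ Gt) (cp t t01)).
have [s ps [Dc _]] := cz_cpieces hk cin cp.
have [mC nC] := curve_negligible ps Dc (cz_cont cin cp).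
have mD : measurable (chart_set 1 (curve_image c) : set (TR * TR)) by rewrite GE.
rewrite (area_chart_sphere Gs _ mD M0); last 2 first.
- by move=> GS; have [] := GM _ GS; rewrite /= subrr ltxx.
- move=> z [z0 Gz]; have [_] := GM _ Gz; rewrite chart_emb//.
 by rewrite -norm2_cabs.
have -> : (\int[mu2]_z (ind (chart_set 1 (curve_image c)) z * lam2 1 z)%:E =
  \int[mu2]_(z in curve01 (cz c)) (lam2 1 z)%:E)%E.
 rewrite [RHS]integral_mkcond; apply: eq_integral => z _; rewrite patchE /ind GE.
 by case: asboolP => h; [rewrite mem_set// mul1r|rewrite memNset// mul0r].
apply: null_set_integral => //.
- by apply: measurable_funTS; apply/measurable_EFinP; exact: measurable_lam2.
- exact/(negligibleP _ mC).
Qed.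

Definition south : R * R * R := ((0, 0), -1).

Lemma isoperimetric_south c A : 0 < A -> A <= 2 * pi -> curve_in 1 c -> simple_closed c ->
 (surface 1 `\` curve_image c) south -> area 1 (comp 1 c south) = A%:E -> isoperimetric 1 A c.
Proof.
move=> A0 A1 cin csc SU aU; have pp := pi_gt0 R.
have hk : [\/ (1 : R) = -1, (1 : R) = 0 | (1 : R) = 1] by constructor 3.
pose E := [set y | [/\ surface 1 y, ~ comp 1 c south y & ~ curve_image c y]].
have Uo := comp_rel_open cin south; have Eo := rest_rel_open cin south.
have SS : comp 1 c south south by exact: connected_component_refl.
have [e e0 eP] := Uo.2 _ SS.
(* A point of the sphere with 1 + y.2 < d has y.1.1^2 + y.1.2^2 < 2 d <= e^2, so it lies in the ball
   around the south pole. The other side thus has 1 + y.2 >= d and squared chart radius below 2 /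
   d. *)
pose d := Num.min e (e ^+ 2 / 2).
have d0 : 0 < d by rewrite lt_min e0 divr_gt0// exprn_gt0.
have de : d <= e by rewrite ge_min lexx.
have de2 : 2 * d <= e ^+ 2 by have : d <= e ^+ 2 / 2 by [rewrite ge_min lexx orbT]; lra.
pose M := Num.sqrt (2 / d); have M0 : 0 < M by rewrite sqrtr_gt0 divr_gt0.
have M2 : M ^+ 2 = 2 / d by rewrite sqr_sqrtr// divr_ge0// ltW.
have EM y : E y \/ curve_image c y -> 0 < 1 + y.2 /\ norm2 (chart y) < M ^+ 2.
 move=> yy; have ys : surface 1 y by case: yy => [[]//|]; exact: curve_image_surface.
 have nU : ~ comp 1 c south y.
  by case: yy => [[]//|Gy] /connected_component_sub[].
 have yd : d <= 1 + y.2.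
  rewrite leNgt; apply/negP => h; apply: nU; apply: eP => //.
  have [yE _] := ys; move: yE; rewrite mul1r => yE.
  have h1 := sqr_ge0 y.1.1; have h2 := sqr_ge0 y.1.2.
  have ym : -1 <= y.2 by nra.
  have y2 : y.1.1 ^+ 2 + y.1.2 ^+ 2 < e ^+ 2 by nra.
  have b1 : `|0 - y.1.1| < e by rewrite sub0r normrN ltr_norml; apply/andP; split; nra.
  have b2 : `|0 - y.1.2| < e by rewrite sub0r normrN ltr_norml; apply/andP; split; nra.
  have b3 : `|-1 - y.2| < e by rewrite ltr_norml; apply/andP; split; lra.
  by split; [split; [exact: b1|exact: b2]|exact: b3].
 have y1 : 0 < 1 + y.2 by lra.
 split => //; have [h _ _] := chart_surface hk ys y1.
 move: h; rewrite -norm2_cabs mul1r M2 => h.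
 have : (1 + y.2)^-1 <= d^-1 by rewrite lef_pV2// posrE.
 by lra.
have aG : area 1 (curve_image c) = 0%E.
 by apply: (area_curve_sphere cin M0) => y Gy; apply: EM; right.
have spl x : surface 1 x -> indE (comp 1 c south) x + indE E x + indE (curve_image c) x = 1.
 move=> xs; rewrite /indE.
 case: (asboolP (comp 1 c south x)) => [Ux|nU].
  have [_ nG] := connected_component_sub Ux.
  by rewrite asboolF ?[X in _ + _ + X]ifF ?addr0// ?asboolF// => -[].
 case: (asboolP (curve_image c x)) => [Gx|nG].
  by rewrite asboolF ?addr0 ?add0r// => -[].
 by rewrite asboolT ?addr0 ?add0r.
have aE : area 1 E = (4 * pi - A)%:E.
 have := area_split Uo Eo aG spl; rewrite aU => h.
 have fE : (area 1 E \is a fin_num)%E.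
  by move: h; case: (area 1 E).
 move: h; rewrite -(fineK fE) -EFinD => -[h]; congr (_%:E); lra.
have E0 : E !=set0.
 apply: contrapT => nE; have E00 : E = set0.
  by rewrite -subset0 => y Ey; apply: nE; exists y.
 move: aE; rewrite E00 areaE (eq_integral (cst 0%E)) ?integral0; last first.
  move=> w _; rewrite /dens /indE; case: ifP => // _.
  by rewrite !asboolF ?addr0 ?mul0r.
 by move=> [h]; lra.
have k11 : (1 : R) = -1 -> M < 1.
 by move/eqP; rewrite -subr_eq0 opprK -[1 + 1]/(2%:R) pnatr_eq0.
have q0 : 0 < (4 * pi - A) * (4 * pi - 1 * (4 * pi - A)).
 by have -> : (4 * pi - A) * (4 * pi - 1 * (4 * pi - A)) = (4 * pi - A) * A by [ring]; rewrite mulr_gt0//; lra.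
have := side_isoperimetric hk cin csc Eo E0 _ _ M0 k11 EM aE q0.
rewrite /isoperimetric; have -> : (4 * pi - A) * (4 * pi - 1 * (4 * pi - A)) = A * (4 * pi - 1 * A) by ring.
apply.
- by move=> y cy ys yG; split => //; exact: rest_closure cy ys yG.
- by move=> y [].
Qed.

(** T carries components to components and preserves length and area, so only the centre of the
    section has to be moved back. *)
Lemma isoperimetric_transport (T T' : R * R * R -> R * R * R) c x A :
 continuous T -> continuous T' -> cancel T T' -> cancel T' T -> preserves 1 T -> preserves 1 T' ->
 (forall E, rel_open 1 E -> rel_open 1 (T' @^-1` E) -> area 1 (T' @^-1` E) = area 1 E) ->
 (forall p y, form 1 p (T y) = form 1 (T' p) y) ->
 curve_in 1 c -> simple_closed c -> (surface 1 `\` curve_image c) x -> area 1 (comp 1 c x) = A%:E ->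
 (curve_in 1 (T \o c) -> simple_closed (T \o c) -> (surface 1 `\` curve_image (T \o c)) (T x) ->
  area 1 (comp 1 (T \o c) (T x)) = A%:E -> isoperimetric 1 A (T \o c)) ->
 isoperimetric 1 A c.
Proof.
move=> cT cT' TK T'K [pT sT] [pT' sT'] aT fT cin csc xU aU concl.
have cin' := (pT c cin).1.
have im y : curve_image (T \o c) (T y) <-> curve_image c y.
 split => -[t t01 e]; exists t; [exact: t01| |exact: t01|].
  by apply: (can_inj TK); exact: e.
 exact: (congr1 T e).
have csc' : simple_closed (T \o c).
 have [c01 ci] := csc; split; first by rewrite /= c01.
 by move=> u v u0 v0 /(can_inj TK); exact: ci.
have dom y : (surface 1 `\` curve_image (T \o c)) (T y) <-> (surface 1 `\` curve_image c) y.
 split => -[ys yG]; split; try by move=> /im.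
  by rewrite -(TK y); exact: sT'.
 exact: sT.
have xU' : (surface 1 `\` curve_image (T \o c)) (T x) by exact/dom.
have cE : comp 1 (T \o c) (T x) = T' @^-1` (comp 1 c x).
 apply/seteqP; split => y.
  move=> Uy; apply: (@connected_component_max _ _ (T' @` comp 1 (T \o c) (T x))).
  - by exists (T x); [exact: connected_component_refl|rewrite TK].
  - by move=> _ [w /connected_component_sub Uw <-]; apply/dom; rewrite T'K.
  - apply: connected_continuous_connected; first exact: component_connected.
   exact: continuous_subspaceT.
  - by exists y.
 move=> Uy; apply: (@connected_component_max _ _ (T @` comp 1 c x)).
 - by exists x => //; exact: connected_component_refl.
 - by move=> _ [w /connected_component_sub Uw <-]; apply/dom.
 - apply: connected_continuous_connected; first exact: component_connected.
  exact: continuous_subspaceT.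
 - by exists (T' y) => //; rewrite T'K.
have aU' : area 1 (comp 1 (T \o c) (T x)) = A%:E.
 rewrite cE aT//; first exact: comp_rel_open.
 by rewrite -cE; exact: comp_rel_open.
have [h1 h2] := concl cin' csc' xU' aU'.
split; first by move: h1; rewrite (pT c cin).2.
move=> Lq; have [p [r [ps r0 r1 pP]]] := h2 (etrans (congr1 (fun u : R => u ^+ 2) (pT c cin).2) Lq).
exists (T' p), r; split => //; first exact: sT'.
move=> y ys; rewrite -im (pP _ (sT _ ys)) /sect oner_eq0.
by rewrite fT.
Qed.

Lemma aff_continuous (A1 A2 A3 o : R * R * R) : continuous (aff A1 A2 A3 o).
Proof.
have h (a : R * R * R) (b : R) : continuous (fun y => dot a y + b).
 move=> y; apply: cvgD; last exact: cvg_cst.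
 by apply: cvgD; [apply: cvgD|]; apply: cvgM; (exact: cvg_cst || exact: cont11 || exact: cont12 || exact: cont2).
by move=> y; apply: cvg_pair_pt; [apply: cvg_pair_pt|]; exact: h.
Qed.

Lemma rotxE t : rotx t = aff ((1, 0), 0) ((0, cos t), - sin t) ((0, sin t), cos t) ((0, 0), 0) :> (R * R * R -> R * R * R).
Proof. by apply/funext => y; rewrite /rotx /aff /dot /=; congr (_, _, _); ring. Qed.

Lemma swap12E : swap12 = aff ((0, 1), 0) ((1, 0), 0) ((0, 0), 1) ((0, 0), 0) :> (R * R * R -> R * R * R).
Proof. by apply/funext => y; rewrite /swap12 /aff /dot /=; congr (_, _, _); ring. Qed.

Lemma rotx_preserves t : preserves 1 (@rotx R t).
Proof.
rewrite rotxE; apply: aff_preserves => [y [yE _]|v].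
 split => //; rewrite -rotxE /rotx /= -[RHS]yE.
 transitivity (y.1.1 ^+ 2 + (y.1.2 ^+ 2 + y.2 ^+ 2) * (cos t ^+ 2 + sin t ^+ 2)); first by ring.
 by rewrite cos2Dsin2; ring.
rewrite /metric /lin /dot /=.
transitivity (v.1.1 * v.1.1 + (v.1.2 * v.1.2 + v.2 * v.2) * (cos t ^+ 2 + sin t ^+ 2)); first by ring.
by rewrite cos2Dsin2; ring.
Qed.

Lemma swap12_preserves : preserves 1 (@swap12 R).
Proof.
rewrite swap12E; apply: aff_preserves => [y [yE _]|v].
 by split => //; rewrite -swap12E /swap12 /= -[RHS]yE; ring.
by rewrite /metric /lin /dot /=; ring.
Qed.

Lemma rotxK t : cancel (@rotx R t) (rotx (- t)).
Proof.
move=> y; rewrite /rotx /= cosN sinN.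
have h := cos2Dsin2 t; case: y => [[a b] d] /=; congr (_, _, _).
- by transitivity (b * (cos t ^+ 2 + sin t ^+ 2)); [ring|rewrite h mulr1].
- by transitivity (d * (cos t ^+ 2 + sin t ^+ 2)); [ring|rewrite h mulr1].
Qed.

(** The rotation brings x into the half plane y = 0, z <= 0; if y and z both vanish, the angle 0 is
    taken. *)
Lemma rotx_angle x : exists2 t, 0 <= t <= 2 * pi &
 (rotx (- t) x) = ((x.1.1, 0), - Num.sqrt (x.1.2 ^+ 2 + x.2 ^+ 2)).
Proof.
have pp := pi_gt0 R.
set s := Num.sqrt _; have s2 : s ^+ 2 = x.1.2 ^+ 2 + x.2 ^+ 2 by rewrite sqr_sqrtr// addr_ge0 ?sqr_ge0.
have [s0|sn] := eqVneq s 0.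
 exists 0; first by rewrite lexx mulr_ge0 ?ltW.
 have h1 := sqr_ge0 x.1.2; have h2 := sqr_ge0 x.2; move: s2; rewrite s0 expr0n/= => s2.
 have /eqP : x.1.2 ^+ 2 = 0 by lra.
 have /eqP : x.2 ^+ 2 = 0 by lra.
 rewrite !sqrf_eq0 /rotx oppr0 => /eqP -> /eqP ->.
 by rewrite !mul0r subrr addr0.
have s0 : 0 < s by rewrite lt_neqAle eq_sym sn sqrtr_ge0.
have [|t t01 [e1 e2]] := @exists_angle R (- x.2) x.1.2 s s0; first by rewrite s2 sqrrN addrC.
exists (2 * pi * t).
 by move: t01; rewrite in_itv/= => /andP[t0 t1]; have p2 : 0 <= 2 * pi :> R by [rewrite mulr_ge0// ltW]; rewrite mulr_ge0//= ler_piMr.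
rewrite /rotx cosN sinN e2; have -> : x.2 = - (s * cos (2 * pi * t)) by rewrite -e1 opprK.
have h := cos2Dsin2 (2 * pi * t); congr (_, _, _); first by ring.
by transitivity (- (s * (cos (2 * pi * t) ^+ 2 + sin (2 * pi * t) ^+ 2))); [ring|rewrite h mulr1].
Qed.

Lemma isoperimetric_rotx c x A t : 0 <= t <= 2 * pi ->
 curve_in 1 c -> simple_closed c -> (surface 1 `\` curve_image c) x -> area 1 (comp 1 c x) = A%:E ->
 (forall c', curve_in 1 c' -> simple_closed c' -> (surface 1 `\` curve_image c') (rotx (- t) x) ->
  area 1 (comp 1 c' (rotx (- t) x)) = A%:E -> isoperimetric 1 A c') -> isoperimetric 1 A c.
Proof.
move=> tt cin csc xU aU concl.
have K' : cancel (@rotx R (- t)) (rotx t) by have := rotxK (- t); rewrite opprK.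
apply: (isoperimetric_transport (T := rotx (- t)) (T' := rotx t) _ _ K' (@rotxK t) _ _ _ _ cin csc xU aU).
- by rewrite rotxE; exact: aff_continuous.
- by rewrite rotxE; exact: aff_continuous.
- exact: rotx_preserves.
- exact: rotx_preserves.
- by move=> E Eo Eo'; exact: area_rotx.
- by move=> p y; rewrite /form /rotx /= cosN sinN; ring.
- exact: concl.
Qed.

Lemma isoperimetric_swap c x A :
 curve_in 1 c -> simple_closed c -> (surface 1 `\` curve_image c) x -> area 1 (comp 1 c x) = A%:E ->
 (forall c', curve_in 1 c' -> simple_closed c' -> (surface 1 `\` curve_image c') (swap12 x) ->
  area 1 (comp 1 c' (swap12 x)) = A%:E -> isoperimetric 1 A c') -> isoperimetric 1 A c.
Proof.
move=> cin csc xU aU concl.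
have K : cancel (@swap12 R) swap12 by move=> [[a b] d].
apply: (isoperimetric_transport (T := swap12) (T' := swap12) _ _ K K _ _ _ _ cin csc xU aU).
- by rewrite swap12E; exact: aff_continuous.
- by rewrite swap12E; exact: aff_continuous.
- exact: swap12_preserves.
- exact: swap12_preserves.
- by move=> E Eo Eo'; exact: area_swap.
- by move=> p y; rewrite /form /swap12 /=; ring.
- exact: concl.
Qed.

(* On the sphere a rotation moves a point enclosed by c to the south pole, so
  that the other component is bounded in the chart; its area 4 pi - A gives
  the same value of A (4 pi - A). *)
Lemma isoperimetric_sphere c A : 0 < A -> A <= 2 * pi -> admissible 1 A c -> isoperimetric 1 A c.
Proof.
move=> A0 A1 [cin csc [x xU [_ aU]]].
(* A rotation about the first axis removes y; after the exchange of x and y a second one removes the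
   remaining coordinate and leaves the south pole. *)
have [t1 t1P e1] := rotx_angle x.
apply: (isoperimetric_rotx t1P cin csc xU aU) => c1; rewrite e1 => cin1 csc1 xU1 aU1.
apply: (isoperimetric_swap cin1 csc1 xU1 aU1) => c2; rewrite /swap12 /= => cin2 csc2 xU2 aU2.
have [t2 t2P e2] := rotx_angle ((0, x.1.1), - Num.sqrt (x.1.2 ^+ 2 + x.2 ^+ 2)).
apply: (isoperimetric_rotx t2P cin2 csc2 xU2 aU2) => c3; rewrite e2 /=.
have -> : Num.sqrt (x.1.1 ^+ 2 + (- Num.sqrt (x.1.2 ^+ 2 + x.2 ^+ 2)) ^+ 2) = 1.
 rewrite sqrrN sqr_sqrtr ?addr_ge0 ?sqr_ge0//; have [[xE _] _] := xU.
 by rewrite -[RHS]sqrtr1 -xE; congr Num.sqrt; ring.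
exact: isoperimetric_south.
Qed.

Lemma isoperimetric_admissible k c A : [\/ k = -1, k = 0 | k = 1] -> 0 < A -> (k = 1 -> A <= 2 * pi) ->
 admissible k A c -> isoperimetric k A c.
Proof.
move=> hk A0 A1 ad; case: hk => kE.
- by apply: isoperimetric_neq1 => //; left.
- by apply: isoperimetric_neq1 => //; right.
- by move: A1 ad; rewrite kE => /(_ erefl) A1 ad; exact: isoperimetric_sphere.
Qed.

(** * The radius, existence and uniqueness of minimizers *)

Section radius.
Variables (k A : R).
Hypotheses (hk : [\/ k = -1, k = 0 | k = 1]) (A0 : 0 < A) (A1 : k = 1 -> A <= 2 * pi).

(** The Euclidean radius of the round circle that encloses area A: its length is 2 pi s and its
    geodesic radius is [AS k s]. *)
Let s := Num.sqrt (A * (4 * pi - k * A)) / (2 * pi).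

Lemma quant_gt0 : 0 < A * (4 * pi - k * A).
Proof.
have pp := pi_gt0 R; have a0 := A0; rewrite mulr_gt0//; case: hk => kE; rewrite kE ?mulN1r ?mul0r ?mul1r; [lra|lra|].
by have := A1 kE; lra.
Qed.

Lemma s_gt0 : 0 < s.
Proof. by rewrite divr_gt0 ?sqrtr_gt0 ?quant_gt0// mulr_gt0// pi_gt0. Qed.

Lemma s_sqr : (2 * pi * s) ^+ 2 = A * (4 * pi - k * A).
Proof.
have p2 : 2 * pi != 0 :> R by rewrite mulf_neq0// gt_eqF// pi_gt0.
by rewrite /s mulrC divfK// sqr_sqrtr// ltW// quant_gt0.
Qed.

Lemma round_length_ge0 : 0 <= 2 * pi * s.
Proof. by rewrite mulr_ge0 ?(ltW s_gt0)// mulr_ge0// ltW// pi_gt0. Qed.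

Lemma s_le1 : k = 1 -> s <= 1.
Proof.
move=> kE; have pp := pi_gt0 R; have s0 := s_gt0.
have h := s_sqr; move: h; rewrite kE mul1r => h.
(* The difference of the two sides is the square of 2 pi - A. *)
have h2 : (2 * pi * s) ^+ 2 <= (2 * pi) ^+ 2 by rewrite h -subr_ge0; have := sqr_ge0 (2 * pi - A); lra.
have p2 : 0 < (2 * pi : R) ^+ 2 by rewrite exprn_gt0// mulr_gt0.
move: h2; rewrite exprMn ger_pMr// => h2; nra.
Qed.

Lemma round_admissible : exists c, admissible k A c /\ arc_length k c = 2 * pi * s.
Proof.
have pp := pi_gt0 R; have p2 : 0 < 2 * pi :> R by rewrite mulr_gt0.
pose h := A / (2 * pi).
have sE : s = Num.sqrt (h * (2 - k * h)).
 rewrite -[LHS]gtr0_norm ?s_gt0// -sqrtr_sqr; congr Num.sqrt.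
 have p2n : (2 * pi) ^+ 2 != 0 :> R by rewrite expf_neq0// gt_eqF.
 have hE : 2 * pi * h = A by rewrite /h mulrC divfK// gt_eqF.
 apply: (mulfI p2n); rewrite -exprMn s_sqr.
 have -> : (2 * pi) ^+ 2 * (h * (2 - k * h)) = (2 * pi * h) * (4 * pi - k * (2 * pi * h)) by ring.
 by rewrite hE.
have en : encloses k (round (Num.sqrt (h * (2 - k * h))) (1 - k * h)) A := round_encloses hk A0 A1.
rewrite -sE in en.
have h0 : 0 < h by rewrite divr_gt0.
have s2 : s ^+ 2 = h * (2 - k * h).
 rewrite sE sqr_sqrtr// ltW//; have := exprn_gt0 2 s_gt0.
 by rewrite sE; case: (ltP 0 (h * (2 - k * h))) => // /ler0_sqrtr ->; rewrite expr0n/= ltxx.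
have h1 : k = 1 -> h <= 1 by move=> /A1; rewrite /h ler_pdivrMr// mul1r.
have b0 : 0 <= 1 - k * h by case: hk => kE; rewrite kE ?mul0r ?mulN1r ?mul1r; [lra|lra|have := h1 kE; lra].
have bpos : k <> 1 -> 0 < 1 - k * h by case: hk => kE; rewrite kE ?mul0r ?mulN1r ?mul1r => // _; lra.
have bs : (1 - k * h) ^+ 2 + k * s ^+ 2 = 1 by rewrite s2; ring.
have kb : k = 0 -> 1 - k * h = 1 by move=> ->; rewrite mul0r subr0.
have [cin csc L _] := round_curve s_gt0 bs b0 bpos kb.
by exists (round s (1 - k * h)); split.
Qed.

(** The round circle attains the isoperimetric bound, so a minimizer is squeezed between the two. *)
Lemma minimizer_length c : perimeter_minimizer k A c -> arc_length k c = 2 * pi * s.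
Proof.
move=> [ad min]; have [c0 [ad0 L0]] := round_admissible.
apply/eqP; rewrite eq_le -{1}L0 min//=.
have [h _] := isoperimetric_admissible hk A0 A1 ad.
rewrite -(@ler_pXn2r _ 2)// ?nnegrE ?arc_length_ge0 ?round_length_ge0//.
by rewrite s_sqr.
Qed.

(* The image of c is that of a round curve, and the same region gives two
  bounds for its radius: one from the minimality of c, one from the
  isoperimetric inequality for the area of the round disc. *)
Lemma minimizer_section c : perimeter_minimizer k A c ->
 exists2 p, surface k p & forall x, surface k x -> (curve_image c x <-> sect k p s x).
Proof.
move=> mc; have [ad min] := mc.
have [_ sec] := isoperimetric_admissible hk A0 A1 ad.
have [p [r [ps r0 r1 pP]]] := sec (etrans (congr1 (fun u : R => u ^+ 2) (minimizer_length mc)) s_sqr).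
suff -> : s = r by exists p.
have pp := pi_gt0 R; have p2 : 0 < 2 * pi :> R by rewrite mulr_gt0.
have [T [T' [pT pT' TK T'K [Tp Ts]]]] := to_north hk ps.
have d0 : 0 <= 1 - k * r ^+ 2.
 case: hk => kE; rewrite kE ?mulN1r ?mul0r ?mul1r ?subr0 ?opprK//; first by rewrite addr_ge0 ?sqr_ge0.
 by have := r1 kE; nra.
pose b := Num.sqrt (1 - k * r ^+ 2).
have b0 : 0 <= b by exact: sqrtr_ge0.
have b2 : b ^+ 2 = 1 - k * r ^+ 2 by rewrite sqr_sqrtr.
have bpos : k <> 1 -> 0 < b.
 move=> kn1; rewrite sqrtr_gt0; case: hk => kE; rewrite kE ?mulN1r ?mul0r ?subr0 ?opprK//.
 by rewrite ltr_pwDl ?sqr_ge0.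
have kb : k = 0 -> b = 1 by move=> kE; rewrite /b kE mul0r subr0 sqrtr1.
have bs : b ^+ 2 + k * r ^+ 2 = 1 by rewrite b2 subrK.
have [rin rsc _ rim] := round_curve r0 bs b0 bpos kb.
have [cin csc _] := ad.
have rin' := (pT'.1 _ rin).1.
have rsc' : simple_closed (T' \o round r b).
 have [c01 ci] := rsc; split; first by rewrite /= c01.
 by move=> u v u0 v0 /(can_inj T'K); exact: ci.
have imE : curve_image (T' \o round r b) = curve_image c.
 have key y : surface k y -> curve_image (round r b) (T y) <-> curve_image c y.
  by move=> ys; rewrite (rim _ (pT.2 _ ys)) -(Ts _ _ ys r0 r1) pP.
 apply/seteqP; split => y.
  move=> [t t01 <-]; apply/key; last by rewrite /= T'K; exists t.
  by apply: pT'.2; have [_ _] := rin; exact.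
 move=> Gy; have ys := curve_image_surface cin Gy.
 by have [t t01 e] := (key y ys).2 Gy; exists t => //; rewrite /= e TK.
have le1 : 2 * pi * s <= 2 * pi * r.
 have [_ _ rL _] := round_curve r0 bs b0 bpos kb.
 rewrite -(minimizer_length mc) -rL -(pT'.1 _ rin).2; apply: min; split; [exact: rin'|exact: rsc'|].
 have [_ _ h] := ad; rewrite /encloses imE; exact: h.
(* The height of the cap with boundary radius r: 1 - b for k = 1, b - 1 for k = -1, and r^2 / 2 for
   k = 0. *)
pose h := r ^+ 2 / (1 + b).
have b1 : 0 < 1 + b by lra.
have b1n : 1 + b != 0 by rewrite gt_eqF.
have h0 : 0 < h by rewrite divr_gt0// exprn_gt0.
have khE : k * h = 1 - b.
 have e : k * r ^+ 2 = (1 - b) * (1 + b) by transitivity (1 - b ^+ 2); [rewrite b2; ring|ring].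
 by rewrite /h mulrA e mulfK.
have hhE : h * (2 - k * h) = r ^+ 2.
 by rewrite khE; have -> : 2 - (1 - b) = 1 + b by [ring]; rewrite /h divfK.
pose A' := 2 * pi * h.
have A'0 : 0 < A' by rewrite mulr_gt0.
have hA : A' / (2 * pi) = h by rewrite /A' mulrC mulKf// gt_eqF.
have A'1 : k = 1 -> A' <= 2 * pi.
 move=> kE; rewrite /A' ger_pMr// /h ler_pdivrMr// mul1r.
 by have := r1 kE; nra.
have en : encloses k (round (Num.sqrt (A' / (2 * pi) * (2 - k * (A' / (2 * pi))))) (1 - k * (A' / (2 * pi)))) A' :=
 round_encloses hk A'0 A'1.
have bE : 1 - (1 - b) = b by ring.
rewrite hA hhE sqrtr_sqr (gtr0_norm r0) khE bE in en.
have cin' := (pT.1 _ cin).1.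
have csc' : simple_closed (T \o c).
 have [c01 ci] := csc; split; first by rewrite /= c01.
 by move=> u v u0 v0 /(can_inj TK); exact: ci.
have imE' : curve_image (T \o c) = curve_image (round r b).
 have -> : curve_image (T \o c) = T @` curve_image c.
  apply/seteqP; split => y; first by move=> [t t01 <-]; exists (c t) => //; exists t.
  by move=> [_ [t t01 <-] <-]; exists t.
 rewrite -imE; apply/seteqP; split => y.
  by move=> [_ [t t01 <-] <-]; exists t => //=; rewrite T'K.
 by move=> [t t01 <-]; exists (T' (round r b t)); [exists t|rewrite T'K].
(* [encloses] depends on the image only, so the moved minimizer also encloses the round cap of area
   A'. *)
have ad' : admissible k A' (T \o c).
 split; [exact: cin'|exact: csc'|]; rewrite /encloses imE'; exact: en.
have [h1 _] := isoperimetric_admissible hk A'0 A'1 ad'.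
have qE : A' * (4 * pi - k * A') = (2 * pi * r) ^+ 2.
 rewrite exprMn -hhE /A'; ring.
have hr : 0 <= 2 * pi * r by rewrite mulr_ge0 ?(ltW r0)// ltW.
have hs := round_length_ge0.
move: h1; rewrite qE (pT.1 _ cin).2 (minimizer_length mc) ler_pXn2r ?nnegrE// => le2.
apply/eqP; rewrite eq_le; apply/andP; split.
 by move: le1; rewrite ler_pM2l.
by move: le2; rewrite ler_pM2l.
Qed.

Lemma AS_gt0 : 0 < AS k s /\ (k = 1 -> AS k s < pi).
Proof.
have pp := pi_gt0 R; have s0 := s_gt0.
have n11 : (-1 : R) == 1 = false.
 by rewrite eq_sym -subr_eq0 opprK -[1 + 1]/(2%:R) pnatr_eq0.
have o0 : (0 : R) == 1 = false by rewrite eq_sym oner_eq0.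
have o1 : (0 : R) == -1 = false by rewrite eq_sym oppr_eq0 oner_eq0.
case: hk => kE; rewrite /AS kE.
- rewrite n11 eqxx asinhE; split; last by move/eqP; rewrite n11.
 rewrite /arsinh ln_gt0//; have : 1 <= Num.sqrt (1 + s ^+ 2).
  by rewrite -[leLHS]sqrtr1; apply: ler_wsqrtr; rewrite lerDl sqr_ge0.
 lra.
- by rewrite o0 o1; split => //; move/eqP; rewrite o0.
- rewrite eqxx; have s1 := s_le1 kE.
 have sI : -1 <= s <= 1 by rewrite s1 andbT; lra.
 split; last by move=> _; have := asin_lepi2 sI; lra.
 rewrite ltNge; apply/negP => h; have e : sin (asin s) = s by apply: asinK; rewrite in_itv.
 have : sin (asin s) <= 0.
  rewrite -oppr_ge0 -sinN; apply: sin_ge0_pi; have := asin_geNpi2 sI => h2.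
  by apply/andP; split; lra.
 by rewrite e; lra.
Qed.

(** Once p is moved to the north pole, both the section and the distance circle are described by
    [rad] and the sign of the height. *)
Lemma section_circle p (G : set (R * R * R)) : surface k p -> (forall x, G x -> surface k x) ->
 (forall x, surface k x -> (G x <-> sect k p s x)) -> G = circle k p (AS k s).
Proof.
move=> ps Gs Gp; have [T [T' [pT pT' TK T'K [Tp Ts]]]] := to_north hk ps.
have key x : surface k x -> G x <-> riem_dist k p x = AS k s.
 move=> xs; rewrite (Gp x xs) (Ts x s xs s_gt0 s_le1) -(dist_north_eq hk (pT.2 _ xs) s_gt0 s_le1).
 by rewrite -Tp (aff_isometry pT.1 pT'.1 TK T'K).
apply/seteqP; split => x; first by move=> Gx; split; [exact: Gs|apply/key => //; exact: Gs].
by move=> [xs /key]; exact.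
Qed.

(** Both sections become the same circle about the north pole; the isometry goes through that common
    position. *)
Lemma section_isometry p1 p2 (G1 G2 : set (R * R * R)) : surface k p1 -> surface k p2 ->
 (forall x, G1 x -> surface k x) -> (forall x, G2 x -> surface k x) ->
 (forall x, surface k x -> (G1 x <-> sect k p1 s x)) ->
 (forall x, surface k x -> (G2 x <-> sect k p2 s x)) ->
 exists2 phi, surface_isometry k phi & phi @` G1 = G2.
Proof.
move=> ps1 ps2 G1s G2s G1P G2P.
have [T1 [T1' [pT1 pT1' TK1 TK1' [Tp1 Ts1]]]] := to_north hk ps1.
have [T2 [T2' [pT2 pT2' TK2 TK2' [Tp2 Ts2]]]] := to_north hk ps2.
exists (T2' \o T1).
 split; last first.
  move=> x y xs ys /=.
  by rewrite (aff_isometry pT2'.1 pT2.1 TK2' TK2) (aff_isometry pT1.1 pT1'.1 TK1 TK1').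
 split.
 - by move=> x xs /=; apply: pT2'.2; exact: pT1.2.
 - by move=> x y _ _ /= /(can_inj TK2')/(can_inj TK1).
 - move=> y ys; exists (T1' (T2 y)) => /=; last by rewrite TK1' TK2.
  by apply: pT1'.2; exact: pT2.2.
have key x : surface k x -> G2 (T2' (T1 x)) <-> G1 x.
 move=> xs; have ys : surface k (T2' (T1 x)) by apply: pT2'.2; exact: pT1.2.
 by rewrite (G2P _ ys) (Ts2 _ _ ys s_gt0 s_le1) TK2' (G1P _ xs) (Ts1 _ _ xs s_gt0 s_le1).
apply/seteqP; split => y; first by move=> [x Gx <-] /=; apply/key => //; exact: G1s.
move=> Gy; exists (T1' (T2 y)) => /=; last by rewrite TK1' TK2.
by apply/key; [apply: pT1'.2; apply: pT2.2; exact: G2s|rewrite TK1' TK2].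
Qed.
End radius.
End isoperimetry.

Theorem theorem2 (R : realType) (k A : R)
    (hk : [\/ k = -1, k = 0 | k = 1])
    (hA : 0 < A) (hA1 : k = 1 -> A <= 2 * pi) :
  [/\ exists c : R -> R * R * R, perimeter_minimizer k A c,
      forall c1 c2 : R -> R * R * R,
        perimeter_minimizer k A c1 -> perimeter_minimizer k A c2 ->
        exists2 phi : R * R * R -> R * R * R,
          surface_isometry k phi & phi @` curve_image c1 = curve_image c2
    & forall c : R -> R * R * R, perimeter_minimizer k A c ->
        is_circle k (AS k (Num.sqrt (A * (4 * pi - k * A)) / (2 * pi)))
          (curve_image c)].
Proof.
have ims c : perimeter_minimizer k A c -> forall x, curve_image c x -> surface k x.
 by move=> [[cin _ _] _] x; exact: curve_image_surface.
split.
- have [c [ad L]] := round_admissible hk hA hA1.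
 have le_sqr (a b : R) : 0 <= a -> 0 <= b -> a ^+ 2 <= b ^+ 2 -> a <= b.
  by move=> a0 b0; rewrite ler_pXn2r ?nnegrE.
 exists c; split; [exact: ad|move=> c' ad'; rewrite L].
 apply: le_sqr; [exact: (round_length_ge0 hk hA hA1)|exact: arc_length_ge0|].
 by rewrite (s_sqr hk hA hA1); exact: (isoperimetric_admissible hk hA hA1 ad').1.
- move=> c1 c2 m1 m2.
 have [p1 ps1 P1] := minimizer_section hk hA hA1 m1.
 have [p2 ps2 P2] := minimizer_section hk hA hA1 m2.
 exact: (section_isometry hk hA hA1 ps1 ps2 (ims c1 m1) (ims c2 m2) P1 P2).
- move=> c mc; have [p ps Pp] := minimizer_section hk hA hA1 mc.
 have [h1 h2] := AS_gt0 hk hA hA1.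
 by split => //; exists p => //; exact: (section_circle hk hA hA1 ps (ims c mc) Pp).
Qed.
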